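(* Let $\alpha,\omega\in\mathbb{R}$ satisfy $0<\omega<\frac{\alpha}{2}$. Let $u,v:\mathbb{R}^3\to(0,\infty)$ be a pair of positive functions satisfying $$\Delta u=u(u^{2}+v^{2}-1)+v(\alpha uv-\omega),\qquad \Delta v=v(u^{2}+v^{2}-1)+u(\alpha uv-\omega)\qquad\text{in }\mathbb{R}^3 .$$ If $$\frac{\partial u}{\partial x_3}>0>\frac{\partial v}{\partial x_3}\quad\text{everywhere in }\mathbb{R}^3,$$ then $(u,v)$ is one-dimensional; precisely, there exist a unit vector $\vec\nu\in\mathbb{R}^3$ and a pair of positive functions $U,V:\mathbb{R}\to(0,\infty)$ satisfying $$U''=U(U^{2}+V^{2}-1)+V(\alpha UV-\omega),\qquad V''=V(U^{2}+V^{2}-1)+U(\alpha UV-\omega)\qquad\text{in }\mathbb{R},$$ such that $$(u(x),v(x))=(U(x\cdot\vec\nu),V(x\cdot\vec\nu))\ \text{ for all }x\in\mathbb{R}^3,\qquad U'(t)>0>V'(t)\ \text{ for all }t\in\mathbb{R}.$$ Moreover, if $0<a<b$ are the constants with $a^2+b^2=1$ and $ab=\frac{\omega}{\alpha}$, then $$\lim_{t\to-\infty}(U(t),V(t))=(a,b),\qquad \lim_{t\to+\infty}(U(t),V(t))=(b,a).$$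
   Context: Solutions are classical (twice continuously differentiable) entire solutions. *)

(* Defs.v *)
From mathcomp Require Import all_boot all_order all_algebra.
From mathcomp Require Import all_classical all_reals all_analysis.
Set Implicit Arguments.
Unset Strict Implicit.
Unset Printing Implicit Defensive.
Import Order.TTheory GRing.Theory Num.Theory numFieldNormedType.Exports.
Local Open Scope classical_set_scope.
Local Open Scope ring_scope.

Definition partial (R : realType) (n : nat) (i : 'I_n) (f : 'rV[R]_n -> R) :
    'rV[R]_n -> R :=
  fun x => 'D_(delta_mx 0 i) f x.

(* ['D_v f x] is a total function, with a junk value where the limit of the
   difference quotients does not exist; hence the [derivable] conjuncts. *)
Definition C1 (R : realType) (n : nat) (f : 'rV[R]_n -> R) : Prop :=
  forall i : 'I_n,
    (forall x, derivable f x (delta_mx 0 i)) /\ continuous (partial i f).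

Definition C2 (R : realType) (n : nat) (f : 'rV[R]_n -> R) : Prop :=
  C1 f /\ forall i : 'I_n, C1 (partial i f).

Definition laplacian (R : realType) (n : nat) (f : 'rV[R]_n -> R) :
    'rV[R]_n -> R :=
  fun x => \sum_(i < n) partial i (partial i f) x.

Definition C2_line (R : realType) (f : R -> R) : Prop :=
  [/\ forall t, derivable f t 1, forall t, derivable (derive1 f) t 1
    & continuous (derive1n 2 f)].

(* The norm that ['rV[R]_n] carries in the library is the sup norm, so the
   Euclidean unit sphere has to be expressed through [dot]. *)
Definition dot (R : realType) (n : nat) (x y : 'rV[R]_n) : R :=
  \sum_(i < n) x 0 i * y 0 i.

(* Main.v *)
Require Import Defs.
From mathcomp Require Import all_boot all_order all_algebra.
From mathcomp Require Import all_classical all_reals all_analysis.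
From mathcomp Require Import ring lra.
Set Implicit Arguments.
Unset Strict Implicit.
Unset Printing Implicit Defensive.
Import Order.TTheory GRing.Theory Num.Theory numFieldNormedType.Exports.
Local Open Scope classical_set_scope.
Local Open Scope ring_scope.

(* Comparison on large balls gives the sharp bounds [u^2 + v^2 <= 1] and
   [omega <= alpha u v], and then bounds on all derivatives.  The linearised
   system is solved by the derivatives of [(u, v)] in every direction and, with
   the favourable signs [d_3 u > 0 > d_3 v], by those along [x_3].  For [w = d_c u] and
   [z = d_c v], testing with the squares of a cutoff yields a Caccioppoli inequality
     int zeta^2 (p^2 |grad (w/p)|^2 + q^2 |grad (z/q)|^2 + 2 G) <= 4 int |grad zeta|^2 (w^2 + z^2)
   where [p = d_3 u], [q = - d_3 v] and [G >= 0] vanishes only if [w q + z p = 0].  With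
   logarithmic cutoffs the right hand side tends to 0 as soon as the energy in balls of
   radius r is O(r^2).  This makes [w/p] and [z/q] constant, so both gradients keep one
   fixed direction, and the Hamiltonian identity determines the limits at the ends.

   Energy (Ambrosio and Cabre): translating along [x_3] changes the energy in a ball of
   radius r by O(r^2), so it suffices to bound the energy of one of the limits of [(u, v)]
   as [x_3 -> +oo] or [-oo], chosen such that its components are not identical.
   The limits do not depend on [x_3], and in two variables the logarithmic cutoffs apply
   without an energy bound: a directional derivative of a limit has zero gradient
   wherever it vanishes, and [d_c u * d_c v <= 0].  By Gronwall the level sets of
   such functions are parallel lines, so the limits are one-dimensional; their Hamiltonian
   constant is 0, and the energy density is at most the derivative of [u - v]
   times a constant, which integrates to O(r^2). *)

(** * Derivatives, continuity and the maximum principle *)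

(** The limits along [x_3] lose the strict signs: the third derivatives of the translates tend to 0,
    so nothing can be divided by their limits. The nodal property is therefore read off at a
    translate close to the limit, where the Caccioppoli inequality controls [p] times the gradient
    of [w / p], and a separate estimate, insensitive to the size of [p], controls the gradient of
    [log p]. The bound [omega <= alpha u v] makes the off-diagonal coefficient of the linearised
    system at least [omega]; with the opposite signs of [d_3 u] and [d_3 v] the coupling then enters
    as a nonnegative square. The energy estimate is forced by the dimension: at scale [r] the
    squared gradient of a cutoff is of order [r^-2] on a volume [r^3], one power of [r] too many for
    functions that are merely bounded. Integration enters only through positivity, linearity, the
    vanishing of divergences and the volume of boxes up to a factor. The functional [II] provides
    just these, and constants such as 48 or 160 only record the losses. *)

(* [is_derive] is a type class; the alias keeps instance resolution from
   guessing the derivative before the calculus lemmas below compute it. *)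
Definition isd {R : realType} (V : normedModType R) (x v : V) (f : V -> R) (l : R) : Prop :=
  is_derive x v f l.

Section derivatives.
Context {R : realType}.

Lemma is_deriveP (V : normedModType R) (f : V -> R) x v l :
  isd x v f l <->
  h^-1 * (f (x + h *: v) - f x) @[h --> 0^'] --> l.
Proof.
have E : (fun h => h^-1 * (f (x + h *: v) - f x)) =
    (fun h => h^-1 *: ((f \o shift x) (h *: v) - f x)).
  by apply/funext => h /=; rewrite [x + _]addrC.
rewrite E; split=> [[d <-]|fl]; first exact: d.
have d : derivable f x v by apply/cvg_ex; exists l.
by apply: DeriveDef => //; exact: cvg_lim fl.
Qed.

Lemma is_derive_inj (V : normedModType R) (f : V -> R) x v l l' :
  isd x v f l -> isd x v f l' -> l = l'.
Proof. by move=> [_ <-] [_ <-]. Qed.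

Lemma is_derive_slice (V : normedModType R) (f : V -> R) x v t l :
  isd (x + t *: v) v f l -> isd (t:R) (1:R) (fun t => f (x + t *: v)) l.
Proof.
move=> /is_deriveP H; apply/is_deriveP; apply: cvg_trans H.
apply: near_eq_cvg; near=> h; congr (_ * (f _ - _)).
by rewrite [h *: 1]mulr1 scalerDl addrA.
Unshelve. all: by end_near. Qed.

Lemma is_derive_unslice (V : normedModType R) (f : V -> R) x v l :
  isd (0:R) (1:R) (fun t => f (x + t *: v)) l -> isd x v f l.
Proof.
move=> /is_deriveP H; apply/is_deriveP; apply: cvg_trans H.
apply: near_eq_cvg; near=> h; congr (_ * (f _ - f _)).
  by rewrite [h *: 1]mulr1 add0r.
by rewrite scale0r addr0.
Unshelve. all: by end_near. Qed.

Variables (V : normedModType R) (x v : V).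
Implicit Types f g : V -> R.

Lemma der_eq f l l' : isd x v f l -> l = l' -> isd x v f l'.
Proof. by move=> ? <-. Qed.

Lemma derD f g df dg : isd x v f df -> isd x v g dg ->
  isd x v (fun y => f y + g y) (df + dg).
Proof. by move=> *; exact: is_deriveD. Qed.

Lemma derN f df : isd x v f df -> isd x v (fun y => - f y) (- df).
Proof. by move=> *; exact: is_deriveN. Qed.

Lemma derM f g df dg : isd x v f df -> isd x v g dg ->
  isd x v (fun y => f y * g y) (f x * dg + g x * df).
Proof. by move=> *; exact: is_deriveM. Qed.

Lemma derX f n df : isd x v f df ->
  isd x v (fun y => f y ^+ n) (n%:R * f x ^+ n.-1 * df).
Proof.
move=> H; have := is_deriveX n H.
by congr (isd _ _ _ _); apply/funext => y; rewrite exprfctE.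
Qed.

Lemma derV f df : f x != 0 -> isd x v f df ->
  isd x v (fun y => (f y)^-1) (- (f x) ^- 2 * df).
Proof.
move=> f0 [d <-]; apply: DeriveDef; first exact: derivableV.
by rewrite deriveV.
Qed.

Lemma derC (c : R) : isd x v (fun _ => c) 0.
Proof. exact: is_derive_cst. Qed.

(** Only the derivative along [v] is assumed of [f], so the chain rule is reduced to one variable by
    restricting [f] to the line through [x]. *)
Lemma der_comp f (g : R -> R) df dg : isd x v f df ->
  isd (f x : R) (1:R) g dg -> isd x v (fun y => g (f y)) (dg * df).
Proof.
move=> Hf Hg; apply: is_derive_unslice.
have Hf0 : isd (0:R) (1:R) (fun t => f (x + t *: v)) df.
  by apply: is_derive_slice; rewrite scale0r addr0.
have Hg0 : isd (f (x + 0 *: v) : R) (1:R) g dg by rewrite scale0r addr0.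
have := @is_derive1_comp _ g (fun t => f (x + t *: v)) _ _ _ Hg0 Hf0.
by [].
Qed.

Lemma der_sum n (h : 'I_n -> V -> R) (dh : 'I_n -> R) :
  (forall i, isd x v (h i) (dh i)) ->
  isd x v (fun y => \sum_(i < n) h i y) (\sum_(i < n) dh i).
Proof.
move=> H; have := is_derive_sum H.
by congr (isd _ _ _ _); apply/funext => y; rewrite fct_sumE.
Qed.

End derivatives.

Ltac der_step := lazymatch goal with
  | |- isd _ _ (fun _ => ?c) _ => apply: derC
  | |- isd _ _ (fun y => @?f y + @?g y) _ => apply: (@derD _ _ _ _ f g)
  | |- isd _ _ (fun y => @?f y * @?g y) _ => apply: (@derM _ _ _ _ f g)
  | |- isd _ _ (fun y => @?f y ^+ ?n) _ => apply: (@derX _ _ _ _ f n)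
  | |- isd _ _ (fun y => - @?f y) _ => apply: (@derN _ _ _ _ f)
  | |- isd _ _ (fun y => (@?f y)^-1) _ => apply: (@derV _ _ _ _ f)
  end.
Ltac der := repeat first [match goal with
   | H : isd ?x ?v ?f _ |- isd ?x ?v ?f _ => exact H
   | H : isd ?x ?v ?f _ |- isd ?x ?v (fun y => ?f y) _ => exact H end | der_step | match goal with
   | H : isd _ _ _ _ |- _ => exact H
   | H : forall _, isd _ _ _ _ |- _ => exact (H _)
   | H : forall _ _, isd _ _ _ _ |- _ => exact (H _ _) end | exact: is_derive_id].

Lemma sqr_normr {R : realDomainType} (a : R) : `|a| ^+ 2 = a ^+ 2.
Proof. by rewrite real_normK ?num_real. Qed.

Lemma ler_norm_sqr {R : realDomainType} (a b : R) : 0 <= b -> a ^+ 2 <= b ^+ 2 -> `|a| <= b.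
Proof. by move=> b0; rewrite -sqr_normr ler_pXn2r ?nnegrE. Qed.

Section continuity.
Context {R : realType} {T : topologicalType}.
Implicit Types f g : T -> R.

Definition cts f : Prop := continuous f.

Lemma ctsD f g : cts f -> cts g -> cts (fun y => f y + g y).
Proof. by move=> cf cg x; exact: cvgD (cf x) (cg x). Qed.

Lemma ctsN f : cts f -> cts (fun y => - f y).
Proof. by move=> cf x; exact: cvgN (cf x). Qed.

Lemma ctsM f g : cts f -> cts g -> cts (fun y => f y * g y).
Proof. by move=> cf cg x; exact: cvgM (cf x) (cg x). Qed.

Lemma ctsC (c : R) : cts (fun _ => c).
Proof. by move=> x; exact: cvg_cst. Qed.

Lemma ctsX f n : cts f -> cts (fun y => f y ^+ n).
Proof.
move=> cf; elim: n => [|n IH]; first exact: ctsC.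
rewrite (_ : (fun _ => _) = (fun y => f y * f y ^+ n)); first exact: ctsM.
by apply/funext => y; rewrite exprS.
Qed.

Lemma ctsV f : (forall x, f x != 0) -> cts f -> cts (fun y => (f y)^-1).
Proof. by move=> f0 cf x; exact: cvgV (f0 x) (cf x). Qed.

Lemma cts_norm f : cts f -> cts (fun y => `|f y|).
Proof. by move=> cf x; exact: cvg_norm (cf x). Qed.

Lemma cts_comp f (g : R -> R) : cts f -> continuous g -> cts (fun y => g (f y)).
Proof. by move=> cf cg x; exact: continuous_comp (cf x) (cg (f x)). Qed.

Lemma cts_sum n (h : 'I_n -> T -> R) : (forall i, cts (h i)) ->
  cts (fun y => \sum_(i < n) h i y).
Proof.
elim: n h => [|n IH] h H.
  by rewrite (_ : (fun _ => _) = fun=> 0); [exact: ctsC|apply/funext => y; rewrite big_ord0].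
rewrite (_ : (fun _ => _) = fun y => \sum_(i < n) h (widen_ord (leqnSn n) i) y + h ord_max y).
  by apply: ctsD => //; exact: IH.
by apply/funext => y; rewrite big_ord_recr.
Qed.

End continuity.

Ltac cont_step := lazymatch goal with
  | |- cts (fun _ => ?c) => apply: ctsC
  | |- cts (fun y => @?f y + @?g y) => apply: (@ctsD _ _ f g)
  | |- cts (fun y => @?f y * @?g y) => apply: (@ctsM _ _ f g)
  | |- cts (fun y => @?f y ^+ ?n) => apply: (@ctsX _ _ f n)
  | |- cts (fun y => - @?f y) => apply: (@ctsN _ _ f)
  | |- cts (fun y => (@?f y)^-1) => apply: (@ctsV _ _ f)
  | |- cts (fun y => `|@?f y|) => apply: (@cts_norm _ _ f)
  | |- cts (fun y => @bigop _ _ _ _ (@?B y)) => apply: cts_sum => ?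
  end.
Ltac cts_leaf := match goal with
  | H : cts ?f |- cts ?f => exact H
  | H : cts ?f |- cts (fun y => ?f y) => exact H
  | H : forall i, cts (?F i) |- cts (?F ?j) => exact (H j)
  | H : forall i, cts (?F i) |- cts (fun y => ?F ?j y) => exact (H j)
  | H : forall i, cts (?D i ?f) |- cts (fun y => ?D ?j ?f y) => exact (H j)
  | H : forall i, cts (?D i (?D i ?f)) |- cts (fun y => ?D ?j (?D ?j ?f) y) => exact (H j)
  end.
Ltac cont := repeat first [cts_leaf | cont_step | match goal with
   | H : cts _ |- _ => exact H
   | H : forall _, cts _ |- _ => exact (H _)
   | H : forall _ _, cts _ |- _ => exact (H _ _)
   | H : forall _, _ != 0 |- forall _, _ != 0 => exact H end].

Section second.
Context {R : realType}.
Implicit Types g : R -> R.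

Lemma is_derive_cont g t l : isd (t:R) (1:R) g l -> {for t, continuous g}.
Proof. by move=> [d _]; apply: differentiable_continuous; exact/derivable1_diffP. Qed.

Lemma der_lt g g1 (a b : R) : a < b -> (forall t, a <= t <= b -> isd (t:R) (1:R) g (g1 t)) ->
  exists2 c, a < c < b & g b - g a = g1 c * (b - a).
Proof.
move=> ab H; have [||c cab E] := @MVT _ g g1 a b ab.
- by move=> t; rewrite in_itv/= => /andP[/ltW ? /ltW ?]; apply: H; apply/andP.
- apply: continuous_in_subspaceT => t; rewrite inE/= in_itv/= => tab.
  by have := H t tab => /is_derive_cont.
- by exists c => //; move: cab; rewrite in_itv.
Qed.

(** Were [g2] positive, [g1] would be positive just to the right of 0, and the mean value theorem
    would produce a value above [g 0]. *)
Lemma second_test (g g1 : R -> R) (g2 d : R) : 0 < d ->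
  (forall t, `|t| < d -> isd (t:R) (1:R) g (g1 t)) -> isd (0:R) (1:R) g1 g2 ->
  (forall t, `|t| < d -> g t <= g 0) -> g1 0 = 0 /\ g2 <= 0.
Proof.
move=> d0 H1 H2 mx.
have g10 : g1 0 = 0.
  have H0 : isd (0:R) (1:R) g (g1 0) by apply: H1; rewrite normr0.
  have Hm : isd (0:R) (1:R) g 0.
    apply: (@derive1_at_max R g (- d) d 0).
    - by lra.
    - by move=> t; rewrite in_itv/= => td; have [] := H1 t _; rewrite // ltr_norml.
    - by rewrite in_itv/=; lra.
    - by move=> t; rewrite in_itv/= => td; apply: mx; rewrite ltr_norml.
  exact: is_derive_inj H0 Hm.
split=> //; rewrite leNgt; apply/negP => g20.
have /is_deriveP := H2; rewrite g10 => /cvgrPdist_lt /(_ _ g20).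
move=> -[e /= e0 He].
pose r := Num.min e d / 2.
have m0 : 0 < Num.min e d by rewrite lt_min e0 d0.
have r0 : 0 < r by rewrite /r; lra.
have [rd re] : r < d /\ r < e.
  have : Num.min e d <= e by rewrite ge_min lexx.
  have : Num.min e d <= d by rewrite ge_min lexx orbT.
  by rewrite /r; split; lra.
have [|c /andP[c0 cr] E] := @der_lt g g1 0 r r0.
  by move=> t /andP[? ?]; apply: H1; rewrite ltr_norml; lra.
have : g1 c > 0.
  have := He c _ _; rewrite /ball/= sub0r normrN gtr0_norm// => H.
  have : `|g2 - c^-1 * (g1 c)| < g2.
    by have := H (lt_trans cr re) (lt0r_neq0 c0); rewrite add0r [c *: 1]mulr1 subr0.
  rewrite ltr_norml => /andP[_]; rewrite ltrBlDr ltrDl => h.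
  by rewrite -(@pmulr_rgt0 _ c^-1) ?invr_gt0.
have : g r <= g 0 by apply: mx; rewrite gtr0_norm.
have := mulr_gt0 (_ : 0 < g1 c) r0; rewrite subr0 in E => h1 h2 h3.
by have := h1 h3; rewrite -E subr_gt0 ltNge h2.
Qed.

End second.

Definition ee {R : realType} (i : 'I_3) : 'rV[R]_3 := delta_mx 0 i.

(** Pure second derivatives along the axes, without mixed ones and without continuity: exactly what
    the derivative tests at a maximum use. *)
Definition twice {R : realType} (f : 'rV[R]_3 -> R) (f1 f2 : 'I_3 -> 'rV[R]_3 -> R) :=
  forall i x, isd x (ee i) f (f1 i x) /\ isd x (ee i) (f1 i) (f2 i x).

Section maxprinciple.
Context {R : realType}.
Notation E := 'rV[R]_3.
Implicit Types (x y z : E) (f g : E -> R).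

Lemma eeE (i j : 'I_3) : ee i 0 j = (i == j)%:R :> R.
Proof. by rewrite mxE eqxx eq_sym. Qed.

Lemma sumd (i : 'I_3) (F : 'I_3 -> R) : \sum_j F j * (i == j)%:R = F i.
Proof.
rewrite (bigD1 i)//= eqxx mulr1 big1 ?addr0// => j /negPf.
by rewrite eq_sym => ->; rewrite mulr0.
Qed.

Lemma der_coord i j x : isd x (ee i) (fun y => y 0 j) (i == j)%:R.
Proof.
apply/is_deriveP; apply: cvg_near_cst; exists 1 => //= h _ h0.
by rewrite mxE [X in _ + X - _]mxE eeE addrC addKr mulKf.
Qed.

Definition sq y x : R := \sum_j (x 0 j - y 0 j) ^+ 2.

Lemma der_sq y i x : isd x (ee i) (sq y) (2 * (x 0 i - y 0 i)).
Proof.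
apply: (@der_eq _ _ _ _ _ (\sum_j 2 * (x 0 j - y 0 j) * (i == j)%:R)).
  apply: der_sum => j; have := der_coord i j x => H.
  by apply: der_eq; [der|rewrite /=; ring].
by rewrite sumd.
Qed.

Lemma sq_ge0 y x : 0 <= sq y x.
Proof. by apply: sumr_ge0 => j _; rewrite sqr_ge0. Qed.

Lemma le_sq y x j : (x 0 j - y 0 j) ^+ 2 <= sq y x.
Proof.
by rewrite /sq (bigD1 j)//= lerDl; apply: sumr_ge0 => k _; rewrite sqr_ge0.
Qed.

Lemma sqE y x : sq y x =
  (x 0 0 - y 0 0) ^+ 2 + (x 0 1 - y 0 1) ^+ 2 + (x 0 ord_max - y 0 ord_max) ^+ 2.
Proof.
rewrite /sq !big_ord_recl big_ord0 addr0 addrA.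
by congr (_ + _ + _); congr ((x 0 _ - y 0 _) ^+ 2); apply/val_inj.
Qed.

Lemma sum3E (F : 'I_3 -> R) : \sum_j F j = F 0 + F 1 + F ord_max.
Proof.
rewrite !big_ord_recl big_ord0 addr0 addrA.
by congr (_ + _ + _); congr (F _); apply/val_inj.
Qed.

Lemma coord_cont (i : 'I_3) : cts (fun x : E => x 0 i).
Proof. exact: coord_continuous. Qed.

Lemma sq_cont y : cts (sq y).
Proof.
have -> : sq y = fun x => (x 0 0 - y 0 0) ^+ 2 + (x 0 1 - y 0 1) ^+ 2
    + (x 0 ord_max - y 0 ord_max) ^+ 2 by apply/funext => x; exact: sqE.
by have Hc := coord_cont; cont.
Qed.

Lemma box_compact (a b : 'I_3 -> R) : compact [set x : E | forall i, a i <= x 0 i <= b i].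
Proof.
have := @rV_compact R 3 (fun i => `[a i, b i]%classic) (fun i => @segment_compact _ _ _).
by congr compact; apply/seteqP; split => x /= H i; have := H i; rewrite in_itv.
Qed.

Lemma ball_compact y (r : R) : compact [set x : E | sq y x <= r ^+ 2].
Proof.
apply: (subclosed_compact _ (@box_compact (fun i => y 0 i - `|r|) (fun i => y 0 i + `|r|))).
  rewrite (_ : mkset _ = sq y @^-1` [set t | t <= r ^+ 2]) //.
  apply: closed_comp; last exact: closed_le.
  by move=> x _; exact: sq_cont.
move=> x /= H i; have := le_trans (le_sq y x i) H.
rewrite -[r ^+ 2]sqr_normr => /(ler_norm_sqr (normr_ge0 _)); rewrite ler_norml.
by move=> /andP[? ?]; apply/andP; split; lra.
Qed.

Lemma max_on (A : set E) f y : cts f -> compact A -> A y ->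
  exists2 z, A z & forall x, A x -> f x <= f z.
Proof.
move=> cf cA Ay; have [|||z zA H] := @EVT_max_rV R 3 f A.
- by exists y.
- exact: cA.
- exact: continuous_subspaceT.
by exists z => [|x Ax]; [rewrite inE in zA|apply: H; rewrite inE].
Qed.

Lemma max_slice (F F1 : E -> R) (F2 d : R) z i : 0 < d ->
  (forall x, isd x (ee i) F (F1 x)) -> isd z (ee i) F1 F2 ->
  (forall t, `|t| < d -> F (z + t *: ee i) <= F z) -> F1 z = 0 /\ F2 <= 0.
Proof.
move=> d0 H1 H2 mx.
have := @second_test R (fun t => F (z + t *: ee i)) (fun t => F1 (z + t *: ee i)) F2 d d0.
rewrite !scale0r !addr0; apply => //.
- by move=> t _; exact: is_derive_slice.
- by apply: is_derive_slice; rewrite scale0r addr0.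
Qed.

Lemma coord_shift x (t : R) i j : (x + t *: ee i) 0 j = x 0 j + t * (i == j)%:R.
Proof. by rewrite mxE [X in _ + X]mxE eeE. Qed.

Lemma sq_shift y x (t : R) i : sq y (x + t *: ee i) = sq y x + 2 * t * (x 0 i - y 0 i) + t ^+ 2.
Proof.
rewrite /sq (eq_bigr (fun j => (x 0 j - y 0 j) ^+ 2 + (2 * t * (x 0 j - y 0 j) + t ^+ 2) * (i == j)%:R)).
  by rewrite big_split/= sumd; ring.
by move=> j _; rewrite coord_shift; case: eqP => _; rewrite /=; ring.
Qed.

(* The points at which a function vanishing outside a ball is positive are interior. *)
Lemma ball_interior y z (r : R) : 0 < r -> sq y z < r ^+ 2 ->
  exists2 d, 0 < d & forall i t, `|t| < d -> sq y (z + t *: ee i) <= r ^+ 2.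
Proof.
move=> r0 zr; pose rho := r ^+ 2 - sq y z.
have rho0 : 0 < rho by rewrite subr_gt0.
have k0 : 0 < 2 * r + 1 by lra.
exists (Num.min 1 (rho / (2 * r + 1))); first by rewrite lt_min ltr01 divr_gt0.
move=> i t; rewrite lt_min => /andP[t1]; rewrite ltr_pdivlMr// => t2.
have a1 : `|z 0 i - y 0 i| <= r.
  by apply: ler_norm_sqr (ltW r0) _; exact: le_trans (le_sq y z i) (ltW zr).
rewrite sq_shift.
have h1 : 2 * t * (z 0 i - y 0 i) <= 2 * `|t| * r.
  apply: le_trans (ler_norm _) _; rewrite !normrM (ger0_norm (_ : 0 <= 2))//.
  by apply: ler_pM => //; rewrite mulr_ge0.
have h2 : t ^+ 2 <= `|t|.
  by rewrite -sqr_normr expr2 ler_piMl// ltW.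
rewrite /rho in t2.
lra.
Qed.

(** No growth condition is put on [f]. The product [q] of [f - A] with the square of
    [r^2 - |x - y|^2] has an interior maximum in the ball, and the derivative tests there give
    [(f y - A) r^2 c <= 24] for every radius [r]. *)
Lemma keller_osserman f (f1 f2 : 'I_3 -> E -> R) (A c : R) : cts f -> twice f f1 f2 -> 0 < c ->
  (forall x, A < f x -> c * (f x - A) ^+ 2 <= \sum_i f2 i x) -> forall x, f x <= A.
Proof.
move=> cf df c0 H y; rewrite leNgt; apply/negP => fy.
suff key (r : R) : 0 < r -> (f y - A) * r ^+ 2 * c <= 24.
  have g0 : 0 < (f y - A) * c by rewrite mulr_gt0// subr_gt0.
  (* At this radius [k * r = 25 + k] and [1 <= r], so the product exceeds 24. *)
  have r0 : 0 < 25 / ((f y - A) * c) + 1 by rewrite addr_gt0// divr_gt0.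
  have := key _ r0; set k := (f y - A) * c in g0 r0 *; set r := _ + 1 in r0 *.
  have -> : (f y - A) * r ^+ 2 * c = k * r * r by rewrite /k; ring.
  have kr : k * r = 25 + k by rewrite /r mulrDr mulr1 mulrC divfK// gt_eqF.
  have r1 : 1 <= r by rewrite /r lerDr divr_ge0// ltW.
  rewrite kr; nra.
move=> r0.
pose rho x := r ^+ 2 - sq y x; pose q x := (f x - A) * rho x ^+ 2.
have cq : cts q.
  by have cs : cts (sq y) by [exact: sq_cont]; change (cts (fun x => (f x - A) * (r ^+ 2 - sq y x) ^+ 2)); cont.
have yK : sq y y <= r ^+ 2.
  by rewrite /sq big1 ?sqr_ge0// => j _; rewrite subrr expr0n.
have [z zK zmax] := max_on cq (@ball_compact y r) yK.
have qy : q y = (f y - A) * r ^+ 2 * r ^+ 2.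
  rewrite /q /rho /sq big1 ?subr0; first by ring.
  by move=> j _; rewrite subrr expr0n.
have r20 : 0 < r ^+ 2 by rewrite exprn_gt0.
have qz : 0 < q z.
  by apply: lt_le_trans (zmax _ yK); rewrite qy !mulr_gt0// subr_gt0.
have rz : 0 < rho z.
  rewrite lt_neqAle subr_ge0 zK andbT eq_sym; apply/eqP => rz0.
  by move: qz; rewrite /q rz0 expr0n mulr0 ltxx.
have gz : 0 < f z - A by move: qz; rewrite /q pmulr_lgt0// exprn_gt0.
have zr : sq y z < r ^+ 2 by rewrite -subr_gt0.
have [d d0 dK] := ball_interior r0 zr.
have drho i x : isd x (ee i) rho (- (2 * (x 0 i - y 0 i))).
  have := der_sq y i x => Hs.
  by apply: der_eq; [rewrite /rho; der|ring].
pose q1 i x := (f x - A) * (2 * rho x * - (2 * (x 0 i - y 0 i))) + rho x ^+ 2 * f1 i x.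
(* The vanishing first derivative gives [rho f1 = 4 (z_i - y_i) (f - A)]. Substituting it into the
   second derivative turns the coefficient 8 into [8 - 32 = - 24]. *)
have step i : rho z ^+ 2 * f2 i z <= (f z - A) * (24 * (z 0 i - y 0 i) ^+ 2 + 4 * rho z).
  have [|||e1 e2] := @max_slice q (q1 i)
    ((f z - A) * (8 * (z 0 i - y 0 i) ^+ 2 - 4 * rho z)
     - 8 * (z 0 i - y 0 i) * rho z * f1 i z + rho z ^+ 2 * f2 i z) d z i d0.
  - move=> x; have [H1 _] := df i x; have H2 := drho i x.
    by apply: der_eq; [rewrite /q; der|rewrite /q1 /=; ring].
  - have [H1 H2] := df i z; have H3 := drho i z; have H4 := der_coord i i z.
    by apply: der_eq; [rewrite /q1; der|rewrite eqxx /=; ring].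
  - by move=> t td; apply: zmax; apply: dK.
  rewrite /q1 in e1.
  have e3 : rho z * f1 i z = 4 * (z 0 i - y 0 i) * (f z - A).
    by apply: (mulfI (lt0r_neq0 rz)); apply/eqP; rewrite -subr_eq0 -e1; apply/eqP; ring.
  have e4 : 8 * (z 0 i - y 0 i) * rho z * f1 i z = 32 * (z 0 i - y 0 i) ^+ 2 * (f z - A).
    have -> : 8 * (z 0 i - y 0 i) * rho z * f1 i z = 8 * (z 0 i - y 0 i) * (rho z * f1 i z) by ring.
    by rewrite e3; ring.
  rewrite e4 in e2; rewrite -subr_le0; apply: le_trans e2; rewrite le_eqVlt; apply/orP; left.
  by apply/eqP; ring.
have sum : rho z ^+ 2 * \sum_i f2 i z <= (f z - A) * (24 * sq y z + 12 * rho z).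
  rewrite mulr_sumr; apply: le_trans (ler_sum _ (fun i _ => step i)) _.
  rewrite -mulr_sumr big_split/= -mulr_sumr sumr_const card_ord -/(sq y z).
  by rewrite le_eqVlt; apply/orP; left; apply/eqP; rewrite -mulr_natl; ring.
have Hz := H z; rewrite -subr_gt0 in Hz; have {}Hz := Hz gz.
have : q z * c <= 24 * r ^+ 2.
  have e1 : rho z ^+ 2 * (c * (f z - A) ^+ 2) <= (f z - A) * (24 * sq y z + 12 * rho z).
    by apply: le_trans sum; rewrite ler_pM2l// exprn_gt0.
  have e2 : 24 * sq y z + 12 * rho z <= 24 * r ^+ 2 by rewrite /rho in rz *; lra.
  rewrite -(ler_pM2l gz); apply: le_trans (_ : (f z - A) * (24 * sq y z + 12 * rho z) <= _).
    by apply: le_trans e1; rewrite le_eqVlt; apply/orP; left; apply/eqP; rewrite /q; ring.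
  by rewrite ler_pM2l.
have := zmax _ yK; rewrite qy => e1 e2.
rewrite -(ler_pM2r r20); apply: le_trans e2.
by rewrite mulrAC ler_pM2r.
Qed.

(** A multiple of [rho ^+ 2] touches [s] from below at some [z]. If [s z < d], comparing the
    Laplacians at [z] gives [rho^2 - 20 rho + 200 <= 0], which is impossible. So [d <= s z], and
    [q y <= q z] carries the bound to the centre. *)
Lemma bounded_below_of_superlinear (s : E -> R) (s1 s2 : 'I_3 -> E -> R) (d : R) : cts s -> twice s s1 s2 ->
  (forall x, 0 < s x) -> (forall x, s x < d -> \sum_i s2 i x <= - s x) -> forall x, d <= s x.
Proof.
move=> cs ds s0 H y.
(* Any radius with [8 r^2 > 100] makes [rho^2 - 20 rho + 8 r^2] positive. *)
pose r : R := 5; have r0 : 0 < r by rewrite /r.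
pose rho x := r ^+ 2 - sq y x; pose q x := rho x ^+ 2 / s x.
have cq : cts q.
  have csq : cts (sq y) by [exact: sq_cont]; change (cts (fun x => (r ^+ 2 - sq y x) ^+ 2 / s x)).
  by cont => x; rewrite gt_eqF.
have sqyy : sq y y = 0 by rewrite /sq big1// => j _; rewrite subrr expr0n.
have yK : sq y y <= r ^+ 2 by rewrite sqyy sqr_ge0.
have [z zK zmax] := max_on cq (@ball_compact y r) yK.
have r20 : 0 < r ^+ 2 by rewrite exprn_gt0.
have qz : 0 < q z.
  apply: lt_le_trans (zmax _ yK); rewrite /q /rho sqyy subr0.
  by rewrite divr_gt0// exprn_gt0.
have rz : 0 < rho z.
  rewrite lt_neqAle subr_ge0 zK andbT eq_sym; apply/eqP => rz0.
  by move: qz; rewrite /q rz0 expr0n mul0r ltxx.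
have zr : sq y z < r ^+ 2 by rewrite -subr_gt0.
have [e e0 eK] := ball_interior r0 zr.
have drho i x : isd x (ee i) rho (- (2 * (x 0 i - y 0 i))).
  have := der_sq y i x => Hs.
  by apply: der_eq; [rewrite /rho; der|ring].
pose th := q z.
have step i : 8 * (z 0 i - y 0 i) ^+ 2 - 4 * rho z <= th * s2 i z.
  have [|||e1 e2] := @max_slice (fun x => rho x ^+ 2 - th * s x)
    (fun x => 2 * rho x * - (2 * (x 0 i - y 0 i)) - th * s1 i x)
    (8 * (z 0 i - y 0 i) ^+ 2 - 4 * rho z - th * s2 i z) e z i e0.
  - move=> x; have [H1 _] := ds i x; have H2 := drho i x.
    by apply: der_eq; [der|rewrite /=; ring].
  - have [H1 H2] := ds i z; have H3 := drho i z; have H4 := der_coord i i z.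
    by apply: der_eq; [der|rewrite eqxx /=; ring].
  - move=> t td; have := zmax _ (eK i t td); rewrite -/th.
    have sz := s0 z; rewrite {2}/th /q divfK ?gt_eqF// subrr.
    by rewrite subr_le0 /q ler_pdivrMr.
  by move: e2; rewrite subr_le0.
have sum : 8 * sq y z - 12 * rho z <= th * \sum_i s2 i z.
  rewrite [leRHS]mulr_sumr; apply: le_trans (ler_sum _ (fun i _ => step i)).
  rewrite sumrB -mulr_sumr sumr_const card_ord -/(sq y z).
  by rewrite le_eqVlt; apply/orP; left; apply/eqP; rewrite -mulr_natl; ring.
have sz : d <= s z.
  rewrite leNgt; apply/negP => /H Hz.
  have e1 : th * \sum_i s2 i z <= - rho z ^+ 2.
    apply: le_trans (_ : th * - s z <= _); first by rewrite ler_pM2l.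
    by rewrite mulrN /th /q divfK ?gt_eqF.
  have := le_trans sum e1; have -> : sq y z = r ^+ 2 - rho z by rewrite /rho; ring.
  rewrite /r; have := sqr_ge0 (rho z - 10); nra.
apply: le_trans sz _; rewrite -lef_pV2 ?posrE//.
have : q y <= q z by exact: zmax.
rewrite {1}/q {1}/rho sqyy subr0 => h.
rewrite -(@ler_pM2l _ ((r ^+ 2) ^+ 2)) ?exprn_gt0//; apply: le_trans h _.
rewrite /q ler_pM2r ?invr_gt0// ler_pXn2r ?nnegrE ?sqr_ge0//; last exact: ltW.
by rewrite /rho gerBl sq_ge0.
Qed.

End maxprinciple.

(** * Interior gradient bound and smoothness *)

Section gradient.
Context {R : realType}.
Notation E := 'rV[R]_3.
Implicit Types (x y z : E) (f g : E -> R).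

Lemma der_shift f x y v l : isd (y + x) v f l -> isd x v (fun x => f (y + x)) l.
Proof.
move=> /is_deriveP H; apply/is_deriveP; move: H.
by under eq_fun do rewrite -addrA.
Qed.

Definition refl (i : 'I_3) x : E := x - (2 * x 0 i) *: ee i.

Lemma der_refl f i j x y l : isd (y + refl i x) (ee j) f l ->
  isd x (ee j) (fun x => f (y + refl i x)) ((1 - 2 * (i == j)%:R) * l).
Proof.
move=> H; apply: is_derive_unslice.
set s := 1 - _.
have -> : (fun t => f (y + refl i (x + t *: ee j))) =
    fun t => (fun u => f (y + refl i x + u *: ee j)) (t * s).
  apply/funext => t; congr f; rewrite -addrA; congr (_ + _).
  rewrite /refl coord_shift /s eq_sym.
  have [->|_] := eqVneq j i; rewrite ?mulr1 ?mulr0 ?addr0 ?subr0 ?mulr1.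
    by rewrite mulrDr scalerDl mulrBr mulr1 scalerBl opprD addrACA [t * 2]mulrC.
  by rewrite addrAC.
rewrite [s * l]mulrC.
apply: (@der_comp R R 0 1 (fun t => t * s) (fun u => f (y + refl i x + u *: ee j)) s l).
  by apply: der_eq; [der|rewrite /=; ring].
by apply: is_derive_slice; rewrite mul0r scale0r addr0.
Qed.

Lemma cts_shift f y : cts f -> cts (fun x => f (y + x)).
Proof.
move=> cf x; apply: (@continuous_comp _ _ _ (fun x => y + x) f); last exact: cf.
have H1 : {for x, continuous (fun _ : E => y)} by exact: cst_continuous.
have H2 : {for x, continuous (@idfun E)} by exact: cvg_id.
exact: continuousD H1 H2.
Qed.

Lemma cts_refl f i y : cts f -> cts (fun x => f (y + refl i x)).
Proof.
move=> cf x; apply: (@continuous_comp _ _ _ (fun x => y + refl i x) f); last exact: cf.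
have H : cts (fun x : E => 2 * x 0 i) by have Hc := coord_cont; cont.
have H0 (c : E) : {for x, continuous (fun _ : E => c)} by exact: cst_continuous.
have H2 : {for x, continuous (@idfun E)} by exact: cvg_id.
exact: continuousD (H0 y) (continuousB H2 (continuousZ (H x) (H0 (ee i)))).
Qed.

Lemma mvt_bound (g g1 : R -> R) (t M : R) :
  (forall s, `|s| <= `|t| -> isd (s : R) (1 : R) g (g1 s)) ->
  (forall s, `|s| <= `|t| -> `|g1 s| <= M) -> `|g t - g 0| <= M * `|t|.
Proof.
move=> H1 H2; have [t0|t0|->] := ltgtP t 0; last by rewrite subrr !normr0 mulr0.
- have [|c /andP[c1 c2]] := @der_lt R g g1 t 0 t0.
    move=> s /andP[s1 s2]; apply: H1.
    by rewrite !ler0_norm ?lerN2// ltW.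
  rewrite distrC => ->; rewrite normrM sub0r normrN ler_wpM2r//.
  by apply: H2; rewrite !ler0_norm ?lerN2// ltW.
- have [|c /andP[c1 c2] ->] := @der_lt R g g1 0 t t0.
    by move=> s /andP[s1 s2]; apply: H1; rewrite !ger0_norm// ltW.
  rewrite normrM subr0 ler_wpM2r//.
  by apply: H2; rewrite !ger0_norm// ltW.
Qed.

(** The odd part of [f] about the hyperplane through [y] vanishes on the face [x_i = 0] of a half
    cube. The barrier [psi] is nonnegative, at least [M] on the other faces, and has Laplacian
    [- N]; the strict bound on the Laplacian of [f] then excludes a positive interior maximum of the
    difference. At [t e_i] the barrier is at most [t (3 M + N / 2)]. *)
Lemma grad_bound f (f1 f2 : 'I_3 -> E -> R) (M N : R) i y (t : R) :
  cts f -> twice f f1 f2 -> (forall x, `|f x| <= M) ->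
  (forall x, `|\sum_j f2 j x| < N) -> 0 <= t <= 1 ->
  f (y + t *: ee i) - f (y - t *: ee i) <= t * (6 * M + N).
Proof.
move=> cf df fM fN t01.
have M0 : 0 <= M by apply: le_trans (fM 0).
have N0 : 0 < N by apply: le_lt_trans (fN 0).
pose psi x := M * (sq 0 x + 3 * x 0 i - 3 * x 0 i ^+ 2) + N / 2 * (x 0 i - x 0 i ^+ 2).
pose F x := (f (y + x) - f (y + refl i x)) / 2 - psi x.
have cF : cts F.
  have Hc := coord_cont; have Hs := @sq_cont R 0; have H1 := cts_shift (y := y) cf.
  by have H2 := cts_refl (i := i) (y := y) cf; rewrite /F /psi; cont.
pose lo (j : 'I_3) : R := if j == i then 0 else -1.
pose K := [set x : E | forall j, lo j <= x 0 j <= 1].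
have K0 x : K x -> 0 <= x 0 i <= 1 by move=> /(_ i); rewrite /lo eqxx.
have te : (t *: ee i) 0 =1 (fun j => t * (i == j)%:R).
  by move=> j; rewrite mxE eeE.
have tK : K (t *: ee i).
  move=> j; rewrite te /lo; have [_|_] := eqVneq j i; rewrite /= ?mulr1 ?mulr0//.
  by rewrite lerN10 ler01.
have [z zK zmax] := max_on cF (@box_compact _ lo (fun=> 1)) tK.
have psi_sq x : psi x = M * (sq 0 x - x 0 i ^+ 2 + x 0 i + 2 * x 0 i * (1 - x 0 i)) + N / 2 * (x 0 i * (1 - x 0 i)).
  by rewrite /psi; ring.
have sqi x j : x 0 j ^+ 2 <= sq 0 x by have := le_sq 0 x j; rewrite mxE subr0.
have sqij x j : j != i -> x 0 j ^+ 2 + x 0 i ^+ 2 <= sq 0 x.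
  move=> ji; rewrite /sq (bigD1 i)//= (bigD1 j)//= !mxE !subr0 addrA [x 0 i ^+ 2 + _]addrC.
  by rewrite lerDl sumr_ge0// => k _; rewrite sqr_ge0.
have psi0 x : K x -> 0 <= psi x.
  move=> /K0 /andP[a b]; rewrite psi_sq addr_ge0// mulr_ge0// ?divr_ge0 ?(ltW N0)//; last first.
    by rewrite mulr_ge0// subr_ge0.
  have : 0 <= x 0 i * (1 - x 0 i) by rewrite mulr_ge0// subr_ge0.
  by have := sqi x i; lra.
have psi1 x j : K x -> `|x 0 j| = 1 -> M <= psi x.
  move=> Kx xj; have /andP[a b] := K0 x Kx.
  have h1 : 0 <= N / 2 * (x 0 i * (1 - x 0 i)).
    by rewrite !mulr_ge0// ?subr_ge0// ltW.
  have h2 : 0 <= x 0 i * (1 - x 0 i) by rewrite mulr_ge0// subr_ge0.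
  rewrite psi_sq; suff : 1 <= sq 0 x - x 0 i ^+ 2 + x 0 i + 2 * x 0 i * (1 - x 0 i) by nra.
  have [ji|ji] := eqVneq j i.
    by move: xj; rewrite ji ger0_norm// => e; have := sqi x i; rewrite !e; lra.
  have := sqij x j ji; have : x 0 j ^+ 2 = 1 by rewrite -sqr_normr xj expr1n.
  by lra.
have FM x : (f (y + x) - f (y + refl i x)) / 2 <= M.
  have := fM (y + x); have := fM (y + refl i x); rewrite !ler_norml.
  by move=> /andP[? ?] /andP[? ?]; lra.
have Fz : F z <= 0.
  rewrite leNgt; apply/negP => Fz.
  have zi0 : 0 < z 0 i.
    have /andP[a _] := K0 z zK; rewrite lt_neqAle a andbT eq_sym; apply/eqP => e.
    move: Fz; rewrite /F /refl e mulr0 scale0r subr0 subrr mul0r sub0r oppr_gt0.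
    by rewrite ltNge psi0.
  have z1 j : `|z 0 j| < 1.
    rewrite lt_neqAle; apply/andP; split.
      apply/eqP => e; move: Fz; rewrite /F subr_gt0 ltNge.
      by rewrite (le_trans (FM z)) ?(psi1 z j).
    have := zK j; rewrite /lo ler_norml; case: eqP => [->|_]; last by [].
    by move=> /andP[? ->]; rewrite andbT; lra.
  have int j : exists2 d, 0 < d & forall s, `|s| < d -> K (z + s *: ee j).
    exists (Num.min (z 0 i) (1 - `|z 0 j|)); first by rewrite lt_min zi0 subr_gt0 z1.
    move=> s; rewrite lt_min => /andP[s1 s2] k; rewrite coord_shift.
    have [jk|_] := eqVneq j k; last by rewrite mulr0 addr0; exact: zK.
    rewrite mulr1 -jk; move: s1 s2; have := zK j; rewrite /lo.
    have h1 := ler_norm s; have h2 := ler_norm (z 0 j).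
    have h3 := ler_norm (- s); have h4 := ler_norm (- z 0 j).
    rewrite !normrN in h3 h4.
    by move: h2 h4; case: eqP => [->|_] h2 h4 /andP[? ?] ? ?; apply/andP; split; lra.
  have step j : (f2 j (y + z) - f2 j (y + refl i z)) / 2
      <= M * (2 - 6 * (i == j)%:R) - N * (i == j)%:R.
    have [d d0 dK] := int j.
    have [|||_] := @max_slice R F (fun x => (f1 j (y + x) - (1 - 2 * (i == j)%:R) * f1 j (y + refl i x)) / 2
      - (M * (2 * x 0 j + 3 * (i == j)%:R - 6 * x 0 i * (i == j)%:R) + N / 2 * ((i == j)%:R - 2 * x 0 i * (i == j)%:R)))
      ((f2 j (y + z) - f2 j (y + refl i z)) / 2
      - (M * (2 - 6 * (i == j)%:R) - N * (i == j)%:R)) d z j d0.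
    - move=> x; have [H1 _] := df j (y + x); have [H2 _] := df j (y + refl i x).
      have {}H1 := der_shift H1; have {}H2 := der_refl H2.
      have H3 := der_sq 0 j x; have H4 := der_coord j i x.
      rewrite mxE subr0 in H3; rewrite eq_sym in H4.
      by apply: der_eq; [rewrite /F /psi; der|rewrite /=; ring].
    - have [_ H1] := df j (y + z); have [_ H2] := df j (y + refl i z).
      have {}H1 := der_shift H1; have {}H2 := der_refl H2.
      have H3 := der_coord j j z; have H4 := der_coord j i z.
      rewrite eqxx in H3; rewrite eq_sym in H4.
      apply: der_eq; [der|rewrite /=].
      by case: (i == j); rewrite /=; lra.
    - by move=> s /dK; exact: zmax.
    by rewrite subr_le0.
  have := ler_sum (index_enum 'I_3) (fun j (_ : true) => step j).
  rewrite -mulr_suml !sumrB sumd -mulr_sumr sumrB -mulr_sumr sumr_const card_ord.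
  have -> : \sum_j (i == j)%:R = 1 :> R.
    by rewrite -[RHS](sumd i (fun=> 1)); apply: eq_bigr => j _; rewrite mul1r.
  have := fN (y + z); have := fN (y + refl i z); rewrite !ltr_norml.
  move=> /andP[? ?] /andP[? ?]; rewrite mulr1 -mulr_natl; lra.
have := le_trans (zmax _ tK) Fz; rewrite /F /psi /refl te eqxx mulr1.
have -> : t *: ee i - (2 * t) *: ee i = - (t *: ee i).
  have -> : 2 * t = t + t by ring.
  by rewrite scalerDl opprD addrA subrr add0r.
have -> : sq 0 (t *: ee i) = t ^+ 2.
  rewrite /sq -[RHS](sumd i (fun=> t ^+ 2)); apply: eq_bigr => j _.
  by rewrite te mxE subr0 exprMn; case: (i == j); rewrite ?expr1n ?expr0n.
move: t01 => /andP[t0 t1]; have := mulr_ge0 M0 (sqr_ge0 t); have := mulr_ge0 (ltW N0) (sqr_ge0 t).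
nra.
Qed.

(** An approximate maximum principle on the whole space. If the Laplacian exceeded [e] wherever
    [f > S - e], it would be at least [(f - (S - e))^2 / e] there, because [f - (S - e) <= e], and
    [keller_osserman] would give [f <= S - e] everywhere. *)
Lemma approx_sup f (f1 f2 : 'I_3 -> E -> R) (S : R) : cts f -> twice f f1 f2 ->
  (forall x, f x <= S) -> (forall S', S' < S -> exists x, S' < f x) ->
  forall e, 0 < e -> exists2 x, S - e < f x & \sum_i f2 i x <= e.
Proof.
move=> cf df fS Sf e e0; apply: contrapT => H.
have {}H x : S - e < f x -> e < \sum_i f2 i x.
  by move=> h; rewrite ltNge; apply/negP => h'; apply: H; exists x.
have [|x] := Sf (S - e); first by rewrite ltrBlDr ltrDl.
rewrite ltNge => /negP; apply.
apply: (@keller_osserman _ f f1 f2 (S - e) (e^-1)) => //; rewrite ?invr_gt0//.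
move=> {}x h; apply: le_trans (ltW (H x h)); rewrite mulrC ler_pdivrMr// -expr2.
rewrite ler_pXn2r ?nnegrE ?subr_ge0 ?(ltW h) ?(ltW e0)//.
by rewrite lerBlDr addrC subrK fS.
Qed.

Section C2.

Lemma rV3E (h : E) : h = h 0 0 *: ee 0 + h 0 1 *: ee 1 + h 0 ord_max *: ee ord_max.
Proof.
apply/rowP => j; rewrite !mxE !eqxx /=.
case: j => -[|[|[|//]]] p; rewrite /= ?mulr1 ?mulr0 ?addr0 ?add0r;
  by congr (h 0 _); apply/val_inj.
Qed.

(** The path from [x] to [x + h] along the axes stays in the cube of radius [r] about [x], so the
    mean value theorem is only needed along coordinate segments. *)
Lemma path_bound f (f1 : 'I_3 -> E -> R) x (h : E) (r M : R) :
  (forall i x, isd x (ee i) f (f1 i x)) ->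
  (forall i y, (forall j, `|y 0 j - x 0 j| <= r) -> `|f1 i y| <= M) ->
  (forall j, `|h 0 j| <= r) ->
  `|f (x + h) - f x| <= M * \sum_j `|h 0 j|.
Proof.
move=> df Mf hr.
have r0 : 0 <= r by apply: le_trans (hr 0).
have step (y : E) j : (forall k, `|y 0 k - x 0 k| <= r) -> y 0 j = x 0 j ->
    `|f (y + h 0 j *: ee j) - f y| <= M * `|h 0 j|.
  move=> yr yj.
  have := @mvt_bound (fun t => f (y + t *: ee j)) (fun t => f1 j (y + t *: ee j)) (h 0 j) M.
  rewrite scale0r addr0; apply => s hs; first exact: is_derive_slice.
  apply: Mf => k; rewrite coord_shift; have [<-|_] := eqVneq j k; last by rewrite mulr0 addr0.
  by rewrite yj addrAC subrr add0r mulr1 (le_trans hs).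
rewrite sum3E {1}(rV3E h) !addrA !mulrDr.
set x1 := x + _; set x2 := x1 + _.
have e0 : `|f x1 - f x| <= M * `|h 0 0|.
  by apply: step => // k; rewrite subrr normr0.
have e1 : `|f x2 - f x1| <= M * `|h 0 1|.
  apply: step => [k|]; rewrite /x1 coord_shift ?mulr0 ?addr0//.
  by rewrite addrAC subrr add0r; case: (0 == k); rewrite ?mulr1 ?mulr0 ?normr0.
have e2 : `|f (x2 + h 0 ord_max *: ee ord_max) - f x2| <= M * `|h 0 ord_max|.
  apply: step => [k|]; rewrite /x2 /x1 !coord_shift ?mulr0 ?addr0//.
  rewrite addrAC [x 0 k + _]addrC addrK.
  case: k => -[|[|[|//]]] p /=; rewrite ?mulr1 ?mulr0 ?add0r ?addr0 ?normr0//.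
have -> : f (x2 + h 0 ord_max *: ee ord_max) - f x =
  (f x1 - f x) + (f x2 - f x1) + (f (x2 + h 0 ord_max *: ee ord_max) - f x2) by ring.
by apply: le_trans (ler_normD _ _) _; rewrite lerD// (le_trans (ler_normD _ _))// lerD.
Qed.

Lemma cts_of_partials f (f1 : 'I_3 -> E -> R) : (forall i x, isd x (ee i) f (f1 i x)) ->
  (forall i, cts (f1 i)) -> cts f.
Proof.
move=> df cf x.
have [M MP] : exists M : R, forall i y, (forall j, `|y 0 j - x 0 j| <= 1) -> `|f1 i y| <= M.
  have bnd i : exists M : R, forall y, (forall j, `|y 0 j - x 0 j| <= 1) -> `|f1 i y| <= M.
    pose K := [set y : E | forall j, x 0 j - 1 <= y 0 j <= x 0 j + 1].
    have KE y : (forall j, `|y 0 j - x 0 j| <= 1) -> K y.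
      by move=> H j; have := H j; rewrite ler_norml => /andP[? ?]; apply/andP; split; lra.
    have [|||z _ zM] := @max_on R K (fun y => `|f1 i y|) x.
    - by have := cf i => ?; cont.
    - exact: box_compact.
    - by apply: KE => j; rewrite subrr normr0.
    by exists `|f1 i z| => y /KE; exact: zM.
  have [M0 H0] := bnd 0; have [M1 H1] := bnd 1; have [M2 H2] := bnd ord_max.
  exists (Num.max M0 (Num.max M1 M2)) => -[[|[|[|//]]] p] y hy; rewrite !le_max.
  - by rewrite (_ : Ordinal p = 0) ?H0//; apply/val_inj.
  - by rewrite (_ : Ordinal p = 1) ?H1 ?orbT//; apply/val_inj.
  - by rewrite (_ : Ordinal p = ord_max) ?H2 ?orbT//; apply/val_inj.
have M0 : 0 <= M by apply: le_trans (MP 0 x _) => // j; rewrite subrr normr0.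
apply/(@cvgrPdist_le R R E (nbhs x) (nbhs_filter x)) => e e0; apply/nbhs_ballP.
exists (Num.min 1 (e / (3 * M + 1))) => /=; first by rewrite lt_min ltr01 divr_gt0// ltr_wpDl// mulr_ge0.
move=> y [_ xy].
have d j : `|(y - x) 0 j| < Num.min 1 (e / (3 * M + 1)).
  by have := xy 0 j; rewrite /ball/= distrC !mxE.
rewrite distrC -[y](subrK x) [y - x + x]addrC.
apply: le_trans (@path_bound _ _ x (y - x) 1 M df MP _) _.
  by move=> j; have := d j; rewrite lt_min => /andP[/ltW].
apply: le_trans (_ : M * \sum_(j < 3) (e / (3 * M + 1)) <= _).
  by rewrite ler_wpM2l// ler_sum// => j _; have := d j; rewrite lt_min => /andP[_ /ltW].
rewrite sumr_const card_ord -[_ *+ 3]mulr_natl.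
have k : 0 < 3 * M + 1 by rewrite ltr_wpDl// mulr_ge0.
have -> : M * (3 * (e / (3 * M + 1))) = 3 * M * e / (3 * M + 1) by ring.
by rewrite ler_pdivrMr//; lra.
Qed.

Lemma C1_isd f i x : C1 f -> isd x (ee i) f (partial i f x).
Proof. by move=> H; apply: derivableP; have [] := H i. Qed.

Lemma C1_cts f : C1 f -> cts f.
Proof.
move=> H; apply: (@cts_of_partials f (fun i => partial i f)).
  by move=> i x; exact: C1_isd.
by move=> i; have [] := H i.
Qed.

Lemma C2_twice f : C2 f -> twice f (fun i => partial i f) (fun i => partial i (partial i f)).
Proof. by move=> [H1 H2] i x; split; [exact: C1_isd|exact: C1_isd (H2 i)]. Qed.

End C2.

End gradient.

(** * Smoothness through bounded difference quotients *)

Section smooth.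
Context {R : realType}.
Notation E := 'rV[R]_3.
Implicit Types (x y z : E) (f g : E -> R) (i j : 'I_3) (C D h : R).

Lemma ultra_bounded (T : Type) (G : set_system T) (GU : UltraFilter G) (a : T -> R) (M : R) :
  G [set t | `|a t| <= M] -> exists l : R, a @ G --> l.
Proof.
move=> aM.
have cK := @segment_compact R (- M) M.
have [|l [_ cl]] := cK (a @ G) _.
  by apply: filterS aM => t H; rewrite /preimage/mkset/= in_itv/= -ler_norml; exact: H.
exists l => A Al; have [//|GA] := in_ultra_setVsetC (a @^-1` A) GU.
have [t [] //] := cl (~` A) A GA Al.
Qed.

Lemma dnbhs_neq0 : 0^' [set k : R | k != 0].
Proof. by exists 1 => //=. Qed.

Definition dq i h f : E -> R := fun x => (f (x + h *: ee i) - f x) / h.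

(* Bounds on iterated difference quotients up to order [k]; they replace bounds on
   derivatives so as to be closed under pointwise limits. *)
Fixpoint Bk (k : nat) C f : Prop :=
  (forall x, `|f x| <= C) /\
  if k is k'.+1 then forall i h, h != 0 -> Bk k' C (dq i h f) else True.

Lemma Bk_bound k C f : Bk k C f -> forall x, `|f x| <= C.
Proof. by case: k => [|k] []. Qed.

Lemma Bk_ge0 k C f : Bk k C f -> 0 <= C.
Proof. by move=> /Bk_bound /(_ 0); apply: le_trans. Qed.

Lemma Bk_dq k C f i h : h != 0 -> Bk k.+1 C f -> Bk k C (dq i h f).
Proof. by move=> h0 [_ H]; exact: H. Qed.

Lemma Bk_le k C D f : C <= D -> Bk k C f -> Bk k D f.
Proof.
elim: k f => [|k IH] f CD /= [fC H]; split=> //; try by move=> x; exact: le_trans (fC x) CD.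
by move=> i h h0; apply: IH => //; exact: H.
Qed.

Lemma Bk_pred k C f : Bk k.+1 C f -> Bk k C f.
Proof.
elim: k f => [|k IH] f [fC H]; split=> //.
by move=> i h h0; apply: IH; exact: H.
Qed.

Lemma Bk_shift k C f a : Bk k C f -> Bk k C (fun x => f (x + a)).
Proof.
elim: k f => [|k IH] f [fC H]; split=> //.
move=> i h h0; rewrite (_ : dq _ _ _ = fun x => dq i h f (x + a)); first exact/IH/H.
by apply/funext => x; rewrite /dq addrAC.
Qed.

Lemma Bk_add k C D f g : Bk k C f -> Bk k D g -> Bk k (C + D) (fun x => f x + g x).
Proof.
elim: k f g => [|k IH] f g [fC Hf] [gD Hg]; split=> //; try by
  move=> x; apply: le_trans (ler_normD _ _) _; exact: lerD.
move=> i h h0; rewrite (_ : dq _ _ _ = fun x => dq i h f x + dq i h g x).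
  by apply: IH; [exact: Hf|exact: Hg].
by apply/funext => x; rewrite /dq; ring.
Qed.

(** The discrete product rule has two terms, one with a shifted factor, so each order doubles the
    constant. *)
Lemma Bk_mul k C D f g : Bk k C f -> Bk k D g ->
  Bk k (2 ^+ k * (C * D)) (fun x => f x * g x).
Proof.
have fg a b : (forall x, `|a x| <= C) -> (forall x, `|b x| <= D) ->
    forall x : E, `|a x * b x| <= C * D.
  by move=> fC gD x; rewrite normrM ler_pM.
elim: k f g => [|k IH] f g [fC Hf] [gD Hg]; split=> //.
- by rewrite mul1r; exact: fg.
- move=> x; apply: le_trans (fg _ _ fC gD x) _.
  rewrite ler_peMl ?exprn_ege1 ?ler1n//.
  by rewrite mulr_ge0// ?(le_trans _ (fC 0))// (le_trans _ (gD 0)).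
move=> i h h0.
rewrite (_ : dq _ _ _ = fun x => dq i h f x * g (x + h *: ee i) + f x * dq i h g x).
  rewrite exprS -mulrA mulr_natl mulr2n; apply: Bk_add; apply: IH.
  - exact: Hf.
  - apply: Bk_shift; exact: (@Bk_pred k).
  - exact: (@Bk_pred k).
  - exact: Hg.
by apply/funext => x; rewrite /dq; ring.
Qed.

Lemma Bk_cst k (c : R) : Bk k `|c| (fun=> c).
Proof.
have B0 : forall k, Bk k 0 (fun=> 0).
  elim=> [|{}k IH]; split=> //; try by move=> x; rewrite normr0.
  move=> i h h0; rewrite (_ : dq _ _ _ = fun=> 0)//.
  by apply/funext => x; rewrite /dq subrr mul0r.
case: k => [|k]; split=> // i h h0; rewrite (_ : dq _ _ _ = fun=> 0).
  exact: (@Bk_le k 0).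
by apply/funext => x; rewrite /dq subrr mul0r.
Qed.

Lemma norm_lim (T : Type) (F : set_system T) (FF : ProperFilter F) (a : T -> R) (l M : R) :
  a @ F --> l -> F [set t | `|a t| <= M] -> `|l| <= M.
Proof. by move=> al aM; apply: (cvgr_to_le (cvg_norm al)). Qed.

Lemma Bk_lim (T : Type) (F : set_system T) (FF : ProperFilter F) (ft : T -> E -> R) k C f :
  F [set t | Bk k C (ft t)] -> (forall x, ft ^~ x @ F --> f x) -> Bk k C f.
Proof.
have bnd m gt g : F [set t | Bk m C (gt t)] -> (forall x, gt ^~ x @ F --> g x) ->
    forall x, `|g x| <= C.
  move=> H cf x; apply: (@norm_lim _ F _ (fun t => gt t x) _ C (cf x)).
  by apply: filterS H => t /= /Bk_bound.
elim: k ft f => [|k IH] ft f H cf; split; try exact: bnd H cf; try by [].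
move=> i h h0; apply: (IH (fun t => dq i h (ft t))).
  by apply: filterS H => t; exact: Bk_dq.
move=> x; apply: cvgM; last exact: cvg_cst.
by apply: cvgB; exact: cf.
Qed.

(* An almost additive function is almost linear; the slope is the limit of the
   difference quotients along an ultrafilter. *)
Lemma quasi_additive (a : R -> R) C : (forall h, `|a h| <= C * `|h|) ->
  (forall h k, `|a (h + k) - a h - a k| <= C * (`|h| * `|k|)) ->
  exists l, forall h, h != 0 -> `|a h / h - l| <= C * `|h|.
Proof.
move=> aC aA.
have C0 : 0 <= C by have := le_trans (normr_ge0 _) (aC 1); rewrite normr1 mulr1.
(* Steps of size [k] are split off one at a time; the defects [C l |k|^2] for [l < m] add up to at
   most [C (m |k|)^2]. *)
have amul (m : nat) k : `|a (m%:R * k) - m%:R * a k| <= C * (m%:R * `|k|) ^+ 2.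
  elim: m => [|m IH].
    by rewrite !mul0r subr0 expr0n mulr0 (le_trans (aC 0))// normr0 mulr0.
  rewrite -natr1 !mulrDl !mul1r.
  have -> : a (m%:R * k + k) - (m%:R * a k + a k) =
    (a (m%:R * k + k) - a (m%:R * k) - a k) + (a (m%:R * k) - m%:R * a k) by ring.
  apply: le_trans (ler_normD _ _) _.
  apply: le_trans (lerD (aA _ _) IH) _.
  rewrite normrM ger0_norm ?ler0n//.
  have := mulr_ge0 C0 (mulr_ge0 (ler0n R m) (sqr_ge0 `|k|)); have := mulr_ge0 C0 (sqr_ge0 `|k|).
  by nra.
(* Division with remainder: [h = m k + r] with [m] the integer part of [h / k]. All terms of the
   bound but [C |h|] vanish as [k] tends to 0. *)
have pos h k : h != 0 -> k != 0 -> 0 < h / k ->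
    `|a h / h - a k / k| <= C * `|h| + (C * `|k| + 2 * C * `|k| / `|h|).
  move=> h0 k0 hk.
  have [m /andP[m1 m2]] : exists m : nat, m%:R <= h / k < m.+1%:R.
    by exists (Num.truncn (h / k)); apply: truncn_itv; exact: ltW.
  pose r := h - m%:R * k.
  have rk : `|r| <= `|k|.
    have -> : r = (h / k - m%:R) * k by rewrite /r; field.
    rewrite normrM ler_piMl// ger0_norm ?subr_ge0//.
    by rewrite lerBlDr addrC natr1 ltW.
  have mh : m%:R * `|k| <= `|h|.
    have : m%:R * `|k| <= h / k * `|k| by rewrite ler_wpM2r.
    by rewrite -{1}[h / k]gtr0_norm// normrM normfV mulfVK ?normr_eq0.
  have e1 : `|a h - m%:R * a k| <= C * (`|h| * `|k|) + (C * `|k| + C * `|h| ^+ 2).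
    have -> : a h - m%:R * a k = (a (m%:R * k + r) - a (m%:R * k) - a r)
       + (a r + (a (m%:R * k) - m%:R * a k)).
      by have -> : m%:R * k + r = h; rewrite /r; ring.
    apply: le_trans (ler_normD _ _) _; apply: lerD.
      apply: le_trans (aA _ _) _; rewrite normrM ger0_norm ?ler0n//.
      by rewrite ler_wpM2l// ler_pM// mulr_ge0.
    apply: le_trans (ler_normD _ _) _; apply: lerD.
      by apply: le_trans (aC _) _; rewrite ler_wpM2l.
    have q0 : 0 <= m%:R * `|k| by rewrite mulr_ge0.
    by apply: le_trans (amul _ _) _; rewrite ler_wpM2l// ler_pXn2r ?nnegrE.
  have e2 : `|m%:R * a k - h / k * a k| <= C * `|k|.
    have -> : m%:R * a k - h / k * a k = - (r / k) * a k by rewrite /r; field.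
    rewrite normrM normrN normrM normfV.
    apply: le_trans (_ : 1 * `|a k| <= _); last by rewrite mul1r.
    by rewrite ler_wpM2r// ler_pdivrMr ?normr_gt0// mul1r.
  have -> : a h / h - a k / k = ((a h - m%:R * a k) + (m%:R * a k - h / k * a k)) / h.
    by field; rewrite h0 k0.
  have nh : 0 < `|h| by rewrite normr_gt0.
  rewrite normrM normfV ler_pdivrMr//; apply: le_trans (ler_normD _ _) _.
  apply: le_trans (lerD e1 e2) _.
  rewrite !mulrDl divfK ?gt_eqF//.
  by rewrite le_eqVlt; apply/orP; left; apply/eqP; ring.
(* When [h] and [k] have opposite signs, the slope at [k] is first compared with the slope at
   [- k]. *)
have gen h k : h != 0 -> k != 0 ->
    `|a h / h - a k / k| <= C * `|h| + (2 * C * `|k| + 2 * C * `|k| / `|h|).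
  move=> h0 k0.
  have Ck : 0 <= C * `|k| by rewrite mulr_ge0.
  have [hk|hk|hk] := ltgtP (h / k) 0; last by move/eqP: hk; rewrite mulf_eq0 invr_eq0 (negPf h0) (negPf k0).
    have := pos h (- k) h0; rewrite oppr_eq0 invrN mulrN oppr_gt0 normrN => /(_ k0 hk) e1.
    have e2 : `|a (- k) / - k - a k / k| <= C * `|k|.
      have -> : a (- k) / - k - a k / k = (a (k + - k) - a k - a (- k) - a 0) / k.
        by rewrite subrr; field.
      have a0 : a 0 = 0.
        by apply/eqP; rewrite -normr_le0 (le_trans (aC 0))// normr0 mulr0.
      rewrite a0 subr0 normrM normfV ler_pdivrMr ?normr_gt0//.
      by apply: le_trans (aA _ _) _; rewrite normrN -mulrA.
    have -> : a h / h - a k / k = (a h / h - a (- k) / - k) + (a (- k) / - k - a k / k) by ring.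
    apply: le_trans (ler_normD _ _) _; move: e1; rewrite invrN mulrN; rewrite invrN mulrN in e2; lra.
  by apply: le_trans (pos h k h0 k0 hk) _; lra.
have [G [GU G0]] := @ultraFilterLemma R (0^') (Proper_dnbhs_numFieldType _).
have FG : Filter G by exact: filter_filter.
have G1 : G [set k | k != 0] by apply: G0; exact: dnbhs_neq0.
have [l lP] : exists l : R, (fun k => a k / k) @ G --> l.
  apply: (@ultra_bounded _ _ _ _ C); apply: filterS G1 => k /= k0.
  by rewrite normrM normfV ler_pdivrMr ?normr_gt0.
exists l => h h0.
have Gk : (fun k : R => `|k|) @ G --> (0 : R).
  rewrite -[X in _ --> X](@normr0 R R); apply: cvg_norm.
  apply: cvg_trans (_ : nbhs (0 : R) `=>` _) => //.
  by move=> A /= A0; apply: G0; rewrite /dnbhs /within /=; apply: filterS A0 => t At _.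
have lim1 : (fun k => `|a h / h - a k / k|) @ G --> `|a h / h - l|.
  by apply: cvg_norm; exact: cvgB (@cvg_cst _ _ _ _ FG) lP.
have lim2 : (fun k => C * `|h| + (2 * C * `|k| + 2 * C * `|k| / `|h|)) @ G -->
    C * `|h| + (2 * C * 0 + 2 * C * 0 / `|h|).
  have cc (c : R) : (fun _ : R => c) @ G --> c by exact: cvg_cst.
  by exact: cvgD (cc _) (cvgD (cvgM (cc _) Gk) (cvgM (cvgM (cc _) Gk) (cc _))).
have := ler_cvg_to lim1 lim2 _; rewrite !mulr0 mul0r !addr0; apply.
by apply: filterS G1 => k /= k0; exact: gen.
Qed.

(** A bound on the second difference quotients says that [h |-> f (x + h e_i) - f x] is almost
    additive. Its slope is the derivative, and the error is linear in [h] with a constant that does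
    not depend on [x]. *)
Lemma Bk_isd k C f i x : Bk k.+2 C f -> isd x (ee i) f (partial i f x) /\
  forall h, h != 0 -> `|dq i h f x - partial i f x| <= C * `|h|.
Proof.
move=> H; have C0 := Bk_ge0 H.
have H2 : Bk 2 C f by elim: k H => // k IH /Bk_pred /IH.
have [||l lP] := @quasi_additive (fun h => f (x + h *: ee i) - f x) C.
- move=> h; have [->|h0] := eqVneq h 0; first by rewrite scale0r addr0 subrr normr0 mulr0.
  have := Bk_bound (Bk_dq i h0 H2) x.
  by rewrite /dq normrM normfV ler_pdivrMr ?normr_gt0.
- move=> h k'; have [->|h0] := eqVneq h 0.
    by rewrite add0r scale0r addr0 subrr subr0 subrr !normr0 mul0r mulr0.
  have [->|k0] := eqVneq k' 0.
    by rewrite addr0 scale0r addr0 subrr addrN subr0 !normr0 !mulr0.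
  have := Bk_bound (Bk_dq i k0 (Bk_dq i h0 H2)) x.
  rewrite /dq -addrA -scalerDl.
  have -> : ((f (x + (k' + h) *: ee i) - f (x + k' *: ee i)) / h - (f (x + h *: ee i) - f x) / h) / k'
     = (f (x + (h + k') *: ee i) - f x - (f (x + h *: ee i) - f x) - (f (x + k' *: ee i) - f x)) / (h * k').
    by rewrite [k' + h]addrC; field; rewrite h0 k0.
  rewrite normrM normfV ler_pdivrMr ?normr_gt0 ?mulf_neq0//.
  by rewrite normrM.
have Hd : isd x (ee i) f l.
  apply/is_deriveP; apply/cvgrPdist_le => e e0.
  exists (e / (C + 1)) => /=; first by rewrite divr_gt0// ltr_wpDl.
  move=> h; rewrite /ball/= sub0r normrN ltr_pdivlMr ?ltr_wpDl// => he h0.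
  rewrite distrC mulrC (le_trans (lP h h0))//.
  by have := normr_ge0 h; nra.
have -> : partial i f x = l by have [_ <-] := Hd.
by [].
Qed.

Lemma dq_lim k C f i x : Bk k.+2 C f -> (fun h => dq i h f x) @ 0^' --> partial i f x.
Proof.
move=> H; have [/is_deriveP Hd _] := Bk_isd i x H.
by apply: cvg_trans Hd; apply: near_eq_cvg; near=> h; rewrite /dq mulrC.
Unshelve. all: by end_near. Qed.

Lemma Bk_partial k C f i : Bk k.+2 C f -> Bk k.+1 C (partial i f).
Proof.
move=> H; apply: (@Bk_lim _ (0^' : set_system R) _ (fun h => dq i h f)).
  by apply: filterS dnbhs_neq0 => h h0; exact: Bk_dq.
by move=> x; exact: dq_lim H.
Qed.

(* C^oo with all derivatives bounded on the whole space. *)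
Definition smooth f := forall k, exists C, Bk k C f.

Lemma smooth_isd f i x : smooth f -> isd x (ee i) f (partial i f x).
Proof. by move=> /(_ 2) [C /Bk_isd H]; have [] := H i x. Qed.

Lemma smooth_partial f i : smooth f -> smooth (partial i f).
Proof. by move=> H k; have [C HC] := H k.+2; exists C; apply: Bk_pred; exact: Bk_partial. Qed.

Lemma smooth_bnd f : smooth f -> exists2 C, 0 <= C & forall x, `|f x| <= C.
Proof. by move=> /(_ 0) [C H]; exists C; [exact: Bk_ge0 H|exact: Bk_bound H]. Qed.

Lemma smoothD f g : smooth f -> smooth g -> smooth (fun x => f x + g x).
Proof. by move=> Hf Hg k; have [C ?] := Hf k; have [D ?] := Hg k; exists (C + D); exact: Bk_add. Qed.

Lemma smoothM f g : smooth f -> smooth g -> smooth (fun x => f x * g x).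
Proof. by move=> Hf Hg k; have [C ?] := Hf k; have [D ?] := Hg k; exists (2 ^+ k * (C * D)); exact: Bk_mul. Qed.

Lemma smoothC (c : R) : smooth (fun=> c).
Proof. by move=> k; exists `|c|; exact: Bk_cst. Qed.

Lemma smoothN f : smooth f -> smooth (fun x => - f x).
Proof.
move=> Hf; rewrite (_ : (fun _ => _) = fun x => (-1) * f x); last by apply/funext => x; rewrite mulN1r.
exact: smoothM (smoothC _) Hf.
Qed.

Lemma smoothX f n : smooth f -> smooth (fun x => f x ^+ n).
Proof.
move=> Hf; elim: n => [|n IH]; first exact: smoothC.
rewrite (_ : (fun _ => _) = fun x => f x * f x ^+ n); first exact: smoothM.
by apply/funext => x; rewrite exprS.
Qed.

Lemma smooth_shift f a : smooth f -> smooth (fun x => f (x + a)).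
Proof. by move=> Hf k; have [C ?] := Hf k; exists C; exact: Bk_shift. Qed.

Lemma partial_shift f a i : partial i (fun x => f (x + a)) = fun x => partial i f (x + a).
Proof.
apply/funext => x; rewrite /partial /derive; congr (lim (_ @ 0^')).
by apply/funext => h /=; rewrite addrA.
Qed.

Lemma smooth_lip f : smooth f -> exists2 C, 0 <= C &
  forall x (h : E), `|f (x + h) - f x| <= C * \sum_j `|h 0 j|.
Proof.
move=> Hf; have [C H] := Hf 2; have C0 := Bk_ge0 H; exists C => // x h.
pose r := \sum_j `|h 0 j|.
apply: (@path_bound R f (fun i => partial i f) x h r C).
- by move=> i y; exact: smooth_isd.
- by move=> i y _; exact: Bk_bound (Bk_partial i H) y.
- by move=> j; rewrite /r (bigD1 j)//= lerDl sumr_ge0.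
Qed.

Lemma partial_dq k C f i j h : h != 0 -> Bk k.+2 C f ->
  partial i (dq j h f) = dq j h (partial i f).
Proof.
move=> h0 H; apply/funext => x.
suff [_ <-] : isd x (ee i) (dq j h f) (dq j h (partial i f) x) by [].
have H1 : isd x (ee i) (fun x => f (x + h *: ee j)) (partial i f (x + h *: ee j)).
  have -> : (fun x => f (x + h *: ee j)) = fun x => f (h *: ee j + x).
    by apply/funext => y; rewrite addrC.
  by apply: der_shift; rewrite addrC; exact: (Bk_isd i _ H).1.
have H2 := (Bk_isd i x H).1.
by apply: der_eq; [rewrite /dq; der|rewrite /dq; ring].
Qed.

(** Difference quotients in two directions commute exactly, and each iterated quotient is within
    [2 C |h|] of the corresponding mixed derivative. *)
Lemma partialC f i j : smooth f -> partial i (partial j f) = partial j (partial i f).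
Proof.
move=> Hf; apply/funext => x; have [C H] := Hf 4; have C0 := Bk_ge0 H.
have key i' j' h : h != 0 -> `|dq i' h (dq j' h f) x - partial i' (partial j' f) x| <= 2 * C * `|h|.
  move=> h0.
  have H3 : Bk 3 C (dq i' h f) by exact: Bk_dq.
  have [_ /(_ h h0)] := Bk_isd j' x H3; rewrite (partial_dq _ _ h0 H).
  have [_ /(_ h h0)] := Bk_isd i' x (Bk_partial j' H).
  have -> : dq j' h (dq i' h f) x = dq i' h (dq j' h f) x.
    by rewrite /dq addrAC; ring.
  set A := dq i' h (dq _ _ _) x; set B := dq _ _ _ x; set D := partial i' _ x.
  move=> e1 e2; have -> : A - D = (A - B) + (B - D) by ring.
  by apply: le_trans (ler_normD _ _) _; lra.
apply/eqP; rewrite -subr_eq0 -normr_le0; apply/ler_addgt0Pr => e e0; rewrite add0r.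
pose h := e / (4 * C + 1).
have k0 : 0 < 4 * C + 1 by lra.
have hp : 0 < h by rewrite divr_gt0.
have h0 : h != 0 by rewrite gt_eqF.
have e1 := key i j h h0; have e2 := key j i h h0.
have E : dq i h (dq j h f) x = dq j h (dq i h f) x by rewrite /dq addrAC; ring.
rewrite E in e1.
set A := dq _ _ _ x in e1 e2; set P := partial i _ x in e1 *; set Q := partial j _ x in e2 *.
have -> : P - Q = (A - Q) - (A - P) by ring.
have nh : `|h| = h by exact: gtr0_norm.
rewrite nh in e1; rewrite nh in e2.
apply: (le_trans (ler_normB _ _)).
have hE : (4 * C + 1) * h = e by rewrite /h mulrC divfK ?gt_eqF.
move: e1 e2 hE; clear -C0 hp; clearbody A P Q h => e1 e2 hE.
by move: (`|A - Q|) (`|A - P|) e1 e2 => r s e1 e2; nra.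
Qed.

End smooth.

(** * Sharp a priori bounds and regularity *)

Section apriori.
Context {R : realType}.
Notation E := 'rV[R]_3.

Lemma least_bound (f : E -> R) (B : R) : (forall x, f x <= B) ->
  exists2 S, (forall x, f x <= S) & forall S', S' < S -> exists x, S' < f x.
Proof.
move=> fB.
have hs : has_sup (range f) by split; [exists (f 0), 0|exists B => _ [x _ <-]].
exists (sup (range f)) => [x|S' S'S].
  by apply: sup_upper_bound => //; exists x.
have [|_ [x _ <-]] := @sup_adherent _ (range f) (sup (range f) - S') _ hs.
  by rewrite subr_gt0.
by rewrite opprB addrC subrK => ?; exists x.
Qed.

Variables (alpha omega : R) (u v : E -> R) (u1 u2 v1 v2 : 'I_3 -> E -> R).
Hypotheses (omega_gt0 : 0 < omega) (omega_lt : omega < alpha / 2)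
  (cu : cts u) (cv : cts v) (du : twice u u1 u2) (dv : twice v v1 v2)
  (u0 : forall x, 0 < u x) (v0 : forall x, 0 < v x)
  (eu : forall x, \sum_i u2 i x =
       u x * (u x ^+ 2 + v x ^+ 2 - 1) + v x * (alpha * u x * v x - omega))
  (ev : forall x, \sum_i v2 i x =
       v x * (u x ^+ 2 + v x ^+ 2 - 1) + u x * (alpha * u x * v x - omega)).

Let M x := u x ^+ 2 + v x ^+ 2.
Let P x := u x * v x.
Let M1 i x := 2 * u x * u1 i x + 2 * v x * v1 i x.
Let M2 i x := 2 * (u1 i x ^+ 2 + v1 i x ^+ 2) + 2 * (u x * u2 i x + v x * v2 i x).
(** A lower bound on [u v] is an upper bound on its reciprocal, and upper bounds are what the
    comparison on balls provides. *)
Let F x := (u x)^-1 * (v x)^-1.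
Let F1 i x := - (u1 i x / u x ^+ 2 / v x + v1 i x / v x ^+ 2 / u x).
Let F2 i x := F x * (- u2 i x / u x - v2 i x / v x + 2 * (u1 i x / u x) ^+ 2
  + 2 * (v1 i x / v x) ^+ 2 + 2 * (u1 i x / u x) * (v1 i x / v x)).

Let un x : u x != 0. Proof. by rewrite gt_eqF. Qed.
Let vn x : v x != 0. Proof. by rewrite gt_eqF. Qed.
Let P0 x : 0 < P x. Proof. by rewrite mulr_gt0. Qed.
Let FP x : F x = (P x)^-1. Proof. by rewrite /F /P invfM. Qed.
Let F0 x : 0 < F x. Proof. by rewrite FP invr_gt0. Qed.
Let a0 : 0 < alpha. Proof. by move: omega_gt0 omega_lt; lra. Qed.
Let PM x : 2 * P x <= M x.
Proof. by have := sqr_ge0 (u x - v x); rewrite /P /M; nra. Qed.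
Let M0 x : 0 < M x. Proof. by apply: lt_le_trans (PM x); rewrite mulr_gt0. Qed.

Let dM : twice M M1 M2.
Proof.
move=> i x; have [Hu1 Hu2] := du i x; have [Hv1 Hv2] := dv i x; split.
  by apply: der_eq; [rewrite /M; der|rewrite /M1 /=; ring].
by apply: der_eq; [rewrite /M1; der|rewrite /M2 /=; ring].
Qed.

Let lapM x : 2 * (M x * (M x - 1) + 2 * P x * (alpha * P x - omega)) <= \sum_i M2 i x.
Proof.
have : 2 * (u x * \sum_i u2 i x + v x * \sum_i v2 i x) <= \sum_i M2 i x.
  apply: (@le_trans _ _ (\sum_i 2 * (u x * u2 i x + v x * v2 i x))).
    by rewrite -mulr_sumr big_split/= -!mulr_sumr.
  apply: ler_sum => i _; rewrite lerDr mulr_ge0//.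
  by rewrite addr_ge0// sqr_ge0.
by apply: le_trans; rewrite eu ev /M /P le_eqVlt; apply/orP; left; apply/eqP; ring.
Qed.

Let dF : twice F F1 F2.
Proof.
move=> i x; have [Hu1 Hu2] := du i x; have [Hv1 Hv2] := dv i x; split.
  apply: der_eq; [rewrite /F; der; rewrite ?expf_neq0//|rewrite /F1 /=; field].
  by rewrite un vn.
apply: der_eq; [rewrite /F1; der; rewrite ?expf_neq0//|rewrite /F2 /F /=; field].
by rewrite un vn.
Qed.

(** With [p] and [q] the logarithmic derivatives of [u] and [v], the first order terms are
    [F (p^2 + q^2 + (p + q)^2)] and may be dropped. *)
Let lapF x : F x * (2 - (2 + alpha) * M x + omega * M x * F x) <= \sum_i F2 i x.
Proof.
have : F x * (- (\sum_i u2 i x) / u x - (\sum_i v2 i x) / v x) <= \sum_i F2 i x.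
  rewrite -mulr_sumr ler_pM2l// -sumrN !mulr_suml -sumrB ler_sum// => i _.
  set p := u1 i x / u x; set q := v1 i x / v x.
  have := sqr_ge0 p; have := sqr_ge0 q; have := sqr_ge0 (p + q).
  rewrite mulNr; nra.
apply: le_trans; rewrite eu ev /M /F le_eqVlt; apply/orP; left; apply/eqP; field.
by rewrite un vn.
Qed.

Let cM : cts M. Proof. by rewrite /M; cont. Qed.
Let cF : cts F. Proof. by rewrite /F; cont. Qed.

Let M_le x : M x <= 1 + omega.
Proof.
apply: (@keller_osserman _ M M1 M2 (1 + omega) 1 cM dM ltr01) => {}x hx; rewrite mul1r.
apply: le_trans (lapM x).
have h1 : 0 <= alpha * P x ^+ 2 by rewrite mulr_ge0 ?sqr_ge0 ?ltW.
have h2 : omega * (2 * P x) <= omega * M x by rewrite ler_pM2l.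
have h3 : 0 < M x - (1 + omega) by rewrite subr_gt0.
have h4 := mulr_gt0 (M0 x) h3.
have h5 : 0 < (1 + omega) * (M x - (1 + omega)) by rewrite mulr_gt0// addr_gt0.
lra.
Qed.

(** The sum [s = u + v] has Laplacian [s (M - 1 + alpha P - omega)], and the bracket is at most -1
    as soon as [(1 + alpha) s^2 <= omega]; this fixes [d]. *)
Let s_ge : exists2 mu, 0 < mu & forall x, mu <= M x.
Proof.
have k0 : 0 < 1 + alpha by have := a0; lra.
pose d := Num.sqrt (omega / (1 + alpha)).
have d2 : d ^+ 2 = omega / (1 + alpha) by rewrite sqr_sqrtr// divr_ge0 ?ltW.
have d0 : 0 < d by rewrite sqrtr_gt0 divr_gt0.
have key x : d <= u x + v x.
  apply: (@bounded_below_of_superlinear _ (fun x => u x + v x)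
    (fun i x => u1 i x + v1 i x) (fun i x => u2 i x + v2 i x)) => //.
  - by cont.
  - move=> i {}x; have [Hu1 Hu2] := du i x; have [Hv1 Hv2] := dv i x.
    by split; exact: derD.
  - by move=> {}x; rewrite addr_gt0.
  - move=> {}x sd; rewrite big_split/= eu ev.
    have s0 : 0 < u x + v x by rewrite addr_gt0.
    have s2 : (1 + alpha) * (u x + v x) ^+ 2 <= omega.
      rewrite mulrC -ler_pdivlMr// -d2 ler_pXn2r ?nnegrE ?(ltW s0) ?(ltW d0)//.
      exact: ltW.
    have h : u x ^+ 2 + v x ^+ 2 - 1 + (alpha * u x * v x - omega) <= - 1.
      have := P0 x; rewrite /P => p0; have := mulr_gt0 a0 p0; have := sqr_ge0 (u x); have := sqr_ge0 (v x).
      have := mulr_ge0 (ltW a0) (sqr_ge0 (u x)); have := mulr_ge0 (ltW a0) (sqr_ge0 (v x)).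
      nra.
    have -> : u x * (u x ^+ 2 + v x ^+ 2 - 1) + v x * (alpha * u x * v x - omega) +
      (v x * (u x ^+ 2 + v x ^+ 2 - 1) + u x * (alpha * u x * v x - omega)) =
      (u x + v x) * (u x ^+ 2 + v x ^+ 2 - 1 + (alpha * u x * v x - omega)) by ring.
    by rewrite -[leRHS]mulrN1 ler_pM2l.
exists (d ^+ 2 / 2); first by rewrite divr_gt0// exprn_gt0.
move=> x; have h : d ^+ 2 <= (u x + v x) ^+ 2.
  by rewrite ler_pXn2r ?nnegrE ?(ltW d0) ?addr_ge0 ?(ltW (u0 x)) ?(ltW (v0 x))// key.
have := sqr_ge0 (u x - v x); rewrite /M; nra.
Qed.

(** Since [M >= mu], the quadratic term [omega mu F^2] beats the linear one once [F > A], which is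
    the growth required by [keller_osserman]. *)
Let F_le : exists B, forall x, F x <= B.
Proof.
have [mu mu0 muM] := s_ge.
have k0 : 0 < omega * mu by rewrite mulr_gt0.
pose A := (2 + alpha) * (1 + omega) / (omega * mu).
exists A; apply: (@keller_osserman _ F F1 F2 A (omega * mu) cF dF k0) => x hx; apply: le_trans (lapF x).
have h1 : omega * mu * A = (2 + alpha) * (1 + omega) by rewrite /A mulrC divfK ?gt_eqF.
have A0 : 0 < A by rewrite divr_gt0// mulr_gt0//; have := a0; have := omega_gt0; lra.
have h2 : (2 + alpha) * M x <= omega * mu * A.
  by rewrite h1 ler_pM2l ?M_le//; have := a0; lra.
have h3 : omega * mu * F x <= omega * M x * F x.
  by rewrite ler_pM2r// ler_pM2l.
apply: (@le_trans _ _ (F x * (omega * mu * (F x - A)))); last first.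
  by rewrite ler_pM2l//; lra.
have := mulr_gt0 k0 (mulr_gt0 A0 (_ : 0 < F x - A)); rewrite subr_gt0 => /(_ hx); lra.
Qed.

(** Neither bound is obtained alone. With [S = sup M] and [p0 = inf P], an approximate maximum of
    [F] yields [J1] and one of [M] yields [I2]; the two inequalities and [omega < alpha / 2] force
    [S <= 1] and [omega <= alpha p0]. *)
Lemma sharp_bounds x : u x ^+ 2 + v x ^+ 2 <= 1 /\ omega <= alpha * u x * v x.
Proof.
have [B FB] := F_le.
have [S MS SM] := least_bound M_le.
have [Phi FPhi PhiF] := least_bound FB.
have Phi0 : 0 < Phi by exact: lt_le_trans (F0 0) (FPhi 0).
have S0 : 0 < S by exact: lt_le_trans (M0 0) (MS 0).
pose p0 := Phi^-1; have p00 : 0 < p0 by rewrite invr_gt0.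
have Pp y : p0 <= P y by rewrite -[P y]invrK -FP lef_pV2 ?posrE.
have I1 : 2 <= S * (2 + alpha - omega * Phi).
  pose K := (1 + omega) / 2 + S * omega.
  have K0 : 0 < K by rewrite /K; have := mulr_gt0 S0 omega_gt0; have := omega_gt0; lra.
  apply/ler_addgt0Pr => e e0.
  (* The first bound makes the total error at most [e]; the second keeps [k] below 2, so that the
     factor [q0] is nonnegative and [M y] may be replaced by [S]. *)
  pose e' := Num.min (e / K) (1 / (1 + omega)).
  have w1 : 0 < 1 + omega by have := omega_gt0; lra.
  have e'0 : 0 < e' by rewrite lt_min !divr_gt0.
  have e'e : e' * K <= e by rewrite -ler_pdivlMr// ge_min lexx.
  have e'1 : e' * (1 + omega) <= 1 by rewrite -ler_pdivlMr// ge_min lexx orbT.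
  have [y y1 y2] := approx_sup cF dF FPhi PhiF e'0.
  have {}y2 := le_trans (lapF y) y2.
  have F2M : 2 <= F y * (1 + omega).
    have := PM y; have := M_le y; rewrite FP => h1 h2.
    by rewrite mulrC ler_pdivlMr//; lra.
  set k := 2 - _ + _ in y2.
  have k1 : k <= e' * (1 + omega) / 2.
    have [k0|k0] := leP k 0; first by apply: le_trans k0 _; rewrite !mulr_ge0 ?ltW.
    have : 2 * k <= F y * (1 + omega) * k by rewrite ler_pM2r.
    have : (1 + omega) * (F y * k) <= (1 + omega) * e' by rewrite ler_pM2l.
    lra.
  have kE : 2 = k + M y * (2 + alpha - omega * F y) by rewrite /k; ring.
  have q0 : 0 <= 2 + alpha - omega * F y.
    by rewrite -(pmulr_rge0 _ (M0 y)); lra.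
  have h1 : M y * (2 + alpha - omega * F y) <= S * (2 + alpha - omega * F y).
    by rewrite ler_wpM2r.
  have h2 : S * (2 + alpha - omega * F y) <= S * (2 + alpha - omega * Phi + omega * e').
    rewrite ler_pM2l//; have : omega * (Phi - e') <= omega * F y by rewrite ler_pM2l// ltW.
    lra.
  rewrite /K in e'e; lra.
pose g := omega - alpha * p0.
have J1 : 2 * p0 <= S * (2 * p0 - g).
  have : p0 * 2 <= p0 * (S * (2 + alpha - omega * Phi)) by rewrite ler_pM2l.
  have e : p0 * Phi = 1 by rewrite /p0 mulVf ?gt_eqF.
  have -> : p0 * (S * (2 + alpha - omega * Phi)) = S * (2 * p0 - (omega * (p0 * Phi) - alpha * p0)) by ring.
  by rewrite e mulr1 -/g; lra.
have I2 : 1 < S -> S - 1 <= Num.max g 0.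
  move=> S1; apply/ler_addgt0Pr => e e0.
  pose e' := Num.min (e / 2) (S - 1).
  have e'0 : 0 < e' by rewrite lt_min divr_gt0//= subr_gt0.
  have e'e : e' <= e / 2 by rewrite ge_min lexx.
  have e'1 : e' <= S - 1 by rewrite ge_min lexx orbT.
  have [y y1 y2] := approx_sup cM dM MS SM e'0.
  have {}y2 := le_trans (lapM y) y2.
  have My : 1 < M y by lra.
  have h : P y * (omega - alpha * P y) <= M y / 2 * Num.max g 0.
    have h1 : omega - alpha * P y <= Num.max g 0.
      by rewrite le_max /g; apply/orP; left; rewrite lerD2l lerN2 ler_pM2l.
    apply: (@le_trans _ _ (P y * Num.max g 0)); first by rewrite ler_pM2l.
    by rewrite ler_wpM2r ?le_max ?lexx ?orbT//; have := PM y; lra.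
  have h2 : M y * (M y - 1 - Num.max g 0) <= e' / 2 by lra.
  have h3 : M y - 1 - Num.max g 0 <= e' / 2.
    have [k0|k0] := leP (M y - 1 - Num.max g 0) 0; first by lra.
    by apply: le_trans h2; rewrite ler_peMl// ltW.
  lra.
(* If [S > 1], then [0 < S - 1 <= g] by [I2], and [J1] gives [S g <= 2 p0 (S - 1) <= 2 p0 g], so
   [1 < 2 p0]. Then [alpha p0 > alpha / 2 > omega], against [g > 0]. *)
have S1 : S <= 1.
  rewrite leNgt; apply/negP => S1; have {}I2 := I2 S1.
  have g0 : 0 < g.
    rewrite ltNge; apply/negP => g0; move: I2; rewrite max_r//; lra.
  move: I2; rewrite max_l ?(ltW g0)// => I2.
  have h1 : S * g <= 2 * p0 * g.
    have : 2 * p0 * (S - 1) <= 2 * p0 * g by rewrite ler_pM2l// mulr_gt0.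
    lra.
  have h2 : S <= 2 * p0 by rewrite -(ler_pM2r g0).
  have : alpha * 1 < alpha * (2 * p0) by rewrite ltr_pM2l ?a0//; lra.
  by move: g0 omega_lt; rewrite /g; lra.
have g0 : g <= 0.
  have : S * (2 * p0 - g) <= 1 * (2 * p0 - g).
    rewrite ler_wpM2r// -(pmulr_rge0 _ S0); have := p00; lra.
  lra.
split; first exact: le_trans (MS x) S1.
have : alpha * p0 <= alpha * P x by rewrite ler_pM2l ?a0.
by move: g0; rewrite /g /P; lra.
Qed.

End apriori.

Ltac sm := repeat first [eassumption | match goal with
   H : _ |- smooth _ => exact: H end | lazymatch goal with
  | |- smooth (fun _ => ?c) => apply: smoothC
  | |- smooth (fun y => @?f y + @?g y) => apply: (@smoothD _ f g)
  | |- smooth (fun y => @?f y * @?g y) => apply: (@smoothM _ f g)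
  | |- smooth (fun y => @?f y ^+ ?n) => apply: (@smoothX _ f n)
  | |- smooth (fun y => - @?f y) => apply: (@smoothN _ f)
  | |- smooth (fun y => partial ?i ?f y) => apply: (@smooth_partial _ f i)
  | |- smooth (partial ?i ?f) => apply: (@smooth_partial _ f i)
  end].

(** * Bootstrap from the Laplacian, and convergence of translates *)

Section regularity.
Context {R : realType}.
Notation E := 'rV[R]_3.
Implicit Types (x y z : E) (f g : E -> R) (i j : 'I_3).

Lemma lip_cts f (C : R) : (forall x (h : E), `|f (x + h) - f x| <= C * \sum_j `|h 0 j|) -> cts f.
Proof.
move=> H x.
have C0 : 0 <= C.
  have := H 0 (ee 0); rewrite sum3E !eeE/= normr1 normr0 !addr0 mulr1.
  by apply: le_trans.
apply/(@cvgrPdist_le R R E (nbhs x) (nbhs_filter x)) => e e0; apply/nbhs_ballP.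
have k : 0 < 3 * C + 1 by rewrite ltr_wpDl// mulr_ge0.
exists (e / (3 * C + 1)) => /=; first by rewrite divr_gt0.
move=> y [_ xy].
have d j : `|(y - x) 0 j| <= e / (3 * C + 1).
  by have := xy 0 j; rewrite /ball/= distrC !mxE => /ltW.
have -> : f y = f (x + (y - x)) by rewrite addrC subrK.
rewrite distrC; apply: le_trans (H x (y - x)) _.
apply: (@le_trans _ _ (C * \sum_(j < 3) (e / (3 * C + 1)))).
  by rewrite ler_wpM2l// ler_sum.
rewrite sumr_const card_ord -[_ *+ 3]mulr_natl.
have -> : C * (3 * (e / (3 * C + 1))) = 3 * C * e / (3 * C + 1) by ring.
by rewrite ler_pdivrMr//; lra.
Qed.

Lemma smooth_cts f : smooth f -> cts f.
Proof. by move=> /smooth_lip[C _ H]; exact: lip_cts H. Qed.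

Lemma isd_partial f i x l : isd x (ee i) f l -> partial i f x = l.
Proof. by move=> [_ <-]. Qed.

Lemma C1_dq_isd f i j (h : R) x : C1 f ->
  isd x (ee i) (dq j h f) (dq j h (partial i f) x).
Proof.
move=> H.
have H1 : isd x (ee i) (fun x => f (x + h *: ee j)) (partial i f (x + h *: ee j)).
  have -> : (fun x => f (x + h *: ee j)) = fun x => f (h *: ee j + x).
    by apply/funext => y; rewrite addrC.
  by apply: der_shift; rewrite addrC; exact: C1_isd.
have H2 := C1_isd i x H.
by apply: der_eq; [rewrite /dq; der|rewrite /dq; ring].
Qed.

Lemma cts_dq f j (h : R) : cts f -> cts (dq j h f).
Proof.
move=> cf; have H := cts_shift (y := h *: ee j) cf.
rewrite (_ : dq j h f = fun x => (f (h *: ee j + x) - f x) / h); first by cont.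
by apply/funext => x; rewrite /dq [x + _]addrC.
Qed.

Lemma C1_dq f j (h : R) : C1 f -> C1 (dq j h f) /\
  forall i, partial i (dq j h f) = dq j h (partial i f).
Proof.
move=> H; have E i : partial i (dq j h f) = dq j h (partial i f).
  by apply/funext => x; apply: isd_partial; exact: C1_dq_isd.
split=> // i; split.
  by move=> x; have [d _] := C1_dq_isd i j h x H.
by rewrite E; apply: cts_dq; have [] := H i.
Qed.

Lemma C2_dq f j (h : R) : C2 f -> C2 (dq j h f) /\
  laplacian (dq j h f) = dq j h (laplacian f).
Proof.
move=> [H1 H2]; have [d1 e1] := C1_dq j h H1.
have E2 i := C1_dq j h (H2 i).
split.
  by split; [exact: d1|move=> i; rewrite e1; exact: (E2 i).1].
apply/funext => x; rewrite /laplacian /dq -sumrB mulr_suml.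
by apply: eq_bigr => i _; rewrite e1; have [_ ->] := E2 i.
Qed.

(** The constant is [6 M + N] of [grad_bound] with [M = C] and [N = C + 1], the 1 being there for
    strictness. Steps [h > 2] are covered by the bound on [f] itself. *)
Lemma dq_bound_of_laplacian f (C : R) : C2 f -> (forall x, `|f x| <= C) ->
  (forall x, `|laplacian f x| <= C) -> forall j h x, h != 0 -> `|dq j h f x| <= 7 * C + 1.
Proof.
move=> H fC lC.
have C0 : 0 <= C by apply: le_trans (fC 0).
have cf := C1_cts H.1; have df := C2_twice H.
have pos j (h : R) x : 0 < h -> `|f (x + h *: ee j) - f x| <= (7 * C + 1) * h.
  move=> h0; have [h2|h2] := leP h 2; last first.
    have := fC (x + h *: ee j); have := fC x => a b.
    apply: le_trans (ler_normB _ _) _; nra.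
  have hx : x + h *: ee j = x + (h / 2) *: ee j + (h / 2) *: ee j.
    by rewrite -addrA -scalerDl -splitr.
  have xx : x = x + (h / 2) *: ee j - (h / 2) *: ee j by rewrite addrK.
  have h01 : 0 <= h / 2 <= 1 by apply/andP; split; lra.
  have lt x0 : `|laplacian f x0| < C + 1 by have := lC x0; lra.
  have b1 := grad_bound j (x + (h / 2) *: ee j) cf df fC lt h01.
  have dnf : twice (fun x => - f x) (fun i x => - partial i f x) (fun i x => - partial i (partial i f) x).
    by move=> i z; have [? ?] := df i z; split; apply: derN.
  have cnf : cts (fun x => - f x) by cont.
  have nfC x0 : `|- f x0| <= C by rewrite normrN.
  have nlt x0 : `|\sum_i - partial i (partial i f) x0| < C + 1 by rewrite sumrN normrN; exact: lt.
  have b2 := grad_bound j (x + (h / 2) *: ee j) cnf dnf nfC nlt h01.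
  rewrite -hx -xx in b1 b2.
  rewrite ler_norml; apply/andP; split; nra.
move=> j h x h0; rewrite /dq normrM normfV ler_pdivrMr ?normr_gt0//.
have [hn|hp|h00] := ltgtP h 0; last by rewrite h00 eqxx in h0.
  rewrite distrC (ler0_norm (ltW hn)).
  have := pos j (- h) (x + h *: ee j); rewrite oppr_gt0 => /(_ hn).
  by rewrite -addrA -scalerDl subrr scale0r addr0.
by rewrite (gtr0_norm hp); exact: pos.
Qed.

(** Induction over difference quotients, which commute with the Laplacian. The constant is chosen
    before [f], because the induction hypothesis is applied to all quotients of [f] at once. *)
Lemma Bk_of_laplacian k (C : R) : exists C', forall f, C2 f -> Bk k C f ->
  Bk k C (laplacian f) -> Bk k.+1 C' f.
Proof.
elim: k => [|k [C' IH]].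
  exists (7 * C + 1) => f H Bf Bl; have C0 := Bk_ge0 Bf; have [fC _] := Bf; have [lC _] := Bl.
  split; first by move=> x; apply: le_trans (fC x) _; clear -C0; lra.
  by move=> j h h0; split=> // x; exact: dq_bound_of_laplacian.
exists (Num.max C C') => f H Bf Bl; split.
  by move=> x; apply: le_trans (Bk_bound Bf x) _; rewrite le_max lexx.
move=> j h h0; apply: (@Bk_le _ k.+1 C'); first by rewrite le_max lexx orbT.
have [H2 E] := C2_dq j h H; apply: IH; first exact: H2.
  exact: Bk_dq.
by rewrite E; exact: Bk_dq.
Qed.

Definition sk k f := exists C : R, Bk k C f.

Lemma skD k f g : sk k f -> sk k g -> sk k (fun x => f x + g x).
Proof. by move=> [C ?] [D ?]; exists (C + D); exact: Bk_add. Qed.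

Lemma skM k f g : sk k f -> sk k g -> sk k (fun x => f x * g x).
Proof. by move=> [C ?] [D ?]; exists (2 ^+ k * (C * D)); exact: Bk_mul. Qed.

Lemma skC k (c : R) : sk k (fun=> c).
Proof. by exists `|c|; exact: Bk_cst. Qed.

Lemma skX2 k f : sk k f -> sk k (fun x => f x ^+ 2).
Proof. by move=> H; apply: (@skM k f f). Qed.

(** The Laplacians are polynomials in [u] and [v], hence have as many bounded quotients as [u] and
    [v]; [Bk_of_laplacian] then adds one order. *)
Lemma smooth_of_system (alpha omega : R) u v : C2 u -> C2 v ->
  (exists C, forall x, `|u x| <= C /\ `|v x| <= C) ->
  (forall x, laplacian u x =
       u x * (u x ^+ 2 + v x ^+ 2 - 1) + v x * (alpha * u x * v x - omega)) ->
  (forall x, laplacian v x =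
       v x * (u x ^+ 2 + v x ^+ 2 - 1) + u x * (alpha * u x * v x - omega)) ->
  smooth u /\ smooth v.
Proof.
move=> Hu Hv [C uvC] eu ev.
have aux k f g : sk k f -> sk k g -> sk k (fun x =>
    f x * (f x ^+ 2 + g x ^+ 2 - 1) + g x * (alpha * f x * g x - omega)).
  by move=> Hf Hg; repeat first [exact: Hf | exact: Hg | exact: skC | exact: skX2 Hf | exact: skX2 Hg | apply: skD | apply: skM].
suff H k : sk k u /\ sk k v by split=> k; have [] := H k.
elim: k => [|k [su sv]].
  by split; exists C; split=> // x; have [] := uvC x.
have E1 : sk k (laplacian u).
  have -> : laplacian u = fun x => u x * (u x ^+ 2 + v x ^+ 2 - 1) + v x * (alpha * u x * v x - omega).
    exact/funext.
  exact: aux.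
have E2 : sk k (laplacian v).
  rewrite (_ : laplacian v = fun x => v x * (v x ^+ 2 + u x ^+ 2 - 1) + u x * (alpha * v x * u x - omega)).
    exact: aux.
  by apply/funext => x; rewrite ev; ring.
have step f : C2 f -> sk k f -> sk k (laplacian f) -> sk k.+1 f.
  move=> Hf [C1 B1] [C2 B2]; have [C' H] := Bk_of_laplacian k (Num.max C1 C2).
  exists C'; apply: H; first exact: Hf.
    by apply: Bk_le B1; rewrite le_max lexx.
  by apply: Bk_le B2; rewrite le_max lexx orbT.
split; [exact: step Hu su E1|exact: step Hv sv E2].
Qed.

(** Pointwise convergence is enough as a definition: for smooth [f] the uniform bounds turn it into
    locally uniform convergence of all derivatives. *)
Definition tends (a : nat -> E) (f fb : E -> R) : Prop := forall x, (fun n => f (x + a n)) @ \oo --> (fb x : R).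

Lemma tends_Bk a k (C : R) f fb : Bk k C f -> tends a f fb -> Bk k C fb.
Proof.
move=> H ta; apply: (@Bk_lim _ _ \oo _ (fun n x => f (x + a n))) => //.
by apply: filterS (filterT : \oo [set: nat]) => n _; exact: Bk_shift.
Qed.

Lemma tends_smooth a f fb : smooth f -> tends a f fb -> smooth fb.
Proof. by move=> H ta k; have [C HC] := H k; exists C; exact: tends_Bk HC ta. Qed.

(** The difference quotients of the translates converge, and they approximate the derivatives at a
    rate uniform in the translate. *)
Lemma tends_partial a f fb i : smooth f -> tends a f fb ->
  tends a (partial i f) (partial i fb).
Proof.
move=> sf ta x; have [C H] := sf 2; have C0 := Bk_ge0 H; have Hb := tends_Bk H ta.
apply/cvgrPdist_le => e e0.
pose h := e / (2 * C + 2).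
have k0 : 0 < 2 * C + 2 by clear -C0; lra.
have h0 : 0 < h by rewrite divr_gt0.
have hE : (2 * C + 2) * h = e by rewrite /h mulrC divfK ?gt_eqF.
have hn : h != 0 by rewrite gt_eqF.
have lim : (fun n => dq i h f (x + a n)) @ \oo --> dq i h fb x.
  apply: cvgM; last exact: cvg_cst.
  apply: cvgB; last exact: ta.
  by have := ta (x + h *: ee i); under eq_fun do rewrite addrAC.
move/cvgrPdist_le : lim => /(_ _ h0); apply: filterS => n hb.
have [_ /(_ h hn) b1] := Bk_isd i (x + a n) H.
have [_ /(_ h hn) b2] := Bk_isd i x Hb.
rewrite (gtr0_norm h0) in b1 b2; rewrite distrC in b2.
have -> : partial i fb x - partial i f (x + a n) = (partial i fb x - dq i h fb x)
  + (dq i h fb x - dq i h f (x + a n)) + (dq i h f (x + a n) - partial i f (x + a n)) by ring.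
apply: le_trans (ler_normD _ _) _; apply: le_trans (lerD (ler_normD _ _) (lexx _)) _.
move: hb b1 b2 hE; clear -h0 C0; move: (`|_|) (`|_|) (`|_|) => p q r; lra.
Qed.

End regularity.

(** * A positive linear functional in place of the integral *)

Section integral.
Context {R : realType}.
Notation E := 'rV[R]_3.
Implicit Types (x y z : E) (f g : E -> R) (i j : 'I_3) (N : R) (k : nat).

Definition box N x : Prop := forall j, `|x 0 j| <= N.

Definition vec3 (p q r : R) : E := p *: ee 0 + q *: ee 1 + r *: ee ord_max.

Lemma vec3_shift p q r h : [/\ vec3 p q r + h *: ee 0 = vec3 (p + h) q r,
  vec3 p q r + h *: ee 1 = vec3 p (q + h) r &
  vec3 p q r + h *: ee ord_max = vec3 p q (r + h)].
Proof.
split; rewrite /vec3 scalerDl.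
- by rewrite addrAC [_ + _ + h *: _]addrAC.
- by rewrite addrAC addrA.
- by rewrite !addrA.
Qed.

Lemma vec3E p q r : [/\ vec3 p q r 0 0 = p, vec3 p q r 0 1 = q & vec3 p q r 0 ord_max = r].
Proof.
by split; rewrite /vec3 mxE [X in X + _]mxE !mxE /= ?mulr1 ?mulr0 ?addr0 ?add0r.
Qed.

Lemma ord3P (Q : 'I_3 -> Prop) : Q 0 -> Q 1 -> Q ord_max -> forall j, Q j.
Proof.
move=> q0 q1 q2 [[|[|[|//]]] p].
- by rewrite (_ : Ordinal p = 0)//; exact/val_inj.
- by rewrite (_ : Ordinal p = 1)//; exact/val_inj.
- by rewrite (_ : Ordinal p = ord_max)//; exact/val_inj.
Qed.

Lemma vec3_box N p q r : `|p| <= N -> `|q| <= N -> `|r| <= N -> box N (vec3 p q r).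
Proof. by have [e0 e1 e2] := vec3E p q r; move=> *; apply: ord3P; rewrite ?e0 ?e1 ?e2. Qed.

Lemma boxP N : compact (box N : set E).
Proof.
have := @box_compact R (fun=> - N) (fun=> N).
by congr compact; apply/seteqP; split=> x H j; have := H j; rewrite ler_norml.
Qed.

Lemma box_bound N f : 0 <= N -> cts f -> exists2 M, 0 <= M & forall x, box N x -> `|f x| <= M.
Proof.
move=> N0 cf; have [|||z _ zM] := @max_on R (box N) (fun x => `|f x|) 0.
- by cont.
- exact: boxP.
- by move=> j; rewrite mxE normr0.
by exists `|f z|.
Qed.

Lemma box_heine N g i (e : R) : 0 <= N -> cts g -> 0 < e -> exists2 d, 0 < d &
  forall x t, box N x -> `|t| <= d -> `|g (x + t *: ee i) - g x| <= e.
Proof.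
move=> N0 cg e0; apply: contrapT => H.
have bad n : exists xt : E * R, [/\ box N xt.1, `|xt.2| <= n.+1%:R^-1 &
    e < `|g (xt.1 + xt.2 *: ee i) - g xt.1|].
  apply: contrapT => H'; apply: H; exists (n.+1%:R^-1); first by rewrite invr_gt0.
  move=> x t bx tn; rewrite leNgt; apply/negP => he; apply: H'.
  by exists (x, t).
have [xt xtP] := choice bad.
have [c [_ cl]] : (box N : set E) `&` cluster ((fun n => (xt n).1) @ \oo) !=set0.
  apply: (@boxP N); apply: filterS (filterT : \oo [set: nat]) => n _.
  by have [] := xtP n.
have /(@cvgrPdist_lt R R E (nbhs c) (nbhs_filter c)) /(_ (e / 2)) := cg c.
rewrite divr_gt0// => /(_ isT) /nbhs_ballP[r /= r0 rP].
have r20 : 0 < r / 2 by rewrite divr_gt0.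
have [n0 n0r] : exists n0, n0.+1%:R^-1 < r / 2.
  exists (Num.truncn (r / 2)^-1).
  by rewrite invf_plt ?posrE//; exact: truncnS_gt.
have [||y [[n /= n0n <-] by_]] := cl [set (xt n).1 | n in [set n | (n0 <= n)%N]] (ball c (r / 2)).
- by exists n0 => // n n0n; exists n.
- by apply: nbhsx_ballx.
have [_ tn en] := xtP n.
have tr : `|(xt n).2| < r / 2.
  apply: le_lt_trans tn (le_lt_trans _ n0r).
  by rewrite lef_pV2 ?posrE// ler_nat.
have b1 : `|g c - g (xt n).1| < e / 2.
  by apply: rP; apply: le_ball by_; lra.
have b2 : `|g c - g ((xt n).1 + (xt n).2 *: ee i)| < e / 2.
  apply: rP; move: by_; rewrite -ball_normE /= => by_.
  rewrite opprD addrA (le_lt_trans (ler_normB _ _))//.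
  have : `|(xt n).2 *: (ee i : E)| <= `|(xt n).2|.
    rewrite normrZ ler_piMr// [leLHS]/Num.norm/= mx_normrE.
    apply/bigmax_leP; split=> // -[a b] _ /=; rewrite ord1 eeE.
    by case: (i == b); rewrite ?normr1 ?normr0.
  lra.
have : `|g ((xt n).1 + (xt n).2 *: ee i) - g (xt n).1| <= e.
  rewrite -(subrKA (g c)) (le_trans (ler_normD _ _))// distrC; lra.
by rewrite leNgt en.
Qed.

(** Left-endpoint Riemann sums over the cube of half side [N]: on each axis [2 (k + 1)] points with
    mesh [N / (k + 1)], iterated three times in [SS]. *)
Definition hh N k : R := N / k.+1%:R.
Definition pt N k (a : nat) : R := - N + hh N k * a%:R.
Definition AA N k (g : R -> R) : R := hh N k * \sum_(0 <= a < (2 * k.+1)%N) g (pt N k a).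
Definition SS N k f : R := AA N k (fun p => AA N k (fun q => AA N k (fun r => f (vec3 p q r)))).

Lemma hh_gt0 N k : 0 < N -> 0 < hh N k.
Proof. by move=> N0; rewrite divr_gt0. Qed.

Lemma pt_end N k : pt N k (2 * k.+1)%N = N.
Proof.
rewrite /pt /hh natrM mulrCA divfK ?pnatr_eq0//; first by ring.
Qed.

Lemma pt_bnd N k a : 0 < N -> (a <= 2 * k.+1)%N -> `|pt N k a| <= N.
Proof.
move=> N0 am; rewrite ler_norml; apply/andP; split.
  by rewrite /pt lerDl mulr_ge0// ltW// hh_gt0.
by rewrite -{2}(pt_end N k) /pt lerD2l ler_pM2l ?hh_gt0// ler_nat.
Qed.

Lemma ptS N k a : pt N k a.+1 = pt N k a + hh N k.
Proof. by rewrite /pt -natr1 mulrDr mulr1 addrA. Qed.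

Lemma AA_le N k (g1 g2 : R -> R) : 0 < N -> (forall p, `|p| <= N -> g1 p <= g2 p) -> AA N k g1 <= AA N k g2.
Proof.
move=> N0 H; rewrite ler_pM2l ?hh_gt0// big_nat_cond [leRHS]big_nat_cond.
by apply: ler_sum => a /andP[/andP[_ am] _]; apply/H/pt_bnd/ltnW.
Qed.

Lemma AA_eq N k (g1 g2 : R -> R) : 0 < N -> (forall p, `|p| <= N -> g1 p = g2 p) -> AA N k g1 = AA N k g2.
Proof.
by move=> N0 H; apply/eqP; rewrite eq_le; apply/andP; split; apply: AA_le => // p pN; rewrite H.
Qed.

Lemma AAD N k (g1 g2 : R -> R) : AA N k (fun p => g1 p + g2 p) = AA N k g1 + AA N k g2.
Proof. by rewrite /AA big_split mulrDr. Qed.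

Lemma AAZ N k c (g : R -> R) : AA N k (fun p => c * g p) = c * AA N k g.
Proof. by rewrite /AA -mulr_sumr mulrCA. Qed.

Lemma AAC N k c : AA N k (fun=> c) = 2 * N * c.
Proof.
rewrite /AA sumr_const_nat subn0 -[_ *+ _]mulr_natr /hh natrM.
have : k.+1%:R != 0 :> R by rewrite pnatr_eq0.
by move: (k.+1%:R) => m m0; field.
Qed.

Lemma AA_swap N k (F : R -> R -> R) :
  AA N k (fun p => AA N k (fun q => F p q)) = AA N k (fun q => AA N k (fun p => F p q)).
Proof. by rewrite /AA -!mulr_sumr exchange_big. Qed.

Lemma AA_tel N k (G : R -> R) : 0 < N -> AA N k (fun p => (G (p + hh N k) - G p) / hh N k) = G N - G (- N).
Proof.
move=> N0; have h0 := hh_gt0 k N0.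
rewrite /AA -mulr_suml mulrC divfK ?gt_eqF//.
rewrite (eq_bigr (fun a => G (pt N k a.+1) - G (pt N k a))).
  by rewrite telescope_sumr// pt_end /pt mulr0 addr0.
by move=> a _; rewrite ptS.
Qed.

Lemma AA_prod N k c (f0 f1 f2 : R -> R) :
  AA N k (fun s => AA N k (fun t => AA N k (fun r => c * f0 s * f1 t * f2 r))) =
  c * (AA N k f0 * (AA N k f1 * AA N k f2)).
Proof.
have e s : AA N k (fun t => AA N k (fun r => c * f0 s * f1 t * f2 r)) =
    c * AA N k f1 * AA N k f2 * f0 s.
  rewrite (_ : (fun t => _) = fun t => c * f0 s * AA N k f2 * f1 t); first by rewrite AAZ; ring.
  by apply/funext => t; rewrite AAZ; ring.
rewrite (_ : (fun s => _) = fun s => c * AA N k f1 * AA N k f2 * f0 s); first by rewrite AAZ; ring.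
by apply/funext => s; rewrite e.
Qed.

Lemma SS_le N k f g : 0 < N -> (forall x, box N x -> f x <= g x) -> SS N k f <= SS N k g.
Proof.
move=> N0 H; apply: AA_le => // p pN; apply: AA_le => // q qN; apply: AA_le => // r rN.
exact/H/vec3_box.
Qed.

Lemma SSD N k f g : SS N k (fun x => f x + g x) = SS N k f + SS N k g.
Proof.
rewrite /SS -AAD; congr (AA _ _ _); apply/funext => p.
by rewrite -AAD; congr (AA _ _ _); apply/funext => q; rewrite -AAD.
Qed.

Lemma SSZ N k c f : SS N k (fun x => c * f x) = c * SS N k f.
Proof.
rewrite /SS -AAZ; congr (AA _ _ _); apply/funext => p.
by rewrite -AAZ; congr (AA _ _ _); apply/funext => q; rewrite -AAZ.
Qed.

Lemma SSC N k c : SS N k (fun=> c) = (2 * N) ^+ 3 * c.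
Proof. by rewrite /SS !AAC; ring. Qed.

Lemma SS_bound N k f M : 0 < N -> (forall x, box N x -> `|f x| <= M) ->
  `|SS N k f| <= (2 * N) ^+ 3 * M.
Proof.
move=> N0 fM; rewrite ler_norml; apply/andP; split.
  rewrite -mulrN -(SSC N k); apply: SS_le => // x /fM.
  by rewrite ler_norml => /andP[].
by rewrite -(SSC N k); apply: SS_le => // x /fM; rewrite ler_norml => /andP[].
Qed.

(** With the mesh as step of the quotient the sum telescopes, so the divergence theorem is exact
    before any limit is taken. *)
Lemma SS_tel N k i F : 0 < N -> (forall x, box N x -> `|x 0 i| = N -> F x = 0) ->
  SS N k (fun x => (F (x + hh N k *: ee i) - F x) / hh N k) = 0.
Proof.
move=> N0; have A0 : AA N k (fun=> 0) = 0 by rewrite AAC mulr0.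
have nN : `|N| = N by rewrite gtr0_norm.
have nNN : `|- N| = N by rewrite normrN.
rewrite /SS; move: i; apply: ord3P => F0.
- rewrite AA_swap (@AA_eq _ _ _ (fun=> 0))// => q qN.
  rewrite AA_swap (@AA_eq _ _ _ (fun=> 0))// => r rN.
  have E p : (F (vec3 p q r + hh N k *: ee 0) - F (vec3 p q r)) / hh N k =
     (F (vec3 (p + hh N k) q r) - F (vec3 p q r)) / hh N k.
    by have [-> _ _] := vec3_shift p q r (hh N k).
  rewrite (@AA_eq N k _ (fun p => (F (vec3 (p + hh N k) q r) - F (vec3 p q r)) / hh N k))//.
  rewrite (AA_tel _ (fun p => F (vec3 p q r)))// !F0 ?subrr//; try by apply: vec3_box; rewrite ?nN ?nNN.
  + by have [-> _ _] := vec3E (- N) q r.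
  + by have [-> _ _] := vec3E N q r.
- rewrite (@AA_eq _ _ _ (fun=> 0))// => p pN.
  rewrite AA_swap (@AA_eq _ _ _ (fun=> 0))// => r rN.
  have E q : (F (vec3 p q r + hh N k *: ee 1) - F (vec3 p q r)) / hh N k =
     (F (vec3 p (q + hh N k) r) - F (vec3 p q r)) / hh N k.
    by have [_ -> _] := vec3_shift p q r (hh N k).
  rewrite (@AA_eq N k _ (fun q => (F (vec3 p (q + hh N k) r) - F (vec3 p q r)) / hh N k))//.
  rewrite (AA_tel _ (fun q => F (vec3 p q r)))// !F0 ?subrr//; try by apply: vec3_box; rewrite ?nN ?nNN.
  + by have [_ -> _] := vec3E p (- N) r.
  + by have [_ -> _] := vec3E p N r.
- rewrite (@AA_eq _ _ _ (fun=> 0))// => p pN.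
  rewrite (@AA_eq _ _ _ (fun=> 0))// => q qN.
  have E r : (F (vec3 p q r + hh N k *: ee ord_max) - F (vec3 p q r)) / hh N k =
     (F (vec3 p q (r + hh N k)) - F (vec3 p q r)) / hh N k.
    by have [_ _ ->] := vec3_shift p q r (hh N k).
  rewrite (@AA_eq N k _ (fun r => (F (vec3 p q (r + hh N k)) - F (vec3 p q r)) / hh N k))//.
  rewrite (AA_tel _ (fun r => F (vec3 p q r)))// !F0 ?subrr//; try by apply: vec3_box; rewrite ?nN ?nNN.
  + by have [_ _ ->] := vec3E p q (- N).
  + by have [_ _ ->] := vec3E p q N.
Qed.

(** No grid points are counted: the difference quotient of the truncation [G] of [t] to [[p + h, q]]
    is at most the indicator of [[p, q]], and its sum telescopes. *)
Lemma AA_ind N k (p q : R) : 0 < N -> - N <= p -> q <= N -> p + hh N k <= q ->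
  q - p - hh N k <= AA N k (fun t : R => ((p <= t <= q)%R)%:R).
Proof.
move=> N0 Np qN pq; have h0 := hh_gt0 k N0; set h := hh N k in h0 pq *.
pose G (t : R) := Num.min q (Num.max (p + h) t).
apply: (@le_trans _ _ (G N - G (- N))).
  have -> : G N = q by rewrite /G (max_r (_ : p + h <= N)) ?min_l//; lra.
  have -> : G (- N) = p + h by rewrite /G (max_l (_ : - N <= p + h)) ?min_r//; lra.
  lra.
rewrite -(AA_tel k G N0) -/h; apply: AA_le => // t _; rewrite ler_pdivrMr// /G.
have minL a b : a <= b + h -> Num.min q a - Num.min q b <= h.
  by move=> ab; rewrite !minElt; case: ltP => ?; case: ltP => ?; lra.
have [pt|tp] := leP p t; last first.
  by rewrite /= mul0r !max_l ?subrr//; lra.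
have [tq|qt] := leP t q; rewrite /= ?mul1r ?mul0r; last first.
  by rewrite !min_l ?subrr// le_max; apply/orP; right; lra.
apply: minL; rewrite ge_max.
have : p + h <= Num.max (p + h) t by rewrite le_max lexx.
have : t <= Num.max (p + h) t by rewrite le_max lexx orbT.
by move=> ? ?; apply/andP; split; lra.
Qed.

(** As in [AA_ind], with the truncation to [[p, q + h]], whose difference quotient is at least the
    indicator. *)
Lemma AA_ind_le N k (p q : R) : 0 < N -> p <= q ->
  AA N k (fun t : R => ((p <= t <= q)%R)%:R) <= q - p + hh N k.
Proof.
move=> N0 pq; have h0 := hh_gt0 k N0; set h := hh N k in h0 *.
pose G (t : R) := Num.min (q + h) (Num.max p t).
apply: (@le_trans _ _ (G N - G (- N))); last first.
  have : G N <= q + h by rewrite ge_min lexx.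
  have : p <= G (- N) by rewrite le_min le_max lexx/=; lra.
  lra.
rewrite -(AA_tel k G N0) -/h; apply: AA_le => // t _; rewrite ler_pdivlMr// /G.
have [pt|tp] := leP p t; have [tq|qt] := leP t q; rewrite /= ?mul1r ?mul0r.
all: case: (leP p (t + h)) => ?; rewrite !minElt; do ?[case: ltP => ?]; lra.
Qed.

Let UUex := cid (@ultraFilterLemma nat \oo _).
Definition UU : set_system nat := projT1 UUex.

Lemma UU_ultra : UltraFilter UU. Proof. exact: (projT2 UUex).1. Qed.

Lemma UU_inf (P : set nat) : \oo P -> UU P. Proof. exact: (projT2 UUex).2. Qed.

(* The limit along a fixed ultrafilter makes [II] a positive linear functional
   without any discussion of the convergence of Riemann sums. *)
Definition II N f : R := lim (SS N ^~ f @ UU).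

Lemma II_cvg N f : 0 < N -> cts f -> SS N ^~ f @ UU --> II N f.
Proof.
move=> N0 cf; have [M M0 fM] := box_bound (ltW N0) cf.
have U := UU_ultra; have PU : ProperFilter UU by exact: ultra_proper.
have [l lP] := @ultra_bounded R nat UU U (SS N ^~ f) ((2 * N) ^+ 3 * M)
  (UU_inf (filterS (fun k _ => SS_bound k N0 fM) (filterT : \oo [set: nat]))).
by rewrite /II (cvg_lim _ lP).
Qed.

Lemma II_near_le N f c : 0 < N -> cts f -> \oo [set k | SS N k f <= c] -> II N f <= c.
Proof.
move=> N0 cf H; have PU : ProperFilter UU by exact: (@ultra_proper _ _ UU_ultra).
by apply: (cvgr_to_le (II_cvg N0 cf)); exact: UU_inf.
Qed.

Lemma II_near_ge N f c : 0 < N -> cts f -> \oo [set k | c <= SS N k f] -> c <= II N f.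
Proof.
move=> N0 cf H; have PU : ProperFilter UU by exact: (@ultra_proper _ _ UU_ultra).
by apply: (cvgr_to_ge (II_cvg N0 cf)); exact: UU_inf.
Qed.

Lemma II_le N f g : 0 < N -> cts f -> cts g -> (forall x, box N x -> f x <= g x) -> II N f <= II N g.
Proof.
move=> N0 cf cg H; have PU : ProperFilter UU by exact: (@ultra_proper _ _ UU_ultra).
apply: (ler_cvg_to (II_cvg N0 cf) (II_cvg N0 cg)).
by apply: UU_inf; apply: filterS (filterT : \oo [set: nat]) => k _; exact: SS_le.
Qed.

Lemma IID N f g : 0 < N -> cts f -> cts g -> II N (fun x => f x + g x) = II N f + II N g.
Proof.
move=> N0 cf cg; have PU : ProperFilter UU by exact: (@ultra_proper _ _ UU_ultra).
have c1 := II_cvg N0 cf; have c2 := II_cvg N0 cg.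
apply: cvg_lim => //; rewrite (_ : SS N ^~ _ = fun k => SS N k f + SS N k g); first exact: cvgD.
by apply/funext => k; rewrite SSD.
Qed.

Lemma IIZ N c f : 0 < N -> cts f -> II N (fun x => c * f x) = c * II N f.
Proof.
move=> N0 cf; have PU : ProperFilter UU by exact: (@ultra_proper _ _ UU_ultra).
have c1 := II_cvg N0 cf.
apply: cvg_lim => //; rewrite (_ : SS N ^~ _ = fun k => c * SS N k f).
  by apply: cvgM => //; exact: cvg_cst.
by apply/funext => k; rewrite SSZ.
Qed.

Lemma IIC N c : 0 < N -> II N (fun=> c) = (2 * N) ^+ 3 * c.
Proof.
move=> N0; have PU : ProperFilter UU by exact: (@ultra_proper _ _ UU_ultra).
apply: cvg_lim => //; rewrite (_ : SS N ^~ _ = fun k => (2 * N) ^+ 3 * c); first exact: cvg_cst.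
by apply/funext => k; rewrite SSC.
Qed.

Lemma near_hh N (d : R) : 0 < N -> 0 < d -> \oo [set k | hh N k <= d].
Proof.
move=> N0 d0; exists (Num.truncn (N / d)) => // k /= nk.
rewrite /hh ler_pdivrMr// mulrC -ler_pdivrMr//.
apply: ltW; apply: lt_le_trans (truncnS_gt _) _.
by rewrite ler_nat ltnS.
Qed.

(** Uniform continuity of [g] on the cube bounds its distance to the difference quotient of [F] with
    the mesh as step; the sums of the latter vanish by [SS_tel]. *)
Lemma II_div N i F g : 0 < N -> cts g -> (forall x, isd x (ee i) F (g x)) ->
  (forall x, box N x -> `|x 0 i| = N -> F x = 0) -> II N g = 0.
Proof.
move=> N0 cg dF F0.
apply/eqP; rewrite -normr_le0; apply/ler_addgt0Pr => e e0; rewrite add0r.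
have V0 : 0 < (2 * N) ^+ 3 by rewrite exprn_gt0// mulr_gt0.
have [d d0 dP] := box_heine i (ltW N0) cg (divr_gt0 e0 V0).
have key k : hh N k <= d -> `|SS N k g| <= e.
  move=> hd; have h0 := hh_gt0 k N0; set h := hh N k in h0 hd.
  have -> : g = fun x => (g x - (F (x + h *: ee i) - F x) / h) + (F (x + h *: ee i) - F x) / h.
    by apply/funext => x; rewrite subrK.
  rewrite SSD SS_tel// addr0.
  have -> : e = (2 * N) ^+ 3 * (e / (2 * N) ^+ 3) by rewrite mulrC divfK ?gt_eqF.
  apply: SS_bound => // x bx.
  have [|c /andP[c0 ch] E] := @der_lt R (fun t => F (x + t *: ee i)) (fun t => g (x + t *: ee i)) 0 h h0.
    by move=> t _; exact: is_derive_slice.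
  rewrite scale0r addr0 subr0 in E.
  rewrite E mulfK ?gt_eqF// distrC; apply: dP => //.
  by rewrite gtr0_norm// (le_trans (ltW ch)).
rewrite ler_norml; apply/andP; split.
  apply: II_near_ge => //; apply: filterS (near_hh N0 d0) => k /= /key.
  by rewrite ler_norml => /andP[].
apply: II_near_le => //; apply: filterS (near_hh N0 d0) => k /= /key.
by rewrite ler_norml => /andP[].
Qed.

(** The form in which integration by parts is used below: a pointwise inequality up to the
    divergence of a field that vanishes on the boundary of the cube. *)
Lemma II_le_div N f g (F G : 'I_3 -> E -> R) : 0 < N -> cts f -> cts g ->
  (forall i, cts (G i)) -> (forall i x, isd x (ee i) (F i) (G i x)) ->
  (forall i x, box N x -> `|x 0 i| = N -> F i x = 0) ->
  (forall x, box N x -> f x <= g x + \sum_i G i x) -> II N f <= II N g.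
Proof.
move=> N0 cf cg cG dF F0 H.
have c3 : cts (fun x => G 0 x + G 1 x + G ord_max x) by cont.
have z i : II N (G i) = 0 by apply: (II_div N0 (cG i) (dF i)); exact: F0.
have <- : II N (fun x => g x + (G 0 x + G 1 x + G ord_max x)) = II N g.
  rewrite IID// IID//; last by cont.
  by rewrite IID// !z !addr0.
by apply: II_le => //; [cont|move=> x bx; have := H x bx; rewrite sum3E].
Qed.

(** The 8 is [2^3]: once the mesh is below half of each side, every one-dimensional sum of an
    indicator is at least half of the length. *)
Lemma II_box_ge N f (p q : 'I_3 -> R) c : 0 < N -> cts f -> 0 <= c ->
  (forall i, - N <= p i) -> (forall i, p i < q i) -> (forall i, q i <= N) ->
  (forall x, box N x -> 0 <= f x) ->
  (forall x, (forall i, p i <= x 0 i <= q i) -> c <= f x) ->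
  c * ((q 0 - p 0) * (q 1 - p 1) * (q ord_max - p ord_max)) / 8 <= II N f.
Proof.
move=> N0 cf c0 Np pq qN f0 fc; apply: II_near_ge => //.
have nr i : \oo [set k | hh N k <= (q i - p i) / 2].
  by apply: near_hh => //; rewrite divr_gt0// subr_gt0.
apply: filterS2 (nr 0) (filterI (nr 1) (nr ord_max)) => k /= h0 [h1 h2].
pose I i (t : R) : R := ((p i <= t <= q i)%R)%:R.
have I0 i t : 0 <= I i t by rewrite /I ler0n.
have AI i : hh N k <= (q i - p i) / 2 -> (q i - p i) / 2 <= AA N k (I i).
  move=> hk; have pqi := pq i.
  have pq' : p i + hh N k <= q i by lra.
  by apply: le_trans (AA_ind N0 (Np i) (qN i) pq'); lra.
have lb := AI 0 h0; have lb1 := AI 1 h1; have lb2 := AI ord_max h2.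
apply: (@le_trans _ _ (c * (AA N k (I 0) * (AA N k (I 1) * AA N k (I ord_max))))).
  have d i : 0 <= (q i - p i) / 2 by rewrite divr_ge0// subr_ge0 ltW.
  rewrite -mulrA ler_wpM2l//.
  apply: (@le_trans _ _ ((q 0 - p 0) / 2 * ((q 1 - p 1) / 2 * ((q ord_max - p ord_max) / 2)))).
    by rewrite le_eqVlt; apply/orP; left; apply/eqP; field.
  by apply: ler_pM => //; [rewrite mulr_ge0|apply: ler_pM].
have -> : c * (AA N k (I 0) * (AA N k (I 1) * AA N k (I ord_max))) =
    AA N k (fun s => AA N k (fun t => AA N k (fun r => c * I 0 s * I 1 t * I ord_max r))).
  by rewrite AA_prod.
apply: AA_le => // s sN; apply: AA_le => // t tN; apply: AA_le => // r rN.
have bx := vec3_box sN tN rN; have [e0 e1 e2] := vec3E s t r.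
rewrite /I.
case: (boolP (p 0 <= s <= q 0)) => [hs|_]; last by rewrite /= mulr0 !mul0r f0.
case: (boolP (p 1 <= t <= q 1)) => [ht|_]; last by rewrite /= mulr0 !mul0r f0.
case: (boolP (p ord_max <= r <= q ord_max)) => [hr|_]; last by rewrite /= mulr0 f0.
by rewrite /= !mulr1; apply: fc; apply: ord3P; rewrite ?e0 ?e1 ?e2.
Qed.

(** Once the mesh is below each side, every one-dimensional sum of an indicator is at most twice the
    length, which gives the factor 8. *)
Lemma II_box_le N f (p q : 'I_3 -> R) c : 0 < N -> cts f -> 0 <= c ->
  (forall i, p i < q i) ->
  (forall x, box N x -> f x <= c) ->
  (forall x i, box N x -> ~~ (p i <= x 0 i <= q i) -> f x <= 0) ->
  II N f <= c * ((q 0 - p 0) * (q 1 - p 1) * (q ord_max - p ord_max)) * 8.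
Proof.
move=> N0 cf c0 pq fc f0; apply: II_near_le => //.
have nr i : \oo [set k | hh N k <= (q i - p i)].
  by apply: near_hh => //; rewrite subr_gt0.
apply: filterS2 (nr 0) (filterI (nr 1) (nr ord_max)) => k /= h0 [h1 h2].
pose I i (t : R) : R := ((p i <= t <= q i)%R)%:R.
have I0 i t : 0 <= I i t by rewrite /I ler0n.
have AI0 i : 0 <= AA N k (I i).
  by rewrite -[leLHS](mulr0 (2 * N)) -(AAC N k); apply: AA_le.
have AI i : hh N k <= q i - p i -> AA N k (I i) <= 2 * (q i - p i).
  move=> hk; apply: le_trans (AA_ind_le k N0 (ltW (pq i))) _; lra.
have lb := AI 0 h0; have lb1 := AI 1 h1; have lb2 := AI ord_max h2.
apply: (@le_trans _ _ (c * (AA N k (I 0) * (AA N k (I 1) * AA N k (I ord_max))))); last first.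
  rewrite -mulrA ler_wpM2l//.
  apply: (@le_trans _ _ ((2 * (q 0 - p 0)) * ((2 * (q 1 - p 1)) * (2 * (q ord_max - p ord_max))))).
    by apply: ler_pM => //; [rewrite mulr_ge0|apply: ler_pM].
  by rewrite le_eqVlt; apply/orP; left; apply/eqP; ring.
have -> : c * (AA N k (I 0) * (AA N k (I 1) * AA N k (I ord_max))) =
    AA N k (fun s => AA N k (fun t => AA N k (fun r => c * I 0 s * I 1 t * I ord_max r))).
  by rewrite AA_prod.
apply: AA_le => // s sN; apply: AA_le => // t tN; apply: AA_le => // r rN.
have bx := vec3_box sN tN rN; have [e0 e1 e2] := vec3E s t r.
rewrite /I.
case: (boolP (p 0 <= s <= q 0)) => [hs|hs]; last by rewrite /= mulr0 !mul0r; apply: (f0 _ 0) => //; rewrite e0.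
case: (boolP (p 1 <= t <= q 1)) => [ht|ht]; last by rewrite /= mulr0 !mul0r; apply: (f0 _ 1) => //; rewrite e1.
case: (boolP (p ord_max <= r <= q ord_max)) => [hr|hr]; last by rewrite /= mulr0; apply: (f0 _ ord_max) => //; rewrite e2.
by rewrite /= !mulr1; exact: fc.
Qed.

End integral.

(** * Cutoffs and the Caccioppoli inequality *)

Section cutoff.
Context {R : realType}.
Notation E := 'rV[R]_3.
Implicit Types (x y z : E) (f g : E -> R) (i j : 'I_3) (N r t : R) (k K : nat).

Definition mx0 t : R := Num.max t 0.

Lemma mx0P t : mx0 t = (if t <= 0 then 0 else t).
Proof. by rewrite /mx0; case: leP. Qed.

Lemma mx0_lip (a b : R) : `|mx0 a - mx0 b| <= `|a - b|.
Proof.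
rewrite !mx0P; case: (leP a 0) => ha; case: (leP b 0) => hb; rewrite ?subrr ?normr0//.
- rewrite sub0r normrN gtr0_norm// ler0_norm; lra.
- rewrite subr0 gtr0_norm// ger0_norm; lra.
Qed.

Lemma der_mx0X2 t : isd t (1 : R) (fun t => mx0 t ^+ 2) (2 * mx0 t).
Proof.
apply/is_deriveP; apply/cvgrPdist_le => e e0; exists e => //= h.
rewrite /ball/= sub0r normrN => he h0.
apply: le_trans (ltW he).
rewrite -(ler_pM2r (_ : 0 < `|h|)) ?normr_gt0// -normrM mulrBl.
rewrite [h^-1 * _]mulrC divfK// [h *: 1]mulr1 -expr2 sqr_normr.
rewrite !mx0P; case: (leP t 0) => a; case: (leP (t + h) 0) => b.
all: rewrite ler_norml; apply/andP; split; nra.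
Qed.

Lemma lip_continuous (g : R -> R) (L : R) : (forall a b, `|g a - g b| <= L * `|a - b|) -> continuous g.
Proof.
move=> H a; have L0 : 0 <= L.
  by have := le_trans (normr_ge0 _) (H 1 0); rewrite subr0 normr1 mulr1.
apply/cvgrPdist_le => e e0; exists (e / (L + 1)) => /=; first by rewrite divr_gt0// ltr_wpDl.
move=> b; rewrite /ball/= ltr_pdivlMr ?ltr_wpDl// => ab.
by apply: le_trans (H a b) _; have := normr_ge0 (a - b); lra.
Qed.

(* A C^1 step from 0 to 1 on the unit interval, quadratic on both halves. *)
Definition st t : R := 2 * mx0 t ^+ 2 - 4 * mx0 (t - 1 / 2) ^+ 2 + 2 * mx0 (t - 1) ^+ 2.
Definition dst t : R := 4 * (mx0 t - 2 * mx0 (t - 1 / 2) + mx0 (t - 1)).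

Lemma der_st t : isd t (1 : R) st (dst t).
Proof.
have sh (c : R) : isd t (1 : R) (fun t => mx0 (t - c) ^+ 2) (2 * mx0 (t - c)).
  have H : isd t (1 : R) (fun t : R => t - c) 1.
    by apply: der_eq; [der|rewrite /=; ring].
  have H2 := der_mx0X2 (t - c).
  have := @der_comp R R t 1 (fun t => t - c) (fun t => mx0 t ^+ 2) _ _ H H2.
  by rewrite mulr1.
have H0 := der_mx0X2 t; have H1 := sh (1 / 2); have H2 := sh 1.
by apply: der_eq; [rewrite /st; der|rewrite /dst /=; ring].
Qed.

Ltac st_cases t := rewrite ?/st ?/dst !mx0P; case: (leP t 0) => ?; case: (leP (t - 1 / 2) 0) => ?; case: (leP (t - 1) 0) => ?.

Lemma st_le0 t : t <= 0 -> st t = 0.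
Proof. by move=> h; st_cases t; lra. Qed.

Lemma st_ge1 t : 1 <= t -> st t = 1.
Proof. by move=> h; st_cases t; try lra; nra. Qed.

Lemma st01 t : 0 <= st t <= 1.
Proof. by st_cases t; apply/andP; split; try lra; nra. Qed.

Lemma dst02 t : 0 <= dst t <= 2.
Proof. by st_cases t; apply/andP; split; lra. Qed.

Lemma dst_out t : t <= 0 \/ 1 <= t -> dst t = 0.
Proof. by case=> h; st_cases t; lra. Qed.

Lemma dst_half t : 1 / 2 <= t <= 1 -> dst t = 4 * (1 - t).
Proof. by move=> /andP[h1 h2]; st_cases t; lra. Qed.

Lemma dst_lip (a b : R) : `|dst a - dst b| <= 16 * `|a - b|.
Proof.
have h0 := mx0_lip a b; have h1 := mx0_lip (a - 1 / 2) (b - 1 / 2).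
have h2 := mx0_lip (a - 1) (b - 1).
have e (c : R) : a - c - (b - c) = a - b by ring.
rewrite !e in h1 h2; move: h0 h1 h2; rewrite /dst.
move: (mx0 a) (mx0 b) (mx0 (a - 1 / 2)) (mx0 (b - 1 / 2)) (mx0 (a - 1)) (mx0 (b - 1)) => a0 b0 a1 b1 a2 b2.
move: (`|a - b|) => d; rewrite !ler_norml => /andP[? ?] /andP[? ?] /andP[? ?]; apply/andP; split; lra.
Qed.

Lemma dst_cont : continuous dst. Proof. exact: lip_continuous dst_lip. Qed.

(** The argument of [st] is 1 at [|t| = r] and 0 at [|t| = 2 r]; being quadratic in [t], it avoids
    differentiating an absolute value. *)
Definition eta r t : R := st ((4 - (t / r) ^+ 2) / 3).
Definition deta r t : R := dst ((4 - (t / r) ^+ 2) / 3) * (- (2 * t / r ^+ 2) / 3).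

Lemma der_eta r t : isd t (1 : R) (eta r) (deta r t).
Proof.
have H : isd t (1 : R) (fun t => (4 - (t / r) ^+ 2) / 3) (- (2 * t / r ^+ 2) / 3).
  by apply: der_eq; [der|rewrite /= -exprVn; ring].
exact: (@der_comp R R t 1 _ st _ _ H (der_st _)).
Qed.

Lemma eta01 r t : 0 <= eta r t <= 1. Proof. exact: st01. Qed.
Lemma eta_ge0 r t : 0 <= eta r t. Proof. by have /andP[] := eta01 r t. Qed.
Lemma eta_le1 r t : eta r t <= 1. Proof. by have /andP[] := eta01 r t. Qed.

Let sqr_div r t (c : R) : 0 < r -> 0 <= c -> (`|t| <= c * r) = ((t / r) ^+ 2 <= c ^+ 2).
Proof.
move=> r0 c0; rewrite -[(t / r) ^+ 2]sqr_normr ler_pXn2r ?nnegrE//.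
by rewrite normrM normfV (gtr0_norm r0) ler_pdivrMr.
Qed.

Let sqr_div' r t (c : R) : 0 < r -> 0 <= c -> (c * r <= `|t|) = (c ^+ 2 <= (t / r) ^+ 2).
Proof.
move=> r0 c0; rewrite -[(t / r) ^+ 2]sqr_normr ler_pXn2r ?nnegrE//.
by rewrite normrM normfV (gtr0_norm r0) ler_pdivlMr.
Qed.

Lemma eta1 r t : 0 < r -> `|t| <= r -> eta r t = 1.
Proof.
move=> r0; rewrite -{1}[r]mul1r sqr_div// => h; apply: st_ge1.
by rewrite ler_pdivlMr//; lra.
Qed.

Lemma eta0 r t : 0 < r -> 2 * r <= `|t| -> eta r t = 0.
Proof.
move=> r0; rewrite sqr_div'// => h; apply: st_le0.
by rewrite ler_pdivrMr//; lra.
Qed.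

Lemma deta0 r t : 0 < r -> `|t| <= r \/ 2 * r <= `|t| -> deta r t = 0.
Proof.
move=> r0 h; rewrite /deta dst_out ?mul0r//.
case: h; [rewrite -{1}[r]mul1r sqr_div//; right|rewrite sqr_div'//; left].
  by rewrite ler_pdivlMr//; lra.
by rewrite ler_pdivrMr//; lra.
Qed.

Lemma deta_bnd r t : 0 < r -> `|deta r t| <= 3 / r.
Proof.
move=> r0; have [h|h] := leP (2 * r) `|t|.
  by rewrite deta0 ?normr0 ?divr_ge0 ?(ltW r0)//; right.
rewrite /deta normrM; have /andP[d0 d2] := dst02 ((4 - (t / r) ^+ 2) / 3).
rewrite (ger0_norm d0).
have -> : - (2 * t / r ^+ 2) / 3 = - (2 / 3) * (t / r) / r by field; rewrite gt_eqF.
have -> : `|- (2 / 3) * (t / r) / r| = 2 / 3 * (`|t| / r) / r.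
  by rewrite !(normrM, normrN, normfV) (gtr0_norm r0) (ger0_norm (ler0n _ 2)) (ger0_norm (ler0n _ 3)).
have tr : `|t| / r <= 2 by rewrite ler_pdivrMr// ltW.
have tr0 : 0 <= `|t| / r by rewrite divr_ge0// ltW.
rewrite mulrA ler_pM2r ?invr_gt0//; nra.
Qed.

Lemma deta_sgn r t : 0 < r -> deta r t = - (Num.sg t * `|deta r t|).
Proof.
move=> r0; have /andP[d0 _] := dst02 ((4 - (t / r) ^+ 2) / 3).
have r3 : 0 < 2 / r ^+ 2 / 3 by rewrite !divr_gt0// exprn_gt0.
rewrite /deta; have -> : - (2 * t / r ^+ 2) / 3 = - t * (2 / r ^+ 2 / 3) by ring.
set D := dst _ in d0 *; rewrite (normrM D) (normrM (- t)) normrN (ger0_norm d0) (gtr0_norm r3).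
by rewrite [X in D * (- X * _)](numEsg t); ring.
Qed.

(** On this part of the transition the argument of [dst] lies in [[1/2, 1]], where [dst] is affine.
    Any such interval of length proportional to [r] would serve for the flux in [nodal_bound]. *)
Lemma deta_low r t : 0 < r -> 7 / 5 * r <= t <= 3 / 2 * r -> 1 / 2 / r <= `|deta r t|.
Proof.
move=> r0 /andP[t1 t2].
have a1 : 7 / 5 <= t / r by rewrite ler_pdivlMr.
have a2 : t / r <= 3 / 2 by rewrite ler_pdivrMr.
have t0 : 0 <= t by apply: le_trans t1; rewrite mulr_ge0// ?divr_ge0// ltW.
rewrite /deta dst_half; last by apply/andP; split; nra.
have -> : - (2 * t / r ^+ 2) / 3 = - (2 / 3 * (t / r) / r) by field; rewrite gt_eqF.
rewrite mulrN normrN ger0_norm; last first.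
  by rewrite mulr_ge0 ?divr_ge0 ?mulr_ge0 ?(ltW r0)//; nra.
rewrite mulrA ler_pM2r ?invr_gt0//.
have a3 : 24 / 25 <= (t / r) ^+ 2 - 1 by nra.
have a4 : 24 / 25 * (7 / 5) <= ((t / r) ^+ 2 - 1) * (t / r) by apply: ler_pM.
by lra.
Qed.

Lemma deta_cont r : continuous (deta r).
Proof.
have H : cts (fun t : R => (4 - (t / r) ^+ 2) / 3) by have H0 : cts (@idfun R) by [move=> t; exact: cvg_id]; cont.
have H2 : cts (fun t : R => - (2 * t / r ^+ 2) / 3) by have H0 : cts (@idfun R) by [move=> t; exact: cvg_id]; cont.
have H3 := cts_comp H dst_cont.
by have := ctsM H3 H2.
Qed.

Lemma eta_cont r : continuous (eta r).
Proof. by move=> t; apply: is_derive_cont (der_eta r t). Qed.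

(** A bump on [[-1, 1]] and, as [Kap], its primitive: a C^1 version of half the sign function. *)
Definition kap t : R := dst ((t + 1) / 2) / 2.
Definition Kap t : R := st ((t + 1) / 2) - 1 / 2.

Lemma der_Kap t : isd t (1 : R) Kap (kap t).
Proof.
have H : isd t (1 : R) (fun t => (t + 1) / 2) (1 / 2) by apply: der_eq; [der|rewrite /=; ring].
have H2 := @der_comp R R t 1 _ st _ _ H (der_st _).
by apply: der_eq; [rewrite /Kap; der|rewrite /kap; ring].
Qed.

Lemma kap01 t : 0 <= kap t <= 1.
Proof. by rewrite /kap; have /andP[? ?] := dst02 ((t + 1) / 2); apply/andP; split; lra. Qed.

Lemma kap_out t : 1 <= `|t| -> kap t = 0.
Proof.
move=> h; rewrite /kap dst_out ?mul0r//.
by move: h; case: (ger0P t) => t0 h; [right|left]; lra.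
Qed.

Lemma Kap_ge1 t : 1 <= t -> Kap t = 1 / 2.
Proof. by move=> h; rewrite /Kap st_ge1; lra. Qed.

Lemma Kap_leN1 t : t <= -1 -> Kap t = - (1 / 2).
Proof. by move=> h; rewrite /Kap st_le0; lra. Qed.

Lemma kap_lip (a b : R) : `|kap a - kap b| <= 4 * `|a - b|.
Proof.
have := dst_lip ((a + 1) / 2) ((b + 1) / 2); rewrite /kap.
have -> : (a + 1) / 2 - (b + 1) / 2 = (a - b) / 2 by ring.
rewrite -mulrBl !normrM; have -> : `|2^-1| = 2^-1 :> R by rewrite ger0_norm.
lra.
Qed.

Lemma Kap_cont : continuous Kap.
Proof. by move=> t; apply: is_derive_cont (der_Kap t). Qed.

Lemma eta_coord r i j x : isd x (ee i) (fun x : E => eta r (x 0 j)) (deta r (x 0 j) * (i == j)%:R).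
Proof. exact: (@der_comp R E x (ee i) (fun x : E => x 0 j) (eta r) _ _ (der_coord i j x) (der_eta r _)). Qed.

Lemma cts_eta r j : cts (fun x : E => eta r (x 0 j)).
Proof. exact: cts_comp (coord_cont (i := j)) (@eta_cont r). Qed.

Lemma cts_deta r j : cts (fun x : E => deta r (x 0 j)).
Proof. exact: cts_comp (coord_cont (i := j)) (@deta_cont r). Qed.

(** The transition zones [[2^(k+1), 2^(k+2)]] do not overlap in their interiors, so all cross terms
    vanish. This is where averaging over [K] scales gains a factor [K]. *)
Lemma deta_disjoint (F : nat -> R) K t :
  (\sum_(0 <= k < K) deta (2 ^+ k.+1) t * F k) ^+ 2 =
  \sum_(0 <= k < K) (deta (2 ^+ k.+1) t * F k) ^+ 2.
Proof.
have p2 k : 0 < 2 ^+ k :> R by rewrite exprn_gt0.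
have [H|H] := pselect (forall k, (k < K)%N -> deta (2 ^+ k.+1) t = 0).
  rewrite (eq_big_nat _ _ (F2 := fun=> 0)) => [|k /andP[_ kK]]; last by rewrite H ?mul0r.
  rewrite [RHS](eq_big_nat _ _ (F2 := fun=> 0)) => [|k /andP[_ kK]]; last by rewrite H// mul0r expr0n.
  by rewrite !big1 ?expr0n.
have [k0 k0K d0] : exists2 k, (k < K)%N & deta (2 ^+ k.+1) t != 0.
  apply: contrapT => H'; apply: H => k kK; apply/eqP; apply: contrapT => /negP d.
  by apply: H'; exists k.
have tk k : deta (2 ^+ k.+1) t != 0 -> 2 ^+ k.+1 < `|t| < 2 ^+ k.+2.
  move=> d; rewrite !ltNge; apply/andP; split; apply/negP => h; move/eqP: d; apply.
    by apply: deta0 => //; left.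
  by apply: deta0 => //; right; rewrite -exprS.
have z k : k != k0 -> deta (2 ^+ k.+1) t = 0.
  move=> kk; apply/eqP; apply: contraT => d.
  have /andP[a1 a2] := tk _ d0; have /andP[b1 b2] := tk _ d.
  have : 2 ^+ k.+1 < 2 ^+ k0.+2 :> R by exact: lt_trans b1 a2.
  have : 2 ^+ k0.+1 < 2 ^+ k.+2 :> R by exact: lt_trans a1 b2.
  rewrite !ltr_eXn2l ?ltr1n// !ltnS => h1 h2.
  by move: kk; rewrite eqn_leq h1 h2.
by rewrite !(bigD1_seq k0) ?iota_uniq ?mem_index_iota//= !big1 ?addr0// => k /z ->; rewrite mul0r ?expr0n.
Qed.

End cutoff.

Section base.
Context {R : realType}.
Notation E := 'rV[R]_3.
Implicit Types (x y z : E) (f g : E -> R) (i j : 'I_3) (N r t : R) (k K : nat).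

(* [test N zeta zeta1]: [zeta] is a C^1 function with partials [zeta1],
   vanishing on the boundary of the cube [box N]. *)
Definition test N (zeta : E -> R) (zeta1 : 'I_3 -> E -> R) : Prop :=
  [/\ cts zeta, forall i, cts (zeta1 i), forall i x, isd x (ee i) zeta (zeta1 i x)
    & forall i x, box N x -> `|x 0 i| = N -> zeta x = 0].

Definition twiceC f (f1 f2 : 'I_3 -> E -> R) : Prop :=
  [/\ cts f, forall i, cts (f1 i), forall i, cts (f2 i) & twice f f1 f2].

(* [p] times the gradient of [w / p]. *)
Definition lrem (w p : E -> R) (w1 p1 : 'I_3 -> E -> R) i x : R := w1 i x - w x * p1 i x / p x.

(** In the divergence of [zeta^2 (w X + z Y)], with [X] and [Y] the remainders [lrem], the diagonal
    coefficients [A] and [D] cancel, since [w], [p] and [z], [q] share them. The opposite signs of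
    [B] in the equations for [(w, z)] and [(p, q)] make the coupling the square
    [B (w q + z p)^2 / (p q)]. *)
Lemma weighted_caccioppoli N (zeta : E -> R) (zeta1 : 'I_3 -> E -> R)
    (w z p q A B D : E -> R) (w1 w2 z1 z2 p1 p2 q1 q2 : 'I_3 -> E -> R) :
  0 < N -> test N zeta zeta1 ->
  twiceC w w1 w2 -> twiceC z z1 z2 -> twiceC p p1 p2 -> twiceC q q1 q2 -> cts B ->
  (forall x, 0 < p x) -> (forall x, 0 < q x) ->
  (forall x, \sum_i w2 i x = A x * w x + B x * z x) ->
  (forall x, \sum_i z2 i x = B x * w x + D x * z x) ->
  (forall x, \sum_i p2 i x = A x * p x - B x * q x) ->
  (forall x, \sum_i q2 i x = D x * q x - B x * p x) ->
  II N (fun x => zeta x ^+ 2 * (\sum_i lrem w p w1 p1 i x ^+ 2 + \sum_i lrem z q z1 q1 i x ^+ 2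
     + 2 * B x * (w x * q x + z x * p x) ^+ 2 / (p x * q x))) <=
  II N (fun x => 4 * \sum_i zeta1 i x ^+ 2 * (w x ^+ 2 + z x ^+ 2)).
Proof.
move=> N0 [cz cz1 dz z0] [cw cw1 cw2 dw] [cz' cz'1 cz'2 dz'] [cp cp1 cp2 dp] [cq cq1 cq2 dq] cB p0 q0 lw lz lp lq.
have pn x : p x != 0 by rewrite gt_eqF.
have qn x : q x != 0 by rewrite gt_eqF.
have pqn x : p x * q x != 0 by rewrite mulf_neq0.
have cX i : cts (lrem w p w1 p1 i) by rewrite /lrem; cont.
have cY i : cts (lrem z q z1 q1 i) by rewrite /lrem; cont.
pose F i x := 2 * (zeta x ^+ 2 * (w x * lrem w p w1 p1 i x + z x * lrem z q z1 q1 i x)).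
pose G i x := 2 * (2 * zeta x * zeta1 i x * (w x * lrem w p w1 p1 i x + z x * lrem z q z1 q1 i x)
  + zeta x ^+ 2 * (lrem w p w1 p1 i x ^+ 2 + lrem z q z1 q1 i x ^+ 2
     + w x * w2 i x - w x ^+ 2 / p x * p2 i x + z x * z2 i x - z x ^+ 2 / q x * q2 i x)).
apply: (@II_le_div R N _ _ F G) => //.
- by cont.
- by cont.
- by move=> i; rewrite /G; cont.
- move=> i x.
  have [H1 H5] := dw i x; have [H2 H6] := dz' i x; have [H3 H7] := dp i x; have [H4 H8] := dq i x.
  have H9 := dz i x.
  apply: der_eq; first by rewrite /F /lrem; der; [exact: pn|exact: qn].
  rewrite /G /lrem /=; have := pn x; have := qn x; clear.
  move: (p x) (q x) (w x) (z x) (zeta x) (zeta1 i x) (p1 i x) (q1 i x) (w1 i x) (z1 i x) (p2 i x) (q2 i x) (w2 i x) (z2 i x).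
  by move=> a b c d e f g h k l m n o r a0 b0; field; rewrite a0 b0.
- by move=> i x bx xi; rewrite /F (z0 i x bx xi) expr0n mul0r mulr0.
move=> x bx.
have E1 : \sum_i (w x * w2 i x - w x ^+ 2 / p x * p2 i x + z x * z2 i x - z x ^+ 2 / q x * q2 i x) =
   B x * (w x * q x + z x * p x) ^+ 2 / (p x * q x).
  transitivity (w x * (A x * w x + B x * z x) - w x ^+ 2 / p x * (A x * p x - B x * q x)
    + z x * (B x * w x + D x * z x) - z x ^+ 2 / q x * (D x * q x - B x * p x)).
    rewrite -(lw x) -(lz x) -(lp x) -(lq x) !sum3E; clear.
    move: (w2 0 x) (w2 1 x) (w2 ord_max x) (z2 0 x) (z2 1 x) (z2 ord_max x) (p2 0 x) (p2 1 x) (p2 ord_max x)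
      (q2 0 x) (q2 1 x) (q2 ord_max x) (w x) (z x) (p x) (q x) => *.
    by ring.
  have := pn x; have := qn x; clear; move: (A x) (B x) (D x) (p x) (q x) (w x) (z x).
  by move=> a b d p' q' w' z' q0 p0; field; rewrite p0 q0.
have -> : zeta x ^+ 2 * (\sum_i lrem w p w1 p1 i x ^+ 2 + \sum_i lrem z q z1 q1 i x ^+ 2
     + 2 * B x * (w x * q x + z x * p x) ^+ 2 / (p x * q x)) =
  zeta x ^+ 2 * (\sum_i lrem w p w1 p1 i x ^+ 2 + \sum_i lrem z q z1 q1 i x ^+ 2) +
  2 * zeta x ^+ 2 * (B x * (w x * q x + z x * p x) ^+ 2 / (p x * q x)).
  move: (\sum_i _) (\sum_i _) (_ ^-1) (B x) (zeta x) ((w x * q x + z x * p x) ^+ 2) => *.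
  by ring.
rewrite -E1 mulrDr !mulr_sumr -!big_split/=; apply: ler_sum => i _; rewrite /G.
set X := lrem w p w1 p1 i x; set Y := lrem z q z1 q1 i x.
move: (X) (Y) (zeta x) (zeta1 i x) (w2 i x) (p2 i x) (z2 i x) (q2 i x) (w x) (z x) (w x ^+ 2 / p x) (z x ^+ 2 / q x); clear.
move=> X Y Z Z1 a b c d w z e f.
(* The cross terms [4 zeta zeta1 w X] and [4 zeta zeta1 z Y] are absorbed by completing squares,
   which costs one of the two copies of [zeta^2 (X^2 + Y^2)] and produces the 4 on the right. *)
by have := sqr_ge0 (Z * X + 2 * Z1 * w); have := sqr_ge0 (Z * Y + 2 * Z1 * z); lra.
Qed.

(** The test function is [zeta^2 / p]. The estimate is invariant under scaling of [p], so it
    persists along translates for which [p] tends to 0. *)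
Lemma caccioppoli_log N (zeta : E -> R) (zeta1 : 'I_3 -> E -> R) (p : E -> R) (p1 p2 : 'I_3 -> E -> R) (C : R) :
  0 < N -> test N zeta zeta1 -> twiceC p p1 p2 -> (forall x, 0 < p x) ->
  (forall x, \sum_i p2 i x <= C * p x) ->
  II N (fun x => zeta x ^+ 2 * \sum_i (p1 i x / p x) ^+ 2) <=
  II N (fun x => 4 * \sum_i zeta1 i x ^+ 2 + 2 * C * zeta x ^+ 2).
Proof.
move=> N0 [cz cz1 dz z0] [cp cp1 cp2 dp] p0 lp.
have pn x : p x != 0 by rewrite gt_eqF.
pose F i x := - 2 * (zeta x ^+ 2 * (p1 i x / p x)).
pose G i x := - 2 * (2 * zeta x * zeta1 i x * (p1 i x / p x)
  + zeta x ^+ 2 * (p2 i x / p x - (p1 i x / p x) ^+ 2)).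
apply: (@II_le_div R N _ _ F G) => //.
- by cont.
- by cont.
- by move=> i; rewrite /G; cont.
- move=> i x; have [H3 H7] := dp i x; have H9 := dz i x.
  apply: der_eq; first by rewrite /F; der; exact: pn.
  rewrite /G /=; have := pn x; clear.
  by move: (p x) (p1 i x) (p2 i x) (zeta x) (zeta1 i x) => a b c d e a0; field.
- by move=> i x bx xi; rewrite /F (z0 i x bx xi) expr0n mul0r mulr0.
move=> x bx.
have E1 : zeta x ^+ 2 * (2 * \sum_i p2 i x / p x) <= 2 * C * zeta x ^+ 2.
  have h : \sum_i p2 i x / p x <= C by rewrite -mulr_suml ler_pdivrMr.
  by have := sqr_ge0 (zeta x); nra.
apply: (@le_trans _ _ (4 * (\sum_i zeta1 i x ^+ 2) + zeta x ^+ 2 * (2 * \sum_i p2 i x / p x) + \sum_i G i x)); last first.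
  by rewrite lerD2r lerD2l.
rewrite !mulr_sumr -!big_split/=; apply: ler_sum => i _; rewrite /G.
move: (p1 i x / p x) (p2 i x / p x) (zeta x) (zeta1 i x); clear => h k Z Z1.
by have := sqr_ge0 (Z * h - 2 * Z1); lra.
Qed.

End base.

(** * Tubular cutoffs, logarithmic in two variables *)

Section cutoffs3.
Context {R : realType}.
Notation E := 'rV[R]_3.
Implicit Types (x y z : E) (f g : E -> R) (i j : 'I_3) (N r t : R) (k K : nat).

Lemma II_sum N K (h : 'I_K -> E -> R) : 0 < N -> (forall k : 'I_K, cts (h k)) ->
  II N (fun x => \sum_(k < K) h k x) = \sum_(k < K) II N (h k).
Proof.
move=> N0; elim: K h => [|K IH] h ch.
  rewrite big_ord0 (_ : (fun _ => _) = fun=> 0); first by rewrite IIC// mulr0.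
  by apply/funext => x; rewrite big_ord0.
rewrite big_ord_recr/= -IH// -IID//; last by apply: cts_sum.
by congr (II _ _); apply/funext => x; rewrite big_ord_recr.
Qed.

Definition cut2 N x : R := eta 1 (x 0 0) * eta 1 (x 0 1) * eta (N / 2) (x 0 ord_max).

Definition cut2' N i x : R :=
  deta 1 (x 0 0) * (i == 0)%:R * eta 1 (x 0 1) * eta (N / 2) (x 0 ord_max)
  + eta 1 (x 0 0) * (deta 1 (x 0 1) * (i == 1)%:R) * eta (N / 2) (x 0 ord_max)
  + eta 1 (x 0 0) * eta 1 (x 0 1) * (deta (N / 2) (x 0 ord_max) * (i == ord_max)%:R).

Lemma cut2_test N : 2 <= N -> test N (cut2 N) (cut2' N).
Proof.
move=> N2; have ce r j := @cts_eta R r j; have cd r j := @cts_deta R r j.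
have c0 := ce 1 0; have c1 := ce 1 1; have c2 := ce (N / 2) ord_max.
have d0 := cd 1 0; have d1 := cd 1 1; have d2 := cd (N / 2) ord_max.
split.
- by rewrite /cut2; cont.
- by move=> i; rewrite /cut2'; cont.
- move=> i x.
  have h0 := eta_coord 1 i 0 x; have h1 := eta_coord 1 i 1 x; have h2 := eta_coord (N / 2) i ord_max x.
  by apply: der_eq; [rewrite /cut2; der|rewrite /cut2' /=; ring].
- move=> i x _; move: i; apply: ord3P => xi; rewrite /cut2.
  + by rewrite [eta 1 (x 0 0)]eta0 ?mul0r// xi; lra.
  + by rewrite [eta 1 (x 0 1)]eta0 ?mulr0 ?mul0r// xi; lra.
  + by rewrite [eta (N / 2) _]eta0 ?mulr0//; [lra|rewrite xi; lra].
Qed.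

Lemma cut2_01 N x : 0 <= cut2 N x <= 1.
Proof.
rewrite /cut2 !mulr_ge0 ?eta_ge0//=.
by rewrite !mulr_ile1 ?mulr_ge0 ?eta_ge0 ?eta_le1.
Qed.

(** The average over the scales [2, 4, ..., 2^K] replaces the usual logarithm of the radius: it
    falls from 1 to 0 by about [1 / K] per dyadic annulus. *)
Definition avg2 K x : R := K%:R^-1 * \sum_(k < K) eta (2 ^+ k.+1) (x 0 0) * eta (2 ^+ k.+1) (x 0 1).
Definition avg2' K i x : R := K%:R^-1 * \sum_(k < K)
  (deta (2 ^+ k.+1) (x 0 0) * (i == 0)%:R * eta (2 ^+ k.+1) (x 0 1)
   + eta (2 ^+ k.+1) (x 0 0) * (deta (2 ^+ k.+1) (x 0 1) * (i == 1)%:R)).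
Definition log2 N K x : R := avg2 K x * eta (N / 2) (x 0 ord_max).
Definition log2' N K i x : R := avg2' K i x * eta (N / 2) (x 0 ord_max)
  + avg2 K x * (deta (N / 2) (x 0 ord_max) * (i == ord_max)%:R).

Lemma p2 k : 0 < 2 ^+ k :> R. Proof. by rewrite exprn_gt0. Qed.

Lemma avg2_cts K : cts (avg2 K).
Proof.
have ce (r : R) j := @cts_eta R r j; rewrite /avg2; apply: ctsM; first exact: ctsC.
by apply: cts_sum => k; apply: ctsM; exact: ce.
Qed.

Lemma avg2'_cts K i : cts (avg2' K i).
Proof.
have ce (r : R) j := @cts_eta R r j; have cd (r : R) j := @cts_deta R r j.
rewrite /avg2'; apply: ctsM; first exact: ctsC.
apply: cts_sum => k; apply: ctsD.
  by apply: ctsM; [apply: ctsM; [exact: cd|exact: ctsC]|exact: ce].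
by apply: ctsM; [exact: ce|apply: ctsM; [exact: cd|exact: ctsC]].
Qed.

Lemma avg2_der K i x : isd x (ee i) (avg2 K) (avg2' K i x).
Proof.
apply: der_eq.
  apply: derM; first exact: derC.
  apply: der_sum => k.
  by apply: derM; exact: eta_coord.
rewrite /avg2' mulr0 addr0; congr (_ * _); apply: eq_bigr => k _.
by ring.
Qed.

Lemma avg2_01 K x : (0 < K)%N -> 0 <= avg2 K x <= 1.
Proof.
move=> K0; have K0' : 0 < K%:R :> R by rewrite ltr0n.
rewrite /avg2 mulr_ge0 ?invr_ge0 ?sumr_ge0//=; last by move=> k _; rewrite mulr_ge0 ?eta_ge0.
rewrite mulrC ler_pdivrMr// mul1r.
apply: (@le_trans _ _ (\sum_(k < K) 1)); last by rewrite sumr_const card_ord.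
by apply: ler_sum => k _; rewrite mulr_ile1 ?eta_ge0 ?eta_le1.
Qed.

Lemma avg2_out K x i : (i == 0) || (i == 1) -> 2 ^+ K.+1 <= `|x 0 i| -> avg2 K x = 0.
Proof.
move=> i01 xi; rewrite /avg2 big1 ?mulr0// => k _.
have h : 2 * 2 ^+ k.+1 <= `|x 0 i|.
  by apply: le_trans xi; rewrite -exprS ler_weXn2l ?ler1n// ltnS ltn_ord.
by move: i01 h => /orP[] /eqP -> h; rewrite (eta0 (p2 _) h) ?mul0r ?mulr0.
Qed.

Lemma avg2_in K x : (0 < K)%N -> `|x 0 0| <= 2 -> `|x 0 1| <= 2 -> avg2 K x = 1.
Proof.
move=> K0 x0 x1; rewrite /avg2 (eq_bigr (fun=> 1)).
  by rewrite sumr_const card_ord mulVf// pnatr_eq0 -lt0n.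
move=> k _; have h : 2 <= 2 ^+ k.+1 :> R by rewrite exprS ler_peMr// exprn_ege1// ler1n.
by rewrite !eta1 ?mulr1// (le_trans _ h).
Qed.

Lemma log2_test N K : (0 < K)%N -> 2 ^+ K.+1 <= N -> test N (log2 N K) (log2' N K).
Proof.
move=> K0 KN; have N0 : 0 < N by apply: lt_le_trans KN; exact: p2.
have ca := @avg2_cts K; have ca' i := @avg2'_cts K i.
have ce := @cts_eta R (N / 2) ord_max; have cd := @cts_deta R (N / 2) ord_max.
split.
- by rewrite /log2; cont.
- by move=> i; rewrite /log2'; cont.
- move=> i x; have h0 := avg2_der K i x; have h1 := eta_coord (N / 2) i ord_max x.
  by apply: der_eq; [rewrite /log2; der|rewrite /log2' /=; ring].
- move=> i x _; move: i; apply: ord3P => xi; rewrite /log2.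
  + by rewrite (@avg2_out K x 0) ?mul0r// xi.
  + by rewrite (@avg2_out K x 1) ?mul0r// xi.
  + by rewrite [eta (N / 2) _]eta0 ?mulr0//; [lra|rewrite xi; lra].
Qed.

Lemma cut2_le_log2 N K x : (0 < K)%N -> cut2 N x <= log2 N K x.
Proof.
move=> K0; rewrite /cut2 /log2 ler_wpM2r ?eta_ge0//.
have /andP[a0 a1] := avg2_01 x K0.
have [x0|x0] := leP `|x 0 0| 2; last by rewrite [eta 1 (x 0 0)]eta0 ?mul0r// mulr1 ltW.
have [x1|x1] := leP `|x 0 1| 2; last by rewrite [eta 1 (x 0 1)]eta0 ?mulr0// mulr1 ltW.
by rewrite avg2_in// mulr_ile1 ?eta_ge0 ?eta_le1.
Qed.

Lemma deta_disjoint_ord (F : nat -> R) K t :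
  (\sum_(k < K) deta (2 ^+ k.+1) t * F k) ^+ 2 = \sum_(k < K) (deta (2 ^+ k.+1) t * F k) ^+ 2.
Proof.
have := deta_disjoint F K t; rewrite !big_mkord; exact.
Qed.

(** In two variables the Dirichlet integral is scale invariant, so each scale contributes [O(N)];
    the [K] disjoint contributions carry the weight [K^-2]. The derivative along [x_3] is [O(1 / N)]
    on a volume [O(4^K N)]. *)
Lemma log2_energy N K : (0 < K)%N -> 2 ^+ K.+1 <= N ->
  II N (fun x => \sum_i log2' N K i x ^+ 2) <= 2 * 48 ^+ 2 * N / K%:R + 192 ^+ 2 * 4 ^+ K / N.
Proof.
move=> K0 KN; have N0 : 0 < N by apply: lt_le_trans KN; exact: p2.
have KR : 0 < K%:R :> R by rewrite ltr0n.
have N20 : 0 < N / 2 by rewrite divr_gt0.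
have ce r j := @cts_eta R r j; have cd r j := @cts_deta R r j.
have [_ cl _ _] := log2_test K0 KN.
pose a (j j' : 'I_3) k x : R := (deta (2 ^+ k.+1) (x 0 j) * eta (2 ^+ k.+1) (x 0 j')) ^+ 2
  * eta (N / 2) (x 0 ord_max) ^+ 2.
have ca j j' k : cts (a j j' k).
  by rewrite /a; apply: ctsM; apply: ctsX; [apply: ctsM; [exact: cd|exact: ce]|exact: ce].
pose b x : R := (avg2 K x * deta (N / 2) (x 0 ord_max)) ^+ 2.
have cb : cts b by rewrite /b; apply: ctsX; apply: ctsM; [exact: avg2_cts|exact: cd].
have cS j j' : cts (fun x => \sum_(k < K) a j j' k x) by apply: cts_sum => k; exact: ca.
have E x : \sum_i log2' N K i x ^+ 2 = (K%:R ^- 2 * (\sum_(k < K) a 0 1 k x)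
    + K%:R ^- 2 * (\sum_(k < K) a 1 0 k x)) + b x.
  rewrite sum3E /log2' /avg2' /=; congr (_ + _ + _).
  - rewrite mulr0 mulr0 addr0 exprMn exprMn exprVn -mulrA; congr (_ * _).
    rewrite (eq_bigr (fun k : 'I_K => deta (2 ^+ k.+1) (x 0 0) * eta (2 ^+ k.+1) (x 0 1))).
      by rewrite (deta_disjoint_ord (fun k => eta (2 ^+ k.+1) (x 0 1))) mulr_suml.
    by move=> k _; rewrite mulr1 !mulr0 addr0.
  - rewrite mulr0 mulr0 addr0 exprMn exprMn exprVn -mulrA; congr (_ * _).
    rewrite (eq_bigr (fun k : 'I_K => deta (2 ^+ k.+1) (x 0 1) * eta (2 ^+ k.+1) (x 0 0))).
      by rewrite (deta_disjoint_ord (fun k => eta (2 ^+ k.+1) (x 0 0))) mulr_suml.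
    by move=> k _; rewrite mulr1 !mulr0 mul0r add0r mulrC.
  - rewrite big1 ?mulr0 ?mul0r ?add0r ?mulr1//.
    by move=> k _; rewrite !mulr0 mul0r addr0.
rewrite (_ : (fun x => _) = fun x => (K%:R ^- 2 * (\sum_(k < K) a 0 1 k x)
    + K%:R ^- 2 * (\sum_(k < K) a 1 0 k x)) + b x); last exact/funext.
have cS' j j' : cts (fun x => K%:R ^- 2 * \sum_(k < K) a j j' k x).
  by apply: ctsM; [exact: ctsC|exact: cS].
rewrite IID//; last by apply: ctsD.
rewrite IID// !IIZ// !II_sum//.
have bnd j j' k : j != ord_max -> j' != ord_max -> j != j' -> II N (a j j' k) <= 48 ^+ 2 * N.
  move=> j2 j'2 jj'; pose L : R := 2 * 2 ^+ k.+1.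
  have L0 : 0 < L by rewrite mulr_gt0// p2.
  pose q i : R := if i == ord_max then N else L.
  have qq0 i : 0 < q i by rewrite /q; case: ifP.
  have := @II_box_le R N (a j j' k) (fun i => - q i) q (9 / (2 ^+ k.+1) ^+ 2) N0 (ca j j' k).
  have e01 : (0 == ord_max :> 'I_3) = false by [].
  have e11 : (1 == ord_max :> 'I_3) = false by [].
  rewrite /q e01 e11 eqxx => H; apply: le_trans (H _ _ _ _) _ => {H}.
  - by rewrite divr_ge0// sqr_ge0.
  - by move=> i; have := qq0 i; rewrite /q; lra.
  - move=> x _; rewrite /a.
    have h1 : (deta (2 ^+ k.+1) (x 0 j) * eta (2 ^+ k.+1) (x 0 j')) ^+ 2 <= 9 / (2 ^+ k.+1) ^+ 2.
      have -> : 9 / (2 ^+ k.+1) ^+ 2 = (3 / 2 ^+ k.+1) ^+ 2 :> R by rewrite expr_div_n; congr (_ / _); ring.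
      rewrite -sqr_normr ler_pXn2r ?nnegrE ?divr_ge0 ?(ltW (p2 _))// normrM.
      rewrite (ger0_norm (eta_ge0 _ _)) -[leRHS]mulr1 ler_pM ?eta_ge0 ?eta_le1//.
      by apply: deta_bnd; exact: p2.
    rewrite -[leRHS]mulr1 ler_pM ?sqr_ge0//.
    by rewrite expr_le1 ?eta_ge0 ?eta_le1.
  - move=> x i bx; case: eqP => [->|/eqP i2]; first by rewrite -ler_norml bx.
    rewrite -ler_norml -ltNge => Lx.
    have [ij|ij] := eqVneq i j.
      by rewrite /a deta0 ?p2//; [rewrite mul0r expr0n mul0r|right; rewrite -ij ltW].
    have ij' : i = j'.
      by move: i2 j2 j'2 jj' ij; clear; move: i j j'; do 3 (apply: ord3P => //).
    by rewrite /a eta0 ?p2//; [rewrite mulr0 expr0n mul0r|rewrite -ij' ltW].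
  have pn : (2 ^+ k.+1 : R) != 0 by rewrite gt_eqF// p2.
  rewrite /L le_eqVlt; apply/orP; left; apply/eqP.
  by move: (2 ^+ k.+1) pn => e e0; field.
have sb j j' : j != ord_max -> j' != ord_max -> j != j' ->
    K%:R ^- 2 * (\sum_(k < K) II N (a j j' k)) <= 48 ^+ 2 * N / K%:R.
  move=> h1 h2 h3; apply: (@le_trans _ _ (K%:R ^- 2 * (\sum_(k < K) 48 ^+ 2 * N))).
    rewrite ler_pM2l ?invr_gt0 ?exprn_gt0//; apply: ler_sum => k _; exact: bnd.
  rewrite sumr_const card_ord -mulr_natr le_eqVlt; apply/orP; left; apply/eqP.
  by field; rewrite gt_eqF.
have bb : II N b <= 192 ^+ 2 * 4 ^+ K / N.
  pose L : R := 2 ^+ K.+1; have L0 : 0 < L by exact: p2.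
  pose q i : R := if i == ord_max then N else L.
  have qq0 i : 0 < q i by rewrite /q; case: ifP.
  have := @II_box_le R N b (fun i => - q i) q (36 / N ^+ 2) N0 cb.
  have e01 : (0 == ord_max :> 'I_3) = false by [].
  have e11 : (1 == ord_max :> 'I_3) = false by [].
  rewrite /q e01 e11 eqxx => H; apply: le_trans (H _ _ _ _) _ => {H}.
  - by rewrite divr_ge0// sqr_ge0.
  - by move=> i; have := qq0 i; rewrite /q; lra.
  - move=> x _; rewrite /b.
    have -> : 36 / N ^+ 2 = (3 / (N / 2)) ^+ 2 :> R by field; rewrite gt_eqF.
    have h : `|avg2 K x * deta (N / 2) (x 0 ord_max)| <= 3 / (N / 2).
      have /andP[a0 a1] := avg2_01 x K0.
      by rewrite normrM (ger0_norm a0) -[leRHS]mul1r ler_pM// deta_bnd.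
    by rewrite -[leLHS]sqr_normr lerXn2r// nnegrE (le_trans _ h).
  - move=> x i bx; case: eqP => [->|/eqP i2]; first by rewrite -ler_norml bx.
    rewrite -ler_norml -ltNge => Lx.
    rewrite /b (@avg2_out K x i) ?mul0r ?expr0n//; last exact: ltW.
    by move: i2; clear; move: i; apply: ord3P.
  have -> : 4 ^+ K = (2 ^+ K) ^+ 2 :> R by rewrite -exprM mulnC exprM; congr (_ ^+ _); ring.
  rewrite /L (exprS 2 K); have Nn : N != 0 by rewrite gt_eqF.
  move: (2 ^+ K : R) => e.
  have -> : 36 / N ^+ 2 * ((2 * e - - (2 * e)) * (2 * e - - (2 * e)) * (N - - N)) * 8
    = 96 ^+ 2 * e ^+ 2 / N by field.
  rewrite ler_pM2r ?invr_gt0//; have := sqr_ge0 e; lra.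
have s0 := sb 0 1 isT isT isT; have s1 := sb 1 0 isT isT isT.
apply: le_trans (lerD (lerD s0 s1) bb) _.
rewrite lerD2r le_eqVlt; apply/orP; left; apply/eqP; field.
by rewrite gt_eqF.
Qed.

End cutoffs3.

(** * Directional derivatives, Taylor bounds, differentiation under the integral *)

Section calculus.
Context {R : realType}.
Notation E := 'rV[R]_3.
Implicit Types (x y z : E) (f g : E -> R) (i j : 'I_3) (N r t : R).

Lemma smooth_sum n (h : 'I_n -> E -> R) : (forall k : 'I_n, smooth (h k)) ->
  smooth (fun x => \sum_(k < n) h k x).
Proof.
elim: n h => [|n IH] h Hh.
  rewrite (_ : (fun _ => _) = fun=> 0); first exact: smoothC.
  by apply/funext => x; rewrite big_ord0.
rewrite (_ : (fun _ => _) = fun x => \sum_(k < n) h (widen_ord (leqnSn n) k) x + h ord_max x).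
  by apply: smoothD; [apply: IH => k; exact: Hh|exact: Hh].
by apply/funext => x; rewrite big_ord_recr.
Qed.

Lemma smooth_twiceC f : smooth f ->
  twiceC f (fun i => partial i f) (fun i => partial i (partial i f)).
Proof.
move=> sf; have s1 i := smooth_partial i sf; have s2 i := smooth_partial i (s1 i).
split; first exact: smooth_cts.
- by move=> i; exact: smooth_cts.
- by move=> i; exact: smooth_cts.
- by move=> i x; split; exact: smooth_isd.
Qed.

Definition Dc (c : 'I_3 -> R) f : E -> R := fun x => \sum_i c i * partial i f x.

Lemma smooth_Dc c f : smooth f -> smooth (Dc c f).
Proof.
move=> sf; apply: smooth_sum => i; apply: smoothM; first exact: smoothC.
exact: smooth_partial.
Qed.

Lemma partial_Dc c f j : smooth f -> partial j (Dc c f) = Dc c (partial j f).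
Proof.
move=> sf; apply/funext => x; apply: isd_partial.
apply: (@der_eq R E x (ee j) _ (\sum_i (c i * partial j (partial i f) x + partial i f x * 0))).
  apply: der_sum => i; apply: derM; first exact: derC.
  by apply: smooth_isd; exact: smooth_partial.
by apply: eq_bigr => i _; rewrite mulr0 addr0 partialC.
Qed.

Lemma Dc_delta j f : Dc (fun i => (j == i)%:R) f = partial j f.
Proof.
apply/funext => x; rewrite -[RHS](sumd j (fun i => partial i f x)).
by apply: eq_bigr => i _; rewrite mulrC.
Qed.

Lemma partial_laplacian f j x : smooth f -> isd x (ee j) (laplacian f) (laplacian (partial j f) x).
Proof.
move=> sf; have s1 i := smooth_partial i sf; have s2 i := smooth_partial i (s1 i).
apply: (@der_eq R E x (ee j) _ (\sum_i partial j (partial i (partial i f)) x)).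
  by apply: der_sum => i; exact: smooth_isd.
by apply: eq_bigr => i _; rewrite (partialC j i (s1 i)) (partialC j i sf).
Qed.

Lemma laplacian_Dc c f x : smooth f -> laplacian (Dc c f) x = \sum_i c i * laplacian (partial i f) x.
Proof.
move=> sf; have s1 i := smooth_partial i sf.
rewrite /laplacian; under [RHS]eq_bigr do rewrite mulr_sumr.
rewrite exchange_big/=; apply: eq_bigr => j _.
rewrite (partial_Dc c j sf) (partial_Dc c j (s1 j)) /Dc; apply: eq_bigr => i _.
by rewrite (partialC j i sf) (partialC j i (s1 j)).
Qed.

(** After subtraction of the linear part at [x], the partial derivatives are [O(r)] on the cube of
    radius [r], and [path_bound] gives the quadratic remainder. *)
Lemma smooth_taylor f : smooth f -> exists2 C, 0 <= C & forall x (h : E),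
  `|f (x + h) - f x - \sum_i h 0 i * partial i f x| <= C * (\sum_j `|h 0 j|) ^+ 2.
Proof.
move=> sf; have s1 i := smooth_partial i sf.
have [C0 C00 H0] := smooth_lip (s1 0); have [C1 C10 H1] := smooth_lip (s1 1).
have [C2 C20 H2] := smooth_lip (s1 ord_max).
pose C := C0 + C1 + C2.
have H i x (h : E) : `|partial i f (x + h) - partial i f x| <= C * \sum_j `|h 0 j|.
  have s0 : 0 <= \sum_j `|h 0 j| by rewrite sumr_ge0.
  move: i; apply: ord3P; [apply: le_trans (H0 x h) _|apply: le_trans (H1 x h) _|apply: le_trans (H2 x h) _];
    by rewrite ler_wpM2r// /C; clear -C00 C10 C20; lra.
have Cp : 0 <= C by rewrite /C; clear -C00 C10 C20; lra.
exists (3 * C) => [|x h]; first by rewrite mulr_ge0.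
pose r := \sum_j `|h 0 j|.
pose g y := f y - \sum_i (y 0 i - x 0 i) * partial i f x.
have dg i y : isd y (ee i) g (partial i f y - partial i f x).
  have h1 := smooth_isd i y sf.
  apply: der_eq.
    apply: derD; first exact: h1.
    apply: derN; apply: der_sum => j; apply: derM; last exact: derC.
    by apply: derD; [exact: der_coord|exact: derC].
  congr (_ - _); rewrite -[RHS](sumd i (fun j => partial j f x)); apply: eq_bigr => j _.
  by rewrite mulr0 add0r addr0.
have := @path_bound R g _ x h r (C * (3 * r)) dg.
have hr j : `|h 0 j| <= r by rewrite /r (bigD1 j)//= lerDl sumr_ge0.
have -> : C * (3 * r) * \sum_j `|h 0 j| = 3 * C * r ^+ 2 by rewrite /r; ring.
have -> : g (x + h) - g x = f (x + h) - f x - \sum_i h 0 i * partial i f x.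
  have -> : \sum_i h 0 i * partial i f x = \sum_i ((x + h) 0 i - x 0 i) * partial i f x.
    by apply: eq_bigr => i _; rewrite mxE [x 0 i + _]addrC addrK.
  rewrite /g [X in _ - (_ - X)]big1; last by move=> i _; rewrite subrr mul0r.
  by rewrite subr0 addrAC.
apply=> // i y yx.
have -> : y = x + (y - x) by rewrite addrC subrK.
apply: le_trans (H i x _) _; rewrite ler_wpM2l//.
apply: (@le_trans _ _ (\sum_(j < 3) r)).
  by apply: ler_sum => j _; have := yx j; rewrite !mxE.
by rewrite sumr_const card_ord -[leLHS]mulr_natl.
Qed.

Lemma isd_quadratic (V : normedModType R) (F : V -> R) (x0 v : V) (l C : R) :
  (forall h : R, `|F (x0 + h *: v) - F x0 - h * l| <= C * h ^+ 2) -> isd x0 v F l.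
Proof.
move=> H; have C0 : 0 <= C by have := H 1; rewrite expr1n mulr1; apply: le_trans.
apply/is_deriveP/cvgrPdist_le => e e0.
have k0 : 0 < C + 1 by rewrite ltr_wpDl.
exists (e / (C + 1)) => /=; first by rewrite divr_gt0.
move=> h; rewrite /= sub0r normrN => he h0.
have hp : 0 < `|h| by rewrite normr_gt0.
have -> : l - h^-1 * (F (x0 + h *: v) - F x0) = - (F (x0 + h *: v) - F x0 - h * l) / h by field.
rewrite normrM normrN normfV ler_pdivrMr//; apply: le_trans (H h) _.
rewrite -sqr_normr expr2 mulrA ler_wpM2r//.
have : `|h| * (C + 1) <= e by rewrite -ler_pdivlMr// ltW.
by lra.
Qed.

Lemma smooth_dir f x (h : E) : smooth f -> isd x h f (\sum_i h 0 i * partial i f x).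
Proof.
move=> /smooth_taylor[C C0 H]; apply: (@isd_quadratic _ f x h _ (C * (\sum_j `|h 0 j|) ^+ 2)) => t.
have := H x (t *: h).
have -> : \sum_i (t *: h) 0 i * partial i f x = t * \sum_i h 0 i * partial i f x.
  by rewrite mulr_sumr; apply: eq_bigr => i _; rewrite mxE mulrA.
have -> : \sum_j `|(t *: h) 0 j| = `|t| * \sum_j `|h 0 j|.
  by rewrite mulr_sumr; apply: eq_bigr => i _; rewrite mxE normrM.
by rewrite exprMn sqr_normr mulrA [C * _ * _]mulrAC.
Qed.

Lemma smooth_line f x (h : E) t : smooth f ->
  isd t (1 : R) (fun s : R => f (x + s *: h)) (Dc (fun i => h 0 i) f (x + t *: h)).
Proof. by move=> sf; apply: is_derive_slice; exact: smooth_dir. Qed.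

Lemma cst_of_derive0 (g : R -> R) : (forall t, isd t (1 : R) g 0) -> forall s t, g s = g t.
Proof.
move=> H s t.
have [st|st|->//] := ltgtP s t.
  by have [c _] := @der_lt R g (fun=> 0) s t st (fun t _ => H t); rewrite mul0r => /subr0_eq.
by have [c _] := @der_lt R g (fun=> 0) t s st (fun t _ => H t); rewrite mul0r => /subr0_eq.
Qed.

Lemma const_on_lines f (h : E) : smooth f -> (forall x, Dc (fun i => h 0 i) f x = 0) ->
  forall x, f (x + h) = f x.
Proof.
move=> sf H x.
have := @cst_of_derive0 (fun s => f (x + s *: h)) _ 1 0.
rewrite scale1r scale0r addr0; apply => t.
by apply: der_eq (smooth_line x h t sf) _; exact: H.
Qed.

Lemma const_of_partials f (f1 : 'I_3 -> E -> R) : (forall i x, isd x (ee i) f (f1 i x)) ->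
  (forall i x, f1 i x = 0) -> forall x y, f x = f y.
Proof.
move=> df f0 x y.
have := @path_bound R f f1 y (x - y) (\sum_j `|(x - y) 0 j|) 0 df.
rewrite mul0r (addrC y) subrK => H; apply/eqP; rewrite -subr_eq0 -normr_le0; apply: H.
  by move=> i z _; rewrite f0 normr0.
by move=> j; rewrite (bigD1 j)//= lerDl sumr_ge0.
Qed.

(** All translates share one Lipschitz constant, so pointwise convergence is uniform on compact
    cubes. *)
Lemma tends_uniform a f fb N e : smooth f -> tends a f fb -> 0 < e ->
  \forall n \near \oo, forall x, box N x -> `|f (x + a n) - fb x| <= e.
Proof.
move=> sf ta e0; have sb := tends_smooth sf ta.
have [C1 C10 H1] := smooth_lip sf; have [C2 C20 H2] := smooth_lip sb.
have cov := (compact_near_coveringP (box N : set E)).1 (@boxP R N).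
have := cov nat \oo (fun n x => `|f (x + a n) - fb x| <= e) _; apply.
move=> x _.
have k : 0 < 6 * (C1 + C2) + 1 by rewrite ltr_wpDl// mulr_ge0// addr_ge0.
pose d := e / (6 * (C1 + C2) + 1).
have d0 : 0 < d by rewrite divr_gt0.
have e20 : 0 < e / 2 by rewrite divr_gt0.
exists (ball x d, [set n | `|fb x - f (x + a n)| <= e / 2]) => /=.
  by split; [exact: nbhsx_ballx|have /cvgrPdist_le := ta x; apply].
move=> [y n] [/= [_ xy] hn].
have dj j : `|(y - x) 0 j| <= d by have := xy 0 j; rewrite /ball/= distrC !mxE => /ltW.
have ds : \sum_j `|(y - x) 0 j| <= 3 * d.
  apply: (@le_trans _ _ (\sum_(j < 3) d)); first exact: ler_sum.
  by rewrite sumr_const card_ord -[leLHS]mulr_natl.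
have yE : y = x + (y - x) by rewrite addrC subrK.
have b1 := H1 (x + a n) (y - x); rewrite addrAC -yE in b1.
have b2 := H2 x (y - x); rewrite -yE in b2.
have dE : (6 * (C1 + C2) + 1) * d = e by rewrite /d mulrC divfK ?gt_eqF.
have -> : f (y + a n) - fb y = (f (y + a n) - f (x + a n)) - (fb x - f (x + a n)) - (fb y - fb x) by ring.
apply: le_trans (ler_normB _ _) _; apply: le_trans (lerD (ler_normB _ _) (lexx _)) _.
move: b1 b2 ds hn dE; clear -C10 C20 d0.
move: (`|_|) (`|_|) (`|_|) (\sum_j _) => p q r s b1 b2 ds hn dE.
have p1 : C1 * s <= C1 * (3 * d) by rewrite ler_wpM2l.
have p2 : C2 * s <= C2 * (3 * d) by rewrite ler_wpM2l.
by lra.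
Qed.

Lemma II_lin N c d f g : 0 < N -> cts f -> cts g ->
  II N (fun x => c * f x + d * g x) = c * II N f + d * II N g.
Proof. by move=> N0 cf cg; rewrite IID ?IIZ//; apply: ctsM => //; exact: ctsC. Qed.

Lemma II_norm N f g : 0 < N -> cts f -> cts g -> (forall x, `|f x| <= g x) -> `|II N f| <= II N g.
Proof.
move=> N0 cf cg H; rewrite ler_norml; apply/andP; split.
  rewrite -mulN1r -IIZ//; apply: II_le => //; first by apply: ctsM => //; exact: ctsC.
  by move=> x _; have := H x; rewrite ler_norml mulN1r => /andP[].
by apply: II_le => // x _; exact: le_trans (ler_norm _) (H x).
Qed.

(** The Taylor remainder is [O(h^2)] uniformly in [x]; positivity of [II] integrates it, and
    [isd_quadratic] concludes. *)
Lemma II_param N (chi f : E -> R) (e : E) t : 0 < N -> cts chi -> smooth f ->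
  isd t (1 : R) (fun s : R => II N (fun x => chi x * f (x + s *: e)))
    (II N (fun x => chi x * Dc (fun i => e 0 i) f (x + t *: e))).
Proof.
move=> N0 cc sf; have [C C0 H] := smooth_taylor sf.
have cf (s : R) : cts (fun x => f (x + s *: e)) by apply: smooth_cts; exact: smooth_shift.
have cD : cts (fun x => Dc (fun i => e 0 i) f (x + t *: e)).
  by apply: smooth_cts; apply: smooth_shift; exact: smooth_Dc.
have cm (s : R) : cts (fun x => chi x * f (x + s *: e)) by apply: ctsM.
have cmD : cts (fun x => chi x * Dc (fun i => e 0 i) f (x + t *: e)) by apply: ctsM.
pose K := C * (\sum_j `|e 0 j|) ^+ 2.
apply: (@isd_quadratic R _ _ _ _ (K * II N (fun x => `|chi x|))) => h.
rewrite [h *: 1]mulr1.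
set A := II N _; set B := II N _; set D := II N _.
have -> : A - B - h * D = 1 * II N (fun x => 1 * (chi x * f (x + (t + h) *: e)) + (-1) * (chi x * f (x + t *: e))) + - h * D.
  by rewrite II_lin// /A /B; ring.
rewrite -II_lin//; last by apply: ctsD; apply: ctsM => //; exact: ctsC.
have -> : K * II N (fun x => `|chi x|) * h ^+ 2 = II N (fun x => K * h ^+ 2 * `|chi x|).
  by rewrite IIZ; [ring|exact: N0|exact: cts_norm].
apply: II_norm => //.
- apply: ctsD; apply: ctsM; try exact: ctsC; last by [].
  by apply: ctsD; apply: ctsM => //; exact: ctsC.
- by apply: ctsM; [exact: ctsC|exact: cts_norm].
move=> x; have := H (x + t *: e) (h *: e).
rewrite -(addrA x) -scalerDl.
have -> : \sum_i (h *: e) 0 i * partial i f (x + t *: e) = h * Dc (fun i => e 0 i) f (x + t *: e).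
  by rewrite mulr_sumr; apply: eq_bigr => i _; rewrite mxE mulrA.
have -> : \sum_j `|(h *: e) 0 j| = `|h| * \sum_j `|e 0 j|.
  by rewrite mulr_sumr; apply: eq_bigr => i _; rewrite mxE normrM.
rewrite exprMn sqr_normr => Hx.
set a := f _; set b := f _; set d := Dc _ _ _.
have -> : 1 * (1 * (chi x * a) + -1 * (chi x * b)) + - h * (chi x * d) = chi x * (a - b - h * d) by ring.
rewrite normrM mulrC ler_wpM2r//; apply: le_trans Hx _.
by rewrite /K le_eqVlt; apply/orP; left; apply/eqP; ring.
Qed.

End calculus.

(** * The linearised system *)

Section system.
Context {R : realType}.
Notation E := 'rV[R]_3.
Variables (alpha omega : R).
Implicit Types (x y z : E) (f g u v : E -> R) (i j : 'I_3) (N r t : R).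

(** Smoothness and the sharp bounds belong to the definition so that the class is closed under
    translation and, for [omega > 0], under pointwise limits of translates. *)
Definition sol u v : Prop :=
  [/\ smooth u /\ smooth v, forall x, 0 < u x, forall x, 0 < v x,
    forall x, laplacian u x = u x * (u x ^+ 2 + v x ^+ 2 - 1) + v x * (alpha * u x * v x - omega) /\
      laplacian v x = v x * (u x ^+ 2 + v x ^+ 2 - 1) + u x * (alpha * u x * v x - omega)
    & forall x, u x ^+ 2 + v x ^+ 2 <= 1 /\ omega <= alpha * u x * v x].

Definition mono u v : Prop :=
  sol u v /\ forall x, 0 < partial ord_max u x /\ partial ord_max v x < 0.

Lemma laplacian_shift f (a : E) : laplacian (fun x => f (x + a)) = fun x => laplacian f (x + a).
Proof. by apply/funext => x; rewrite /laplacian; apply: eq_bigr => i _; rewrite !partial_shift. Qed.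

Lemma sol_swap u v : sol u v -> sol v u.
Proof.
move=> [[su sv] u0 v0 eq b]; split=> // x; have [e1 e2] := eq x; have [b1 b2] := b x.
  by rewrite e1 e2; split; ring.
by rewrite addrC mulrAC.
Qed.

Lemma sol_shift u v (a : E) : sol u v -> sol (fun x => u (x + a)) (fun x => v (x + a)).
Proof.
move=> [[su sv] u0 v0 eq b]; split=> //; first by split; exact: smooth_shift.
by move=> x; rewrite !laplacian_shift.
Qed.

Lemma mono_shift u v (a : E) : mono u v -> mono (fun x => u (x + a)) (fun x => v (x + a)).
Proof. by move=> [suv m]; split; [exact: sol_shift|move=> x; rewrite !partial_shift]. Qed.

(* [gd] and [gx] are the second derivatives of the potential: diagonal and mixed. *)
Definition gd f g x : R := 3 * f x ^+ 2 + g x ^+ 2 - 1 + alpha * g x ^+ 2.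
Definition gx f g x : R := 2 * (1 + alpha) * f x * g x - omega.

Lemma gxC f g : gx f g = gx g f.
Proof. by apply/funext => x; rewrite /gx; ring. Qed.

Lemma smooth_gd f g : smooth f -> smooth g -> smooth (gd f g).
Proof. by move=> sf sg; rewrite /gd; sm. Qed.

Lemma smooth_gx f g : smooth f -> smooth g -> smooth (gx f g).
Proof. by move=> sf sg; rewrite /gx; sm. Qed.

Lemma lin_partial u v i x : sol u v ->
  laplacian (partial i u) x = gd u v x * partial i u x + gx u v x * partial i v x.
Proof.
move=> [[su sv] _ _ eq _].
have E1 : laplacian u = fun x => u x * (u x ^+ 2 + v x ^+ 2 - 1) + v x * (alpha * u x * v x - omega).
  by apply/funext => y; have [] := eq y.
have H := partial_laplacian i x su; rewrite E1 in H.
have h1 := smooth_isd i x su; have h2 := smooth_isd i x sv.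
apply: is_derive_inj H _; apply: der_eq; first by der.
by rewrite /gd /gx /=; move: (u x) (v x) (partial i u x) (partial i v x) => a b c d; ring.
Qed.

Lemma lin_Dc u v c x : sol u v ->
  laplacian (Dc c u) x = gd u v x * Dc c u x + gx u v x * Dc c v x.
Proof.
move=> suv; have [[su sv] _ _ _ _] := suv.
rewrite laplacian_Dc// /Dc !mulr_sumr -big_split/=; apply: eq_bigr => i _.
rewrite (lin_partial i x suv).
by move: (gd _ _ _) (gx _ _ _) (partial _ _ _) (partial _ _ _) => *; ring.
Qed.

Section sol.
Variables (u v : E -> R).
Hypotheses (om0 : 0 < omega) (al : omega < alpha / 2) (suv : sol u v).

Lemma sol_le1 x : u x <= 1 /\ v x <= 1.
Proof.
have [_ u0 v0 _ b] := suv; have [b1 b2] := b x; have := u0 x; have := v0 x.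
by move: (u x) (v x) b1 => p q; split; nra.
Qed.

(** From [alpha u v >= omega] follows [2 alpha u v - omega >= omega]. This positive coupling is the
    purpose of the lower bound on [u v]. *)
Lemma gx_ge x : omega <= gx u v x.
Proof.
have [_ u0 v0 _ b] := suv; have [b1 b2] := b x; have := u0 x; have := v0 x.
by rewrite /gx; move: (u x) (v x) b1 b2 => p q; nra.
Qed.

Lemma gd_le x : gd u v x <= 2 + alpha.
Proof.
have [_ u0 v0 _ b] := suv; have [b1 b2] := b x; have := u0 x; have := v0 x.
rewrite /gd; move: (u x) (v x) b1 b2 => p q b1 b2 p0 q0.
have a0 : 0 <= alpha by have := om0; have := al; lra.
have q1 : 0 <= 1 - q ^+ 2 by have := sqr_ge0 p; lra.
have := mulr_ge0 a0 q1.
by have := sqr_ge0 q; lra.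
Qed.

End sol.

Definition neg3 f x : R := - partial ord_max f x.

Lemma smooth_neg3 f : smooth f -> smooth (neg3 f).
Proof. by move=> sf; apply: smoothN; exact: smooth_partial. Qed.

Section mono.
Variables (u v : E -> R).
Hypotheses (om0 : 0 < omega) (al : omega < alpha / 2) (muv : mono u v).

Local Notation p := (partial ord_max u).
Local Notation q := (neg3 v).

Let suv : sol u v := muv.1.
Let su : smooth u. Proof. by have [[]] := suv. Qed.
Let sv : smooth v. Proof. by have [[]] := suv. Qed.

Definition lremu (w : E -> R) := lrem w p (fun i => partial i w) (fun i => partial i p).
Definition lremv (w : E -> R) := lrem w q (fun i => partial i w) (fun i => partial i q).

Lemma partialN f i : smooth f -> partial i (fun x => - f x) = fun x => - partial i f x.
Proof. by move=> sf; apply/funext => x; apply: isd_partial; apply: derN; exact: smooth_isd. Qed.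

Lemma laplacianN f x : smooth f -> laplacian (fun x => - f x) x = - laplacian f x.
Proof.
move=> sf; rewrite /laplacian -sumrN; apply: eq_bigr => i _.
by rewrite partialN// partialN//; exact: smooth_partial.
Qed.

Lemma mono_energy N zeta zeta1 (c : 'I_3 -> R) : 0 < N -> test N zeta zeta1 ->
  II N (fun x => zeta x ^+ 2 * (\sum_i lremu (Dc c u) i x ^+ 2 + \sum_i lremv (Dc c v) i x ^+ 2
    + 2 * gx u v x * (Dc c u x * q x + Dc c v x * p x) ^+ 2 / (p x * q x))) <=
  II N (fun x => 4 * \sum_i zeta1 i x ^+ 2 * (Dc c u x ^+ 2 + Dc c v x ^+ 2)).
Proof.
move=> N0 tz; have [_ m] := muv.
have su3 := smooth_partial ord_max su; have sv3 := smooth_partial ord_max sv.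
have svu := sol_swap suv.
apply: (@weighted_caccioppoli R N zeta zeta1 (Dc c u) (Dc c v) p q (gd u v) (gx u v) (gd v u)
  (fun i => partial i (Dc c u)) (fun i => partial i (partial i (Dc c u)))
  (fun i => partial i (Dc c v)) (fun i => partial i (partial i (Dc c v)))
  (fun i => partial i p) (fun i => partial i (partial i p))
  (fun i => partial i q) (fun i => partial i (partial i q)) N0 tz).
- by apply: smooth_twiceC; exact: smooth_Dc.
- by apply: smooth_twiceC; exact: smooth_Dc.
- exact: smooth_twiceC.
- by apply: smooth_twiceC; exact: smooth_neg3.
- by apply: smooth_cts; exact: smooth_gx.
- by move=> x; have [] := m x.
- by move=> x; rewrite /neg3 oppr_gt0; have [] := m x.
- by move=> x; exact: lin_Dc suv.
- by move=> x; rewrite gxC addrC; exact: lin_Dc svu.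
- move=> x; rewrite -[LHS]/(laplacian p x) (lin_partial _ _ suv) /neg3.
  by move: (gd _ _ _) (gx _ _ _) (partial _ _ _) (partial _ _ _) => *; ring.
- move=> x; rewrite -[LHS]/(laplacian q x) laplacianN// (lin_partial _ _ svu) [gx v u]gxC /neg3.
  by move: (gd _ _ _) (gx _ _ _) (partial _ _ _) (partial _ _ _) => *; ring.
Qed.

(** The coupling has the favourable sign: the Laplacian of [p] is [gd p - gx q], at most
    [(2 + alpha) p], and likewise for [q]. *)
Lemma log_energy N zeta zeta1 : 0 < N -> test N zeta zeta1 ->
  II N (fun x => zeta x ^+ 2 * \sum_i (partial i p x / p x) ^+ 2) <=
    II N (fun x => 4 * \sum_i zeta1 i x ^+ 2 + 2 * (2 + alpha) * zeta x ^+ 2) /\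
  II N (fun x => zeta x ^+ 2 * \sum_i (partial i q x / q x) ^+ 2) <=
    II N (fun x => 4 * \sum_i zeta1 i x ^+ 2 + 2 * (2 + alpha) * zeta x ^+ 2).
Proof.
move=> N0 tz; have [_ m] := muv.
have su3 := smooth_partial ord_max su; have sv3 := smooth_partial ord_max sv.
have svu := sol_swap suv.
split.
  apply: (caccioppoli_log N0 tz (smooth_twiceC su3)) => x; have [m1 m2] := m x => //.
  rewrite -[leLHS]/(laplacian p x) (lin_partial _ _ suv).
  have := gx_ge suv x; have := gd_le om0 al suv x.
  by move: (gd _ _ _) (gx _ _ _) (partial _ _ _) (partial _ _ _) m1 m2 => a b d e m1 m2 h1 h2; have := om0; nra.
apply: (caccioppoli_log N0 tz (smooth_twiceC (smooth_neg3 sv))) => x; have [m1 m2] := m x.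
  by rewrite /neg3 oppr_gt0.
rewrite -[leLHS]/(laplacian q x) laplacianN// (lin_partial _ _ svu) /neg3.
have := gx_ge svu x; have := gd_le om0 al svu x.
by move: (gd _ _ _) (gx _ _ _) (partial _ _ _) (partial _ _ _) m1 m2 => a b d e m1 m2 h1 h2; have := om0; nra.
Qed.

End mono.
End system.

(** * Nodal property of the limits along the third axis *)

Section nodal.
Context {R : realType}.
Notation E := 'rV[R]_3.
Implicit Types (x y z : E) (f g : E -> R) (i j : 'I_3) (N r t : R).

Lemma cut2_energy N : 2 <= N -> II N (fun x => cut2 N x ^+ 2) <= 256 * N /\
  II N (fun x => \sum_i cut2' N i x ^+ 2) <= 27 * 256 * N.
Proof.
move=> N2; have N0 : 0 < N by apply: lt_le_trans N2.
have [cc cc1 _ _] := cut2_test N2.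
have N20 : 0 < N / 2 by rewrite divr_gt0.
pose q j : R := if j == ord_max then N else 2.
have q0 j : 0 < q j by rewrite /q; case: ifP.
have vol : (q 0 - - q 0) * (q 1 - - q 1) * (q ord_max - - q ord_max) = 32 * N by rewrite /q /=; ring.
have out x j : box N x -> ~~ (- q j <= x 0 j <= q j) -> cut2 N x = 0 /\ forall i, cut2' N i x = 0.
  rewrite /q /cut2 /cut2' => bx; move: j; apply: ord3P; rewrite /= -ler_norml -?ltNge => h.
  - have -> : eta 1 (x 0 0) = 0 by apply: eta0 => //; lra.
    have -> : deta 1 (x 0 0) = 0 by apply: deta0 => //; right; lra.
    by split=> [|i]; ring.
  - have -> : eta 1 (x 0 1) = 0 by apply: eta0 => //; lra.
    have -> : deta 1 (x 0 1) = 0 by apply: deta0 => //; right; lra.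
    by split=> [|i]; ring.
  - by have := bx ord_max; rewrite leNgt h.
split.
  have := @II_box_le R N (fun x => cut2 N x ^+ 2) (fun i => - q i) q 1 N0.
  rewrite vol => H; apply: le_trans (H _ _ _ _ _) _ => {H}.
  - by cont.
  - by [].
  - by move=> i; have := q0 i; lra.
  - by move=> x _; have /andP[h0 h1] := cut2_01 N x; rewrite expr_le1.
  - by move=> x i bx /(out _ _ bx)[-> _]; rewrite expr0n.
  - by lra.
have := @II_box_le R N (fun x => \sum_i cut2' N i x ^+ 2) (fun i => - q i) q 27 N0.
rewrite vol => H; apply: le_trans (H _ _ _ _ _) _ => {H}.
- by cont.
- by [].
- by move=> i; have := q0 i; lra.
- move=> x _.
  have d0 : `|deta 1 (x 0 0)| <= 3 by apply: le_trans (deta_bnd _ _) _ => //; lra.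
  have d1 : `|deta 1 (x 0 1)| <= 3 by apply: le_trans (deta_bnd _ _) _ => //; lra.
  have d2 : `|deta (N / 2) (x 0 ord_max)| <= 3.
    by apply: le_trans (deta_bnd _ _) _ => //; rewrite ler_pdivrMr//; lra.
  have sq3 (a b c : R) : `|a| <= 3 -> 0 <= b <= 1 -> 0 <= c <= 1 -> (a * b * c) ^+ 2 <= 9.
    move=> ha /andP[b0 b1] /andP[c0 c1]; rewrite !exprMn.
    have : a ^+ 2 <= 9 by rewrite -sqr_normr (_ : 9 = 3 ^+ 2); [rewrite lerXn2r ?nnegrE|ring].
    have : b ^+ 2 <= 1 by rewrite expr_le1.
    have : c ^+ 2 <= 1 by rewrite expr_le1.
    have := sqr_ge0 a; have := sqr_ge0 b; have := sqr_ge0 c.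
    move: (a ^+ 2) (b ^+ 2) (c ^+ 2) => A B C C0 B0 A0 C1 B1 A1.
    by apply: (@le_trans _ _ (A * 1 * 1)); [rewrite !ler_pM// mulr_ge0|lra].
  have e01 r t : 0 <= eta r t <= 1 by rewrite eta_ge0 eta_le1.
  rewrite sum3E /cut2' /= !mulr0 !mulr1 !mul0r !addr0 !add0r.
  have s0 := sq3 _ _ _ d0 (e01 1 (x 0 1)) (e01 (N / 2) (x 0 ord_max)).
  have s1 := sq3 _ _ _ d1 (e01 1 (x 0 0)) (e01 (N / 2) (x 0 ord_max)).
  have s2 := sq3 _ _ _ d2 (e01 1 (x 0 0)) (e01 1 (x 0 1)).
  rewrite [eta 1 (x 0 0) * deta _ _]mulrC [_ * _ * deta (N / 2) _]mulrC mulrA.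
  by move: s0 s1 s2; move: (_ ^+ 2) (_ ^+ 2) (_ ^+ 2) => a b c; lra.
- move=> x i bx /(out _ _ bx)[_ h]; rewrite big1// => j _; by rewrite h expr0n.
- by lra.
Qed.

Definition flat f := forall x t, f (x + t *: ee ord_max) = f x.

Lemma flat_partial f i : flat f -> flat (partial i f).
Proof.
move=> H x t; rewrite -[LHS]/((fun y => partial i f (y + t *: ee ord_max)) x) -partial_shift.
by congr (partial i _ x); apply/funext => y; exact: H.
Qed.

Lemma flat_proj f x i j : flat f -> i != ord_max -> j != ord_max -> i != j ->
  f x = f (x 0 i *: ee i + x 0 j *: ee j).
Proof.
move=> H; rewrite -(H (x 0 i *: ee i + x 0 j *: ee j) (x 0 ord_max)) {1}(rV3E x).
move: i j; apply: ord3P => //; apply: ord3P => // _ _ _.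
by rewrite [x 0 0 *: _ + _]addrC.
Qed.

(** The radius [r] is small against the Lipschitz constant of [partial i f], so the slope stays
    above [g]. The width [r'] is smaller still: moving across the tube changes [f] by at most
    [g r / 2], half of what the slope produces at distance [r]; hence [m = g r / 2]. *)
Lemma nodal_lower f i i' (g : R) : smooth f -> flat f -> i != ord_max -> i' != ord_max -> i != i' ->
  f 0 = 0 -> 0 < g -> 2 * g <= partial i f 0 ->
  exists r r' m : R, [/\ 0 < r <= 1 / 2, 0 < r' <= 1 / 2, 0 < m &
    forall x, `|x 0 i| <= 2 * r -> `|x 0 i'| <= 2 * r' -> g <= partial i f x /\
      (r <= x 0 i -> m <= f x) /\ (x 0 i <= - r -> f x <= - m)].
Proof.
move=> sf ff i2 i'2 ii' f0 g0 fg.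
have [L L0 HL] := smooth_lip sf; have [L1 L10 HL1] := smooth_lip (smooth_partial i sf).
pose r := Num.min (1 / 2) (g / (4 * (L1 + 1))).
have k1 : 0 < 4 * (L1 + 1) by lra.
have r0 : 0 < r by rewrite /r lt_min divr_gt0//= divr_gt0.
have r1 : r <= 1 / 2 by rewrite /r ge_min lexx.
have r2 : r * (4 * (L1 + 1)) <= g by rewrite -ler_pdivlMr// /r ge_min lexx orbT.
pose r' := Num.min r (g * r / (4 * (L + 1))).
have k2 : 0 < 4 * (L + 1) by lra.
have r'0 : 0 < r' by rewrite /r' lt_min r0/= divr_gt0// mulr_gt0.
have r'1 : r' <= r by rewrite /r' ge_min lexx.
have r'2 : r' * (4 * (L + 1)) <= g * r by rewrite -ler_pdivlMr// /r' ge_min lexx orbT.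
have sumee k (t : R) : \sum_j `|(t *: (ee k : E)) 0 j| = `|t|.
  rewrite -[RHS](sumd k (fun=> `|t|)); apply: eq_bigr => j _.
  by rewrite mxE eeE normrM; case: (k == j); rewrite ?normr1 ?normr0.
have dlow s s' : `|s| <= 2 * r -> `|s'| <= 2 * r -> g <= partial i f (s *: ee i + s' *: ee i').
  move=> hs hs'; have := HL1 0 (s *: ee i); have := HL1 (s *: ee i) (s' *: ee i').
  rewrite !sumee add0r => h1 h2.
  have l1 : L1 * `|s| <= L1 * (2 * r) by rewrite ler_wpM2l.
  have l2 : L1 * `|s'| <= L1 * (2 * r) by rewrite ler_wpM2l.
  move: h1 h2; rewrite !ler_norml => /andP[h1 _] /andP[h2 _].
  have : r * (4 * (L1 + 1)) = L1 * (2 * r) + L1 * (2 * r) + 4 * r by ring.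
  by move: h1 h2 l1 l2 r2 fg; clear -r0; lra.
have ds t : isd t (1 : R) (fun s => f (0 + s *: ee i)) (partial i f (0 + t *: ee i)).
  by apply: is_derive_slice; exact: smooth_isd.
have line s : 0 < s -> s <= 2 * r -> g * s <= f (s *: ee i) /\ f (- s *: ee i) <= - (g * s).
  move=> s0 sr; split.
    have [c /andP[c0 cs]] := der_lt s0 (fun t _ => ds t).
    rewrite !add0r scale0r f0 !subr0 => ->; rewrite ler_pM2r//.
    have := dlow c 0; rewrite scale0r addr0 normr0; apply; last lra.
    by rewrite gtr0_norm//; lra.
  have s0' : - s < 0 by lra.
  have [c /andP[c0 cs]] := der_lt s0' (fun t _ => ds t).
  rewrite !add0r scale0r f0 sub0r opprK => h; rewrite -lerN2 opprK h.
  rewrite ler_pM2r//; have := dlow c 0; rewrite scale0r addr0 normr0; apply; last lra.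
  by rewrite ltr0_norm//; lra.
exists r, r', (g * r / 2); split; first by rewrite r0.
- by rewrite r'0 (le_trans r'1).
- by rewrite divr_gt0// mulr_gt0.
move=> x xi xi'; split.
  by rewrite (flat_proj x (flat_partial i ff) i2 i'2 ii'); apply: dlow => //; lra.
have b : `|f x - f (x 0 i *: ee i)| <= g * r / 2.
  rewrite (flat_proj x ff i2 i'2 ii'); apply: le_trans (HL _ _) _; rewrite sumee.
  have : L * `|x 0 i'| <= L * (2 * r') by rewrite ler_wpM2l.
  by move: r'2; clear -r'0; lra.
move: b; rewrite ler_norml => /andP[b1 b2]; split=> h.
  have xp : 0 < x 0 i by apply: lt_le_trans h.
  have [l _] := line _ xp (le_trans (ler_norm _) xi).
  have : g * r <= g * x 0 i by rewrite ler_pM2l.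
  by move: l b1; clear; lra.
have xp : 0 < - x 0 i by rewrite oppr_gt0; apply: le_lt_trans h _; rewrite oppr_lt0.
have xn : - x 0 i <= 2 * r by apply: le_trans xi; rewrite -normrN ler_norm.
have [_] := line _ xp xn; rewrite opprK => l.
have : g * r <= g * (- x 0 i) by rewrite ler_pM2l//; move: h; clear; lra.
by move: l b2; clear; lra.
Qed.

Definition lremn (w p : nat -> E -> R) n j x : R :=
  lrem (w n) (p n) (fun j => partial j (w n)) (fun j => partial j (p n)) j x.

(* Caccioppoli-type bounds for [w n / p n], together with local C^1 convergence of [w n]
   to a function [wb] independent of [x_3].  The bounds [N / K + 4 ^ K / N] and [N] are for
   cutoffs of height [N] in [x_3], logarithmic respectively of bounded width in the other
   variables. *)
Definition nodal_data (w p : nat -> E -> R) (wb : E -> R) (A : R) : Prop :=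
  [/\ forall n, smooth (w n) /\ smooth (p n), forall n x, 0 < p n x,
    [/\ smooth wb, flat wb & 0 <= A],
    (forall N (e : R), 0 < e -> exists n, forall x, box N x ->
      (`|w n x - wb x| <= e)%R /\ (forall j, `|partial j (w n) x - partial j wb x| <= e))
  & ((forall n N (K : nat), (0 < K)%N -> 2 ^+ K.+1 <= N ->
      II N (fun x => log2 N K x ^+ 2 * \sum_j lremn w p n j x ^+ 2) <= A * (N / K%:R + 4 ^+ K / N)) /\
    (forall n N, 2 <= N ->
      II N (fun x => cut2 N x ^+ 2 * \sum_j (partial j (p n) x / p n x) ^+ 2) <= A * N))].

(** The derivative along [e_i] of [chi Kap (wb / d)] integrates to 0. Its first part is a flux of
    order [r' N]. The second part lives where [|wb| <= d]; there [partial i wb >= g], so it is at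
    most [(partial i wb)^2 / (g d)], which is the remainder plus [O(d^2)] times the logarithmic
    gradient and 1. The left side is linear in [d] and the last term quadratic. *)
Lemma nodal_bound (w p : nat -> E -> R) (wb : E -> R) (A : R) i i' (g r r' m d N : R) (K : nat) :
  nodal_data w p wb A -> i != ord_max -> i' != ord_max -> i != i' ->
  0 < g -> 0 < r <= 1 / 2 -> 0 < r' <= 1 / 2 ->
  (forall x, `|x 0 i| <= 2 * r -> `|x 0 i'| <= 2 * r' -> g <= partial i wb x /\
      (r <= x 0 i -> m <= wb x) /\ (x 0 i <= - r -> wb x <= - m)) ->
  0 < d <= m -> (0 < K)%N -> 2 ^+ K.+1 <= N ->
  g * d * r' / 160 * N <= 4 * (A * (N / K%:R + 4 ^+ K / N)) + d ^+ 2 * ((16 * A + 2 * 16 ^+ 2) * N).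
Proof.
move=> [swp p0 [sb fb A0] near_w [enX enL]] i2 i'2 ii' g0 /andP[r0 r1] /andP[r'0 r'1] H /andP[d0 dm] K0 KN.
have N2 : 2 <= N by apply: le_trans KN; rewrite exprS ler_peMr// exprn_ege1// ler1n.
have N0 : 0 < N by apply: lt_le_trans N2.
have N20 : 0 < N / 2 by rewrite divr_gt0.
(* The translate depends on [N] and [d]; this is harmless because the bounds in [nodal_data] are
   uniform in [n]. *)
have [n Hn] := near_w N _ d0; have [swn spn] := swp n.
pose X j x : R := lremn w p n j x.
pose Lg j x : R := partial j (p n) x / p n x.
have cwb : cts wb by exact: smooth_cts.
have cdb : cts (partial i wb) by apply: smooth_cts; exact: smooth_partial.
have ckap : cts (fun x => kap (wb x / d)).
  apply: (@cts_comp R E (fun x => wb x / d) kap); first by cont.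
  by apply: lip_continuous; exact: kap_lip.
have cKap : cts (fun x => Kap (wb x / d)).
  by apply: (@cts_comp R E (fun x => wb x / d) Kap); [cont|exact: Kap_cont].
have ce (r : R) j := @cts_eta R r j; have cd (r : R) j := @cts_deta R r j.
have ei := ce r i; have ei' := ce r' i'; have e3 := ce (N / 2) ord_max; have di := cd r i.
have i3 : (i == ord_max) = false by apply/negbTE.
have ii'f : (i == i') = false by apply/negbTE.
have dn : d != 0 by rewrite gt_eqF.
pose chi x := eta r (x 0 i) * eta r' (x 0 i') * eta (N / 2) (x 0 ord_max) ^+ 2.
pose dchi x := deta r (x 0 i) * eta r' (x 0 i') * eta (N / 2) (x 0 ord_max) ^+ 2.
have cchi : cts chi by rewrite /chi; cont.
have cdchi : cts dchi by rewrite /dchi; cont.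
pose G x := dchi x * Kap (wb x / d) + chi x * (kap (wb x / d) * (partial i wb x / d)).
have cG : cts G by rewrite /G; cont.
have G0 : II N G = 0.
  apply: (@II_div R N i (fun x => chi x * Kap (wb x / d))) => //.
    move=> x; have h1 := eta_coord r i i x; have h2 := eta_coord r' i i' x.
    have h3 := eta_coord (N / 2) i ord_max x; have h4 := smooth_isd i x sb.
    have h5 : isd x (ee i) (fun x => Kap (wb x / d)) (kap (wb x / d) * (partial i wb x / d)).
      apply: (@der_comp R E x (ee i) (fun x => wb x / d) Kap); last exact: der_Kap.
      by apply: der_eq; [der|rewrite /=; ring].
    apply: der_eq; first by rewrite /chi; der.
    by rewrite /G /dchi /chi /= i3 ii'f eqxx /=; move: (kap _) (Kap _) => k1 k2; field.
  move=> x _ xi; rewrite /chi eta0 ?mul0r//.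
  by rewrite xi; apply: le_trans N2; lra.
pose S x := log2 N K x ^+ 2 * \sum_j X j x ^+ 2.
pose T x := cut2 N x ^+ 2 * \sum_j Lg j x ^+ 2.
have [cc2 _ _ _] := cut2_test N2.
have [cl2 _ _ _] := log2_test K0 KN.
have pn x : p n x != 0 by rewrite gt_eqF.
have [cw cw1 _ _] := smooth_twiceC swn.
have [cp cp1 _ _] := smooth_twiceC spn.
have cX j : cts (X j) by rewrite /X /lremn /lrem; cont.
have cL j : cts (Lg j) by rewrite /Lg; cont.
have cS : cts S by rewrite /S; cont.
have cT : cts T by rewrite /T; cont.
pose f0 x := 1 / 2 * (`|deta r (x 0 i)| * eta r' (x 0 i') * eta (N / 2) (x 0 ord_max) ^+ 2).
have cf0 : cts f0 by rewrite /f0; cont.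
have S0 x : 0 <= S x by rewrite /S mulr_ge0 ?sqr_ge0// sumr_ge0// => j _; rewrite sqr_ge0.
have T0 x : 0 <= T x by rewrite /T mulr_ge0 ?sqr_ge0// sumr_ge0// => j _; rewrite sqr_ge0.
(* Where [deta r] does not vanish, [Kap (wb / d)] is exactly half the sign of [x_i], opposite to the
   sign of [deta]; hence the factor [1 / 2]. *)
have K1 x : f0 x <= - (dchi x * Kap (wb x / d)).
  rewrite /f0 /dchi.
  have [h|h] := leP (2 * r') `|x 0 i'|; first by rewrite eta0// !(mulr0, mul0r) oppr0.
  have [h1|h1] := leP `|x 0 i| r; first by rewrite deta0 ?normr0; [rewrite !(mulr0, mul0r) oppr0|done|left].
  have [h2|h2] := leP (2 * r) `|x 0 i|; first by rewrite deta0 ?normr0; [rewrite !(mulr0, mul0r) oppr0|done|right].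
  have [_ [H1 H2]] := H x (ltW h2) (ltW h).
  have eg := eta_ge0 r' (x 0 i').
  rewrite [X in - (X * _ * _ * _)]deta_sgn//.
  have [xp|xn|x0] := ltgtP 0 (x 0 i).
  - rewrite gtr0_sg// Kap_ge1; last first.
      by rewrite ler_pdivlMr// mul1r (le_trans dm)// H1//; rewrite gtr0_norm// in h1; exact: ltW.
    by move: (`|deta _ _|) (eta r' _) (eta (N / 2) _) => a b c; lra.
  - rewrite ltr0_sg// Kap_leN1; last first.
      rewrite ler_pdivrMr// mulN1r; apply: le_trans (H2 _) _; last by rewrite lerN2.
      by rewrite ltr0_norm// in h1; move: h1; clear; lra.
    by move: (`|deta _ _|) (eta r' _) (eta (N / 2) _) => a b c; lra.
  - by move: h1; rewrite -x0 normr0 => /(lt_trans r0); rewrite ltxx.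
have K2 x : box N x -> chi x * (kap (wb x / d) * (partial i wb x / d)) <=
    (g * d)^-1 * (4 * S x + (16 * d ^+ 2 * T x + 2 * d ^+ 2 * cut2 N x ^+ 2)).
  move=> bx; have rhs0 : 0 <= (g * d)^-1 * (4 * S x + (16 * d ^+ 2 * T x + 2 * d ^+ 2 * cut2 N x ^+ 2)).
    have gd0 : 0 <= (g * d)^-1 by rewrite invr_ge0 ltW// mulr_gt0.
    apply: mulr_ge0 => //.
    have t1 : 0 <= d ^+ 2 * T x by rewrite mulr_ge0 ?sqr_ge0.
    have t2 : 0 <= d ^+ 2 * cut2 N x ^+ 2 by rewrite mulr_ge0 ?sqr_ge0.
    move: t1 t2 (S0 x); move: (S x) (T x) (cut2 N x ^+ 2) (d ^+ 2); clear => *; lra.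
  have [h|h] := leP (2 * r') `|x 0 i'|; first by rewrite /chi [eta r' _]eta0// mulr0 !mul0r.
  have [h2|h2] := leP (2 * r) `|x 0 i|; first by rewrite /chi [eta r _]eta0// !mul0r.
  have [h3|h3] := leP 1 `|wb x / d|; first by rewrite kap_out// mul0r mulr0.
  have [H1 _] := H x (ltW h2) (ltW h).
  have hw : `|wb x| <= d.
    by move: h3; rewrite normrM normfV (gtr0_norm d0) ltr_pdivrMr// mul1r => /ltW.
  have [n1 /(_ i) n2] := Hn x bx.
  have /andP[k0 k1] := kap01 (wb x / d).
  have xs : `|x 0 0| <= 1 /\ `|x 0 1| <= 1.
    move: (ltW h) (ltW h2) i2 i'2 ii' r1 r'1; clear; move: i i'; apply: ord3P => //; apply: ord3P => //.
      by move=> a b _ _ _ c e; split; lra.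
    by move=> a b _ _ _ c e; split; lra.
  have chic : 0 <= chi x <= cut2 N x ^+ 2.
    rewrite /chi /cut2 (eta1 ltr01 xs.1) (eta1 ltr01 xs.2).
    rewrite !mul1r mulr_ge0 ?mulr_ge0 ?eta_ge0 ?sqr_ge0//=.
    by rewrite ler_piMl ?sqr_ge0// mulr_ile1 ?eta_ge0 ?eta_le1.
  have cl : cut2 N x ^+ 2 <= log2 N K x ^+ 2.
    have /andP[c0 _] := cut2_01 N x; have cl := cut2_le_log2 N x K0.
    by rewrite lerXn2r ?nnegrE// (le_trans c0).
  (* Two applications of [(a + b)^2 <= 2 a^2 + 2 b^2], with [|w n| <= 2 d] and [partial i (w n)]
     within [d] of its limit. *)
  have hX : (partial i wb x) ^+ 2 <= 4 * X i x ^+ 2 + 16 * d ^+ 2 * Lg i x ^+ 2 + 2 * d ^+ 2.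
    have E1 : partial i (w n) x = X i x + w n x * Lg i x.
      by rewrite /X /lremn /lrem /Lg mulrA subrK.
    have w2 : w n x ^+ 2 <= (2 * d) ^+ 2.
      rewrite -sqr_normr lerXn2r ?nnegrE ?mulr_ge0 ?(ltW d0)//.
      have -> : w n x = (w n x - wb x) + wb x by rewrite subrK.
      by apply: le_trans (ler_normD _ _) _; move: n1 hw; clear; lra.
    have q2 : (partial i (w n) x - partial i wb x) ^+ 2 <= d ^+ 2.
      by rewrite -sqr_normr lerXn2r ?nnegrE// ltW.
    move: q2; rewrite E1; move: (X i x) (Lg i x) (w n x) (partial i wb x) w2; clear.
    move=> a b c e w2 q2.
    have := sqr_ge0 (2 * (a + c * b) - e).
    have := sqr_ge0 (a - c * b).
    have : c ^+ 2 * b ^+ 2 <= (2 * d) ^+ 2 * b ^+ 2 by rewrite ler_wpM2r ?sqr_ge0.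
    by lra.
  have Xs : X i x ^+ 2 <= \sum_j X j x ^+ 2.
    by rewrite (bigD1 i)//= lerDl sumr_ge0// => j _; rewrite sqr_ge0.
  have Ls : Lg i x ^+ 2 <= \sum_j Lg j x ^+ 2.
    by rewrite (bigD1 i)//= lerDl sumr_ge0// => j _; rewrite sqr_ge0.
  have gd0 : 0 < g * d by rewrite mulr_gt0.
  rewrite [leRHS]mulrC ler_pdivlMr//.
  have -> : chi x * (kap (wb x / d) * (partial i wb x / d)) * (g * d) =
     chi x * (kap (wb x / d) * (g * partial i wb x)) by field.
  have P0 : 0 <= partial i wb x by apply: le_trans H1; exact: ltW.
  move: chic => /andP[chi0 chic].
  apply: (@le_trans _ _ (chi x * (partial i wb x) ^+ 2)).
    rewrite ler_wpM2l//; apply: (@le_trans _ _ (1 * (g * partial i wb x))).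
      by rewrite ler_wpM2r// mulr_ge0// ltW.
    by rewrite mul1r expr2 ler_wpM2r.
  apply: (@le_trans _ _ (chi x * (4 * X i x ^+ 2 + 16 * d ^+ 2 * Lg i x ^+ 2 + 2 * d ^+ 2))).
    by rewrite ler_wpM2l.
  have p1 : chi x * X i x ^+ 2 <= S x by rewrite /S ler_pM ?sqr_ge0// (le_trans chic).
  have p2 : chi x * Lg i x ^+ 2 <= T x by rewrite /T ler_pM ?sqr_ge0.
  have p3 : d ^+ 2 * (chi x * Lg i x ^+ 2) <= d ^+ 2 * T x by rewrite ler_wpM2l ?sqr_ge0.
  have p4 : d ^+ 2 * chi x <= d ^+ 2 * cut2 N x ^+ 2 by rewrite ler_wpM2l ?sqr_ge0.
  move: p1 p3 p4; move: (chi x) (S x) (T x) (cut2 N x ^+ 2) (X i x ^+ 2) (Lg i x ^+ 2) (d ^+ 2).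
  by clear=> *; lra.
(* On the box [[7r/5, 3r/2]] times [[-r', r']] times [[-N/2, N/2]], of volume [r r' N / 5], the
   integrand is at least [1 / (4 r)]; [II_box_ge] loses a further factor 8. *)
have lower : r' * N / 160 <= II N f0.
  pose a j : R := if j == i then 7 / 5 * r else if j == i' then - r' else - (N / 2).
  pose b j : R := if j == i then 3 / 2 * r else if j == i' then r' else N / 2.
  have := @II_box_ge R N f0 a b (1 / 4 / r) N0 cf0.
  have -> : (b 0 - a 0) * (b 1 - a 1) * (b ord_max - a ord_max) = r * r' * N / 5.
    rewrite /a /b; move: i2 i'2 ii'; clear; move: i i'; apply: ord3P => //; apply: ord3P => // _ _ _ /=; by field.
  have rn : r != 0 by rewrite gt_eqF.
  have -> : 1 / 4 / r * (r * r' * N / 5) / 8 = r' * N / 160 by field.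
  apply.
  - by rewrite !divr_ge0// ltW.
  - by move=> j; rewrite /a; case: ifP => _; [|case: ifP => _]; move: N0 r0 N2 r'1; clear; lra.
  - by move=> j; rewrite /a /b; case: ifP => _; [|case: ifP => _]; move: N0 r0 N2 r'0; clear; lra.
  - by move=> j; rewrite /b; case: ifP => _; [|case: ifP => _]; move: N0 r0 N2 r'1 r1; clear; lra.
  - by move=> x _; rewrite /f0 mulr_ge0// mulr_ge0 ?sqr_ge0// mulr_ge0 ?eta_ge0.
  - move=> x Hx; have := Hx i; have := Hx i'; have := Hx ord_max.
    rewrite /a /b eqxx [i' == i]eq_sym ii'f eqxx ![ord_max == _]eq_sym i3 (negbTE i'2) => h3 h2 h1.
    rewrite /f0 [eta r' _]eta1 ?ler_norml// [eta (N / 2) _]eta1 ?ler_norml// expr1n !mulr1.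
    have := deta_low r0 h1; have -> : 1 / 4 / r = 1 / 2 * (1 / 2 / r) by field; rewrite gt_eqF.
    by move=> ?; rewrite ler_wpM2l.
have upper : II N f0 <= (g * d)^-1 * (4 * II N S + (16 * d ^+ 2 * II N T + 2 * d ^+ 2 * II N (fun x => cut2 N x ^+ 2))) + -1 * II N G.
  have cc : cts (fun x => cut2 N x ^+ 2) by cont.
  have c1 : cts (fun x => 16 * d ^+ 2 * T x + 2 * d ^+ 2 * cut2 N x ^+ 2) by cont.
  have c2 : cts (fun x => 4 * S x + 1 * (16 * d ^+ 2 * T x + 2 * d ^+ 2 * cut2 N x ^+ 2)).
    by apply: ctsD; apply: ctsM => //; exact: ctsC.
  rewrite -(II_lin (16 * d ^+ 2) (2 * d ^+ 2) N0 cT cc) -[X in 4 * _ + X]mul1r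
    -(II_lin 4 1 N0 cS c1) -(II_lin ((g * d)^-1) (-1) N0 c2 cG).
  apply: II_le => //; first by apply: ctsD; apply: ctsM => //; exact: ctsC.
  move=> x bx; have := K1 x; have := K2 x bx; rewrite /G mul1r mulN1r.
  by move: (f0 x) (dchi x * _) (chi x * _) (_^-1 * _); clear => *; lra.
rewrite G0 mulr0 addr0 in upper.
have gd0 : 0 < g * d by rewrite mulr_gt0.
have := le_trans lower upper; rewrite [leRHS]mulrC (ler_pdivlMr _ _ gd0) => h.
have uS : II N S <= A * (N / K%:R + 4 ^+ K / N) by exact: enX.
have uT : II N T <= A * N by exact: enL.
have [uc _] := cut2_energy N2.
have dT : d ^+ 2 * II N T <= d ^+ 2 * (A * N) by rewrite ler_wpM2l ?sqr_ge0.
have dc : d ^+ 2 * II N (fun x => cut2 N x ^+ 2) <= d ^+ 2 * (256 * N) by rewrite ler_wpM2l ?sqr_ge0.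
move: h uS dT dc; move: (II N S) (II N T) (II N _) (A * (N / K%:R + 4 ^+ K / N)) => s t c B; clear.
by move: (d ^+ 2) => e; lra.
Qed.

(** The order of the choices matters: [d] makes the quadratic term small against the linear one,
    then [K] handles [N / K], and last [N] handles [4^K / N]. *)
Lemma nodal_parameters (A B c g r' m : R) : 0 <= A -> 0 < B -> 0 < c -> 0 < g -> 0 < r' -> 0 < m ->
  exists (d N : R) (K : nat), [/\ 0 < d <= m, (0 < K)%N, 2 ^+ K.+1 <= N &
    4 * (A * (N / K%:R + 4 ^+ K / N)) + d ^+ 2 * (B * N) < g * d * r' / c * N].
Proof.
move=> A0 B0 c0 g0 r'0 m0.
pose d := Num.min m (g * r' / (2 * c * B)).
have c20 : 0 < 2 * c by rewrite mulr_gt0.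
have cn : c != 0 by rewrite gt_eqF.
have gr0 : 0 < g * r' by rewrite mulr_gt0.
have d0 : 0 < d by rewrite /d lt_min m0/= divr_gt0// mulr_gt0.
have dm : d <= m by rewrite /d ge_min lexx.
have d2 : d * (2 * c * B) <= g * r' by rewrite -ler_pdivlMr ?mulr_gt0// /d ge_min lexx orbT.
pose k := g * d * r' / (2 * c).
have k0 : 0 < k by rewrite /k divr_gt0// mulr_gt0// mulr_gt0.
have dB : d ^+ 2 * B <= k.
  rewrite /k ler_pdivlMr//; have : d * (d * (2 * c * B)) <= d * (g * r') by rewrite ler_wpM2l// ltW.
  by clear; move=> H; nra.
pose K := (Num.truncn (8 * A / k)).+1.
have K0 : 0 < K%:R :> R by rewrite ltr0n.
have KA : 8 * A < k * K%:R by rewrite [ltRHS]mulrC -ltr_pdivrMr//; exact: truncnS_gt.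
pose M : R := 4 ^+ K; have M0 : 0 < M by rewrite /M exprn_gt0.
pose N := 2 ^+ K.+1 + (1 + 8 * A * M / k).
have AM : 0 <= 8 * A * M / k by rewrite divr_ge0// ?(ltW k0)// mulr_ge0// ?(ltW M0)// mulr_ge0// A0.
have KN : 2 ^+ K.+1 <= N by rewrite /N lerDl addr_ge0.
have N1 : 2 <= N by apply: le_trans KN; rewrite exprS ler_peMr// exprn_ege1// ler1n.
have N0 : 0 < N by apply: lt_le_trans N1.
have NA : 8 * A * M < k * N.
  rewrite [ltRHS]mulrC -ltr_pdivrMr//; apply: (@lt_le_trans _ _ (1 + 8 * A * M / k)); first by rewrite ltrDr.
  by rewrite /N lerDr exprn_ge0.
have d0m : 0 < d <= m by rewrite d0.
exists d, N, K; split=> //.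
have e1 : 4 * (A * (N / K%:R)) < k / 2 * N.
  have -> : 4 * (A * (N / K%:R)) = 4 * A * N / K%:R by ring.
  rewrite ltr_pdivrMr//.
  have : 8 * A * N < k * K%:R * N by rewrite ltr_pM2r.
  by clear; lra.
have e2 : 4 * (A * (M / N)) < k / 2 * N.
  have -> : 4 * (A * (M / N)) = 4 * A * M / N by ring.
  rewrite ltr_pdivrMr//; apply: (@lt_le_trans _ _ (k / 2 * N)); first by move: NA; clear; lra.
  have kN : 0 <= k * N by rewrite mulr_ge0// ltW.
  have : k * N * 1 <= k * N * N by rewrite ler_wpM2l//; move: N1; clear; lra.
  by clear; lra.
have e3 : d ^+ 2 * (B * N) <= k * N by rewrite mulrA ler_wpM2r// ltW.
have -> : g * d * r' / c * N = k * 2 * N by rewrite /k; field.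
rewrite -/M.
have -> : 4 * (A * (N / K%:R + M / N)) = 4 * (A * (N / K%:R)) + 4 * (A * (M / N)) by ring.
by move: e1 e2 e3; clear; lra.
Qed.

(* If [wb] crossed 0 transversally, so would [w n / p n] along a tube of length [N], which
   costs an energy of order [N]; the logarithmic cutoffs only allow [o(N)]. *)
Lemma nodal (w p : nat -> E -> R) (wb : E -> R) (A : R) i : nodal_data w p wb A -> i != ord_max ->
  wb 0 = 0 -> partial i wb 0 <= 0.
Proof.
move=> nd i2 w0; have [_ _ [sb fb A0] _ _] := nd; rewrite leNgt; apply/negP => wp.
have [i' i'2 ii'] : exists2 i' : 'I_3, i' != ord_max & i != i'.
  by move: i i2 {wp}; apply: ord3P => // _; [exists 1|exists 0].
have gg : 2 * (partial i wb 0 / 2) <= partial i wb 0 by rewrite mulrC divfK.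
have g0 : 0 < partial i wb 0 / 2 by rewrite divr_gt0.
have [r [r' [m [hr hr' m0 H]]]] := nodal_lower sb fb i2 i'2 ii' w0 g0 gg.
have r'0 : 0 < r' by case/andP: hr'.
have B0 : 0 < 16 * A + 2 * 16 ^+ 2 by apply: ltr_wpDl; [exact: mulr_ge0|apply: mulr_gt0 => //; exact: exprn_gt0].
have c0 : 0 < 160 :> R by rewrite ltr0n.
have [d [N [K [d0 K0 KN lt]]]] := nodal_parameters A0 B0 c0 g0 r'0 m0.
have := nodal_bound nd i2 i'2 ii' g0 hr hr' H d0 K0 KN.
by rewrite leNgt lt.
Qed.

End nodal.

(** * Limits of translates along the third axis *)

Section limits.
Context {R : realType}.
Notation E := 'rV[R]_3.
Implicit Types (x y z : E) (f g : E -> R) (i j : 'I_3) (N r t : R).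

Definition up (s : R) (n : nat) : E := (s * n%:R) *: ee ord_max.

Lemma line_incr f x : smooth f -> (forall x, 0 < partial ord_max f x) ->
  {homo (fun t => f (x + t *: ee ord_max)) : s t / s <= t}.
Proof.
move=> sf f0 s t; rewrite le_eqVlt => /predU1P[->//|st].
have [|c _ h] := @der_lt R (fun t => f (x + t *: ee ord_max)) (fun t => partial ord_max f (x + t *: ee ord_max)) s t st.
  by move=> r _; apply: is_derive_slice; exact: smooth_isd.
by rewrite -subr_ge0 h mulr_ge0 ?(ltW (f0 _))// subr_ge0 ltW.
Qed.

(** The limit exists by monotonicity and boundedness; it does not depend on [x_3] because a shift
    along the axis only reindexes a monotone limit. *)
Lemma lim_line f (s : R) : (s = 1 \/ s = -1) -> smooth f ->
  (forall x, 0 < partial ord_max f x) \/ (forall x, partial ord_max f x < 0) ->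
  exists fb, [/\ tends (up s) f fb, flat fb &
    (forall x, 0 < partial ord_max f x) -> forall x, 0 <= s * (fb x - f x)].
Proof.
move=> s1 sf f0.
have ss : s * s = 1 by case: s1 => ->; rewrite ?mulrNN mulr1.
(* The sign [e] unifies the four cases: [e f] is nondecreasing in the direction [s e_3]. *)
have [e [ee1 eP ep]] : exists e : R, [/\ e * e = 1,
   forall x, {homo (fun t => e * f (x + (s * t) *: ee ord_max)) : t t' / t <= t'} &
   (forall x, 0 < partial ord_max f x) -> e = s].
  have H g x : smooth g -> (forall x, 0 < partial ord_max g x) ->
      {homo (fun t => s * g (x + (s * t) *: ee ord_max)) : t t' / t <= t'}.
    move=> sg g0 t t' tt'; have mg := line_incr x sg g0.
    by case: s1 => ->; [rewrite !mul1r; exact: mg|rewrite !mulN1r lerN2; apply: mg; rewrite lerN2].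
  case: f0 => f0.
    by exists s; split=> // x; exact: H.
  exists (- s); split.
  - by rewrite mulrNN.
  - move=> x t t' tt'; rewrite !mulNr -!mulrN.
    apply: (H (fun x => - f x)) => //; first exact: smoothN.
    by move=> y; rewrite partialN// oppr_gt0.
  - by move=> /(_ 0) /lt_trans /(_ (f0 0)); rewrite ltxx.
have [C C0 HC] := smooth_bnd sf.
pose k x (n : nat) : R := e * f (x + up s n).
have kup x : has_ubound (range (k x)).
  exists C => _ [n _ <-]; rewrite /k; apply: le_trans (ler_norm _) _.
  rewrite normrM; have -> : `|e| = 1; last by rewrite mul1r.
  have : (`|e| - 1) * (`|e| + 1) = 0 by rewrite -subr_sqr expr1n sqr_normr expr2 ee1 subrr.
  move=> /eqP; rewrite mulf_eq0 => /orP[/eqP /subr0_eq//|/eqP h].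
  by have := normr_ge0 e; lra.
have knd x : nondecreasing_seq (k x).
  by move=> n n' nn'; apply: (eP x); rewrite ler_nat.
have kc x : cvgn (k x) by exact: nondecreasing_is_cvgn.
pose fb x : R := e * limn (k x).
have kle x t : e * f (x + (s * t) *: ee ord_max) <= limn (k x).
  apply: (@le_trans _ _ (k x (Num.truncn t).+1)).
    by apply: eP; exact/ltW/truncnS_gt.
  exact: nondecreasing_cvgn_le.
exists fb; split.
- move=> x; rewrite (_ : (fun n => f (x + up s n)) = fun n => e * k x n).
    by apply: cvgM; [exact: cvg_cst|exact: kc].
  by apply/funext => n; rewrite /k mulrA ee1 mul1r.
- have lle x t : limn (k (x + t *: ee ord_max)) <= limn (k x).
    apply: limr_le => //; apply: nearW => n.
    have := kle x (s * t + n%:R); rewrite mulrDr mulrA ss mul1r scalerDl addrA.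
    exact.
  move=> x t; rewrite /fb; congr (_ * _); apply/eqP; rewrite eq_le lle/=.
  by have := lle (x + t *: ee ord_max) (- t); rewrite scaleNr addrK.
- move=> /ep es x; rewrite /fb -es mulrBr mulrA ee1 mul1r subr_ge0.
  by have := kle x 0; rewrite mulr0 scale0r addr0.
Qed.

Lemma tends_shift a f fb (y : E) : tends a f fb -> tends a (fun x => f (x + y)) (fun x => fb (x + y)).
Proof. by move=> ta x; have := ta (x + y); under eq_fun do rewrite addrAC. Qed.

Lemma tendsD a f g fb gb : tends a f fb -> tends a g gb ->
  tends a (fun x => f x + g x) (fun x => fb x + gb x).
Proof. by move=> h1 h2 x; apply: cvgD; [exact: h1|exact: h2]. Qed.

Lemma tendsM a f g fb gb : tends a f fb -> tends a g gb ->
  tends a (fun x => f x * g x) (fun x => fb x * gb x).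
Proof. by move=> h1 h2 x; apply: cvgM; [exact: h1|exact: h2]. Qed.

Lemma tendsC a (c : R) : tends a (fun=> c) (fun=> c).
Proof. by move=> x; exact: cvg_cst. Qed.

Lemma tendsX a f fb (n : nat) : tends a f fb -> tends a (fun x => f x ^+ n) (fun x => fb x ^+ n).
Proof.
move=> h; elim: n => [|n IH]; first by exact: tendsC.
have -> : (fun x => f x ^+ n.+1) = fun x => f x * f x ^+ n by apply/funext => x; rewrite exprS.
have -> : (fun x => fb x ^+ n.+1) = fun x => fb x * fb x ^+ n by apply/funext => x; rewrite exprS.
exact: tendsM.
Qed.

Lemma tends_sum a (f fb : 'I_3 -> E -> R) : (forall i, tends a (f i) (fb i)) ->
  tends a (fun x => \sum_i f i x) (fun x => \sum_i fb i x).
Proof.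
move=> h.
have e (F : 'I_3 -> E -> R) : (fun x => \sum_i F i x) = fun x => F 0 x + F 1 x + F ord_max x.
  by apply/funext => x; exact: sum3E.
by rewrite !e; apply: tendsD => //; exact: tendsD.
Qed.

Lemma tends_Dc a c f fb : smooth f -> tends a f fb -> tends a (Dc c f) (Dc c fb).
Proof.
move=> sf h; apply: tends_sum => i; apply: tendsM; first exact: tendsC.
exact: tends_partial.
Qed.

Lemma tends_unique a f fb gb : tends a f fb -> tends a f gb -> fb = gb.
Proof. by move=> h1 h2; apply/funext => x; exact: (cvg_unique _ (h1 x) (h2 x)). Qed.

Lemma tends_le a f fb (c : R) x : (forall y, f y <= c) -> tends a f fb -> fb x <= c.
Proof.
move=> fc h; apply: (cvgr_to_le (h x)).
by apply: nearW => n; exact: fc.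
Qed.

Lemma tends_ge a f fb (c : R) x : (forall y, c <= f y) -> tends a f fb -> c <= fb x.
Proof.
move=> fc h; apply: (cvgr_to_ge (h x)).
by apply: nearW => n; exact: fc.
Qed.

Variables (alpha omega : R).
Hypotheses (om0 : 0 < omega) (al : omega < alpha / 2).

(** Only weak inequalities pass to the limit; strict positivity is recovered from
    [0 < omega <= alpha ub vb]. *)
Lemma limit_sol a u v ub vb : sol alpha omega u v -> tends a u ub -> tends a v vb -> sol alpha omega ub vb.
Proof.
move=> [[su sv] u0 v0 eq b] tu tv.
have tlap f fb : smooth f -> tends a f fb -> tends a (laplacian f) (laplacian fb).
  move=> sf h; apply: tends_sum => i; apply: tends_partial; last exact: tends_partial.
  exact: smooth_partial.
have sb : forall x, ub x ^+ 2 + vb x ^+ 2 <= 1 /\ omega <= alpha * ub x * vb x.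
  move=> x; split.
    apply: (@tends_le a (fun x => u x ^+ 2 + v x ^+ 2) (fun x => ub x ^+ 2 + vb x ^+ 2)).
      by move=> y; have [] := b y.
    by apply: tendsD; exact: tendsX.
  apply: (@tends_ge a (fun x => alpha * u x * v x) (fun x => alpha * ub x * vb x)).
    by move=> y; have [] := b y.
  by apply: tendsM => //; apply: tendsM => //; exact: tendsC.
have u0' x : 0 <= ub x by apply: (tends_ge _ _ tu) => y; exact: ltW.
have v0' x : 0 <= vb x by apply: (tends_ge _ _ tv) => y; exact: ltW.
have tF f g fb gb : tends a f fb -> tends a g gb -> tends a
   (fun x => f x * (f x ^+ 2 + g x ^+ 2 - 1) + g x * (alpha * f x * g x - omega))
   (fun x => fb x * (fb x ^+ 2 + gb x ^+ 2 - 1) + gb x * (alpha * fb x * gb x - omega)).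
  move=> h1 h2; have h3 := tendsX (n := 2) h1; have h4 := tendsX (n := 2) h2.
  by repeat first [exact: h1|exact: h2|exact: h3|exact: h4|exact: tendsC|apply: tendsD|apply: tendsM].
split=> //; first by split; [exact: tends_smooth tu|exact: tends_smooth tv].
- move=> x; rewrite lt_neqAle u0' andbT; apply/eqP => h.
  by have [_] := sb x; rewrite -h mulr0 mul0r leNgt om0.
- move=> x; rewrite lt_neqAle v0' andbT; apply/eqP => h.
  by have [_] := sb x; rewrite -h mulr0 leNgt om0.
move=> x; split.
  have H := tlap _ _ su tu.
  have E1 : laplacian u = fun x => u x * (u x ^+ 2 + v x ^+ 2 - 1) + v x * (alpha * u x * v x - omega).
    by apply/funext => y; have [] := eq y.
  by rewrite E1 in H; rewrite (tends_unique H (tF _ _ _ _ tu tv)).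
have H := tlap _ _ sv tv.
have E1 : laplacian v = fun x => v x * (v x ^+ 2 + u x ^+ 2 - 1) + u x * (alpha * v x * u x - omega).
  by apply/funext => y; have [_ ->] := eq y; ring.
by rewrite E1 in H; rewrite (tends_unique H (tF _ _ _ _ tv tu)); ring.
Qed.

Section energy_terms.
Variables (u v : E -> R).
Hypothesis muv : mono alpha omega u v.
Let suv : sol alpha omega u v := muv.1.
Let su : smooth u. Proof. by have [[]] := suv. Qed.
Let sv : smooth v. Proof. by have [[]] := suv. Qed.

(* The integrand on the left of the Caccioppoli inequality for the derivatives along [c]. *)
Definition efun (c : 'I_3 -> R) x : R :=
  \sum_i lremu u (Dc c u) i x ^+ 2 + \sum_i lremv v (Dc c v) i x ^+ 2
    + 2 * gx alpha omega u v x * (Dc c u x * neg3 v x + Dc c v x * partial ord_max u x) ^+ 2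
       / (partial ord_max u x * neg3 v x).

Let p0 x : 0 < partial ord_max u x. Proof. by have [_ /(_ x)[]] := muv. Qed.
Let q0 x : 0 < neg3 v x. Proof. by have [_ /(_ x)[_]] := muv; rewrite /neg3 oppr_gt0. Qed.

Lemma efun_cts c : cts (efun c).
Proof.
have [cw cw1 _ _] := smooth_twiceC (smooth_Dc c su).
have [cz cz1 _ _] := smooth_twiceC (smooth_Dc c sv).
have [cp cp1 _ _] := smooth_twiceC (smooth_partial ord_max su).
have [cq cq1 _ _] := smooth_twiceC (smooth_neg3 sv).
have cg : cts (gx alpha omega u v) by apply: smooth_cts; exact: smooth_gx.
have pn x : partial ord_max u x != 0 by rewrite gt_eqF.
have qn x : neg3 v x != 0 by rewrite gt_eqF.
have pqn x : partial ord_max u x * neg3 v x != 0 by rewrite mulf_neq0.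
have cX i : cts (lremu u (Dc c u) i) by rewrite /lremu /lrem; cont.
have cY i : cts (lremv v (Dc c v) i) by rewrite /lremv /lrem; cont.
by rewrite /efun; cont.
Qed.

(** From [(w q + z p)^2 >= 4 w z p q] the division by [p q] leaves a bound on the positive part of
    [w z] free of [p] and [q], which can be compared with the limit. *)
Lemma efun_ge c x : [/\ \sum_i lremu u (Dc c u) i x ^+ 2 <= efun c x,
  \sum_i lremv v (Dc c v) i x ^+ 2 <= efun c x,
  4 * omega * (`|Dc c u x * Dc c v x| + Dc c u x * Dc c v x) <= efun c x &
  0 < gx alpha omega u v x * (Dc c u x * neg3 v x + Dc c v x * partial ord_max u x) ^+ 2 -> 0 < efun c x].
Proof.
have g0 := gx_ge suv x; have := p0 x; have := q0 x; rewrite /efun.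
have : 0 <= \sum_i lremu u (Dc c u) i x ^+ 2 by rewrite sumr_ge0// => i _; rewrite sqr_ge0.
have : 0 <= \sum_i lremv v (Dc c v) i x ^+ 2 by rewrite sumr_ge0// => i _; rewrite sqr_ge0.
move: (\sum_i lremu _ _ _ _ ^+ 2) (\sum_i lremv _ _ _ _ ^+ 2) (Dc c u x) (Dc c v x) (neg3 v x) (partial _ _ _) (gx _ _ _ _ _) g0.
move=> X Y w z q p g og Y0 X0 qp pp.
have := om0; move: omega og; clear -Y0 X0 qp pp => o og o0.
have pq : 0 < p * q by rewrite mulr_gt0.
have g0 : 0 < g by apply: lt_le_trans og.
have T0 : 0 <= (w * q + z * p) ^+ 2 / (p * q) by rewrite divr_ge0 ?sqr_ge0// ltW.
have T1 : 4 * (w * z) <= (w * q + z * p) ^+ 2 / (p * q).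
  by rewrite ler_pdivlMr//; have := sqr_ge0 (w * q - z * p); lra.
rewrite -mulrA -[2 * g * _]mulrA.
set T := _ / (p * q) in T0 T1 *.
have gT : 0 <= g * T by rewrite mulr_ge0// ltW.
split; [lra|lra| |].
  have [wz|wz] := leP 0 (w * z).
    rewrite ger0_norm//.
    have h1 : g * (4 * (w * z)) <= g * T by rewrite ler_pM2l.
    have h2 : o * (4 * (w * z)) <= g * (4 * (w * z)) by rewrite ler_wpM2r// mulr_ge0.
    by move: h1 h2 X0 Y0; lra.
  by rewrite ltr0_norm// addNr mulr0; lra.
move=> h; have : 0 < g * T by rewrite /T mulrA divr_gt0.
by lra.
Qed.

Lemma efun_energy N zeta zeta1 c : 0 < N -> test N zeta zeta1 ->
  II N (fun x => zeta x ^+ 2 * efun c x) <=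
  II N (fun x => 4 * \sum_i zeta1 i x ^+ 2 * (Dc c u x ^+ 2 + Dc c v x ^+ 2)).
Proof. exact: mono_energy. Qed.

End energy_terms.
End limits.

Section nodal_limit.
Context {R : realType}.
Notation E := 'rV[R]_3.
Implicit Types (x y z : E) (f g : E -> R) (i j : 'I_3) (N r t : R).

Lemma lrem_cts (w p : E -> R) (w1 w2 p1 p2 : 'I_3 -> E -> R) i : twiceC w w1 w2 -> twiceC p p1 p2 ->
  (forall x, p x != 0) -> cts (lrem w p w1 p1 i).
Proof. by move=> [cw cw1 _ _] [cp cp1 _ _] pn; rewrite /lrem; cont. Qed.

Lemma flat_partial3 f x : flat f -> partial ord_max f x = 0.
Proof.
move=> ff; apply: isd_partial; apply: is_derive_unslice.
rewrite (_ : (fun t => f _) = fun=> f x); first exact: derC.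
by apply/funext => t; exact: ff.
Qed.

Lemma flat_Dc c f : flat f -> flat (Dc c f).
Proof. by move=> ff x t; apply: eq_bigr => i _; rewrite (flat_partial i ff). Qed.

Lemma Dc_shift c f (y : E) : Dc c (fun x => f (x + y)) = fun x => Dc c f (x + y).
Proof. by apply/funext => x; apply: eq_bigr => i _; rewrite partial_shift. Qed.

Lemma DcN c f : Dc (fun i => - c i) f = fun x => - Dc c f x.
Proof. by apply/funext => x; rewrite /Dc -sumrN; apply: eq_bigr => i _; rewrite mulNr. Qed.

Lemma tends_uniform1 a f fb N e : smooth f -> tends a f fb -> 0 < e ->
  \forall n \near \oo, forall x, box N x ->
    `|f (x + a n) - fb x| <= e /\ forall j, `|partial j f (x + a n) - partial j fb x| <= e.
Proof.
move=> sf tf e0; have H := tends_uniform N sf tf e0.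
have Hj j := tends_uniform N (smooth_partial j sf) (tends_partial (i := j) sf tf) e0.
have [m _ h] := H; have [m0 _ h0] := Hj 0; have [m1 _ h1] := Hj 1; have [m2 _ h2] := Hj ord_max.
exists (maxn (maxn m m0) (maxn m1 m2)) => // n /=.
rewrite !geq_max => /andP[/andP[n0 n1] /andP[n2 n3]] x bx; split; first exact: h.
by apply: ord3P; [exact: h0|exact: h1|exact: h2].
Qed.

Variables (alpha omega : R) (u v ub vb : E -> R) (a : nat -> E).
Hypotheses (om0 : 0 < omega) (al : omega < alpha / 2) (muv : mono alpha omega u v)
  (tu : tends a u ub) (tv : tends a v vb) (fu : flat ub) (fv : flat vb).

Let un n : E -> R := fun x => u (x + a n).
Let vn n : E -> R := fun x => v (x + a n).
Let mn n : mono alpha omega (un n) (vn n). Proof. exact: mono_shift. Qed.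
Let su : smooth u. Proof. by have [[[]]] := muv. Qed.
Let sv : smooth v. Proof. by have [[[]]] := muv. Qed.

(** The constant does not depend on the translate, since the derivatives of [u] and [v] are bounded
    on the whole space. *)
Lemma log2_bound c : exists2 A, 0 <= A & forall (n : nat) N (K : nat), (0 < K)%N -> 2 ^+ K.+1 <= N ->
  II N (fun x => log2 N K x ^+ 2 * efun alpha omega (un n) (vn n) c x) <= A * (N / K%:R + 4 ^+ K / N).
Proof.
have [Mw Mw0 Hw] := smooth_bnd (smooth_Dc c su); have [Mz Mz0 Hz] := smooth_bnd (smooth_Dc c sv).
pose M := Mw ^+ 2 + Mz ^+ 2; have M0 : 0 <= M by rewrite addr_ge0 ?sqr_ge0.
exists (4 * M * 192 ^+ 2); first by rewrite mulr_ge0 ?sqr_ge0// mulr_ge0.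
move=> n N K K0 KN.
have N0 : 0 < N by apply: lt_le_trans KN; rewrite exprn_gt0.
have tz := log2_test K0 KN; have [_ cl1 _ _] := tz.
apply: (le_trans (efun_energy (mn n) c N0 tz)).
have cw : cts (Dc c (un n)) by apply: smooth_cts; apply: smooth_Dc; exact: smooth_shift.
have cz : cts (Dc c (vn n)) by apply: smooth_cts; apply: smooth_Dc; exact: smooth_shift.
apply: (@le_trans _ _ (4 * M * II N (fun x => \sum_i log2' N K i x ^+ 2))).
  rewrite -IIZ//; last by cont.
  apply: II_le => //; [by cont|by cont|].
  move=> x _; rewrite -mulrA ler_pM2l// mulr_sumr; apply: ler_sum => i _.
  rewrite mulrC ler_wpM2r ?sqr_ge0// /un /vn !Dc_shift /M.
  by apply: lerD; rewrite -sqr_normr lerXn2r ?nnegrE.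
rewrite -[leRHS]mulrA ler_wpM2l ?mulr_ge0//; apply: (le_trans (log2_energy K0 KN)).
have h1 : 0 <= N / K%:R by rewrite divr_ge0// ltW.
have h2 : 0 <= 4 ^+ K / N by rewrite divr_ge0 ?exprn_ge0// ltW.
rewrite mulrDr -mulrA -[192 ^+ 2 * 4 ^+ K / N]mulrA lerD2r ler_wpM2r//.
rewrite (_ : 192 = 4 * 48); last by ring.
by rewrite exprMn ler_wpM2r ?sqr_ge0// expr2; lra.
Qed.

Lemma cut2_bound : exists2 A, 0 <= A & forall (n : nat) N, 2 <= N ->
  II N (fun x => cut2 N x ^+ 2 * \sum_i (partial i (partial ord_max (un n)) x / partial ord_max (un n) x) ^+ 2)
    <= A * N /\
  II N (fun x => cut2 N x ^+ 2 * \sum_i (partial i (neg3 (vn n)) x / neg3 (vn n) x) ^+ 2) <= A * N.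
Proof.
have a0 : 0 <= alpha by have := om0; have := al; lra.
have [B B0 HB] : exists2 B : R, 0 <= B & forall N, 2 <= N -> II N (fun x => cut2 N x ^+ 2) <= B * N /\
    II N (fun x => \sum_i cut2' N i x ^+ 2) <= 27 * B * N.
  by exists 256; [exact: ler0n|exact: cut2_energy].
exists (4 * (27 * B) + 2 * (2 + alpha) * B).
  by rewrite addr_ge0// mulr_ge0// mulr_ge0// addr_ge0.
move=> n N N2; have N0 : 0 < N by apply: lt_le_trans N2.
have tz := cut2_test N2; have [cc cc1 _ _] := tz.
have [e1 e2] := HB N N2.
have bd : II N (fun x => 4 * \sum_i cut2' N i x ^+ 2 + 2 * (2 + alpha) * cut2 N x ^+ 2) <=
   (4 * (27 * B) + 2 * (2 + alpha) * B) * N.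
  rewrite II_lin//; [|by cont|by cont].
  have k1 : 4 * II N (fun x => \sum_i cut2' N i x ^+ 2) <= 4 * (27 * B * N) by rewrite ler_wpM2l.
  have k2 : 2 * (2 + alpha) * II N (fun x => cut2 N x ^+ 2) <= 2 * (2 + alpha) * (B * N).
    by rewrite ler_wpM2l// mulr_ge0// addr_ge0.
  apply: le_trans (lerD k1 k2) _.
  by rewrite le_eqVlt; apply/orP; left; apply/eqP; ring.
have [h1 h2] := log_energy om0 al (mn n) N0 tz.
by split; [exact: le_trans h1 bd|exact: le_trans h2 bd].
Qed.

Lemma limit_data c : exists A,
  nodal_data (fun n => Dc c (un n)) (fun n => partial ord_max (un n)) (Dc c ub) A /\
  nodal_data (fun n => Dc c (vn n)) (fun n => neg3 (vn n)) (Dc c vb) A.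
Proof.
have [A1 A10 H1] := log2_bound c; have [A2 A20 H2] := cut2_bound.
have sun n : smooth (un n) by exact: smooth_shift.
have svn n : smooth (vn n) by exact: smooth_shift.
have p0 n x : 0 < partial ord_max (un n) x by have [_ /(_ x)[]] := mn n.
have q0 n x : 0 < neg3 (vn n) x by have [_ /(_ x)[_]] := mn n; rewrite /neg3 oppr_gt0.
have A0 : 0 <= A1 + A2 by rewrite addr_ge0.
have nr f fb : smooth f -> tends a f fb -> forall N (e : R), 0 < e -> exists n, forall x, box N x ->
    (`|Dc c (fun x => f (x + a n)) x - Dc c fb x| <= e)%R /\
    (forall j, `|partial j (Dc c (fun x => f (x + a n))) x - partial j (Dc c fb) x| <= e).
  move=> sf tf N e e0.
  have [n _ Hn] := tends_uniform1 N (smooth_Dc c sf) (tends_Dc (c := c) sf tf) e0.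
  exists n => x bx; have [h1 h2] := Hn n (leqnn n) x bx.
  rewrite Dc_shift; split; first exact: h1.
  by move=> j; rewrite partial_shift; exact: h2.
have enl (n : nat) N (K : nat) X : (0 < K)%N -> 2 ^+ K.+1 <= N -> cts X ->
    (forall x, X x <= efun alpha omega (un n) (vn n) c x) ->
    II N (fun x => log2 N K x ^+ 2 * X x) <= (A1 + A2) * (N / K%:R + 4 ^+ K / N).
  move=> K0 KN cX HX; have N0 : 0 < N by apply: lt_le_trans KN; rewrite exprn_gt0.
  have [cl _ _ _] := log2_test K0 KN; have ce := efun_cts (c := c) (mn n).
  apply: (@le_trans _ _ (II N (fun x => log2 N K x ^+ 2 * efun alpha omega (un n) (vn n) c x))).
    apply: II_le => //; [by cont|by cont|].
    by move=> x _; rewrite ler_wpM2l ?sqr_ge0.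
  apply: le_trans (H1 n N K K0 KN) _; rewrite ler_wpM2r//.
    by rewrite addr_ge0// divr_ge0 ?exprn_ge0// ltW.
  by rewrite lerDl.
have le12 N r : 2 <= N -> r <= A2 * N -> r <= (A1 + A2) * N.
  move=> N2 h; apply: le_trans h _; rewrite ler_wpM2r//; first by apply: le_trans N2.
  by rewrite lerDr.
exists (A1 + A2); split; split.
- by move=> n; split; [exact: smooth_Dc|exact: smooth_partial].
- by [].
- by split=> //; [apply: smooth_Dc; exact: tends_smooth tu|exact: flat_Dc].
- exact: nr.
- split=> [n N K K0 KN|n N N2].
    apply: (enl n N K) => //.
      apply: cts_sum => j; apply: ctsX.
      have pn x : partial ord_max (un n) x != 0 by rewrite gt_eqF.
      exact: (lrem_cts (smooth_twiceC (smooth_Dc c (sun n))) (smooth_twiceC (smooth_partial ord_max (sun n))) pn).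
    by move=> x; have [] := efun_ge om0 (mn n) c x.
  by apply: le12 => //; have [] := H2 n N N2.
- by move=> n; split; [exact: smooth_Dc|exact: smooth_neg3].
- by [].
- by split=> //; [apply: smooth_Dc; exact: tends_smooth tv|exact: flat_Dc].
- exact: nr.
- split=> [n N K K0 KN|n N N2].
    apply: (enl n N K) => //.
      apply: cts_sum => j; apply: ctsX.
      have pn x : neg3 (vn n) x != 0 by rewrite gt_eqF.
      exact: (lrem_cts (smooth_twiceC (smooth_Dc c (svn n))) (smooth_twiceC (smooth_neg3 (svn n))) pn).
    by move=> x; have [] := efun_ge om0 (mn n) c x.
  by apply: le12 => //; have [] := H2 n N N2.
Qed.

(** The one-sided statement [nodal] is applied to [c] and to [- c]; along [e_3] there is nothing to
    prove for flat functions. *)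
Lemma limit_nodal0 c i : (Dc c ub 0 = 0 -> partial i (Dc c ub) 0 = 0) /\
  (Dc c vb 0 = 0 -> partial i (Dc c vb) 0 = 0).
Proof.
have sub := tends_smooth su tu; have svb := tends_smooth sv tv.
have [->|i3] := eqVneq i ord_max.
  by split=> _; apply: flat_partial3; exact: flat_Dc.
have [A [d1 d2]] := limit_data c; have [B [e1 e2]] := limit_data (fun i => - c i).
rewrite !DcN in e1 e2.
have neg f : smooth f -> partial i (fun x => - Dc c f x) 0 = - partial i (Dc c f) 0.
  by move=> sf; rewrite partialN//; exact: smooth_Dc.
split=> h; apply/eqP; rewrite eq_le.
  rewrite (nodal d1 i3 h)/= -oppr_le0 -neg//; apply: (nodal e1 i3).
  by rewrite h oppr0.
rewrite (nodal d2 i3 h)/= -oppr_le0 -neg//; apply: (nodal e2 i3).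
by rewrite h oppr0.
Qed.

(** A positive product at 0 would persist on a tube around the third axis, because the limits are
    flat. By [efun_ge] the integrand would be bounded below there, at a cost of order [N], while
    [log2_bound] allows only [o(N)]. *)
Lemma limit_sign0 c : Dc c ub 0 * Dc c vb 0 <= 0.
Proof.
have sub := tends_smooth su tu; have svb := tends_smooth sv tv.
rewrite leNgt; apply/negP; pose W x := Dc c ub x * Dc c vb x; rewrite -/(W 0) => W0.
have sW : smooth W by apply: smoothM; exact: smooth_Dc.
have fW : flat W by move=> x t; rewrite /W (flat_Dc c fu) (flat_Dc c fv).
have [L L0 HL] := smooth_lip sW.
pose r := Num.min 1 (W 0 / (4 * (L + 1))).
have k1 : 0 < 4 * (L + 1) by rewrite mulr_gt0// ltr_wpDl.
have r0 : 0 < r by rewrite /r lt_min ltr01/= divr_gt0.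
have r1 : r <= 1 by rewrite /r ge_min lexx.
have r2 : r * (4 * (L + 1)) <= W 0 by rewrite -ler_pdivlMr// /r ge_min lexx orbT.
clearbody r.
have near0 x : `|x 0 0| <= r -> `|x 0 1| <= r -> W 0 / 2 <= W x.
  move=> x0 x1; rewrite (flat_proj x fW (isT : 0 != ord_max :> 'I_3) (isT : 1 != ord_max :> 'I_3) isT).
  have := HL 0 (x 0 0 *: ee 0 + x 0 1 *: ee 1); rewrite add0r.
  have -> : \sum_j `|(x 0 0 *: ee 0 + x 0 1 *: ee 1 : E) 0 j| = `|x 0 0| + `|x 0 1|.
    rewrite sum3E !mxE /= !mulr0 !mulr1 !addr0 ?add0r normr0 addr0//.
  rewrite ler_norml => /andP[h _].
  have : L * (`|x 0 0| + `|x 0 1|) <= L * (r + r) by rewrite ler_wpM2l// lerD.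
  by move: h r2 r0; move: (W 0) (W _) (`|x 0 0|) (`|x 0 1|) => w0 w s1 s2; lra.
have [A A0 HA] := log2_bound c.
have tW : tends a (fun x => Dc c u x * Dc c v x) W.
  by apply: tendsM; exact: tends_Dc.
clearbody W.
have k0 : 0 < omega * W 0 * r ^+ 2 by rewrite !mulr_gt0// ?exprn_gt0.
(* With [B], [c], [r'] and [m] equal to 1 the lemma supplies [K] and [N]; the extra factor [d <= 1]
   is discarded at the end. *)
have [d [N [K [/andP[d0 d1] K0 KN lt]]]] := nodal_parameters A0 ltr01 ltr01 k0 (ltr01 : 0 < 1) ltr01.
have N2 : 2 <= N by apply: le_trans KN; rewrite exprS ler_peMr// exprn_ege1// ler1n.
have N0 : 0 < N by apply: lt_le_trans N2.
have W4 : 0 < W 0 / 4 by rewrite divr_gt0.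
have sWu : smooth (fun x => Dc c u x * Dc c v x) by apply: smoothM; exact: smooth_Dc.
have [n _ /(_ n (leqnn n)) Hn] := tends_uniform N sWu tW W4.
have ub1 := HA n N K K0 KN.
have [cl _ _ _] := log2_test K0 KN; have ce := efun_cts (c := c) (mn n).
have e0 x : 0 <= efun alpha omega (un n) (vn n) c x.
  have [h _ _ _] := efun_ge om0 (mn n) c x; apply: le_trans h.
  by rewrite sumr_ge0// => i _; rewrite sqr_ge0.
pose p i : R := if i == ord_max then - (N / 2) else - r.
pose q i : R := if i == ord_max then N / 2 else r.
have := @II_box_ge R N (fun x => log2 N K x ^+ 2 * efun alpha omega (un n) (vn n) c x) p q (2 * omega * W 0) N0.
have -> : 2 * omega * W 0 * ((q 0 - p 0) * (q 1 - p 1) * (q ord_max - p ord_max)) / 8 =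
    omega * W 0 * r ^+ 2 * N.
  by rewrite /p /q /=; field.
move=> /(_ _ _ _ _ _ _ _) H.
have {H} lb : omega * W 0 * r ^+ 2 * N <= II N (fun x => log2 N K x ^+ 2 * efun alpha omega (un n) (vn n) c x).
  apply: H.
  - by cont.
  - by rewrite !mulr_ge0// ltW.
  - by move=> i; rewrite /p; case: ifP => _; move: N2 r1; lra.
  - by move=> i; rewrite /p /q; case: ifP => _; move: N2 r0; lra.
  - by move=> i; rewrite /q; case: ifP => _; move: N2 r1; lra.
  - by move=> x _; rewrite mulr_ge0// sqr_ge0.
  move=> x Hx; have x0 := Hx 0; have x1 := Hx 1; have x2 := Hx ord_max.
  rewrite /p /q /= -!ler_norml in x0 x1 x2.
  have c1 : 1 <= log2 N K x.
    apply: le_trans (cut2_le_log2 N x K0).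
    rewrite /cut2 (eta1 ltr01 (le_trans x0 r1)) (eta1 ltr01 (le_trans x1 r1)) eta1 ?mulr1//.
    by rewrite divr_gt0.
  have c2 : 1 <= log2 N K x ^+ 2 by rewrite exprn_ege1.
  have bx : box N x.
    by apply: ord3P; [apply: (le_trans x0)|apply: (le_trans x1)|apply: (le_trans x2)]; move: N2 r1; lra.
  have := Hn x bx; have [_ _ h _] := efun_ge om0 (mn n) c x.
  move: h; rewrite /un /vn !Dc_shift; set w := Dc c u _ * Dc c v _ => h.
  rewrite ler_norml => /andP[h1 _]; have h2 := near0 x x0 x1.
  apply: (@le_trans _ _ (1 * efun alpha omega (un n) (vn n) c x)); last by rewrite ler_wpM2r.
  rewrite mul1r; apply: le_trans h.
  have w4 : W 0 / 4 <= w by move: h1 h2; move: (W 0) (W x) => *; lra.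
  have w0 : 0 <= w by apply: le_trans w4; exact: ltW.
  rewrite ger0_norm//.
  have : omega * (W 0 / 4) <= omega * w by rewrite ler_wpM2l// ltW.
  by lra.
have := le_trans lb ub1; rewrite leNgt => /negP; apply.
move: lt; rewrite divr1 mulr1.
have s0 : 0 <= A * (N / K%:R + 4 ^+ K / N).
  by rewrite mulr_ge0// addr_ge0// divr_ge0 ?exprn_ge0// ltW.
have : omega * W 0 * r ^+ 2 * d * N <= omega * W 0 * r ^+ 2 * 1 * N.
  by rewrite ler_wpM2r ?(ltW N0)// ler_wpM2l// ltW.
have : 0 <= d ^+ 2 * (1 * N) by rewrite mulr_ge0 ?sqr_ge0// mul1r ltW.
rewrite mulr1; move: (_ * (_ / _ + _)) s0 (omega * _ * _ * N) (omega * _ * _ * d * N) (d ^+ 2 * _).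
by move=> *; lra.
Qed.

End nodal_limit.

Section nodal_limit_shift.
Context {R : realType}.
Notation E := 'rV[R]_3.
Variables (alpha omega : R) (u v ub vb : E -> R) (a : nat -> E).
Hypotheses (om0 : 0 < omega) (al : omega < alpha / 2) (muv : mono alpha omega u v)
  (tu : tends a u ub) (tv : tends a v vb) (fu : flat ub) (fv : flat vb).

Lemma limit_nodal (x : E) c i : (Dc c ub x = 0 -> partial i (Dc c ub) x = 0) /\
  (Dc c vb x = 0 -> partial i (Dc c vb) x = 0).
Proof.
have fs f : flat f -> flat (fun y => f (y + x)) by move=> ff y t; rewrite addrAC ff.
have := limit_nodal0 om0 al (mono_shift x muv) (tends_shift (y := x) tu) (tends_shift (y := x) tv) (fs _ fu) (fs _ fv) c i.
by rewrite !Dc_shift !partial_shift add0r.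
Qed.

Lemma limit_sign (x : E) c : Dc c ub x * Dc c vb x <= 0.
Proof.
have fs f : flat f -> flat (fun y => f (y + x)) by move=> ff y t; rewrite addrAC ff.
have := limit_sign0 om0 (mono_shift x muv) (tends_shift (y := x) tu) (tends_shift (y := x) tv) (fs _ fu) (fs _ fv) c.
by rewrite !Dc_shift add0r.
Qed.

End nodal_limit_shift.

(** * One-dimensionality and energy density of the limits *)

Section ode.
Context {R : realType}.
Implicit Types (G f g : R -> R) (s t : R).

Lemma nonincr_of_derive G G1 : (forall t, isd t (1 : R) G (G1 t)) -> (forall t, G1 t <= 0) ->
  forall s t, s <= t -> G t <= G s.
Proof.
move=> dG G0 s t; rewrite le_eqVlt => /predU1P[->//|st].
have [c _ h] := @der_lt R G G1 s t st (fun t _ => dG t).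
by rewrite -subr_le0 h mulr_le0_ge0// subr_ge0 ltW.
Qed.

Lemma der_expR_lin (k t : R) : isd t (1 : R) (fun s => expR (k * s)) (k * expR (k * t)).
Proof.
have h : isd t (1 : R) (fun s : R => k * s) k.
  apply: der_eq; first by apply: derM; [exact: derC|exact: is_derive_id].
  by rewrite /=; ring.
rewrite [k * _]mulrC.
by apply: (@der_comp R R t 1 (fun s : R => k * s) expR _ _ h); exact: is_derive_expR.
Qed.

(** The weight [expR (- C t)] serves positive times and [expR (C t)] negative ones. *)
Lemma gronwall0 G G1 (C : R) : (forall t, isd t (1 : R) G (G1 t)) -> (forall t, 0 <= G t) ->
  (forall t, `|G1 t| <= C * G t) -> G 0 = 0 -> forall t, G t = 0.
Proof.
move=> dG G0 GC z t; apply/eqP; rewrite eq_le G0 andbT.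
have [t0|t0] := leP 0 t.
  have := @nonincr_of_derive (fun t => G t * expR (- C * t)) (fun t => (G1 t - C * G t) * expR (- C * t)) _ _ 0 t t0.
  rewrite /= z mul0r pmulr_lle0 ?expR_gt0//; apply.
    by move=> s; have h := der_expR_lin (- C) s; have h' := dG s; apply: der_eq; [der|rewrite /=; ring].
  move=> s; rewrite pmulr_lle0 ?expR_gt0// subr_le0.
  by apply: le_trans (GC s); exact: ler_norm.
have := @nonincr_of_derive (fun t => - (G t * expR (C * t))) (fun t => - ((G1 t + C * G t) * expR (C * t))) _ _ t 0 (ltW t0).
rewrite /= z mul0r oppr0 oppr_ge0 pmulr_lle0 ?expR_gt0//; apply.
  by move=> s; have h := der_expR_lin C s; have h' := dG s; apply: der_eq; [der|rewrite /=; ring].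
move=> s; rewrite oppr_le0 pmulr_lge0 ?expR_gt0//.
by have := GC s; rewrite ler_norml => /andP[h _]; rewrite -lerBlDr sub0r.
Qed.

Lemma gronwall_family n (k k1 : 'I_n -> R -> R) (C : R) :
  (forall i t, isd t (1 : R) (k i) (k1 i t)) -> (forall i, k i 0 = 0) ->
  (forall i t, `|k1 i t| <= C * \sum_j `|k j t|) -> forall i t, k i t = 0.
Proof.
move=> dk k0 kC i t.
pose G s := \sum_j k j s ^+ 2.
suff : G t = 0.
  move=> /eqP; rewrite psumr_eq0; last by move=> j _; rewrite sqr_ge0.
  by move=> /allP /(_ i); rewrite mem_index_enum sqrf_eq0 => /(_ isT) /eqP.
apply: (@gronwall0 G (fun s => \sum_j 2 * k j s * k1 j s) (2 * (`|C| * n%:R))).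
- move=> s; apply: der_sum => j; have h := dk j s.
  by apply: der_eq; [der|rewrite /=; ring].
- by move=> s; rewrite /G sumr_ge0// => j _; rewrite sqr_ge0.
- move=> s; apply: le_trans (ler_norm_sum _ _ _) _.
  apply: (@le_trans _ _ (\sum_j \sum_l `|C| * (k j s ^+ 2 + k l s ^+ 2))).
    apply: ler_sum => j _; rewrite !normrM (ger0_norm (ler0n _ 2)).
    have h : `|k1 j s| <= \sum_l `|C| * `|k l s|.
      rewrite -mulr_sumr; apply: le_trans (kC j s) _; rewrite ler_wpM2r ?ler_norm//.
      by apply: sumr_ge0.
    apply: (@le_trans _ _ (2 * `|k j s| * \sum_l `|C| * `|k l s|)); first by rewrite ler_wpM2l// mulr_ge0.
    rewrite mulr_sumr; apply: ler_sum => l _; rewrite -(sqr_normr (k j s)) -(sqr_normr (k l s)).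
    have := mulr_ge0 (normr_ge0 C) (sqr_ge0 (`|k j s| - `|k l s|)).
    by move: (`|k j s|) (`|k l s|) (`|C|); clear => *; lra.
  rewrite le_eqVlt; apply/orP; left; apply/eqP.
  under eq_bigr do rewrite -mulr_sumr big_split/= sumr_const card_ord.
  rewrite -mulr_sumr big_split/= sumr_const card_ord sumrMnl -/(G s).
  by rewrite -[G s *+ n]mulr_natr; ring.
- by rewrite /G big1// => j _; rewrite k0 expr0n.
Qed.

(* A bounded increasing [f] that is concave where it is positive flattens out:
   [f'] and the coefficient [g] in [f'' = - g f] become simultaneously small. *)
Lemma concave_flattens f f1 f2 g (K : R) : (forall t, isd t (1 : R) f (f1 t)) ->
  (forall t, isd t (1 : R) f1 (f2 t)) -> (forall t, f2 t = - (g t * f t)) -> (forall t, 0 <= g t) ->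
  (forall t, 0 < f1 t) -> (forall t, `|f t| <= K) -> 0 < f 0 ->
  forall e : R, 0 < e -> exists t, f1 t < e /\ g t < e.
Proof.
move=> d1 d2 eq g0 p fK f00 e e0.
have fpos t : 0 <= t -> f 0 <= f t.
  rewrite le_eqVlt => /predU1P[<-//|t0].
  have [c _ h] := @der_lt R f f1 0 t t0 (fun t _ => d1 t).
  by rewrite -subr_ge0 h mulr_ge0 ?(ltW (p _))// subr_ge0 ltW.
have f2neg t : 0 <= t -> f2 t <= 0.
  by move=> t0; rewrite eq oppr_le0 mulr_ge0// (le_trans _ (fpos t t0))// ltW.
have dec s t : 0 <= s -> s <= t -> f1 t <= f1 s.
  move=> s0; rewrite le_eqVlt => /predU1P[->//|st].
  have [c /andP[sc _] h] := @der_lt R f1 f2 s t st (fun t _ => d2 t).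
  by rewrite -subr_le0 h mulr_le0_ge0 ?f2neg// ?subr_ge0 ltW// (le_lt_trans s0).
have K0 : 0 <= K by apply: le_trans (fK 0).
have small t : 0 < t -> f1 t * t <= 2 * K.
  move=> t0; have [c /andP[c0 ct] h] := @der_lt R f f1 0 t t0 (fun t _ => d1 t).
  have : f1 t * t <= f1 c * (t - 0) by rewrite subr0 ler_wpM2r ?(ltW t0)// dec// ltW.
  rewrite -h; have := fK t; have := fK 0; rewrite !ler_norml => /andP[h1 h2] /andP[h3 h4].
  by lra.
pose a := 2 * K / e + 2 * K / (e * f 0) + 1.
have a1 : 0 <= 2 * K / e by rewrite divr_ge0 ?(ltW e0)// mulr_ge0.
have a2 : 0 <= 2 * K / (e * f 0) by rewrite divr_ge0 ?mulr_ge0// ltW// mulr_gt0.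
have a0 : 0 < a by rewrite /a; lra.
have fa : f1 a < e.
  rewrite -(ltr_pM2r a0); apply: le_lt_trans (small a a0) _.
  by rewrite [ltRHS]mulrC -ltr_pdivrMr// /a; lra.
have fa2 : f1 a < e * f 0.
  rewrite -(ltr_pM2r a0); apply: le_lt_trans (small a a0) _.
  by rewrite [ltRHS]mulrC -ltr_pdivrMr ?mulr_gt0// /a; lra.
have aa : a < a + 1 by lra.
have [c /andP[ac _] h] := @der_lt R f1 f2 a (a + 1) aa (fun t _ => d2 t).
have c0 : 0 <= c by apply: ltW; exact: lt_trans ac.
exists c; split; first by apply: le_lt_trans fa; apply: dec; exact: ltW.
rewrite -(ltr_pM2r f00); apply: le_lt_trans fa2.
have g1 : g c * f 0 <= g c * f c by rewrite ler_wpM2l// fpos.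
move: h; rewrite eq (addrC a 1) addrK mulr1 => h.
by have := p (1 + a); move: g1 h; lra.
Qed.

End ode.

Local Opaque partial.

(** * Parallel level lines from the nodal property *)

Section profile.
Context {R : realType}.
Notation E := 'rV[R]_3.
Implicit Types (x y z h : E) (f g u v : E -> R) (i j : 'I_3) (t : R).

Lemma smooth_bnd_family (T : finType) (F : T -> E -> R) : (forall a, smooth (F a)) ->
  exists2 C, 0 <= C & forall a x, `|F a x| <= C.
Proof.
move=> sF; have H a : exists C, 0 <= C /\ forall x, `|F a x| <= C.
  by have [C C0 HC] := smooth_bnd (sF a); exists C.
have [C HC] := choice H; exists (\sum_a C a); first by apply: sumr_ge0 => a _; case: (HC a).
move=> a x; have [_ h] := HC a; apply: le_trans (h x) _.
by rewrite (bigD1 a)//= lerDl sumr_ge0// => b _; case: (HC b).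
Qed.

(** The vector [c] may be chosen after the point: taking it orthogonal to the gradient at [x] shows
    that the Hessian annihilates the tangent of the level set. *)
Definition nodal_property f := forall x c i, Dc c f x = 0 -> partial i (Dc c f) x = 0.

Definition perp f x : E := partial 1 f x *: ee 0 - partial 0 f x *: ee 1.

Lemma perpE f x : [/\ perp f x 0 0 = partial 1 f x, perp f x 0 1 = - partial 0 f x & perp f x 0 ord_max = 0].
Proof.
have ej (r : R) i j : (r *: (ee i : E)) 0 j = r * (i == j)%:R by rewrite mxE eeE.
have h j : perp f x 0 j = partial 1 f x * (0 == j)%:R - partial 0 f x * (1 == j)%:R.
  by rewrite /perp -scaleNr mxE !ej mulNr.
by split; rewrite h /= ?mulr0 ?mulr1 ?subr0 ?sub0r.
Qed.

Local Opaque perp.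

Lemma Dc3 (c : 'I_3 -> R) f x (a b : R) : c 0 = a -> c 1 = b -> c ord_max = 0 ->
  Dc c f x = a * partial 0 f x + b * partial 1 f x.
Proof. by move=> <- <- c2; rewrite /Dc sum3E c2 mul0r addr0. Qed.

(** The Hessian at [y] annihilates [perp f y], so differentiating the gradient along the fixed
    vector [perp f x] gives only the difference of the two vectors, which the change of gradient
    itself controls; Gronwall then applies. *)
Lemma grad_const f : smooth f -> nodal_property f -> forall x t,
  partial 0 f (x + t *: perp f x) = partial 0 f x /\ partial 1 f (x + t *: perp f x) = partial 1 f x.
Proof.
move=> sf nf x t; set tau := perp f x.
have s1 i := smooth_partial i sf.
have [C C0 HC] := @smooth_bnd_family ('I_3 * 'I_3)%type (fun a => partial a.1 (partial a.2 f))
   (fun a => smooth_partial a.1 (s1 a.2)).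
pose k i s := partial i f (x + s *: tau) - partial i f x.
pose k1 i s := Dc (fun j => tau 0 j) (partial i f) (x + s *: tau).
have dk i s : isd s (1 : R) (k i) (k1 i s).
  have h := smooth_line x tau s (s1 i).
  by apply: der_eq; [rewrite /k; der|rewrite /k1 /= addr0].
have k1E i s : k1 i s = partial 1 (partial i f) (x + s *: tau) * k 0 s - partial 0 (partial i f) (x + s *: tau) * k 1 s.
  set y := x + s *: tau.
  have := nf y (fun j => perp f y 0 j) i; rewrite (partial_Dc _ i sf).
  have [p0 p1 p2] := perpE f y; have [q0 q1 q2] := perpE f x.
  rewrite /k1 -/y (Dc3 (partial i f) y p0 p1 p2) (Dc3 (partial i f) y q0 q1 q2) (Dc3 f y p0 p1 p2) /k -/y => H.
  have /H : partial 1 f y * partial 0 f y + - partial 0 f y * partial 1 f y = 0 by ring.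
  move: (partial 0 f y) (partial 1 f y) (partial 0 f x) (partial 1 f x) (partial 0 (partial i f) y) (partial 1 (partial i f) y).
  move=> a b c d e g H'; have -> : d * e + - c * g = d * e + - c * g - (b * e + - a * g) by rewrite H' subr0.
  by ring.
pose l (a : 'I_2) : 'I_3 := if a == 0 then 0 else 1.
have kz : forall (a : 'I_2) s, k (l a) s = 0.
  apply: (@gronwall_family R 2 (fun a => k (l a)) (fun a => k1 (l a)) C).
  - by move=> a s; exact: dk.
  - by move=> a; rewrite /k scale0r addr0 subrr.
  - move=> a s; rewrite k1E big_ord_recl big_ord1 /l /=.
    apply: le_trans (ler_normB _ _) _; rewrite !normrM mulrDr.
    by apply: lerD; rewrite ler_wpM2r//; [exact: (HC (1, _))|exact: (HC (0, _))].
have z0 := kz 0 t; have z1 := kz 1 t.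
by split; apply/subr0_eq; [exact: z0|exact: z1].
Qed.

Lemma lines_meet (a b c d p q r s : R) : a * d - b * c != 0 ->
  exists t t', p + t * b = r + t' * d /\ q + t * - a = s + t' * - c.
Proof.
move=> dn; have dn' : b * c - a * d != 0 by rewrite -oppr_eq0 opprB.
exists ((c * (r - p) + d * (s - q)) / (b * c - a * d)), ((a * (r - p) + b * (s - q)) / (b * c - a * d)).
by split; field.
Qed.

(** Otherwise the lines orthogonal to the two gradients would meet, after projection along [x_3],
    and by [grad_const] the gradients would agree at the meeting point. *)
Lemma grad_parallel f : smooth f -> flat f -> nodal_property f -> forall x y,
  partial 0 f x * partial 1 f y = partial 1 f x * partial 0 f y.
Proof.
move=> sf ff nf x y; apply/eqP; rewrite -subr_eq0; apply: contraT => dn.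
set a := partial 0 f x in dn *; set b := partial 1 f x in dn *.
set c := partial 0 f y in dn *; set d := partial 1 f y in dn *.
have [t [s [m1 m2]]] := lines_meet (x 0 0) (x 0 1) (y 0 0) (y 0 1) dn.
have [h1 h2] := grad_const sf nf x t; have [h3 h4] := grad_const sf nf y s.
have cE (w z : E) r j : (w + r *: z) 0 j = w 0 j + r * z 0 j by rewrite !mxE.
have E1 i : partial i f (x + t *: perp f x) = partial i f (y + s *: perp f y).
  have [p0 p1 _] := perpE f x; have [q0 q1 _] := perpE f y.
  have PF z : partial i f z = partial i f (z 0 0 *: ee 0 + z 0 1 *: ee 1).
    exact: (flat_proj z (flat_partial i ff)).
  have key (z z' : E) : z 0 0 = z' 0 0 -> z 0 1 = z' 0 1 -> partial i f z = partial i f z'.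
    by move=> e0 e1; rewrite (PF z) (PF z') e0 e1.
  apply: key.
    exact: (etrans (etrans (cE x _ t 0) (congr1 (fun r => x 0 0 + t * r) p0))
      (etrans m1 (esym (etrans (cE y _ s 0) (congr1 (fun r => y 0 0 + s * r) q0))))).
  exact: (etrans (etrans (cE x _ t 1) (congr1 (fun r => x 0 1 + t * r) p1))
    (etrans m2 (esym (etrans (cE y _ s 1) (congr1 (fun r => y 0 1 + s * r) q1))))).
have ac : a = c by rewrite /a -h1 E1 h3.
have bd : b = d by rewrite /b -h2 E1 h4.
by move: dn; rewrite ac bd mulrC subrr eqxx.
Qed.

Lemma unidirectional f : smooth f -> flat f -> nodal_property f -> exists e : 'I_3 -> R,
  [/\ e ord_max = 0, 0 < e 0 ^+ 2 + e 1 ^+ 2 & forall x, e 0 * partial 1 f x - e 1 * partial 0 f x = 0].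
Proof.
move=> sf ff nf.
have [[x xn]|H] := pselect (exists x, 0 < partial 0 f x ^+ 2 + partial 1 f x ^+ 2).
  exists (fun i => if i == 0 then partial 0 f x else if i == 1 then partial 1 f x else 0); split=> //= y.
  by rewrite (grad_parallel sf ff nf) subrr.
exists (fun i => (i == 0)%:R); split=> [//||x] /=; first by rewrite expr1n expr0n addr0.
rewrite mul1r mul0r subr0; apply/eqP; apply: contraT => p0.
case: H; exists x; rewrite ltr_wpDl ?sqr_ge0// exprn_even_gt0//.
Qed.

End profile.

(** * Hamiltonian identity and energy density of one-dimensional limits *)

Section profile_energy.
Context {R : realType}.
Notation E := 'rV[R]_3.
Implicit Types (x y z h : E) (f g u v : E -> R) (i j : 'I_3) (t : R).

Local Opaque partial.

Lemma gronwall4 (a b c d a1 b1 c1 d1 : R -> R) (C : R) :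
  (forall t, [/\ isd t (1 : R) a (a1 t), isd t (1 : R) b (b1 t), isd t (1 : R) c (c1 t) & isd t (1 : R) d (d1 t)]) ->
  [/\ a 0 = 0, b 0 = 0, c 0 = 0 & d 0 = 0] -> 0 <= C ->
  (forall t, [/\ `|a1 t| <= C * (`|a t| + `|b t| + `|c t| + `|d t|),
     `|b1 t| <= C * (`|a t| + `|b t| + `|c t| + `|d t|),
     `|c1 t| <= C * (`|a t| + `|b t| + `|c t| + `|d t|) &
     `|d1 t| <= C * (`|a t| + `|b t| + `|c t| + `|d t|)]) ->
  forall t, [/\ a t = 0, b t = 0, c t = 0 & d t = 0].
Proof.
move=> dd [a0 b0 c0 d0] C0 H t.
pose G s := a s ^+ 2 + b s ^+ 2 + c s ^+ 2 + d s ^+ 2.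
have : G t = 0.
  apply: (@gronwall0 R G (fun s => 2 * a s * a1 s + 2 * b s * b1 s + 2 * c s * c1 s + 2 * d s * d1 s) (8 * C)).
  - by move=> s; have [h1 h2 h3 h4] := dd s; apply: der_eq; [rewrite /G; der|rewrite /=; ring].
  - by move=> s; rewrite /G !addr_ge0// sqr_ge0.
  - move=> s; have [h1 h2 h3 h4] := H s.
    apply: le_trans (ler_normD _ _) _; apply: le_trans (lerD (ler_normD _ _) (lexx _)) _.
    apply: le_trans (lerD (lerD (ler_normD _ _) (lexx _)) (lexx _)) _.
    rewrite !normrM (ger0_norm (ler0n _ 2)) /G.
    rewrite -(sqr_normr (a s)) -(sqr_normr (b s)) -(sqr_normr (c s)) -(sqr_normr (d s)).
    move: h1 h2 h3 h4 (normr_ge0 (a s)) (normr_ge0 (b s)) (normr_ge0 (c s)) (normr_ge0 (d s)).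
    move: (`|a s|) (`|b s|) (`|c s|) (`|d s|) (`|a1 s|) (`|b1 s|) (`|c1 s|) (`|d1 s|) C0; clear.
    move=> p q r l p1 q1 r1 l1 C0 h1 h2 h3 h4 p0 q0 r0 l0.
    have e1 := ler_wpM2l p0 h1; have e2 := ler_wpM2l q0 h2.
    have e3 := ler_wpM2l r0 h3; have e4 := ler_wpM2l l0 h4.
    have f1 := mulr_ge0 C0 (sqr_ge0 (p - q)); have f2 := mulr_ge0 C0 (sqr_ge0 (p - r)).
    have f3 := mulr_ge0 C0 (sqr_ge0 (p - l)); have f4 := mulr_ge0 C0 (sqr_ge0 (q - r)).
    have f5 := mulr_ge0 C0 (sqr_ge0 (q - l)); have f6 := mulr_ge0 C0 (sqr_ge0 (r - l)).
    by lra.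
  - by rewrite /G a0 b0 c0 d0 !expr0n !addr0.
rewrite /G => /eqP; rewrite !paddr_eq0 ?addr_ge0 ?sqr_ge0// !sqrf_eq0.
by move=> /andP[/andP[/andP[/eqP -> /eqP ->] /eqP ->] /eqP ->].
Qed.

Lemma sqr_sub_ge (p q : R) : p * q <= 0 -> p ^+ 2 + q ^+ 2 <= (p - q) ^+ 2.
Proof. by move=> h; lra. Qed.

Lemma linearized_bounds (C1 C2 C3 n s a b f g d1 d2 d3 : R) : 0 < n ->
  `|d1| <= C1 -> `|d2| <= C2 -> `|d3| <= C3 -> 0 <= C1 -> 0 <= C2 -> 0 <= C3 ->
  let K := `|s| * (1 + (C1 + C2 + C3) / n) in let S := `|a| + `|b| + `|f| + `|g| in
  [/\ `|s * f| <= K * S, `|s * g| <= K * S, `|s * ((d1 * a + d3 * b) / n)| <= K * S &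
    `|s * ((d2 * b + d3 * a) / n)| <= K * S].
Proof.
move=> n0 h1 h2 h3 p1 p2 p3 K S.
have b1 (l m p q : R) : `|l| <= C1 + C2 -> `|m| <= C3 -> `|(l * p + m * q) / n| <= (C1 + C2 + C3) / n * (`|p| + `|q|).
  move=> hl hm; rewrite normrM normfV (gtr0_norm n0) mulrAC ler_pM2r ?invr_gt0//.
  apply: le_trans (ler_normD _ _) _; rewrite !normrM mulrDr.
  by apply: lerD; rewrite ler_wpM2r//; [move: hl p3|move: hm p1 p2]; clear; lra.
have c1 : `|d1| <= C1 + C2 by move: h1 p2; clear; lra.
have c2 : `|d2| <= C1 + C2 by move: h2 p1; clear; lra.
have := b1 d1 d3 a b c1 h3; have := b1 d2 d3 b a c2 h3.
have k0 : 0 <= (C1 + C2 + C3) / n by rewrite divr_ge0 ?(ltW n0)// !addr_ge0.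
have big (l : R) : `|l| <= (1 + (C1 + C2 + C3) / n) * S -> `|s * l| <= K * S.
  by move=> hl; rewrite normrM /K -mulrA ler_wpM2l.
move: k0 big; rewrite /S; clear.
move: ((d1 * a + d3 * b) / n) ((d2 * b + d3 * a) / n) ((C1 + C2 + C3) / n) => l1 l2 k k0 big hl2 hl1.
have := normr_ge0 a; have := normr_ge0 b; have := normr_ge0 f; have := normr_ge0 g.
move: big hl1 hl2; move: (`|a|) (`|b|) => a' b' big hl1 hl2 g0 f0 b0 a0.
have ka := mulr_ge0 k0 a0; have kb := mulr_ge0 k0 b0; have kf := mulr_ge0 k0 f0; have kg := mulr_ge0 k0 g0.
by split; apply: big; move: hl1 hl2 g0 f0 b0 a0 ka kb kf kg; clear; move: (`|f|) (`|g|) => *; lra.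
Qed.

(** The potential whose gradient in [(u, v)] is the right-hand side of the system; for [alpha > 0]
    it vanishes exactly at the wells [u^2 + v^2 = 1], [alpha u v = omega]. *)
Definition Wpot (alpha omega : R) u v x : R :=
  (u x ^+ 2 + v x ^+ 2 - 1) ^+ 2 / 4 + (alpha * u x * v x - omega) ^+ 2 / (2 * alpha).

Definition edens (alpha omega : R) u v x : R :=
  (\sum_i partial i u x ^+ 2 + \sum_i partial i v x ^+ 2) / 2 + Wpot alpha omega u v x.

Lemma der_Wpot (alpha omega : R) u v i x : alpha != 0 -> sol alpha omega u v ->
  isd x (ee i) (Wpot alpha omega u v) (laplacian u x * partial i u x + laplacian v x * partial i v x).
Proof.
move=> a0 [[su sv] _ _ eq _]; have h1 := smooth_isd i x su; have h2 := smooth_isd i x sv.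
have [-> ->] := eq x; apply: der_eq; first by rewrite /Wpot; der.
by rewrite /=; move: (u x) (v x) (partial i u x) (partial i v x) => *; field.
Qed.

Lemma smooth_laplacian f : smooth f -> smooth (laplacian f).
Proof. by move=> sf; apply: smooth_sum => i; apply: smooth_partial; exact: smooth_partial. Qed.

(** All gradients being parallel to [e], the Hessian is a multiple of the matrix [e_i e_j], and the
    multiple is read off from the trace. *)
Lemma partial_Dc_of_direction (e : 'I_3 -> R) (n : R) f : n != 0 -> smooth f ->
  (forall i x, n * partial i f x = e i * Dc e f x) ->
  forall i x, partial i (Dc e f) x = e i * laplacian f x.
Proof.
move=> n0 sf H i x; have sA := smooth_Dc e sf.
have step j k : n * partial k (partial j f) x = e j * partial k (Dc e f) x.
  have h1 := smooth_isd k x (smooth_partial j sf); have h2 := smooth_isd k x sA.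
  have E1 : (fun y => n * partial j f y) = (fun y => e j * Dc e f y) by apply/funext => y; exact: H.
  have d1 : isd x (ee k) (fun y => n * partial j f y) (n * partial k (partial j f) x).
    by apply: der_eq; [der|rewrite mulr0 addr0].
  rewrite E1 in d1; apply: is_derive_inj d1 _.
  by apply: der_eq; [der|rewrite mulr0 addr0].
apply: (mulfI n0); rewrite (partial_Dc e i sf) /Dc /laplacian mulr_sumr mulrCA.
rewrite !mulr_sumr; apply: eq_bigr => j _.
have E1 := step i j; have E2 := step j j.
have -> : n * (e j * partial j (partial i f) x) = e j * (n * partial j (partial i f) x) by ring.
exact: (etrans (congr1 ( *%R (e j)) E1) (etrans (mulrCA _ _ _) (esym (congr1 ( *%R (e i)) E2)))).
Qed.

Lemma ivt_sign f : cts f -> (forall x, f x != 0) -> smooth f ->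
  exists s : R, s * s = 1 /\ forall x, 0 < s * f x.
Proof.
move=> cf f0 sf.
have key x y : 0 < f x -> f y < 0 -> False.
  move=> fx fy; pose g t := f (x + t *: (y - x)).
  have cg : continuous g by move=> t; exact: is_derive_cont (smooth_line x (y - x) t sf).
  have [|||c _ gc] := @IVT R g 0 1 0.
  - exact: ler01.
  - exact: continuous_subspaceT.
  - rewrite /g scale0r addr0 scale1r addrC subrK.
    by rewrite ge_min le_max (ltW fx) (ltW fy) orbT.
  by move/eqP: gc; rewrite /g (negbTE (f0 _)).
have [f00|f00] := ltP 0 (f 0).
  exists 1; split=> [|x]; rewrite mul1r// lt_neqAle eq_sym f0/= leNgt.
  by apply/negP => fx; exact: key f00 fx.
exists (-1); split=> [|x]; first by rewrite mulrNN mul1r.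
rewrite mulN1r oppr_gt0 lt_neqAle f0/= leNgt; apply/negP => fx; apply: (key x 0) => //.
by rewrite lt_neqAle f0.
Qed.

Section profile.
Variables (alpha omega : R) (u v : E -> R) (e : 'I_3 -> R) (n : R).
Hypotheses (a0 : 0 < alpha) (om0 : 0 < omega) (suv : sol alpha omega u v) (n0 : 0 < n)
  (nE : \sum_i e i ^+ 2 = n)
  (Hu : forall i x, n * partial i u x = e i * Dc e u x)
  (Hv : forall i x, n * partial i v x = e i * Dc e v x)
  (nu : nodal_property u) (nv : nodal_property v) (sgn : forall x, Dc e u x * Dc e v x <= 0).

Let su : smooth u. Proof. by case: suv => -[]. Qed.
Let sv : smooth v. Proof. by case: suv => -[]. Qed.
Let A := Dc e u.
Let B := Dc e v.
Let nn : n != 0. Proof. by rewrite gt_eqF. Qed.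
Let an : alpha != 0. Proof. by rewrite gt_eqF. Qed.
Let dA i x : partial i A x = e i * laplacian u x.
Proof. exact: partial_Dc_of_direction nn su Hu i x. Qed.
Let dB i x : partial i B x = e i * laplacian v x.
Proof. exact: partial_Dc_of_direction nn sv Hv i x. Qed.
Let sA : smooth A. Proof. exact: smooth_Dc. Qed.
Let sB : smooth B. Proof. exact: smooth_Dc. Qed.
Let pu i x : partial i u x = e i * A x / n.
Proof. by apply: (mulfI nn); rewrite Hu -/A; field; exact: nn. Qed.
Let pv i x : partial i v x = e i * B x / n.
Proof. by apply: (mulfI nn); rewrite Hv -/B; field; exact: nn. Qed.

Definition hamiltonian x : R := (A x ^+ 2 + B x ^+ 2) / (2 * n) - Wpot alpha omega u v x.

Lemma hamiltonian_const x y : hamiltonian x = hamiltonian y.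
Proof.
apply: (@const_of_partials R hamiltonian (fun i x => 0)) => // i z.
have h1 := smooth_isd i z sA; have h2 := smooth_isd i z sB; have h3 := der_Wpot i z an suv.
apply: der_eq; first by rewrite /hamiltonian; der.
rewrite /= dA dB pu pv; move: (laplacian u z) (laplacian v z) (A z) (B z) (e i) => *.
by field; exact: nn.
Qed.

Lemma edensE x : edens alpha omega u v x = (A x ^+ 2 + B x ^+ 2) / (2 * n) + Wpot alpha omega u v x.
Proof.
rewrite /edens; congr (_ + _).
have E1 (a : R) : \sum_i (e i * a / n) ^+ 2 = a ^+ 2 / n.
  rewrite (eq_bigr (fun i => (a / n) ^+ 2 * e i ^+ 2)); last by move=> i _; field; exact: nn.
  by rewrite -mulr_sumr nE; field; exact: nn.
under eq_bigr do rewrite pu; under [X in _ + X]eq_bigr do rewrite pv.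
by rewrite !E1; field; exact: nn.
Qed.

(** The coefficient of [u - v] in the difference of the two equations; the sharp bounds make it
    nonnegative, so [u - v] is concave along [e] where it is positive. *)
Let grow x : R := (1 - (u x ^+ 2 + v x ^+ 2)) + (alpha * u x * v x - omega).
Let grow0 x : 0 <= grow x.
Proof. by case: suv => _ _ _ _ /(_ x)[h1 h2]; rewrite /grow addr_ge0// subr_ge0. Qed.
Let lapB x : laplacian u x - laplacian v x = - (grow x * (u x - v x)).
Proof. by case: suv => _ _ _ /(_ x)[-> ->] _; rewrite /grow; ring. Qed.

(** Since [A B <= 0], equality forces [A = B = 0] at [x2], and the nodal property makes both
    Laplacians vanish there too. By uniqueness for the linearised system they vanish everywhere; at
    [x1], where [u] and [v] differ, an equilibrium under the sharp bounds must be a well, so the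
    density is 0. *)
Lemma profile_degenerate x1 x2 : u x1 != v x1 -> A x2 = B x2 -> forall x, edens alpha omega u v x = 0.
Proof.
move=> uv1 AB2.
have A2 : A x2 = 0.
  by apply/eqP; rewrite -sqrf_eq0 eq_le sqr_ge0 andbT expr2 {2}AB2; exact: sgn.
have B2 : B x2 = 0 by rewrite -AB2.
have lap0 (f : E -> R) : (forall i, e i * laplacian f x2 = 0) -> laplacian f x2 = 0.
  move=> H; apply: (mulfI nn); rewrite mulr0 -nE mulr_suml big1// => i _.
  by rewrite expr2 -mulrA H mulr0.
have Fu2 : laplacian u x2 = 0 by apply: lap0 => i; rewrite -dA; exact: nu.
have Fv2 : laplacian v x2 = 0 by apply: lap0 => i; rewrite -dB; exact: nv.
have [C1 C10 HC1] := smooth_bnd (smooth_gd alpha su sv).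
have [C2 C20 HC2] := smooth_bnd (smooth_gd alpha sv su).
have [C3 C30 HC3] := smooth_bnd (smooth_gx alpha omega su sv).
have vanish x : [/\ A x = 0, B x = 0, laplacian u x = 0 & laplacian v x = 0].
  pose h := x - x2; pose s := \sum_i h 0 i * e i.
  have sl f (l : E -> R) t : smooth f -> (forall i y, partial i f y = e i * l y) ->
      isd t (1 : R) (fun t => f (x2 + t *: h)) (s * l (x2 + t *: h)).
    move=> sf H; apply: der_eq (smooth_line x2 h t sf) _.
    by rewrite /Dc mulr_suml; apply: eq_bigr => i _; rewrite H mulrA.
  have dl f g : sol alpha omega f g -> (forall i y, partial i f y = e i * Dc e f y / n) ->
      (forall i y, partial i g y = e i * Dc e g y / n) ->
      forall i y, partial i (laplacian f) y = e i * ((gd alpha f g y * Dc e f y + gx alpha omega f g y * Dc e g y) / n).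
    move=> sfg pf pg i y; have [[sf _] _ _ _ _] := sfg.
    rewrite (isd_partial (partial_laplacian i y sf)) (lin_partial i y sfg) pf pg.
    by move: (gd _ _ _ _) (gx _ _ _ _ _) (Dc _ _ _) (Dc _ _ _) (e i) => *; field; exact: nn.
  pose C := `|s| * (1 + (C1 + C2 + C3) / n).
  have k0 : 0 <= (C1 + C2 + C3) / n by rewrite divr_ge0 ?(ltW n0)// !addr_ge0.
  have C0 : 0 <= C by rewrite mulr_ge0// addr_ge0.
  (* Along a segment [A], [B] and the two Laplacians form a closed linear first order system. *)
  have := @gronwall4 (fun t => A (x2 + t *: h)) (fun t => B (x2 + t *: h))
    (fun t => laplacian u (x2 + t *: h)) (fun t => laplacian v (x2 + t *: h)) _ _ _ _ C.
  move=> /(_ _ _ _ _ (fun t => And4 (sl _ _ t sA dA) (sl _ _ t sB dB)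
    (sl _ _ t (smooth_laplacian su) (dl u v suv pu pv)) (sl _ _ t (smooth_laplacian sv) (dl v u (sol_swap suv) pv pu)))).
  rewrite scale0r addr0 => /(_ (And4 A2 B2 Fu2 Fv2) C0 _ 1); rewrite scale1r /h (addrC x2) subrK; apply.
  move=> t; set y := _ + _.
  have n0' := n0; move: (HC1 y) (HC2 y) (HC3 y) C10 C20 C30; rewrite [gx _ _ v u]gxC -/(A y) -/(B y).
  move: (A y) (B y) (laplacian u y) (laplacian v y) (gd alpha u v y) (gd alpha v u y) (gx alpha omega u v y).
  by move=> a b f g d1 d2 d3 h1 h2 h3 p1 p2 p3; exact: linearized_bounds.
have W1 : Wpot alpha omega u v x1 = 0.
  have [_ _ h1 h2] := vanish x1; have := lapB x1; rewrite h1 h2 subrr => /esym/eqP.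
  rewrite oppr_eq0 mulf_eq0 [_ - _ == 0]subr_eq0 (negbTE uv1) orbF /grow.
  case: suv => _ _ _ _ /(_ x1)[b1 b2].
  rewrite paddr_eq0 ?subr_ge0// => /andP[/eqP e1 /eqP e2].
  by rewrite /Wpot e2 -opprB e1 oppr0 expr0n !mul0r addr0.
move=> x; have := hamiltonian_const x x1; rewrite edensE /hamiltonian W1.
by have [-> -> _ _] := vanish x; have [-> -> _ _] := vanish x1; rewrite expr0n !addr0 mul0r !sub0r oppr0 => /eqP; rewrite oppr_eq0 add0r => /eqP.
Qed.

(** Moving from [x1] in the sense that increases [|u - v|], [concave_flattens] finds points where
    [A - B] and [grow] are arbitrarily small. There [A^2 + B^2 <= (A - B)^2] is small, and so is
    [Wpot], being quadratic in the two parts of [grow]. *)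
Lemma profile_hamiltonian0 x1 : u x1 != v x1 -> (forall x, A x != B x) -> forall x, hamiltonian x = 0.
Proof.
move=> uv1 AB.
have sD : smooth (fun x => A x - B x) by apply: smoothD => //; exact: smoothN.
have [s [s1 sP]] := ivt_sign (smooth_cts sD) (fun x => ltac:(by rewrite subr_eq0)) sD.
(* The sign [k] makes [f = k (u - v)] positive at [x1], and the factor [k s] in [h] makes it
   increasing. *)
pose k : R := Num.sg (u x1 - v x1).
have uvn : u x1 - v x1 != 0 by rewrite subr_eq0.
have kk : k * k = 1 by rewrite /k -expr2 sqr_sg uvn.
pose ev : E := e 0 *: ee 0 + e 1 *: ee 1 + e ord_max *: ee ord_max.
have evE i : ev 0 i = e i.
  by rewrite /ev !mxE; move: i; apply: ord3P => /=; rewrite ?mulr0 ?mulr1 ?addr0 ?add0r.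
pose h := (k * s) *: ev.
have sl f t : smooth f -> isd t (1 : R) (fun t => f (x1 + t *: h)) (k * s * Dc e f (x1 + t *: h)).
  move=> sf; apply: der_eq (smooth_line x1 h t sf) _.
  by rewrite /Dc mulr_sumr; apply: eq_bigr => i _; rewrite /h mxE evE mulrA.
have DA y : Dc e A y = n * laplacian u y.
  by rewrite /Dc -nE mulr_suml; apply: eq_bigr => i _; rewrite dA mulrA -expr2.
have DB y : Dc e B y = n * laplacian v y.
  by rewrite /Dc -nE mulr_suml; apply: eq_bigr => i _; rewrite dB mulrA -expr2.
pose f t := k * (u (x1 + t *: h) - v (x1 + t *: h)).
pose f1 t := s * (A (x1 + t *: h) - B (x1 + t *: h)).
pose f2 t := - (n * grow (x1 + t *: h) * f t).
have [Cu Cu0 HCu] := smooth_bnd su; have [Cv Cv0 HCv] := smooth_bnd sv.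
have k1 : `|k| = 1 by rewrite /k normr_sg uvn.
have fl := @concave_flattens R f f1 f2 (fun t => n * grow (x1 + t *: h)) (Cu + Cv).
have small ep : 0 < ep -> exists y, (A y - B y) ^+ 2 <= ep ^+ 2 /\ n * grow y <= ep.
  move=> ep0; case: (fl _ _ _ _ _ _ _ ep ep0).
  - move=> t; have h1 := sl u t su; have h2 := sl v t sv.
    apply: der_eq; first by rewrite /f; der.
    rewrite /= /f1 -/A -/B; move: (A _) (B _) => p q; rewrite mulr0 addr0.
    by rewrite -mulrBr !mulrA kk mul1r.
  - move=> t; have h1 := sl A t sA; have h2 := sl B t sB.
    apply: der_eq; first by rewrite /f1; der.
    rewrite /= DA DB /f2 /f; move: (lapB (x1 + t *: h)).
    move: (laplacian u _) (laplacian v _) (grow _) (u _ - v _) => p q r l pq.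
    have -> : p = q - r * l by rewrite -pq addrC subrK.
    rewrite mulr0 addr0.
    have -> : s * (k * s * (n * (q - r * l)) - k * s * (n * q)) = - (n * r * (k * l)) * (s * s) by ring.
    by rewrite s1 mulr1.
  - by [].
  - by move=> t; rewrite mulr_ge0// ltW.
  - by move=> t; exact: sP.
  - move=> t; rewrite /f normrM k1 mul1r; apply: le_trans (ler_normB _ _) _.
    exact: lerD.
  - by rewrite /f scale0r addr0 /k -normrEsg normr_gt0.
  move=> t [h1 h2]; exists (x1 + t *: h); split; last exact: ltW.
  have -> : (A (x1 + t *: h) - B (x1 + t *: h)) ^+ 2 = f1 t ^+ 2.
    by rewrite /f1 exprMn [s ^+ 2]expr2 s1 mul1r.
  by rewrite lerXn2r ?nnegrE ?(ltW ep0)// ltW// sP.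
pose K := 1 / (2 * n) + (1 / 4 + 1 / (2 * alpha)) / n ^+ 2.
have K0 : 0 < K.
  by rewrite /K addr_gt0// ?divr_gt0// ?mulr_gt0// ?exprn_gt0// addr_gt0// divr_gt0// mulr_gt0.
have Hs ep : 0 < ep -> `|hamiltonian x1| <= K * ep ^+ 2.
  move=> ep0; have [y [h1 h2]] := small ep ep0; rewrite (hamiltonian_const x1 y) /hamiltonian.
  have AB2 : 0 <= A y ^+ 2 + B y ^+ 2 <= ep ^+ 2.
    rewrite addr_ge0 ?sqr_ge0//=; apply: le_trans h1; have := sgn y.
    exact: sqr_sub_ge.
  have [_ _ _ _ /(_ y)[b1 b2]] := suv.
  have m0 : 0 <= 1 - (u y ^+ 2 + v y ^+ 2) by rewrite subr_ge0.
  have e0 : 0 <= alpha * u y * v y - omega by rewrite subr_ge0.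
  move: h2; rewrite /grow /Wpot -[u y ^+ 2 + v y ^+ 2 - 1]opprB sqrrN.
  move: (1 - _) m0 (alpha * _ * _ - omega) e0 => m m0 l l0 h2.
  move: AB2; move: (A y ^+ 2 + B y ^+ 2) => ab /andP[ab0 ab1].
  have ml : n * (m + l) <= ep by [].
  have m1 : m ^+ 2 <= (ep / n) ^+ 2.
    rewrite lerXn2r ?nnegrE ?divr_ge0 ?(ltW n0) ?(ltW ep0)// ler_pdivlMr// mulrC.
    by apply: le_trans ml; rewrite ler_pM2l// lerDl.
  have l1 : l ^+ 2 <= (ep / n) ^+ 2.
    rewrite lerXn2r ?nnegrE ?divr_ge0 ?(ltW n0) ?(ltW ep0)// ler_pdivlMr// mulrC.
    by apply: le_trans ml; rewrite ler_pM2l// lerDr.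
  have KE : K * ep ^+ 2 = ep ^+ 2 / (2 * n) + ((ep / n) ^+ 2 / 4 + (ep / n) ^+ 2 / (2 * alpha)).
    by rewrite /K; field; rewrite nn an.
  have i1 : 0 <= ab / (2 * n) <= ep ^+ 2 / (2 * n).
    by rewrite divr_ge0 ?mulr_ge0 ?(ltW n0)//= ler_pM2r// invr_gt0 mulr_gt0.
  have i2 : 0 <= l ^+ 2 / (2 * alpha) <= (ep / n) ^+ 2 / (2 * alpha).
    by rewrite divr_ge0 ?sqr_ge0 ?mulr_ge0 ?(ltW a0)//= ler_pM2r// invr_gt0 mulr_gt0.
  rewrite KE ler_norml; move: i1 i2 m1 (sqr_ge0 m); move: (ab / _) (ep ^+ 2 / _) (l ^+ 2 / _) (m ^+ 2) ((ep / n) ^+ 2).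
  by move=> p q r m2 z; move: (z / (2 * alpha)) => z2 /andP[p0 pq] /andP[r0 rz] m2z m20; apply/andP; split; lra.
move=> x; rewrite (hamiltonian_const x x1); apply/eqP; rewrite -normr_le0 leNgt; apply/negP => Hp.
pose ep := Num.min 1 (`|hamiltonian x1| / (2 * K)).
have ep0 : 0 < ep by rewrite /ep lt_min ltr01/= divr_gt0// mulr_gt0.
have := Hs ep ep0; rewrite leNgt => /negP; apply.
have ep1 : ep <= 1 by rewrite /ep ge_min lexx.
have ep2 : ep * (2 * K) <= `|hamiltonian x1| by rewrite -ler_pdivlMr ?mulr_gt0// /ep ge_min lexx orbT.
have : K * (ep * ep) <= K * (ep * 1) by rewrite !ler_pM2l.
by rewrite expr2; move: Hp ep2; lra.
Qed.

(** With zero Hamiltonian the density is [(A^2 + B^2) / n <= (A - B)^2 / n], and one factor [A - B],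
    of constant sign [s], is replaced by its bound [CD]. In the degenerate case [c = 0] works. *)
Lemma profile_edens x1 : u x1 != v x1 ->
  exists c : 'I_3 -> R, forall x, edens alpha omega u v x <= Dc c u x - Dc c v x.
Proof.
move=> uv1.
have [[x2 AB2]|AB] := pselect (exists x, A x = B x).
  exists (fun=> 0) => x; rewrite (profile_degenerate uv1 AB2).
  by rewrite /Dc !big1 ?subrr// => i _; rewrite mul0r.
have AB' x : A x != B x by apply/eqP => h; apply: AB; exists x.
have H0 := profile_hamiltonian0 uv1 AB'.
have sD : smooth (fun x => A x - B x) by apply: smoothD => //; exact: smoothN.
have [s [s1 sP]] := ivt_sign (smooth_cts sD) (fun x => ltac:(by rewrite subr_eq0)) sD.
have [CD CD0 HCD] := smooth_bnd sD.
exists (fun i => CD * s / n * e i) => x.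
have DE f : Dc (fun i => CD * s / n * e i) f x = CD * s / n * Dc e f x.
  by rewrite /Dc mulr_sumr; apply: eq_bigr => i _; rewrite mulrA.
rewrite !DE -mulrBr -/A -/B edensE.
have : Wpot alpha omega u v x = (A x ^+ 2 + B x ^+ 2) / (2 * n).
  by apply/esym/subr0_eq; exact: H0.
move=> ->; have -> : (A x ^+ 2 + B x ^+ 2) / (2 * n) + (A x ^+ 2 + B x ^+ 2) / (2 * n) = (A x ^+ 2 + B x ^+ 2) / n.
  by field; exact: nn.
have -> : CD * s / n * (A x - B x) = CD * (s * (A x - B x)) / n by ring.
rewrite ler_pM2r ?invr_gt0//.
apply: (@le_trans _ _ ((s * (A x - B x)) * (s * (A x - B x)))).
  have -> : s * (A x - B x) * (s * (A x - B x)) = (s * s) * (A x - B x) ^+ 2 by ring.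
  by rewrite s1 mul1r; apply: sqr_sub_ge; exact: sgn.
rewrite ler_pM2r//; apply: le_trans (ler_norm _) _; rewrite normrM.
have -> : `|s| = 1; last by rewrite mul1r; exact: HCD.
have : (`|s| - 1) * (`|s| + 1) = 0 by rewrite -subr_sqr expr1n sqr_normr expr2 s1 subrr.
move=> /eqP; rewrite mulf_eq0 => /orP[/eqP /subr0_eq//|/eqP h].
by have := normr_ge0 s; lra.
Qed.

End profile.

(** The direction [e] is found from [u] alone. The derivative of [u] along the orthogonal [tau]
    vanishes identically, so its linearised equation reduces to [gx * Dc tau v = 0], and [v] has the
    same direction because [gx > 0]. *)
Lemma limit_energy (alpha omega : R) u v x1 : 0 < alpha -> 0 < omega -> sol alpha omega u v ->
  flat u -> flat v -> nodal_property u -> nodal_property v ->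
  (forall x c, Dc c u x * Dc c v x <= 0) -> u x1 != v x1 ->
  exists c : 'I_3 -> R, forall x, edens alpha omega u v x <= Dc c u x - Dc c v x.
Proof.
move=> a0 om0 suv fu fv nu nv sgn uv1; have [[su sv] _ _ _ _] := suv.
have [e [e2 n0 det]] := unidirectional su fu nu.
have nE : \sum_i e i ^+ 2 = e 0 ^+ 2 + e 1 ^+ 2 by rewrite sum3E e2 expr0n addr0.
pose tau i : R := if i == 0 then - e 1 else if i == 1 then e 0 else 0.
have tauE f x : Dc tau f x = - e 1 * partial 0 f x + e 0 * partial 1 f x by exact: Dc3.
have tu : Dc tau u = fun=> 0.
  by apply/funext => x; rewrite tauE addrC mulNr; exact: det.
have tv x : Dc tau v x = 0.
  have := lin_Dc tau x suv; rewrite tu mulr0 add0r.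
  have -> : laplacian (fun=> 0 : R) x = 0.
    have p0 i : partial i (fun=> 0 : R) = fun=> 0 :> R.
      by apply/funext => y; apply: isd_partial; exact: derC.
    by rewrite /laplacian big1// => i _; rewrite !p0.
  move/esym/eqP; rewrite mulf_eq0 => /orP[|/eqP//].
  by rewrite gt_eqF// (lt_le_trans om0)//; exact: gx_ge suv x.
have dir f : flat f -> (forall x, Dc tau f x = 0) ->
    forall i x, (e 0 ^+ 2 + e 1 ^+ 2) * partial i f x = e i * Dc e f x.
  move=> ff tf i x; have := tf x; rewrite tauE (Dc3 f x (erefl (e 0)) (erefl (e 1)) e2).
  move: i; apply: ord3P; last by rewrite flat_partial3// e2 mulr0 mul0r.
    move: (partial 0 f x) (partial 1 f x) (e 0) (e 1) => p q a b h.
    by apply/eqP; rewrite -subr_eq0; apply/eqP; transitivity (- b * (- b * p + a * q)); [ring|rewrite h mulr0].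
  move: (partial 0 f x) (partial 1 f x) (e 0) (e 1) => p q a b h.
  by apply/eqP; rewrite -subr_eq0; apply/eqP; transitivity (a * (- b * p + a * q)); [ring|rewrite h mulr0].
have tu' x : Dc tau u x = 0 by rewrite tu.
exact: (profile_edens a0 suv n0 nE (dir u fu tu') (dir v fv tv) nu nv (fun x => sgn x e) uv1).
Qed.

End profile_energy.

(** * Energy growth and rigidity *)

Section energy.
Context {R : realType}.
Notation E := 'rV[R]_3.
Implicit Types (x y z h : E) (f g u v : E -> R) (i j : 'I_3) (N r t : R).

Local Opaque partial.

Definition cut3 r x : R := eta r (x 0 0) * eta r (x 0 1) * eta r (x 0 ord_max).

Definition cut3' r i x : R :=
  deta r (x 0 0) * (i == 0)%:R * eta r (x 0 1) * eta r (x 0 ord_max)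
  + eta r (x 0 0) * (deta r (x 0 1) * (i == 1)%:R) * eta r (x 0 ord_max)
  + eta r (x 0 0) * eta r (x 0 1) * (deta r (x 0 ord_max) * (i == ord_max)%:R).

Lemma cut3_cts r : cts (cut3 r) /\ forall i, cts (cut3' r i).
Proof.
have ce j := @cts_eta R r j; have cd j := @cts_deta R r j.
have c0 := ce 0; have c1 := ce 1; have c2 := ce ord_max.
have d0 := cd 0; have d1 := cd 1; have d2 := cd ord_max.
by split=> [|i]; [rewrite /cut3|rewrite /cut3']; cont.
Qed.

Lemma cut3_der r i x : isd x (ee i) (cut3 r) (cut3' r i x).
Proof.
have h0 := eta_coord r i 0 x; have h1 := eta_coord r i 1 x; have h2 := eta_coord r i ord_max x.
by apply: der_eq; [rewrite /cut3; der|rewrite /cut3' /=; ring].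
Qed.

Lemma cut3_out r x j : 0 < r -> 2 * r <= `|x 0 j| -> cut3 r x = 0 /\ forall i, cut3' r i x = 0.
Proof.
move=> r0; rewrite /cut3 /cut3'; move: j; apply: ord3P => h.
- have -> : eta r (x 0 0) = 0 by exact: eta0.
  have -> : deta r (x 0 0) = 0 by apply: deta0 => //; right.
  by split=> [|i]; ring.
- have -> : eta r (x 0 1) = 0 by exact: eta0.
  have -> : deta r (x 0 1) = 0 by apply: deta0 => //; right.
  by split=> [|i]; ring.
- have -> : eta r (x 0 ord_max) = 0 by exact: eta0.
  have -> : deta r (x 0 ord_max) = 0 by apply: deta0 => //; right.
  by split=> [|i]; ring.
Qed.

Lemma cut3_01 r x : 0 <= cut3 r x <= 1.
Proof.
rewrite /cut3 !mulr_ge0 ?eta_ge0//=.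
by rewrite !mulr_ile1 ?mulr_ge0 ?eta_ge0 ?eta_le1.
Qed.

Lemma cut3'_bnd r i x : 0 < r -> `|cut3' r i x| <= 3 / r.
Proof.
move=> r0; have d j := deta_bnd (x 0 j) r0.
have aux (a b c : R) : `|a| <= 3 / r -> 0 <= b <= 1 -> 0 <= c <= 1 -> `|a * b * c| <= 3 / r.
  move=> ha /andP[b0 b1] /andP[c0 c1]; rewrite !normrM (ger0_norm b0) (ger0_norm c0).
  apply: le_trans ha; rewrite -[leRHS]mulr1 -mulrA ler_wpM2l// mulr_ile1//.
have e01 t : 0 <= eta r t <= 1 by rewrite eta_ge0 eta_le1.
move: i; rewrite /cut3'; apply: ord3P; rewrite /= ?mulr0 ?mulr1 ?mul0r ?addr0 ?add0r.
- exact: aux.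
- by rewrite [eta r (x 0 0) * _]mulrC; exact: aux.
- by rewrite mulrC mulrA; exact: aux.
Qed.

Lemma cut3_flux r N : 0 < r -> 2 * r <= N -> II N (fun x => \sum_i `|cut3' r i x|) <= 2 * 48 ^+ 2 * r ^+ 2.
Proof.
move=> r0 rN; have N0 : 0 < N by apply: lt_le_trans rN; rewrite mulr_gt0.
have [_ c'] := cut3_cts r.
have := @II_box_le R N (fun x => \sum_i `|cut3' r i x|) (fun=> - (2 * r)) (fun=> 2 * r) (9 / r) N0.
have rn : r != 0 by rewrite gt_eqF.
have -> : 9 / r * ((2 * r - - (2 * r)) * (2 * r - - (2 * r)) * (2 * r - - (2 * r))) * 8 = 2 * 48 ^+ 2 * r ^+ 2.
  by field.
apply.
- by cont.
- by rewrite divr_ge0// ltW.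
- by move=> _; lra.
- move=> x _; apply: (@le_trans _ _ (\sum_(i < 3) 3 / r)).
    by apply: ler_sum => i _; exact: cut3'_bnd.
  by rewrite sumr_const card_ord -[leLHS]mulr_natl mulrA -natrM.
- move=> x i _; rewrite -ler_norml -ltNge => h; have [_ H] := cut3_out r0 (ltW h).
  by rewrite big1// => j _; rewrite H normr0.
Qed.

Lemma sum_split4 (a b c d : 'I_3 -> R) (p q : R) :
  \sum_i (a i + p * b i + (c i + q * d i)) = (\sum_i a i + p * \sum_i b i) + (\sum_i c i + q * \sum_i d i).
Proof. by rewrite !mulr_sumr -!big_split. Qed.

Lemma sum_lin (a b : 'I_3 -> R) (k c : R) : \sum_i k * (a i + c * b i) = k * (\sum_i a i + c * \sum_i b i).
Proof. by rewrite -mulr_sumr big_split/= -[X in _ + X]mulr_sumr. Qed.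

Section evolution.
Variables (alpha omega : R) (u v : E -> R).
Hypotheses (a0 : 0 < alpha) (muv : mono alpha omega u v).

Let suv : sol alpha omega u v := muv.1.
Let su : smooth u. Proof. by case: suv => -[]. Qed.
Let sv : smooth v. Proof. by case: suv => -[]. Qed.
Let f := edens alpha omega u v.

Lemma smooth_edens (u0 v0 : E -> R) : smooth u0 -> smooth v0 -> smooth (edens alpha omega u0 v0).
Proof.
move=> s0 s1; rewrite /edens /Wpot.
have h1 : smooth (fun x => \sum_i partial i u0 x ^+ 2).
  by apply: smooth_sum => i; apply: smoothX; exact: smooth_partial.
have h2 : smooth (fun x => \sum_i partial i v0 x ^+ 2).
  by apply: smooth_sum => i; apply: smoothX; exact: smooth_partial.
by sm.
Qed.

Lemma edens_ge x : \sum_i partial i u x ^+ 2 + \sum_i partial i v x ^+ 2 <= 2 * f x.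
Proof.
have : 0 <= Wpot alpha omega u v x.
  by rewrite /Wpot addr_ge0// divr_ge0 ?sqr_ge0// mulr_ge0// ltW.
by rewrite /f /edens; move: (\sum_i _) (\sum_i _) (Wpot _ _ _ _ _) => *; lra.
Qed.

(** The [x_3]-derivative of the energy density is the divergence of this field, by the equations. *)
Let flux i x : R := partial i u x * partial ord_max u x + partial i v x * partial ord_max v x.
Let dflux i x : R := partial i u x * partial i (partial ord_max u) x + partial ord_max u x * partial i (partial i u) x
  + (partial i v x * partial i (partial ord_max v) x + partial ord_max v x * partial i (partial i v) x).

Lemma flux_der i x : isd x (ee i) (flux i) (dflux i x).
Proof.
have h1 := smooth_isd i x (smooth_partial i su); have h2 := smooth_isd i x (smooth_partial ord_max su).
have h3 := smooth_isd i x (smooth_partial i sv); have h4 := smooth_isd i x (smooth_partial ord_max sv).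
by rewrite /flux /dflux; der.
Qed.

Lemma edens_der3 x : partial ord_max f x = \sum_i dflux i x.
Proof.
apply: isd_partial; have h0 := der_Wpot ord_max x (lt0r_neq0 a0) suv.
pose T (g : E -> R) := \sum_i partial i g x * partial i (partial ord_max g) x.
have hs (g : E -> R) : smooth g -> isd x (ee ord_max) (fun x => \sum_i partial i g x ^+ 2) (2 * T g).
  move=> sg; apply: (@der_eq R E x (ee ord_max) _
     (\sum_i 2 * partial i g x * partial ord_max (partial i g) x)).
    apply: der_sum => i; have h := smooth_isd ord_max x (smooth_partial i sg).
    by apply: der_eq; [der|rewrite expr1].
  rewrite /T mulr_sumr; apply: eq_bigr => i _; rewrite (partialC ord_max i sg); exact/esym/mulrA.
have L : \sum_i dflux i x = (T u + partial ord_max u x * laplacian u x) + (T v + partial ord_max v x * laplacian v x).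
  exact: sum_split4.
have h1 := hs u su; have h2 := hs v sv; rewrite L.
apply: der_eq; first by rewrite /f /edens; der.
move: (T u) (T v) (laplacian u x) (laplacian v x) (partial ord_max u x) (partial ord_max v x) => * /=.
by field.
Qed.

(** Translating changes the energy by a boundary flux, at most [C] times the integral of
    [|grad cut3|] against [d_3 u - d_3 v]; the signs make the latter the derivative of [u - v]. So
    the energy plus [s C Sf] is nondecreasing along the translation. Since [|u - v| <= 1] and the
    integral of [|grad cut3|] is [O(r^2)], the correction is [O(r^2)] for all [n] at once. *)
Lemma energy_growth : exists2 C, 0 <= C & forall r N, 0 < r -> 2 * r <= N ->
  forall s (n : nat), (s = 1 \/ s = -1) ->
  II N (fun x => cut3 r x * f x) <= II N (fun x => cut3 r x * f (x + up s n)) + C * r ^+ 2.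
Proof.
have [C1 C10 HC1] := @smooth_bnd_family R 'I_3 (fun i => partial i u) (fun i => smooth_partial i su).
have [C2 C20 HC2] := @smooth_bnd_family R 'I_3 (fun i => partial i v) (fun i => smooth_partial i sv).
pose C := C1 + C2; have C0 : 0 <= C by rewrite addr_ge0.
exists (2 * C * (2 * 48 ^+ 2)); first by rewrite !mulr_ge0// exprn_ge0.
move=> r N r0 rN s n s1; have N0 : 0 < N by apply: lt_le_trans rN; rewrite mulr_gt0.
have ss : s * s = 1 by case: s1 => ->; rewrite ?mulrNN mulr1.
have [cc cc'] := cut3_cts r.
pose psi x := \sum_i `|cut3' r i x|; have cpsi : cts psi by rewrite /psi; cont.
pose h : E := s *: ee ord_max.
pose d x := u x - v x; have sd : smooth d by apply: smoothD => //; exact: smoothN.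
have sf : smooth f by exact: smooth_edens.
have pd x : partial ord_max d x = partial ord_max u x - partial ord_max v x.
  apply: isd_partial; have h1 := smooth_isd ord_max x su; have h2 := smooth_isd ord_max x sv.
  by rewrite /d; der.
have Dh (g : E -> R) x : Dc (fun i => h 0 i) g x = s * partial ord_max g x.
  rewrite -(sumd ord_max (fun i => partial i g x)) mulr_sumr; apply: eq_bigr => i _.
  by rewrite /h mxE eeE; ring.
pose Ef t := II N (fun x => cut3 r x * f (x + t *: h)).
pose Sf t := II N (fun x => psi x * d (x + t *: h)).
pose G1 t := II N (fun x => cut3 r x * Dc (fun i => h 0 i) f (x + t *: h))
   + s * C * II N (fun x => psi x * Dc (fun i => h 0 i) d (x + t *: h)).
have cS (g : E -> R) t : smooth g -> cts (fun x => g (x + t *: h)).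
  by move=> sg; apply: smooth_cts; exact: smooth_shift.
have G1pos t : 0 <= G1 t.
  have sDf := smooth_Dc (fun i => h 0 i) sf; have sDd := smooth_Dc (fun i => h 0 i) sd.
  have cDf := cS _ t sDf; have cDd := cS _ t sDd.
  have cfd : cts (fun x => cut3 r x * Dc (fun i => h 0 i) f (x + t *: h)) by apply: ctsM.
  have cdd : cts (fun x => psi x * Dc (fun i => h 0 i) d (x + t *: h)) by apply: ctsM.
  have IIm : - II N (fun x => cut3 r x * Dc (fun i => h 0 i) f (x + t *: h)) <=
      s * C * II N (fun x => psi x * Dc (fun i => h 0 i) d (x + t *: h)); last first.
    by rewrite /G1 -lerBlDl sub0r.
  rewrite -mulN1r -(IIZ _ N0 cfd) -(IIZ _ N0 cdd).
  have sfl i : smooth (flux i).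
    have p1 := smooth_partial i su; have p2 := smooth_partial i sv.
    have p3 := smooth_partial ord_max su; have p4 := smooth_partial ord_max sv.
    exact: (smoothD (smoothM p1 p3) (smoothM p2 p4)).
  have cfl i := cS _ t (sfl i).
  have sdfl i : smooth (dflux i).
    have p1 := smooth_partial i su; have p2 := smooth_partial i sv.
    have p3 := smooth_partial ord_max su; have p4 := smooth_partial ord_max sv.
    have q1 := smooth_partial i p1; have q2 := smooth_partial i p2.
    have q3 := smooth_partial i p3; have q4 := smooth_partial i p4.
    exact: (smoothD (smoothD (smoothM p1 q3) (smoothM p3 q1)) (smoothD (smoothM p2 q4) (smoothM p4 q2))).
  have cdfl i := cS _ t (sdfl i).
  apply: (@II_le_div R N _ _ (fun i x => - s * (cut3 r x * flux i (x + t *: h)))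
    (fun i x => - s * (cut3' r i x * flux i (x + t *: h) + cut3 r x * dflux i (x + t *: h)))) => //.
  - by apply: ctsM => //; exact: ctsC.
  - by apply: ctsM => //; exact: ctsC.
  - by move=> i; apply: ctsM; [exact: ctsC|apply: ctsD; apply: ctsM].
  - move=> i x; have h1 := cut3_der r i x.
    have h2 : isd x (ee i) (fun x => flux i (x + t *: h)) (dflux i (x + t *: h)).
      have -> : (fun x => flux i (x + t *: h)) = fun x => flux i (t *: h + x).
        by apply/funext => y; rewrite addrC.
      by apply: der_shift; rewrite addrC; exact: flux_der.
    by apply: der_eq; [der|rewrite /=; ring].
  - move=> i x bx xi; have rx : 2 * r <= `|x 0 i| by rewrite xi.
    by have [-> _] := cut3_out r0 rx; rewrite mul0r mulr0.
  move=> x _; rewrite !Dh pd edens_der3; set y := x + _.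
  rewrite (sum_lin (fun i => cut3' r i x * flux i y) (fun i => dflux i y)).
  have [_ m] := muv; have [m1 m2] := m y.
  have p0 : 0 <= partial ord_max u y - partial ord_max v y by rewrite subr_ge0; exact: (le_trans (ltW m2) (ltW m1)).
  have b i : s * (cut3' r i x * flux i y) <= `|cut3' r i x| * (C * (partial ord_max u y - partial ord_max v y)).
    apply: le_trans (ler_norm _) _; rewrite normrM.
    have -> : `|s| = 1 by case: s1 => ->; rewrite ?normrN normr1.
    rewrite mul1r normrM ler_wpM2l//; apply: le_trans (ler_normD _ _) _.
    rewrite !normrM (gtr0_norm m1) (ltr0_norm m2) mulrBr -mulrN.
    by apply: lerD; rewrite ler_wpM2r ?(ltW m1)// ?oppr_ge0 ?(ltW m2)// /C; [apply: le_trans (HC1 i y) _|apply: le_trans (HC2 i y) _]; rewrite ?lerDl ?lerDr.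
  have bs : s * \sum_i cut3' r i x * flux i y <= psi x * (C * (partial ord_max u y - partial ord_max v y)).
    by rewrite mulr_sumr /psi mulr_suml; apply: ler_sum => i _; exact: b.
  move: bs; move: (psi x) (\sum_i cut3' r i x * _) (\sum_i dflux i y) (partial ord_max u y - _) (cut3 r x).
  move=> ps a b' p c bs.
  have -> : s * C * (ps * (s * p)) = (s * s) * (ps * (C * p)) by ring.
  by rewrite ss mul1r; move: bs; lra.
have dG t : isd t (1 : R) (fun t => Ef t + s * C * Sf t) (G1 t).
  have h1 : isd t (1 : R) Ef (II N (fun x => cut3 r x * Dc (fun i => h 0 i) f (x + t *: h))) by exact: II_param.
  have h2 : isd t (1 : R) Sf (II N (fun x => psi x * Dc (fun i => h 0 i) d (x + t *: h))) by exact: II_param.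
  by apply: der_eq; [der|rewrite /G1 mulr0 addr0].
have := @nonincr_of_derive R (fun t => - (Ef t + s * C * Sf t)) (fun t => - G1 t) (fun t => derN (dG t)) _ 0 n%:R.
move=> /(_ _ (ler0n _ n)); rewrite lerN2 => H.
have {H} : Ef 0 + s * C * Sf 0 <= Ef n%:R + s * C * Sf n%:R by apply: H => t; rewrite oppr_le0.
have -> : Ef 0 = II N (fun x => cut3 r x * f x).
  by congr (II _ _); apply/funext => x; rewrite scale0r addr0.
have -> : Ef n%:R = II N (fun x => cut3 r x * f (x + up s n)).
  by congr (II _ _); apply/funext => x; rewrite /h scalerA [n%:R * s]mulrC.
have Sb t : `|Sf t| <= II N psi.
  apply: II_norm => //; first by apply: ctsM => //; exact: cS.
  move=> x; have ps0 : 0 <= psi x by rewrite sumr_ge0.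
  rewrite normrM (ger0_norm ps0) ler_piMr// /d.
  have [l1 l2] := sol_le1 suv (x + t *: h); have [_ /(_ (x + t *: h)) u0 /(_ (x + t *: h)) v0 _ _] := suv.
  by rewrite ler_norml; move: l1 l2 u0 v0; move: (u _) (v _) => *; apply/andP; split; lra.
have fl := cut3_flux r0 rN; rewrite -/psi in fl.
have : `|s * C * Sf n%:R - s * C * Sf 0| <= 2 * C * II N psi.
  have sn : `|s| = 1 by case: s1 => ->; rewrite ?normrN normr1.
  rewrite -mulrBr normrM normrM sn mul1r (ger0_norm C0) [2 * C]mulrC -mulrA ler_wpM2l//.
  by apply: le_trans (ler_normB _ _) _; have := Sb n%:R; have := Sb 0; lra.
have : 2 * C * II N psi <= 2 * C * (2 * 48 ^+ 2 * r ^+ 2) by rewrite ler_wpM2l// mulr_ge0.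
rewrite [2 * C * (_ * r ^+ 2)]mulrA.
move: (II N psi) (II N _) (II N _) (s * C * Sf n%:R) (s * C * Sf 0) (2 * C * (2 * 48 ^+ 2) * r ^+ 2) (2 * C * _).
move=> p a b c d' e k k1 k2; have := ler_norm (c - d').
by move: k1 k2; lra.
Qed.

End evolution.
End energy.

(** * Quadratic energy growth and rigidity *)

Section energy_bound.
Context {R : realType}.
Notation E := 'rV[R]_3.
Implicit Types (x y z h : E) (f g u v : E -> R) (i j : 'I_3) (N r t : R).

Local Opaque partial.

Lemma cts_near f x (m : R) : cts f -> m < f x ->
  exists2 d, 0 < d & forall y, (forall j, `|y 0 j - x 0 j| <= d) -> m <= f y.
Proof.
move=> cf mf; have fm : 0 < f x - m by rewrite subr_gt0.
have /(@cvgrPdist_le R R E (nbhs x) (nbhs_filter x)) /(_ _ fm) /nbhs_ballP[e /= e0 He] := cf x.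
exists (e / 2); first by rewrite divr_gt0.
move=> y hy; have /He : ball x e y.
  by split=> // j k; rewrite /ball/= ord1 distrC (le_lt_trans (hy k))// ltr_pdivrMr// ltr_pMr// ltr1n.
by rewrite ler_norml => /andP[_]; rewrite lerD2l lerN2.
Qed.

Variables (alpha omega : R) (u v : E -> R).
Hypotheses (om0 : 0 < omega) (al : omega < alpha / 2) (muv : mono alpha omega u v).

Let a0 : 0 < alpha. Proof. by have := om0; have := al; lra. Qed.
Let suv : sol alpha omega u v := muv.1.
Let su : smooth u. Proof. by case: suv => -[]. Qed.
Let sv : smooth v. Proof. by case: suv => -[]. Qed.

Lemma limits_along s : s = 1 \/ s = -1 -> exists ub vb, [/\ tends (up s) u ub, tends (up s) v vb,
  flat ub /\ flat vb, forall x, 0 <= s * (ub x - u x) & forall x, 0 <= s * (v x - vb x)].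
Proof.
have [_ m] := muv; have mu x : 0 < partial ord_max u x by have [] := m x.
have snv : smooth (fun x => - v x) by exact: smoothN.
have mv x : 0 < partial ord_max (fun x => - v x) x.
  by rewrite partialN// oppr_gt0; have [] := m x.
move=> s1; have [ub [t1 f1 l1]] := lim_line s1 su (or_introl mu).
have [vb [t2 f2 l2]] := lim_line s1 snv (or_introl mv).
exists ub, (fun x => - vb x); split=> //.
- move=> x; rewrite (_ : (fun n => v (x + up s n)) = fun n => - - v (x + up s n)).
    by apply: cvgN; exact: t2.
  by apply/funext => n; rewrite opprK.
- by split=> // x t; rewrite f2.
- exact: l1.
- by move=> x; have := l2 mv x; have -> : vb x - - v x = v x - - vb x by ring.
Qed.

(** If the components agreed in both limits, monotonicity would give [u <= ub = vb <= v] from one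
    end and [v <= vb' = ub' <= u] from the other. Then [u] equals [ub], which does not depend on
    [x_3], against [d_3 u > 0]. *)
Lemma limit_profile : exists s ub vb x1, [/\ s = 1 \/ s = -1, tends (up s) u ub, tends (up s) v vb,
  flat ub /\ flat vb & ub x1 != vb x1].
Proof.
have [_ m] := muv; have mu x : 0 < partial ord_max u x by have [] := m x.
have lim := limits_along.
have [ub [vb [t1 t2 f12 l1 l2]]] := lim 1 (or_introl erefl).
have [[x1 x1P]|e1] := pselect (exists x, ub x != vb x).
  by exists 1, ub, vb, x1; split=> //; left.
have [ub' [vb' [t1' t2' f12' l1' l2']]] := lim (-1) (or_intror erefl).
have [[x1 x1P]|e2] := pselect (exists x, ub' x != vb' x).
  by exists (-1), ub', vb', x1; split=> //; right.
exfalso.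
have e1' x : ub x = vb x by apply/eqP/negPn/negP => h; apply: e1; exists x.
have e2' x : ub' x = vb' x by apply/eqP/negPn/negP => h; apply: e2; exists x.
have uE : u = ub.
  apply/funext => x; have := l1 x; have := l2 x; have := l1' x; have := l2' x.
  rewrite (e1' x) (e2' x); move: (u x) (v x) (vb x) (vb' x) => p q r l h1 h2 h3 h4.
  by apply/eqP; rewrite eq_le; apply/andP; split; lra.
by have := mu 0; rewrite uE flat_partial3 ?ltxx//; case: f12.
Qed.

Lemma tends_edens a ub vb : tends a u ub -> tends a v vb ->
  tends a (edens alpha omega u v) (edens alpha omega ub vb).
Proof.
move=> tu tv.
have h1 : tends a (fun x => \sum_i partial i u x ^+ 2) (fun x => \sum_i partial i ub x ^+ 2).
  by apply: tends_sum => i; apply: tendsX; exact: tends_partial.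
have h2 : tends a (fun x => \sum_i partial i v x ^+ 2) (fun x => \sum_i partial i vb x ^+ 2).
  by apply: tends_sum => i; apply: tendsX; exact: tends_partial.
have h3 : tends a (fun x => u x ^+ 2 + v x ^+ 2 - 1) (fun x => ub x ^+ 2 + vb x ^+ 2 - 1).
  by apply: tendsD; [apply: tendsD; exact: tendsX|exact: tendsC].
have h4 : tends a (fun x => alpha * u x * v x - omega) (fun x => alpha * ub x * vb x - omega).
  by apply: tendsD; [apply: tendsM => //; apply: tendsM => //|]; exact: tendsC.
have h5 := tendsX (n := 2) h3; have h6 := tendsX (n := 2) h4.
apply: tendsD; first by apply: tendsM; [exact: tendsD|exact: tendsC].
by apply: tendsD; apply: tendsM => //; exact: tendsC.
Qed.

Lemma energy_bound : exists2 C, 0 <= C & forall r N, 1 <= r -> 2 * r <= N ->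
  II N (fun x => cut3 r x * edens alpha omega u v x) <= C * r ^+ 2.
Proof.
have [C C0 HC] := energy_growth a0 muv.
have [s [ub [vb [x1 [s1 tu tv [fu fv] uv1]]]]] := limit_profile.
have suvb := limit_sol om0 suv tu tv; have [[sub svb] ub0 vb0 _ _] := suvb.
have nu : nodal_property ub.
  by move=> x c i; have [] := limit_nodal om0 al muv tu tv fu fv x c i.
have nv : nodal_property vb.
  by move=> x c i; have [] := limit_nodal om0 al muv tu tv fu fv x c i.
have sgn x c : Dc c ub x * Dc c vb x <= 0 by exact: limit_sign om0 muv tu tv fu fv x c.
have [c Hc] := limit_energy a0 om0 suvb fu fv nu nv sgn uv1.
pose Cc := \sum_i `|c i|; have Cc0 : 0 <= Cc by rewrite sumr_ge0.
exists (C + (Cc * (2 * 48 ^+ 2) + 1)); first by rewrite !addr_ge0// mulr_ge0// mulr_ge0// exprn_ge0.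
move=> r N r1 rN; have r0 : 0 < r by apply: lt_le_trans r1.
have N0 : 0 < N by apply: lt_le_trans rN; rewrite mulr_gt0.
have [cc cc'] := cut3_cts r.
have se := smooth_edens alpha omega su sv; have seb := smooth_edens alpha omega sub svb.
have k0 : 0 < (2 * N) ^+ 3 by rewrite exprn_gt0// mulr_gt0.
have k1 : 0 < ((2 * N) ^+ 3)^-1 by rewrite invr_gt0.
(* Closeness up to the inverse volume of [box N] makes the total error at most 1, and [r >= 1]
   absorbs it into [r^2]. *)
have [n _ /(_ n (leqnn n)) Hn] := tends_uniform N se (tends_edens tu tv) k1.
rewrite mulrDl addrC; apply: le_trans (HC r N r0 rN s n s1) _; rewrite lerD2r.
have ces : cts (fun x => edens alpha omega u v (x + up s n)) by apply: smooth_cts; exact: smooth_shift.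
have ceb : cts (edens alpha omega ub vb) by exact: smooth_cts.
have c1 : cts (fun x => cut3 r x * edens alpha omega ub vb x) by apply: ctsM.
have st1 : II N (fun x => cut3 r x * edens alpha omega u v (x + up s n)) <=
    II N (fun x => cut3 r x * edens alpha omega ub vb x) + 1.
  rewrite -[X in _ + X](mulfV (lt0r_neq0 k0)) -(IIC ((2 * N) ^+ 3)^-1 N0) -IID//; last exact: ctsC.
  apply: II_le => //; [by apply: ctsM|by apply: ctsD => //; exact: ctsC|].
  move=> x bx; have := Hn x bx; have /andP[h0 h1] := cut3_01 r x; rewrite ler_norml => /andP[_ h2].
  apply: (@le_trans _ _ (cut3 r x * (edens alpha omega ub vb x + ((2 * N) ^+ 3)^-1))).
    by rewrite ler_wpM2l// -lerBlDl.
  by rewrite mulrDr lerD2l ler_piMl// ltW.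
apply: le_trans st1 _; rewrite mulrDl mul1r; apply: lerD; last by rewrite exprn_ege1.
have fl := cut3_flux r0 rN.
apply: (@le_trans _ _ (Cc * II N (fun x => \sum_i `|cut3' r i x|))); last first.
  by rewrite -mulrA ler_wpM2l.
have cp : cts (fun x => \sum_i `|cut3' r i x|) by cont.
rewrite -IIZ//.
pose d x := ub x - vb x; have sd : smooth d by apply: smoothD => //; exact: smoothN.
have dd i x : isd x (ee i) d (partial i ub x - partial i vb x).
  have h1 := smooth_isd i x sub; have h2 := smooth_isd i x svb.
  by rewrite /d; der.
have cd : cts d by exact: smooth_cts.
have cdi i : cts (fun x => partial i ub x - partial i vb x).
  by apply: smooth_cts; apply: smoothD; [|apply: smoothN]; exact: smooth_partial.
apply: (@II_le_div R N _ _ (fun i x => c i * (cut3 r x * d x))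
   (fun i x => c i * (cut3' r i x * d x + cut3 r x * (partial i ub x - partial i vb x)))) => //.
- by apply: ctsM => //; exact: ctsC.
- by move=> i; apply: ctsM; [exact: ctsC|apply: ctsD; apply: ctsM].
- move=> i x; have h1 := cut3_der r i x; have h2 := dd i x.
  by apply: der_eq; [der|rewrite /=; ring].
- move=> i x bx xi; have rx : 2 * r <= `|x 0 i| by rewrite xi.
  by have [-> _] := cut3_out r0 rx; rewrite mul0r mulr0.
move=> x _.
have -> : \sum_i c i * (cut3' r i x * d x + cut3 r x * (partial i ub x - partial i vb x)) =
    \sum_i c i * (cut3' r i x * d x) + cut3 r x * (Dc c ub x - Dc c vb x).
  by rewrite /Dc !sum3E; ring.
have d1 : `|d x| <= 1.
  have [l1 l2] := sol_le1 suvb x; have := ub0 x; have := vb0 x.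
  by rewrite ler_norml /d; move: l1 l2; move: (ub x) (vb x) => *; apply/andP; split; lra.
have b : - (Cc * \sum_i `|cut3' r i x|) <= \sum_i c i * (cut3' r i x * d x).
  rewrite lerNl -sumrN mulr_sumr; apply: ler_sum => i _.
  apply: le_trans (ler_norm _) _; rewrite normrN !normrM.
  apply: ler_pM => //.
    by rewrite /Cc (bigD1 i)//= lerDl sumr_ge0.
  by rewrite ler_piMr.
have b2 : cut3 r x * edens alpha omega ub vb x <= cut3 r x * (Dc c ub x - Dc c vb x).
  by rewrite ler_wpM2l//; have /andP[] := cut3_01 r x.
by apply: le_trans b2 _; rewrite addrA lerDr -lerBlDl sub0r.
Qed.

Definition log3 (K : nat) x : R := K%:R^-1 * \sum_(k < K) cut3 (2 ^+ k.+1) x.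
Definition log3' (K : nat) i x : R := K%:R^-1 * \sum_(k < K) cut3' (2 ^+ k.+1) i x.

Lemma log3_test (K : nat) N : 2 ^+ K.+2 <= N -> test N (log3 K) (log3' K).
Proof.
move=> KN; split.
- rewrite /log3; apply: ctsM; first exact: ctsC.
  by apply: cts_sum => k; exact: (cut3_cts (2 ^+ k.+1)).1.
- move=> i; rewrite /log3'; apply: ctsM; first exact: ctsC.
  by apply: cts_sum => k; exact: ((cut3_cts (2 ^+ k.+1)).2 i).
- move=> i x; apply: der_eq.
    apply: derM; first exact: derC.
    by apply: der_sum => k; exact: cut3_der.
  by rewrite mulr0 addr0.
- move=> i x _ xi; rewrite /log3 big1 ?mulr0// => k _.
  have h : 2 * 2 ^+ k.+1 <= `|x 0 i|.
    rewrite xi; apply: le_trans KN; rewrite -exprS ler_weXn2l ?ler1n// !ltnS ltnW// ltn_ord.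
  by have [] := cut3_out (p2 _) h.
Qed.

Lemma log3'_sqr (K : nat) i x : log3' K i x ^+ 2 = K%:R ^- 2 * \sum_(k < K) cut3' (2 ^+ k.+1) i x ^+ 2.
Proof.
rewrite /log3' exprMn exprVn; congr (_ * _).
pose F (k : nat) : R := if i == 0 then eta (2 ^+ k.+1) (x 0 1) * eta (2 ^+ k.+1) (x 0 ord_max)
  else if i == 1 then eta (2 ^+ k.+1) (x 0 0) * eta (2 ^+ k.+1) (x 0 ord_max)
  else eta (2 ^+ k.+1) (x 0 0) * eta (2 ^+ k.+1) (x 0 1).
have FE (k : nat) : cut3' (2 ^+ k.+1) i x = deta (2 ^+ k.+1) (x 0 i) * F k.
  rewrite /cut3' /F; clear F; move: i; apply: ord3P => /=; ring.
under eq_bigr do rewrite FE; under [RHS]eq_bigr do rewrite FE.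
exact: deta_disjoint_ord.
Qed.

(** The squared gradient is dominated by a larger cutoff, since [energy_bound] is stated for
    integrals against [cut3]. *)
Lemma cut3'_le r i x : 0 < r -> cut3' r i x ^+ 2 <= 9 / r ^+ 2 * cut3 (2 * r) x.
Proof.
move=> r0; have rr : 0 < 2 * r by rewrite mulr_gt0.
have k0 : 0 <= 9 / r ^+ 2 by rewrite divr_ge0// sqr_ge0.
have [[j jr]|H] := pselect (exists j, 2 * r <= `|x 0 j|).
  have [_ ->] := cut3_out r0 jr; rewrite expr0n mulr_ge0//.
  by have /andP[] := cut3_01 (2 * r) x.
have lt j : `|x 0 j| <= 2 * r by rewrite leNgt; apply/negP => h; apply: H; exists j; exact: ltW.
rewrite /cut3 !eta1// !mulr1.
have -> : 9 / r ^+ 2 = (3 / r) ^+ 2 by field; rewrite gt_eqF.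
by rewrite -[leLHS]sqr_normr lerXn2r ?nnegrE ?divr_ge0 ?(ltW r0)// cut3'_bnd.
Qed.

(** At each scale the [O(r^2)] energy cancels the [r^-2] of the squared gradient; [K] scales with
    weight [K^-2] leave [C / K]. *)
Lemma log3_energy i : exists2 C, 0 <= C & forall (K : nat), (0 < K)%N ->
  II (2 ^+ K.+2) (fun x => 4 * \sum_j log3' K j x ^+ 2 *
     (Dc (fun j => (i == j)%:R) u x ^+ 2 + Dc (fun j => (i == j)%:R) v x ^+ 2)) <= C / K%:R.
Proof.
have [C C0 HC] := energy_bound; exists (4 * 6 ^+ 3 * C); first by rewrite !mulr_ge0// exprn_ge0.
move=> K K0; have K0' : 0 < K%:R :> R by rewrite ltr0n.
set N := 2 ^+ K.+2; have N0 : 0 < N by exact: p2.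
rewrite !Dc_delta.
have se := smooth_edens alpha omega su sv; have ce := smooth_cts se.
have cu : cts (partial i u) by apply: smooth_cts; exact: smooth_partial.
have cv : cts (partial i v) by apply: smooth_cts; exact: smooth_partial.
have [_ cl _ _] := @log3_test K N (lexx _).
pose J (k : 'I_K) x := cut3 (2 * 2 ^+ k.+1) x * edens alpha omega u v x.
have cJ k : cts (J k) by apply: ctsM => //; exact: (cut3_cts (2 * 2 ^+ k.+1)).1.
pose w (k : 'I_K) : R := 6 ^+ 3 * K%:R ^- 2 / (2 ^+ k.+1) ^+ 2.
have cwJ (k : 'I_K) : cts (fun x => w k * J k x) by apply: ctsM; [exact: ctsC|exact: cJ].
apply: (@le_trans _ _ (II N (fun x => \sum_(k < K) w k * J k x))).
  apply: II_le => //; [by cont|by apply: cts_sum|].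
  move=> x _; have ge := @edens_ge R alpha omega u v a0 x.
  have ui : partial i u x ^+ 2 + partial i v x ^+ 2 <= 2 * edens alpha omega u v x.
    apply: le_trans ge; apply: lerD; rewrite [leRHS](bigD1 i)//= lerDl sumr_ge0// => j _; exact: sqr_ge0.
  have e0 : 0 <= 2 * edens alpha omega u v x by apply: le_trans ui; rewrite addr_ge0// sqr_ge0.
  rewrite mulr_sumr.
  apply: (@le_trans _ _ (\sum_(j < 3) \sum_(k < K) 4 * (K%:R ^- 2 * (9 / (2 ^+ k.+1) ^+ 2 * cut3 (2 * 2 ^+ k.+1) x) * (2 * edens alpha omega u v x)))).
    apply: ler_sum => j _; rewrite -mulr_sumr ler_pM2l// -mulr_suml.
    apply: ler_pM; [exact: sqr_ge0|by rewrite addr_ge0// sqr_ge0| |exact: ui].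
    rewrite log3'_sqr -mulr_sumr ler_pM2l ?invr_gt0 ?exprn_gt0//; apply: ler_sum => k _.
    by apply: cut3'_le; exact: p2.
  rewrite sumr_const card_ord -[leLHS]mulr_natl mulr_sumr le_eqVlt; apply/orP; left; apply/eqP.
  apply: eq_bigr => k _; rewrite /w /J; move: (cut3 _ x) (edens _ _ _ _ x) (K%:R ^- 2) ((2 ^+ k.+1) ^+ 2)^-1.
  by move=> *; ring.
rewrite II_sum//.
apply: (@le_trans _ _ (\sum_(k < K) 4 * 6 ^+ 3 * C * K%:R ^- 2)); last first.
  rewrite sumr_const card_ord -mulr_natr le_eqVlt; apply/orP; left; apply/eqP.
  by field; rewrite gt_eqF.
apply: ler_sum => k _; rewrite IIZ//.
have w0 : 0 <= w k by rewrite /w !divr_ge0 ?mulr_ge0 ?invr_ge0 ?exprn_ge0.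
have h1 : 1 <= 2 * 2 ^+ k.+1 :> R by rewrite -exprS exprn_ege1// ler1n.
have h2 : 2 * (2 * 2 ^+ k.+1) <= N.
  by rewrite -!exprS /N ler_weXn2l ?ler1n// !ltnS ltn_ord.
apply: le_trans (ler_wpM2l w0 (HC _ _ h1 h2)) _; rewrite /w le_eqVlt; apply/orP; left; apply/eqP.
have pn : (2 ^+ k.+1 : R) != 0 by rewrite gt_eqF// p2.
have Kn : (K%:R : R) != 0 by rewrite gt_eqF.
by move: (2 ^+ k.+1 : R) (K%:R : R) pn Kn => a b an bn; field; rewrite an bn.
Qed.

(** A positive value at 0 would keep the integral over a fixed small box bounded below, while the
    right-hand side of the Caccioppoli inequality tends to 0. Other points follow by translation. *)
Lemma efun_zero i : efun alpha omega u v (fun j => (i == j)%:R) 0 = 0.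
Proof.
set c := (fun j => _); set f := efun _ _ _ _ _.
have cf : cts f by exact: (efun_cts (c := c) muv).
have f0 x : 0 <= f x.
  have [h _ _ _] := efun_ge om0 muv c x; apply: le_trans h.
  by rewrite sumr_ge0// => j _; rewrite sqr_ge0.
apply/eqP; rewrite eq_le f0 andbT leNgt; apply/negP => fp.
have f2 : f 0 / 2 < f 0 by rewrite ltr_pdivrMr// ltr_pMr// ltr1n.
have [d d0 Hd] := cts_near cf f2.
pose b := Num.min d 1; have b0 : 0 < b by rewrite /b lt_min d0 ltr01.
have b1 : b <= 1 by rewrite /b ge_min lexx orbT.
have bd : b <= d by rewrite /b ge_min lexx.
have [C C0 HC] := log3_energy i.
pose m := f 0 / 2 * b ^+ 3; have m0 : 0 < m by rewrite mulr_gt0 ?divr_gt0// exprn_gt0.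
pose K := (Num.truncn (C / m)).+1.
have K0 : 0 < K%:R :> R by rewrite ltr0n.
have CK : C / K%:R < m.
  rewrite ltr_pdivrMr// [ltRHS]mulrC -ltr_pdivrMr//; exact: truncnS_gt.
set N : R := 2 ^+ K.+2; have N0 : 0 < N by exact: p2.
have N1 : 1 <= N by rewrite exprn_ege1// ler1n.
have tz := @log3_test K N (lexx _); have [cl _ _ _] := tz.
have up := le_trans (efun_energy muv c N0 tz) (HC K isT).
have := @II_box_ge R N (fun x => log3 K x ^+ 2 * f x) (fun=> - b) (fun=> b) (f 0 / 2) N0.
have -> : f 0 / 2 * ((b - - b) * (b - - b) * (b - - b)) / 8 = m by rewrite /m; field.
move=> H; have := le_lt_trans up CK; rewrite ltNge => /negP; apply; apply: H.
- by cont.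
- by rewrite divr_ge0.
- by move=> _; lra.
- by move=> _; lra.
- by move=> _; lra.
- by move=> x _; rewrite mulr_ge0// sqr_ge0.
move=> x Hx; have hx j : `|x 0 j| <= b by rewrite ler_norml.
have -> : log3 K x = 1.
  rewrite /log3 (eq_bigr (fun=> 1)); first by rewrite sumr_const card_ord mulVf// gt_eqF.
  move=> k _; have h j : `|x 0 j| <= 2 ^+ k.+1.
    by apply: le_trans (hx j) (le_trans b1 _); rewrite exprn_ege1// ler1n.
  by rewrite /cut3 !eta1 ?p2// !mulr1.
rewrite expr1n mul1r; apply: Hd => j; rewrite mxE subr0; exact: le_trans (hx j) bd.
Qed.

(** The first conclusion makes [d_i u / d_3 u] stationary; the second transfers the ratio to [v], so
    the remainder of [v] is not recorded. *)
Lemma rigidity i : (forall j, lremu u (partial i u) j 0 = 0) /\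
  partial i u 0 * neg3 v 0 + partial i v 0 * partial ord_max u 0 = 0.
Proof.
have z := efun_zero i; have [h1 _ _ h4] := efun_ge om0 muv (fun j => (i == j)%:R) 0.
rewrite z !Dc_delta in h1 h4; split.
  move=> j; apply/eqP; rewrite -sqrf_eq0 eq_le sqr_ge0 andbT; apply: le_trans h1.
  by rewrite (bigD1 j)//= lerDl sumr_ge0// => k _; rewrite sqr_ge0.
apply/eqP; rewrite -sqrf_eq0 eq_le sqr_ge0 andbT leNgt; apply/negP => h.
have g0 : 0 < gx alpha omega u v 0 by apply: lt_le_trans om0 _; exact: gx_ge.
by have := h4 (mulr_gt0 g0 h); rewrite ltxx.
Qed.

End energy_bound.

(** * The one-dimensional profile *)

Section symmetry.
Context {R : realType}.
Notation E := 'rV[R]_3.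
Implicit Types (x y z h : E) (f g u v : E -> R) (i j : 'I_3) (N r t : R).

Local Opaque partial.

Lemma cvg_pair_pinfty (U V : R -> R) (a b : R) :
  (forall e, 0 < e -> exists T, forall t, T <= t -> `|a - U t| <= e /\ `|b - V t| <= e) ->
  (U t, V t) @[t --> +oo] --> (a, b).
Proof.
move=> H.
have hU : U t @[t --> +oo] --> a.
  apply/cvgrPdist_le => e e0; have [T HT] := H e e0; near=> t.
  have tT : T <= t by near: t; exact: nbhs_pinfty_ge (num_real T).
  by have [] := HT t tT.
have hV : V t @[t --> +oo] --> b.
  apply/cvgrPdist_le => e e0; have [T HT] := H e e0; near=> t.
  have tT : T <= t by near: t; exact: nbhs_pinfty_ge (num_real T).
  by have [] := HT t tT.
exact: (cvg_pair hU hV).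
Unshelve. all: by end_near. Qed.

Lemma cvg_pair_ninfty (U V : R -> R) (a b : R) :
  (forall e, 0 < e -> exists T, forall t, t <= T -> `|a - U t| <= e /\ `|b - V t| <= e) ->
  (U t, V t) @[t --> -oo] --> (a, b).
Proof.
move=> H.
have hU : U t @[t --> -oo] --> a.
  apply/cvgrPdist_le => e e0; have [T HT] := H e e0; near=> t.
  have tT : t <= T by near: t; exact: nbhs_ninfty_le (num_real T).
  by have [] := HT t tT.
have hV : V t @[t --> -oo] --> b.
  apply/cvgrPdist_le => e e0; have [T HT] := H e e0; near=> t.
  have tT : t <= T by near: t; exact: nbhs_ninfty_le (num_real T).
  by have [] := HT t tT.
exact: (cvg_pair hU hV).
Unshelve. all: by end_near. Qed.

Lemma isd_derive1 (g : R -> R) (g1 : R -> R) : (forall t, isd t (1 : R) g (g1 t)) ->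
  derive1 g = g1 /\ forall t, derivable g t 1.
Proof.
move=> H; split=> [|t]; last by case: (H t).
by apply/funext => t; rewrite derive1E; case: (H t).
Qed.

(** An equilibrium under the sharp bounds is either diagonal or a well. On the diagonal the
    potential is positive, because [omega < alpha / 2], and at a well it is 0. As the potentials
    agree, both ends are of the same kind, and the gap excludes two diagonal ones. *)
Lemma well_of_ends (alpha omega l m l' m' : R) : 0 < omega -> omega < alpha / 2 ->
  0 < l -> 0 < m -> l ^+ 2 + m ^+ 2 <= 1 -> omega <= alpha * l * m ->
  l * (l ^+ 2 + m ^+ 2 - 1) + m * (alpha * l * m - omega) = 0 ->
  m * (l ^+ 2 + m ^+ 2 - 1) + l * (alpha * l * m - omega) = 0 ->
  0 < l' -> 0 < m' -> l' ^+ 2 + m' ^+ 2 <= 1 -> omega <= alpha * l' * m' ->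
  l' * (l' ^+ 2 + m' ^+ 2 - 1) + m' * (alpha * l' * m' - omega) = 0 ->
  m' * (l' ^+ 2 + m' ^+ 2 - 1) + l' * (alpha * l' * m' - omega) = 0 ->
  (l ^+ 2 + m ^+ 2 - 1) ^+ 2 / 4 + (alpha * l * m - omega) ^+ 2 / (2 * alpha) =
    (l' ^+ 2 + m' ^+ 2 - 1) ^+ 2 / 4 + (alpha * l' * m' - omega) ^+ 2 / (2 * alpha) ->
  l' - m' < l - m ->
  [/\ l ^+ 2 + m ^+ 2 = 1, l' ^+ 2 + m' ^+ 2 = 1, alpha * l * m = omega & alpha * l' * m' = omega].
Proof.
move=> om0 al.
have a0 : 0 < alpha by lra.
have aux p q : p ^+ 2 + q ^+ 2 <= 1 -> omega <= alpha * p * q ->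
    p * (p ^+ 2 + q ^+ 2 - 1) + q * (alpha * p * q - omega) = 0 ->
    q * (p ^+ 2 + q ^+ 2 - 1) + p * (alpha * p * q - omega) = 0 ->
    p = q \/ p ^+ 2 + q ^+ 2 = 1 /\ alpha * p * q = omega.
  move=> h1 h2 e1 e2; have [->|pq] := eqVneq p q; first by left.
  right; have : (p - q) * (p ^+ 2 + q ^+ 2 - 1 - (alpha * p * q - omega)) = 0.
    rewrite (_ : _ * _ = p * (p ^+ 2 + q ^+ 2 - 1) + q * (alpha * p * q - omega)
      - (q * (p ^+ 2 + q ^+ 2 - 1) + p * (alpha * p * q - omega))); last by ring.
    by rewrite e1 e2 subrr.
  move=> /eqP; rewrite mulf_eq0 subr_eq0 (negbTE pq) /= => /eqP.
  by move: (p ^+ 2 + q ^+ 2) (alpha * p * q) h1 h2 => M P *; split; lra.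
have pos p : (p ^+ 2 + p ^+ 2 - 1) ^+ 2 / 4 + (alpha * p * p - omega) ^+ 2 / (2 * alpha) <> 0.
  move=> /eqP; rewrite paddr_eq0; last 2 first.
  - by rewrite divr_ge0 ?sqr_ge0.
  - by rewrite divr_ge0 ?sqr_ge0// mulr_ge0// ltW.
  rewrite !mulf_eq0 !invr_eq0 mulf_eq0 !pnatr_eq0 (gt_eqF a0) !orbF !orbb => /andP[/eqP e1 /eqP e2].
  have p2 : p ^+ 2 = 1 / 2 by lra.
  have : alpha * p ^+ 2 = alpha / 2 by rewrite p2; ring.
  by rewrite expr2 mulrA; lra.
move=> l0 m0 b1 b2 e1 e2 l0' m0' b1' b2' e1' e2' W g.
have [lm|[M1 P1]] := aux l m b1 b2 e1 e2; have [lm'|[M2 P2]] := aux l' m' b1' b2' e1' e2'.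
- by move: g; rewrite lm lm' !subrr ltxx.
- by case: (pos m); move: W; rewrite lm M2 P2 !subrr expr0n !mul0r addr0.
- by case: (pos m'); move: W; rewrite lm' M1 P1 !subrr expr0n !mul0r addr0 => /esym.
- by [].
Qed.

Section ends.
Variables (alpha omega : R) (u v : E -> R).
Hypotheses (om0 : 0 < omega) (al : omega < alpha / 2) (muv : mono alpha omega u v).

Let suv : sol alpha omega u v := muv.1.
Let su : smooth u. Proof. by case: suv => -[]. Qed.
Let sv : smooth v. Proof. by case: suv => -[]. Qed.
Let p0 x : 0 < partial ord_max u x. Proof. by have [_ /(_ x)[]] := muv. Qed.
Let q0 x : partial ord_max v x < 0. Proof. by have [_ /(_ x)[]] := muv. Qed.
Let a0 : 0 < alpha. Proof. by have := om0; have := al; lra. Qed.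

(** Applying [rigidity] at all translates shows that the ratio has zero gradient; the normalisation
    by [d_3 u] gives the third component 1. *)
Lemma direction : exists c : 'I_3 -> R, c ord_max = 1 /\
  forall i x, partial i u x = c i * partial ord_max u x /\ partial i v x = c i * partial ord_max v x.
Proof.
have pn x : partial ord_max u x != 0 by rewrite gt_eqF.
exists (fun i => partial i u 0 / partial ord_max u 0); split; first by rewrite mulfV.
move=> i x.
have rig y := rigidity om0 al (mono_shift y muv) i.
have ratio : partial i u x / partial ord_max u x = partial i u 0 / partial ord_max u 0.
  apply: (@const_of_partials R (fun x => partial i u x / partial ord_max u x) (fun j x =>
    partial j (partial i u) x / partial ord_max u x - partial i u x * partial j (partial ord_max u) x / partial ord_max u x ^+ 2)).
    move=> j y; have h1 := smooth_isd j y (smooth_partial i su).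
    have h2 := smooth_isd j y (smooth_partial ord_max su).
    apply: der_eq; first by der; exact: pn.
    rewrite /=; have := pn y; move: (partial i u y) (partial ord_max u y) (partial j (partial i u) y) (partial j (partial ord_max u) y).
    by move=> a b c d b0; field.
  move=> j y; have [/(_ j) h _] := rig y.
  move: h; rewrite /lremu /lrem !partial_shift add0r.
  have := pn y; move: (partial i u y) (partial ord_max u y) (partial j (partial i u) y) (partial j (partial ord_max u) y).
  move=> a b c d b0 h; have -> : c = a * d / b by apply/subr0_eq.
  by field.
have ux : partial i u x = partial i u 0 / partial ord_max u 0 * partial ord_max u x.
  by rewrite -ratio divfK.
split=> //; have [_] := rig x; rewrite /neg3 !partial_shift add0r -ratio.
have := pn x; move: (partial i u x) (partial ord_max u x) (partial i v x) (partial ord_max v x).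
move=> a b c d b0 h; apply: (mulIf b0).
have -> : c * b = a * d by apply/eqP; rewrite -subr_eq0; apply/eqP; rewrite -[RHS]h; ring.
by field.
Qed.

(** A limit is flat and its gradient is still [c] times its third derivative, so it is constant,
    hence an equilibrium. The constant Hamiltonian passes to both limits, which equates their
    potentials as [well_of_ends] requires. *)
Lemma two_limits : exists lm : R -> R * R,
  (forall s, s = 1 \/ s = -1 -> [/\ tends (up s) u (fun=> (lm s).1), tends (up s) v (fun=> (lm s).2),
    forall x, 0 <= s * ((lm s).1 - u x) & forall x, 0 <= s * (v x - (lm s).2)]) /\
  [/\ (lm 1).1 ^+ 2 + (lm 1).2 ^+ 2 = 1, (lm (-1)).1 ^+ 2 + (lm (-1)).2 ^+ 2 = 1,
      alpha * (lm 1).1 * (lm 1).2 = omega, alpha * (lm (-1)).1 * (lm (-1)).2 = omega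
    & (lm (-1)).1 - (lm (-1)).2 < (lm 1).1 - (lm 1).2] /\
  [/\ 0 < (lm 1).1, 0 < (lm 1).2, 0 < (lm (-1)).1 & 0 < (lm (-1)).2].
Proof.
have [c [c3 Hc]] := direction.
pose n := \sum_i c i ^+ 2.
have n0 : 0 < n.
  rewrite /n (bigD1 ord_max)//= c3 expr1n ltr_pwDl// sumr_ge0// => i _; exact: sqr_ge0.
have Dn f x : (forall i, partial i f x = c i * partial ord_max f x) -> Dc c f x = n * partial ord_max f x.
  by move=> H; rewrite /Dc /n mulr_suml; apply: eq_bigr => i _; rewrite H mulrA -expr2.
have Du x : Dc c u x = n * partial ord_max u x by apply: Dn => i; have [] := Hc i x.
have Dv x : Dc c v x = n * partial ord_max v x by apply: Dn => i; have [] := Hc i x.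
have Hu i x : n * partial i u x = c i * Dc c u x by rewrite Du (Hc i x).1; ring.
have Hv i x : n * partial i v x = c i * Dc c v x by rewrite Dv (Hc i x).2; ring.
have hc := hamiltonian_const a0 suv n0 Hu Hv.
have lim s : s = 1 \/ s = -1 -> exists lm : R * R,
    [/\ tends (up s) u (fun=> lm.1), tends (up s) v (fun=> lm.2),
        forall x, 0 <= s * (lm.1 - u x), forall x, 0 <= s * (v x - lm.2) &
     [/\ 0 < lm.1, 0 < lm.2, lm.1 ^+ 2 + lm.2 ^+ 2 <= 1, omega <= alpha * lm.1 * lm.2 &
       [/\ lm.1 * (lm.1 ^+ 2 + lm.2 ^+ 2 - 1) + lm.2 * (alpha * lm.1 * lm.2 - omega) = 0,
           lm.2 * (lm.1 ^+ 2 + lm.2 ^+ 2 - 1) + lm.1 * (alpha * lm.1 * lm.2 - omega) = 0 &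
           (lm.1 ^+ 2 + lm.2 ^+ 2 - 1) ^+ 2 / 4 + (alpha * lm.1 * lm.2 - omega) ^+ 2 / (2 * alpha) = - hamiltonian alpha omega u v c n 0]]].
  move=> s1; have [ub [vb [tu tv [fu fv] l1 l2]]] := limits_along muv s1.
  have suvb := limit_sol om0 suv tu tv; have [[sub svb] ub0 vb0 eqb bb] := suvb.
  have part0 (f fb : E -> R) : smooth f -> tends (up s) f fb -> flat fb ->
      (forall i x, partial i f x = c i * partial ord_max f x) -> forall i, partial i fb = fun=> 0.
    move=> sf tf ff H i.
    have t1 := tends_partial (i := i) sf tf.
    have t2 : tends (up s) (fun x => c i * partial ord_max f x) (fun x => c i * partial ord_max fb x).
      by apply: tendsM; [exact: tendsC|exact: tends_partial].
    have e : partial i f = (fun x => c i * partial ord_max f x) by apply/funext => x; exact: H.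
    rewrite e in t1; rewrite (tends_unique t1 t2).
    by apply/funext => x; rewrite flat_partial3// mulr0.
  have pu := part0 u ub su tu fu (fun i x => (Hc i x).1).
  have pv := part0 v vb sv tv fv (fun i x => (Hc i x).2).
  have cst (f : E -> R) : smooth f -> (forall i, partial i f = fun=> 0) -> f = fun=> f 0.
    move=> sf H; apply/funext => x.
    by apply: (@const_of_partials R f (fun i => partial i f) (fun i x => smooth_isd i x sf)) => i y; rewrite H.
  have eu := cst ub sub pu; have ev := cst vb svb pv.
  have lap0 (f : E -> R) : (forall i, partial i f = fun=> 0) -> laplacian f 0 = 0.
    move=> H; rewrite /laplacian big1// => i _; rewrite H.
    by apply: isd_partial; exact: derC.
  exists (ub 0, vb 0); split=> //=.
  - by rewrite -eu.
  - by rewrite -ev.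
  - by move=> x; have := l1 x; rewrite eu.
  - by move=> x; have := l2 x; rewrite ev.
  split=> //; [by have [] := bb 0|by have [] := bb 0|].
  have [e1 e2] := eqb 0; split; [by rewrite -e1 lap0|by rewrite -e2 lap0|].
  have tW : tends (up s) (Wpot alpha omega u v) (Wpot alpha omega ub vb).
    have h3 : tends (up s) (fun x => u x ^+ 2 + v x ^+ 2 - 1) (fun x => ub x ^+ 2 + vb x ^+ 2 - 1).
      by apply: tendsD; [apply: tendsD; exact: tendsX|exact: tendsC].
    have h4 : tends (up s) (fun x => alpha * u x * v x - omega) (fun x => alpha * ub x * vb x - omega).
      by apply: tendsD; [apply: tendsM => //; apply: tendsM => //|]; exact: tendsC.
    have h5 := tendsX (n := 2) h3; have h6 := tendsX (n := 2) h4.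
    by apply: tendsD; apply: tendsM => //; exact: tendsC.
  have tD (f fb : E -> R) : smooth f -> tends (up s) f fb -> (forall i, partial i fb = fun=> 0) ->
      tends (up s) (Dc c f) (fun=> 0).
    move=> sf tf H; rewrite (_ : (fun=> 0) = Dc c fb); first exact: tends_Dc.
    by apply/funext => x; rewrite /Dc big1// => i _; rewrite H mulr0.
  have tA := tendsX (n := 2) (tD u ub su tu pu); have tB := tendsX (n := 2) (tD v vb sv tv pv).
  have tH : tends (up s) (fun x => hamiltonian alpha omega u v c n x + Wpot alpha omega u v x)
     (fun=> (0 ^+ 2 + 0 ^+ 2) * (2 * n)^-1).
    have -> : (fun x => hamiltonian alpha omega u v c n x + Wpot alpha omega u v x) =
        fun x => (Dc c u x ^+ 2 + Dc c v x ^+ 2) * (2 * n)^-1.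
      by apply/funext => x; rewrite /hamiltonian subrK.
    by apply: tendsM; [exact: tendsD|exact: tendsC].
  have tH' : tends (up s) (fun x => hamiltonian alpha omega u v c n x + Wpot alpha omega u v x)
      (fun x => hamiltonian alpha omega u v c n 0 + Wpot alpha omega ub vb x).
    apply: tendsD => // x; rewrite (_ : (fun k => _) = fun=> hamiltonian alpha omega u v c n 0).
      exact: cvg_cst.
    by apply/funext => k; exact: hc.
  have := congr1 (fun f => f (0 : E)) (tends_unique tH' tH).
  rewrite expr0n addr0 mul0r => h.
  by have : Wpot alpha omega ub vb 0 = - hamiltonian alpha omega u v c n 0 by apply/eqP; rewrite -addr_eq0 addrC h.
have [lp [tu tv l1 l2 [b1 b2 b3 b4 [e1 e2 w]]]] := lim 1 (or_introl erefl).
have [lq [tu' tv' l1' l2' [b1' b2' b3' b4' [e1' e2' w']]]] := lim (-1) (or_intror erefl).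
have gap : lq.1 - lq.2 < lp.1 - lp.2.
  have key : lq.1 < lp.1.
    have le x : lq.1 <= u x <= lp.1.
      by have := l1 x; have := l1' x; rewrite mul1r mulN1r oppr_ge0 subr_le0 subr_ge0 => -> ->.
    rewrite lt_neqAle; have /andP[h1 h2] := le 0; rewrite (le_trans h1 h2) andbT.
    (* If the two limits of [u] coincided, [u] would be squeezed to a constant, against
       [d_3 u > 0]. *)
    apply/eqP => h; have uc : u = fun=> lp.1.
      by apply/funext => x; have := le x; rewrite h -eq_le => /eqP.
    have := p0 0; rewrite uc (_ : partial _ _ _ = 0) ?ltxx//.
    by apply: isd_partial; exact: derC.
  have : lp.2 <= lq.2.
    have := l2 0; have := l2' 0; rewrite mul1r mulN1r oppr_ge0 subr_le0 subr_ge0 => h1 h2.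
    exact: le_trans h2 h1.
  by move: key; lra.
have W0 := well_of_ends om0 al b1 b2 b3 b4 e1 e2 b1' b2' b3' b4' e1' e2' (etrans w (esym w')) gap.
exists (fun s => if s == 1 then lp else lq); split.
  have n1 : (-1 == 1 :> R) = false by rewrite lt_eqF//; lra.
  by move=> s [->|->]; rewrite ?eqxx ?n1.
have n1 : (-1 == 1 :> R) = false by rewrite lt_eqF//; lra.
by rewrite eqxx n1; case: W0 => *; do !split.
Qed.

End ends.
End symmetry.

(** * The profile and its limits *)

Section one_dimensional.
Context {R : realType}.
Notation E := 'rV[R]_3.

Local Opaque partial.

Lemma root_pair (a b l m : R) : 0 < a -> a < b -> 0 < l -> 0 < m -> a ^+ 2 + b ^+ 2 = 1 ->
  l ^+ 2 + m ^+ 2 = 1 -> l * m = a * b -> l = b /\ m = a \/ l = a /\ m = b.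
Proof.
move=> a0 ab l0 m0 hab hlm e.
have s : l + m = a + b.
  apply/eqP; rewrite -(@eqrXn2 _ 2) ?addr_ge0 ?ltW//; last exact: lt_trans ab.
  apply/eqP; have -> : (l + m) ^+ 2 = l ^+ 2 + m ^+ 2 + 2 * (l * m) by ring.
  by rewrite (etrans hlm (esym hab)) e; ring.
have : (l - a) * (l - b) = 0.
  have -> : (l - a) * (l - b) = l ^+ 2 - (a + b) * l + a * b by ring.
  by rewrite -s -e; ring.
by move=> /eqP; rewrite mulf_eq0 !subr_eq0 => /orP[/eqP h|/eqP h]; [right|left]; split=> //; move: s; rewrite h; lra.
Qed.

Variables (alpha omega : R) (u v : E -> R).
Hypotheses (om0 : 0 < omega) (al : omega < alpha / 2) (muv : mono alpha omega u v).

Lemma one_dimensional : exists (nu : 'rV[R]_3) (U V : R -> R),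
    dot nu nu = 1 /\
    (C2_line U /\ C2_line V) /\
    (forall t, 0 < U t /\ 0 < V t) /\
    (forall t, derive1n 2 U t =
       U t * (U t ^+ 2 + V t ^+ 2 - 1) + V t * (alpha * U t * V t - omega)) /\
    (forall t, derive1n 2 V t =
       V t * (U t ^+ 2 + V t ^+ 2 - 1) + U t * (alpha * U t * V t - omega)) /\
    (forall x, (u x, v x) = (U (dot x nu), V (dot x nu))) /\
    (forall t, 0 < derive1 U t /\ derive1 V t < 0) /\
    (forall a b : R, 0 < a -> a < b -> a ^+ 2 + b ^+ 2 = 1 ->
       a * b = omega / alpha ->
       (U t, V t) @[t --> -oo] --> (a, b) /\
       (U t, V t) @[t --> +oo] --> (b, a)).
Proof.
have [[[su sv] u0 v0 eq _] mp] := muv.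
have a0 : 0 < alpha by have := om0; have := al; lra.
have [c [c3 Hc]] := direction om0 al muv.
have [lm [Hlm [[M1 M2 W1 W2 gap] [P1 P2 P3 P4]]]] := two_limits om0 al muv.
pose n := \sum_i c i ^+ 2.
have n0 : 0 < n.
  rewrite /n (bigD1 ord_max)//= c3 expr1n ltr_pwDl// sumr_ge0// => i _; exact: sqr_ge0.
pose L := Num.sqrt n; have L0 : 0 < L by rewrite sqrtr_gt0.
have L2 : L ^+ 2 = n by rewrite sqr_sqrtr// ltW.
have Ln : L != 0 by rewrite gt_eqF.
(* Normalising [c] by its Euclidean norm [L] makes the derivative along [nu] equal to [L d_3], so
   the profile inherits the strict signs. *)
pose nu : E := \row_i (c i / L).
have nuE i : nu 0 i = c i / L by rewrite mxE.
have nu1 : dot nu nu = 1.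
  rewrite /dot (eq_bigr (fun i => c i ^+ 2 / L ^+ 2)); last by move=> i _; rewrite nuE -expr2 expr_div_n.
  by rewrite -mulr_suml L2 -/n mulfV// gt_eqF.
have nuc : \sum_i nu 0 i * c i = L.
  rewrite (eq_bigr (fun i => c i ^+ 2 / L)); last by move=> i _; rewrite nuE; ring.
  by rewrite -mulr_suml -/n -L2 expr2 mulfK.
pose U t := u (t *: nu); pose V t := v (t *: nu).
have line (f : E -> R) t : smooth f -> isd t (1 : R) (fun s : R => f (s *: nu)) (Dc (fun i => nu 0 i) f (t *: nu)).
  by move=> sf; have := smooth_line 0 nu t sf; rewrite add0r; under eq_fun do rewrite add0r.
have Dnu (f : E -> R) x : (forall i x, partial i f x = c i * partial ord_max f x) ->
    Dc (fun i => nu 0 i) f x = L * partial ord_max f x.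
  by move=> H; rewrite /Dc -nuc mulr_suml; apply: eq_bigr => i _; rewrite H mulrA.
have lapL (f : E -> R) x : smooth f -> (forall i x, partial i f x = c i * partial ord_max f x) ->
    L * Dc (fun i => nu 0 i) (partial ord_max f) x = laplacian f x.
  move=> sf H; rewrite /Dc /laplacian mulr_sumr; apply: eq_bigr => i _.
  have -> : partial i f = fun x => c i * partial ord_max f x by apply/funext => y; exact: H.
  have h := smooth_isd i x (smooth_partial ord_max sf).
  have -> : partial i (fun x => c i * partial ord_max f x) x = c i * partial i (partial ord_max f) x.
    by apply: isd_partial; apply: der_eq; [der|rewrite mulr0 addr0].
  by rewrite nuE mulrA [L * _]mulrC divfK.
have prof (f : E -> R) : smooth f -> (forall i x, partial i f x = c i * partial ord_max f x) ->
    [/\ C2_line (fun t => f (t *: nu)), forall t, derive1n 2 (fun t => f (t *: nu)) t = laplacian f (t *: nu),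
      derive1 (fun t => f (t *: nu)) = fun t => L * partial ord_max f (t *: nu) &
      forall x, f x = f (dot x nu *: nu)].
  move=> sf H; have s3 := smooth_partial ord_max sf.
  have d1 t : isd t (1 : R) (fun s : R => f (s *: nu)) (L * partial ord_max f (t *: nu)).
    by apply: der_eq (line f t sf) _; exact: Dnu.
  have d2 t : isd t (1 : R) (fun s : R => L * partial ord_max f (s *: nu)) (laplacian f (t *: nu)).
    have h := line _ t s3; apply: der_eq; first by der.
    by rewrite mulr0 addr0; exact: lapL.
  have [e1 der1] := isd_derive1 d1; have [e2 der2] := isd_derive1 d2.
  have e3 : derive1n 2 (fun t => f (t *: nu)) = fun t => laplacian f (t *: nu).
    by rewrite /derive1n /= e1 e2.
  split.
  - split=> //; first by rewrite e1.
    rewrite e3 => t; exact: is_derive_cont (line _ t (smooth_laplacian sf)).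
  - by move=> t; rewrite e3.
  - exact: e1.
  (* The vector from [x] to its projection on [nu] is orthogonal to [c], so the derivative along it
     vanishes identically. *)
  move=> x; have -> : dot x nu *: nu = x + (dot x nu *: nu - x) by rewrite addrC subrK.
  rewrite (const_on_lines sf)// => y.
  transitivity ((dot x nu * L - \sum_i x 0 i * c i) * partial ord_max f y).
    rewrite /Dc -nuc mulr_sumr -sumrB mulr_suml; apply: eq_bigr => i _.
    by rewrite H !mxE; ring.
  have -> : dot x nu * L = \sum_i x 0 i * c i.
    by rewrite /dot mulr_suml; apply: eq_bigr => i _; rewrite nuE -!mulrA mulVf// mulr1.
  by rewrite subrr mul0r.
have [Uc Ud U1 UE] := prof u su (fun i x => (Hc i x).1).
have [Vc Vd V1 VE] := prof v sv (fun i x => (Hc i x).2).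
have U1p t : 0 < derive1 U t by rewrite /U U1 mulr_gt0//; have [] := mp (t *: nu).
have V1n t : derive1 V t < 0 by rewrite /V V1 pmulr_rlt0//; have [] := mp (t *: nu).
have Uinc s t : s <= t -> U s <= U t.
  move=> st; rewrite -lerN2.
  apply: (@nonincr_of_derive R (fun t => - U t) (fun t => - derive1 U t)) => //.
    move=> r; rewrite /U U1; apply: derN; apply: der_eq (line u r su) _.
    by apply: Dnu => i x; exact: (Hc i x).1.
  by move=> r; rewrite oppr_le0 ltW.
have Vdec s t : s <= t -> V t <= V s.
  move=> st; apply: (@nonincr_of_derive R V (fun t => derive1 V t)) => //.
    move=> r; rewrite /V V1; apply: der_eq (line v r sv) _.
    by apply: Dnu => i x; exact: (Hc i x).2.
  by move=> r; rewrite ltW.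
exists nu, U, V; split; first exact: nu1.
split; first by split; [exact: Uc|exact: Vc].
split; first by move=> t; split; [exact: u0|exact: v0].
split; first by move=> t; rewrite /U Ud; have [-> _] := eq (t *: nu).
split; first by move=> t; rewrite /V Vd; have [_ ->] := eq (t *: nu).
split; first by move=> x; rewrite /U /V -UE -VE.
split; first by move=> t; split; [exact: U1p|exact: V1n].
(* The limits are known along the points [s k e_3], whose coordinate along [nu] is [s k / L] because
   [c] has third component 1. Monotonicity of [U] and [V] fills in the remaining [t]. *)
have end_ s : s = 1 \/ s = -1 -> forall e, 0 < e -> exists T, forall t, T <= s * t ->
    `|(lm s).1 - U t| <= e /\ `|(lm s).2 - V t| <= e.
  move=> s1 e e0; have ss : s * s = 1 by case: s1 => ->; rewrite ?mulrNN mulr1.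
  have [tu tv l1 l2] := Hlm s s1.
  have upE (k : nat) (i : 'I_3) : up s k 0 i = s * k%:R * (i == ord_max)%:R.
    by rewrite /up mxE /ee mxE eqxx.
  have upd (k : nat) : dot (up s k) nu = s * (k%:R / L).
    rewrite /dot (bigD1 ord_max)//= big1 ?addr0; last first.
      by move=> i i3; rewrite upE (negbTE i3) mulr0 mul0r.
    by rewrite upE eqxx nuE c3 mulr1 mul1r mulrA.
  have close (f : E -> R) (F : R -> R) (p : R) : (forall x, f x = F (dot x nu)) ->
      tends (up s) f (fun=> p) -> exists k0 : nat, forall k, (k0 <= k)%N -> `|p - F (s * (k%:R / L))| <= e.
    move=> fF /(_ 0) /cvgrPdist_le /(_ e e0) [k0 _ hk]; exists k0 => k kk.
    by have := hk k kk; rewrite /= add0r fF upd.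
  have [k1 h1] := close u U _ UE tu; have [k2 h2] := close v V _ VE tv.
  pose k := maxn k1 k2; exists (k%:R / L) => t Tt.
  have {h1} := h1 k (leq_maxl _ _); have {h2} := h2 k (leq_maxr _ _).
  have {l1} := l1 (t *: nu); have {l2} := l2 (t *: nu); rewrite -/(U t) -/(V t).
  have mo : 0 <= s * (U t - U (s * (k%:R / L))) /\ 0 <= s * (V (s * (k%:R / L)) - V t).
    case: s1 Tt => ->; rewrite ?mul1r ?mulN1r ?oppr_ge0 ?subr_ge0 ?subr_le0 => Tt.
      by split; [exact: Uinc|exact: Vdec].
    by split; [apply: Uinc|apply: Vdec]; rewrite lerNr.
  case: mo; case: s1 => ->; rewrite ?mul1r ?mulN1r.
    by rewrite !ler_norml; move: (lm 1) => -[p q] /=; lra.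
  by rewrite !ler_norml; move: (lm (-1)) => -[p q] /=; lra.
move=> a b ha hab ab1 abw.
have prod l m : alpha * l * m = omega -> l * m = a * b.
  by move=> h; rewrite abw -h; field; rewrite gt_eqF.
have r1 := root_pair ha hab P1 P2 ab1 M1 (prod _ _ W1).
have r2 := root_pair ha hab P3 P4 ab1 M2 (prod _ _ W2).
(* [root_pair] leaves two assignments at each end; [gap], by which [U - V] has the larger limit at
   plus infinity, selects one. *)
have [[e1 e2] [e3 e4]] : ((lm 1).1 = b /\ (lm 1).2 = a) /\ ((lm (-1)).1 = a /\ (lm (-1)).2 = b).
  case: r1 => -[e1 e2]; case: r2 => -[e3 e4]; move: gap; rewrite e1 e2 e3 e4 //; rewrite ?ltxx// => h; exfalso; move: h hab; lra.
split.
  apply: cvg_pair_ninfty => e e0; have [T HT] := end_ (-1) (or_intror erefl) e e0.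
  exists (- T) => t tT; rewrite -e3 -e4; apply: HT; by rewrite mulN1r lerNr.
apply: cvg_pair_pinfty => e e0; have [T HT] := end_ 1 (or_introl erefl) e e0.
by exists T => t tT; rewrite -e1 -e2; apply: HT; rewrite mul1r.
Qed.

End one_dimensional.

Theorem theorem2p1 (R : realType) (alpha omega : R) (u v : 'rV[R]_3 -> R)
    (omega_gt0 : 0 < omega) (omega_lt : omega < alpha / 2)
    (u_C2 : C2 u) (v_C2 : C2 v)
    (u_gt0 : forall x, 0 < u x) (v_gt0 : forall x, 0 < v x)
    (eq_u : forall x, laplacian u x =
       u x * (u x ^+ 2 + v x ^+ 2 - 1) + v x * (alpha * u x * v x - omega))
    (eq_v : forall x, laplacian v x =
       v x * (u x ^+ 2 + v x ^+ 2 - 1) + u x * (alpha * u x * v x - omega))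
    (u_incr : forall x, 0 < partial (ord_max : 'I_3) u x)
    (v_decr : forall x, partial (ord_max : 'I_3) v x < 0) :
  exists (nu : 'rV[R]_3) (U V : R -> R),
    dot nu nu = 1 /\
    (C2_line U /\ C2_line V) /\
    (forall t, 0 < U t /\ 0 < V t) /\
    (forall t, derive1n 2 U t =
       U t * (U t ^+ 2 + V t ^+ 2 - 1) + V t * (alpha * U t * V t - omega)) /\
    (forall t, derive1n 2 V t =
       V t * (U t ^+ 2 + V t ^+ 2 - 1) + U t * (alpha * U t * V t - omega)) /\
    (forall x, (u x, v x) = (U (dot x nu), V (dot x nu))) /\
    (forall t, 0 < derive1 U t /\ derive1 V t < 0) /\
    (forall a b : R, 0 < a -> a < b -> a ^+ 2 + b ^+ 2 = 1 ->
       a * b = omega / alpha ->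
       (U t, V t) @[t --> -oo] --> (a, b) /\
       (U t, V t) @[t --> +oo] --> (b, a)).
Proof.
have bounds := sharp_bounds omega_gt0 omega_lt (C1_cts u_C2.1) (C1_cts v_C2.1)
  (C2_twice u_C2) (C2_twice v_C2) u_gt0 v_gt0 eq_u eq_v.
have le1 (f g : 'rV[R]_3 -> R) x : 0 < f x -> f x ^+ 2 + g x ^+ 2 <= 1 -> `|f x| <= 1.
  move=> f0 h; rewrite gtr0_norm//.
  rewrite -(@expr_le1 _ 2)// ?(ltW f0)//; apply: le_trans h.
  by rewrite lerDl sqr_ge0.
(* The sharp bound gives [u, v <= 1], the starting point of the bootstrap. *)
have [su sv] : smooth u /\ smooth v.
  apply: (smooth_of_system u_C2 v_C2 _ eq_u eq_v); exists 1 => x; have [b _] := bounds x.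
  by split; [exact: le1 b|rewrite addrC in b; exact: le1 b].
apply: (@one_dimensional R alpha omega u v omega_gt0 omega_lt).
by split=> // x; split.
Qed.
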